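(* Let $K\subset\mathbb{R}^d$ be a convex, compact set with nonempty interior and let $G$ be a (complete) normed Abelian group. Let $1\le k<d$ and let $T\in\mathscr{F}_k^G(K)$ be a flat $G$-chain with $\mathbb{M}(T)<\infty$. Then for every $\varepsilon>0$ there exist a normal current $T'\in\mathscr{N}_k^G(K)$ and a Borel set $E\subset K$ such that: (i) $\partial T'=0$; (ii) $T=T'\llcorner E$; (iii) $\mathbb{M}(T')\le(2+\varepsilon)\,\mathbb{M}(T)$. In particular, if $G=\mathbb{Z}$ then $T'$ is an integral current without boundary.
   Context: Normed group: an Abelian group $(G,+)$ with $\|\cdot\|:G\to\mathbb{R}$ such that $\|g\|\ge0$ with equality iff $g=0$, $\|-g\|=\|g\|$, $\|g+h\|\le\|g\|+\|h\|$; $G$ is assumed complete for the metric $\|g-h\|$. Polyhedral chains: $\mathscr{P}_k^G(K)$ is the group of finite formal sums $P=\sum_{\ell=1}^N g_\ell\llbracket\sigma_\ell\rrbracket$, with $g_\ell\in G$ and $\sigma_\ell\subset K$ non-overlapping oriented $k$-simplexes, identified when they have a common refinement (reversing orientation of $\sigma_\ell$ changes $g_\ell$ to $-g_\ell$); the sum is obtained by taking common refinements and adding coefficients. Mass: $\mathbb{M}(P)=\sum_\ell\|g_\ell\|\mathcal{H}^k(\sigma_\ell)$. Boundary: $\partial P=\sum_\ell g_\ell\,\partial\llbracket\sigma_\ell\rrbracket$. Flat norm: $\mathbb{F}(P)=\inf\{\mathbb{M}(Q)+\mathbb{M}(P-\partial Q): Q\in\mathscr{P}_{k+1}^G(K)\}$.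 Flat chains: $\mathscr{F}_k^G(K)$ is the $\mathbb{F}$-completion of $\mathscr{P}_k^G(K)$; $\partial$ extends by continuity, and mass extends by relaxation, $\mathbb{M}(T)=\inf\{\liminf_n\mathbb{M}(P_n): P_n\in\mathscr{P}_k^G(K),\ \mathbb{F}(P_n-T)\to0\}$. $\mathscr{N}_k^G(K)$ (normal currents) is the set of $T\in\mathscr{F}_k^G(K)$ with $\mathbb{M}(T)+\mathbb{M}(\partial T)<\infty$. For $G=\mathbb{Z}$ (usual absolute value) these notions agree with the classical ones for integral flat chains. Restriction: for $T\in\mathscr{F}_k^G(K)$ with finite mass and $E\subset K$ Borel, $T\llcorner E\in\mathscr{F}_k^G(K)$ is the restriction in the sense of Fleming: if $P_n$ are polyhedral, $P_n\to T$ in $\mathbb{F}$ and $\mathbb{M}(P_n)\to\mathbb{M}(T)$, then $T\llcorner I$ is the flat limit of $P_n\llcorner I$ for almost every box $I$, and this extends to a set function $E\mapsto T\llcorner E$ on Borel sets, countably additive with respect to mass convergence. *)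

(* Defs.v *)
From HB Require Import structures.
From mathcomp Require Import all_boot all_order all_algebra.
From mathcomp Require Import all_classical all_reals all_analysis.

Set Implicit Arguments.
Unset Strict Implicit.
Unset Printing Implicit Defensive.

Import Order.TTheory GRing.Theory Num.Theory.
Import numFieldNormedType.Exports.

Local Open Scope classical_set_scope.
Local Open Scope ring_scope.

(* Conventions.

   Points of R^d are row vectors; their Mathcomp-Analysis topology is the
   usual one, but the Euclidean norm has to be defined (the library norm on
   matrices is the sup norm).

   An oriented k-simplex is the matrix of its k+1 ordered vertices.

   A polyhedral k-chain is given by a finite formal sum of oriented simplexes,
   which need not be non-overlapping; coefficients and mass are computed on
   common refinements.  No quotient is taken: two sums P and Q represent the
   same polyhedral chain exactly when mass (P - Q) = 0.

   A flat chain is given by an F-Cauchy sequence of polyhedral chains, and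
   [flat_eq] is equality in the F-completion. *)

(** Normed groups.  The library structure [normedZmodType] is not suitable: it
    requires |g *+ n| = |g| *+ n, which rules out e.g. all torsion groups. *)

Definition group_norm (R : realType) (G : zmodType) (nrm : G -> R) : Prop :=
  [/\ forall g, 0 <= nrm g,
      forall g, nrm g = 0 <-> g = 0,
      forall g, nrm (- g) = nrm g &
      forall g h, nrm (g + h) <= nrm g + nrm h].

Definition group_complete (R : realType) (G : zmodType) (nrm : G -> R) : Prop :=
  forall u : nat -> G,
    (forall e : R, 0 < e ->
       exists N, forall m n, (N <= m)%N -> (N <= n)%N -> nrm (u m - u n) < e) ->
    exists g : G, (fun n => nrm (u n - g)) @ \oo --> (0 : R).

Definition int_norm (R : realType) (z : int) : R := (`|z|)%:~R.

(** Hausdorff measure, as an outer measure on R^n. *)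

Definition euclid (R : realType) (n : nat) (x : 'rV[R]_n) : R :=
  Num.sqrt (\sum_(i < n) x ord0 i ^+ 2).

(* equal to -oo on the empty set *)
Definition diameter (R : realType) (n : nat) (U : set 'rV[R]_n) : \bar R :=
  ereal_sup [set (euclid (p.1 - p.2))%:E | p in U `*` U].

(* Lebesgue measure of the Euclidean unit ball of R^k *)
Fixpoint unit_ball_volume (R : realType) (k : nat) : R :=
  match k with
  | 0 => 1
  | 1 => 2
  | (j.+1 as i).+1 => 2 * pi / i.+1%:R * unit_ball_volume R j
  end.

(* The empty set is singled out because of the case k = 0, where diam^0 = 1. *)
Definition hausdorff_gauge (R : realType) (n k : nat) (U : set 'rV[R]_n)
    : \bar R :=
  if `[< U = set0 >] then 0%E
  else ((unit_ball_volume R k / 2 ^+ k)%:E * diameter U ^+ k)%E.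

Definition hausdorff_mesh (R : realType) (n k : nat) (delta : R)
    (A : set 'rV[R]_n) : \bar R :=
  ereal_inf
    [set (\sum_(0 <= i <oo) hausdorff_gauge k (U i))%E
    | U in [set U : nat -> set 'rV[R]_n |
             (forall i, (diameter (U i) <= delta%:E)%E) /\
             A `<=` \bigcup_i U i]].

Definition hausdorff (R : realType) (n k : nat) (A : set 'rV[R]_n) : \bar R :=
  ereal_sup [set hausdorff_mesh k delta A | delta in [set delta : R | 0 < delta]].

(** Simplexes. *)

Definition hull (R : realType) (d k : nat) (s : 'M[R]_(k.+1, d))
    : set 'rV[R]_d :=
  [set t *m s | t in [set t : 'rV[R]_k.+1 |
                       (forall i, 0 <= t ord0 i) /\ \sum_i t ord0 i = 1]].

Definition affinely_independent (R : realType) (d k : nat) (s : 'M[R]_(k.+1, d)) : bool :=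
  row_free (\matrix_(i < k, j < d) (s (lift ord0 i) j - s ord0 j)).

(* B is the matrix of barycentric coordinates of the vertices of t with respect
   to s; its determinant is that of the change of basis from the edge vectors
   of s issued from its first vertex to those of t.  Meaningful when t and s
   are nondegenerate and span the same k-plane. *)
Definition same_orientation (R : realType) (d k : nat)
    (s t : 'M[R]_(k.+1, d)) : Prop :=
  exists B : 'M[R]_k.+1,
    [/\ forall i, \sum_j B i j = 1, t = B *m s & 0 < \det B].

(** Polyhedral chains. *)

Definition chain (R : realType) (G : zmodType) (d k : nat) : Type :=
  seq (G * 'M[R]_(k.+1, d)).

Definition polyhedral (R : realType) (G : zmodType) (d k : nat)
    (K : set 'rV[R]_d) (P : chain R G d k) : Prop :=
  forall p, p \in P -> affinely_independent p.2 /\ hull p.2 `<=` K.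

Definition chain_opp (R : realType) (G : zmodType) (d k : nat)
    (P : chain R G d k) : chain R G d k :=
  [seq (- p.1, p.2) | p <- P].

Definition chain_sub (R : realType) (G : zmodType) (d k : nat)
    (P Q : chain R G d k) : chain R G d k :=
  P ++ chain_opp Q.

Definition boundary (R : realType) (G : zmodType) (d k : nat)
    : chain R G d k -> chain R G d k.-1 :=
  match k with
  | 0 => fun _ => [::]
  | j.+1 => fun P =>
      [seq ((if odd (i : 'I_j.+2) then - p.1 else p.1), row' i p.2)
      | p : G * 'M[R]_(j.+2, d) <- P, i : 'I_j.+2 <- enum 'I_j.+2]
  end.

(* s is a family of non-overlapping simplexes which simultaneously subdivides
   all the simplexes of P. *)
Definition refinement (R : realType) (G : zmodType) (d k : nat)
    (P : chain R G d k) (s : seq 'M[R]_(k.+1, d)) : Prop :=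
  [/\ forall t, t \in s -> affinely_independent t,
      forall i j, (i < j < size s)%N ->
        hausdorff k (hull (nth 0 s i) `&` hull (nth 0 s j)) = 0%E,
      forall t, t \in s -> exists2 p, p \in P & hull t `<=` hull p.2 &
      forall p, p \in P ->
        hull p.2 = \bigcup_(t in [set t | t \in s /\ hull t `<=` hull p.2]) hull t].

(* coefficient in P of a simplex t of a refinement of P *)
Definition coefficient (R : realType) (G : zmodType) (d k : nat)
    (P : chain R G d k) (t : 'M[R]_(k.+1, d)) : G :=
  \sum_(p <- P | `[< hull t `<=` hull p.2 >])
    (if `[< same_orientation p.2 t >] then p.1 else - p.1).

(* The infimum is over a set with one element: the sum does not depend on the
   refinement. *)
Definition mass (R : realType) (G : zmodType) (nrm : G -> R) (d k : nat)
    (P : chain R G d k) : \bar R :=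
  ereal_inf
    [set (\sum_(t <- s) (nrm (coefficient P t))%:E * hausdorff k (hull t))%E
    | s in [set s | refinement P s]].

Definition flat (R : realType) (G : zmodType) (nrm : G -> R) (d k : nat)
    (K : set 'rV[R]_d) (P : chain R G d k) : \bar R :=
  ereal_inf
    [set (mass nrm Q + mass nrm (chain_sub P (boundary Q)))%E
    | Q in [set Q : chain R G d k.+1 | polyhedral K Q]].

(** Flat chains. *)

Definition flat_chain (R : realType) (G : zmodType) (nrm : G -> R) (d k : nat)
    (K : set 'rV[R]_d) (T : nat -> chain R G d k) : Prop :=
  (forall n, polyhedral K (T n)) /\
  forall e : R, 0 < e ->
    exists N, forall m n, (N <= m)%N -> (N <= n)%N ->
      (flat nrm K (chain_sub (T m) (T n)) < e%:E)%E.

Definition flat_sub (R : realType) (G : zmodType) (d k : nat)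
    (T S : nat -> chain R G d k) : nat -> chain R G d k :=
  fun m => chain_sub (T m) (S m).

Definition flat_boundary (R : realType) (G : zmodType) (d k : nat)
    (T : nat -> chain R G d k) : nat -> chain R G d k.-1 :=
  fun m => boundary (T m).

Definition flat_zero (R : realType) (G : zmodType) (d k : nat)
    : nat -> chain R G d k :=
  fun=> [::].

(* the extension of F to the completion *)
Definition flat_norm (R : realType) (G : zmodType) (nrm : G -> R) (d k : nat)
    (K : set 'rV[R]_d) (T : nat -> chain R G d k) : \bar R :=
  limn (fun m => flat nrm K (T m)).

Definition flat_eq (R : realType) (G : zmodType) (nrm : G -> R) (d k : nat)
    (K : set 'rV[R]_d) (T S : nat -> chain R G d k) : Prop :=
  (fun m => flat nrm K (chain_sub (T m) (S m))) @ \oo --> 0%E.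

(* P is a sequence of polyhedral chains converging to the flat chain T *)
Definition flat_cvg (R : realType) (G : zmodType) (nrm : G -> R) (d k : nat)
    (K : set 'rV[R]_d) (P T : nat -> chain R G d k) : Prop :=
  (fun n => flat_norm nrm K (flat_sub (fun=> P n) T)) @ \oo --> 0%E.

Definition flat_mass (R : realType) (G : zmodType) (nrm : G -> R) (d k : nat)
    (K : set 'rV[R]_d) (T : nat -> chain R G d k) : \bar R :=
  ereal_inf
    [set limn_einf (fun n => mass nrm (P n))
    | P in [set P : nat -> chain R G d k |
             (forall n, polyhedral K (P n)) /\ flat_cvg nrm K P T]].

Definition normal_chain (R : realType) (G : zmodType) (nrm : G -> R)
    (d k : nat) (K : set 'rV[R]_d) (T : nat -> chain R G d k) : Prop :=
  flat_chain nrm K T /\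
  (flat_mass nrm K T + flat_mass nrm K (flat_boundary T) < +oo)%E.

(* Federer, Geometric measure theory, 4.2.16: the integral currents are the
   integral flat chains T such that T and its boundary have finite mass. *)
Definition integral_current (R : realType) (d k : nat) (K : set 'rV[R]_d)
    (T : nat -> chain R int d k) : Prop :=
  normal_chain (@int_norm R) K T.

(** Restriction to Borel sets. *)

Definition borel (R : realType) (d : nat) (E : set 'rV[R]_d) : Prop :=
  (<<s [set U : set 'rV[R]_d | open U] >>) E.

Definition box (R : realType) (d : nat) (a b : 'rV[R]_d) : set 'rV[R]_d :=
  [set x | forall i, a ord0 i <= x ord0 i <= b ord0 i].

(* S represents the restriction of the polyhedral chain P to the closed box I *)
Definition box_restriction (R : realType) (G : zmodType) (d k : nat)
    (P : chain R G d k) (I : set 'rV[R]_d) (S : chain R G d k) : Prop :=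
  exists s : seq 'M[R]_(k.+1, d),
    [/\ refinement P s,
        forall t, t \in s -> hull t `<=` I \/ hausdorff k (hull t `&` I) = 0%E &
        S = [seq (coefficient P t, t) | t <- s & `[< hull t `<=` I >]]].

(* The pairs (a, b) of opposite corners of boxes form R^(2d), on which the
   2d-dimensional Hausdorff measure is Lebesgue measure. *)
Definition almost_every_box (R : realType) (d : nat)
    (A : set 'rV[R]_d -> Prop) : Prop :=
  hausdorff (d + d)
    [set c : 'rV[R]_(d + d) | ~ A (box (lsubmx c) (rsubmx c))] = 0%E.

(* rho is the set function E |-> T restricted to E, for T of finite mass *)
Definition restriction_map (R : realType) (G : zmodType) (nrm : G -> R)
    (d k : nat) (K : set 'rV[R]_d) (T : nat -> chain R G d k)
    (rho : set 'rV[R]_d -> nat -> chain R G d k) : Prop :=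
  [/\ forall E, borel E -> flat_chain nrm K (rho E),
      forall P : nat -> chain R G d k,
        (forall n, polyhedral K (P n)) ->
        flat_cvg nrm K P T ->
        (fun n => mass nrm (P n)) @ \oo --> flat_mass nrm K T ->
        almost_every_box (fun I =>
          exists2 S : nat -> chain R G d k,
            forall n, box_restriction (P n) I (S n) &
            flat_cvg nrm K S (rho I)) &
      forall E : nat -> set 'rV[R]_d,
        (forall i, borel (E i)) -> trivIset setT E ->
        (fun n => flat_mass nrm K
           (flat_sub (rho (\bigcup_i E i))
                     (fun m => flatten [seq rho (E i) m | i <- iota 0 n])))
        @ \oo --> 0%E].

Definition is_restriction (R : realType) (G : zmodType) (nrm : G -> R)
    (d k : nat) (K : set 'rV[R]_d) (T : nat -> chain R G d k)
    (E : set 'rV[R]_d) (S : nat -> chain R G d k) : Prop :=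
  exists2 rho : set 'rV[R]_d -> nat -> chain R G d k,
    restriction_map nrm K T rho & flat_eq nrm K S (rho E).

(* Main.v *)
Require Import Defs.
From HB Require Import structures.
From mathcomp Require Import all_boot all_order all_algebra.
From mathcomp Require Import all_classical all_reals all_analysis measurable_realfun.
From mathcomp Require Import ring lra zify.

Set Implicit Arguments.
Unset Strict Implicit.
Unset Printing Implicit Defensive.

Import Order.TTheory GRing.Theory Num.Theory.
Import numFieldNormedType.Exports.

Local Open Scope classical_set_scope.
Local Open Scope ring_scope.

(* Choose polyhedral chains A_n converging fast to T with mass close to M(T), and
   write A_0 = r_0 and A_(n+1) - A_n = r_(n+1) + boundary(s_(n+1)), the remainders
   r_n having total mass at most (1 + e) M(T).  Up to a boundary, each simplex of
   r_n may be replaced by the other faces of a flat cone over it, whose total area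
   is almost that of the simplex.  Uncountably many apices give disjoint new
   faces, so these can be made negligible for the mass measure of T.
   If Z is the sum of all the new faces, then M(Z) <= (1 + e)^2 M(T), the chain
   T' = T - Z is a limit of boundaries, and T' restricted to the complement E of the
   new faces is T.

   The mass measure of T is an outer measure generated by the limits, along an
   ultrafilter, of the masses of A_n in polyhedral sets.  Restrictions to Borel sets
   are obtained from restrictions to polyhedral sets, by approximation in this measure. *)

(** * Hausdorff measure *)

(** The constant 2 is the price of T plus that of Z: the remainders r_n, of total mass close to
    M(T), are all replaced by new faces. The assumption k < d leaves room for an apex outside the
    plane of each simplex. The main obstacle is that T' is only known through the chains A_n - Z_n,
    whose masses need not converge to M(T'), whereas restrictions are characterised by
    mass-converging sequences. Restriction is therefore built for every Cauchy sequence whose mass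
    in polyhedral sets is dominated by that of A_n plus a fixed finite measure. An arbitrary
    mass-converging sequence is compared with it afterwards, on boxes cut out one half-space at a
    time. The comparison works when the bounding hyperplanes carry no mass in the limit, and only
    countably many levels fail. A second obstacle is that polyhedral chains are formal sums of
    possibly overlapping simplexes. Identities between them are stated for coefficients on simplexes
    not cut by finitely many hyperplanes, and it has to be proved that the boundary respects
    them. *)

Section Euclid.
Variables (R : realType) (n : nat).
Implicit Types (x y : 'rV[R]_n) (U A B : set 'rV[R]_n).

Definition nsq (m : nat) (x : 'rV[R]_m) : R := \sum_(i < m) x ord0 i ^+ 2.

Lemma nsq_ge0 x : 0 <= nsq x.
Proof. by apply: sumr_ge0 => i _; rewrite sqr_ge0. Qed.

Lemma euclidE x : euclid x = Num.sqrt (nsq x). Proof. by []. Qed.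

Lemma euclid_ge0 x : 0 <= euclid x.
Proof. exact: sqrtr_ge0. Qed.

Lemma euclid0 : euclid (0 : 'rV[R]_n) = 0.
Proof.
by rewrite euclidE /nsq big1 ?sqrtr0 // => i _; rewrite mxE expr0n.
Qed.

Lemma coord_le_euclid x i : `|x ord0 i| <= euclid x.
Proof.
rewrite -sqrtr_sqr euclidE ler_sqrt ?nsq_ge0 // /nsq (bigD1 i) //= lerDl.
by apply: sumr_ge0 => j _; rewrite sqr_ge0.
Qed.

Lemma euclid_le_coord x (e : R) :
  0 <= e -> (forall i, `|x ord0 i| <= e) -> euclid x <= n%:R * e.
Proof.
move=> e0 h; rewrite euclidE -(ger0_norm (_ : 0 <= n%:R * e)); last first.
  by rewrite mulr_ge0.
rewrite -sqrtr_sqr ler_sqrt ?sqr_ge0 //.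
apply: (@le_trans _ _ (\sum_(i < n) e ^+ 2)).
  by apply: ler_sum => i _; rewrite -real_normK ?num_real // lerXn2r ?nnegrE.
rewrite sumr_const card_ord exprMn -[X in X <= _]mulr_natl ler_wpM2r ?sqr_ge0 //.
by rewrite -natrX ler_nat expnS expn1; case: (n) => // m; rewrite leq_pmulr.
Qed.

Lemma diam_ge x y U : U x -> U y -> ((euclid (x - y))%:E <= diameter U)%E.
Proof. by move=> Ux Uy; apply: ereal_sup_ubound; exists (x, y). Qed.

Lemma diam_ge0 U : U !=set0 -> (0 <= diameter U)%E.
Proof.
by move=> [x Ux]; have := diam_ge Ux Ux; rewrite subrr euclid0.
Qed.

Lemma diam_le U (e : \bar R) :
  (forall x y, U x -> U y -> ((euclid (x - y))%:E <= e)%E) ->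
  (diameter U <= e)%E.
Proof. by move=> h; apply: ge_ereal_sup => _ [[x y] [Ux Uy] <-]; exact: h. Qed.

Lemma le_diam U V : U `<=` V -> (diameter U <= diameter V)%E.
Proof. by move=> UV; apply: diam_le => x y /UV Vx /UV Vy; exact: diam_ge. Qed.

Lemma diam_set0 : diameter (set0 : set 'rV[R]_n) = -oo%E.
Proof. by rewrite /diameter setX0 image_set0 ereal_sup0. Qed.
End Euclid.

Section Gauge.
Variables (R : realType).

Lemma expe_le (x y : \bar R) n : (0 <= x -> x <= y -> x ^+ n <= y ^+ n)%E.
Proof.
move=> x0 xy; elim: n => [|n IH]; first by rewrite !expe0.
rewrite !expeS; apply: lee_pmul => //; exact: expe_ge0.
Qed.

Lemma expeM (x y : \bar R) n : ((x * y) ^+ n = x ^+ n * y ^+ n)%E.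
Proof. by elim: n => [|n IH]; rewrite ?expe0 ?mule1 // !expeS IH muleACA. Qed.

Lemma unit_ball_volume_gt0 k : 0 < unit_ball_volume R k.
Proof.
suff : 0 < unit_ball_volume R k /\ 0 < unit_ball_volume R k.+1 by case.
elim: k => [|k [h1 h2]] //=; split => //.
by rewrite mulr_gt0 // divr_gt0 // mulr_gt0 // pi_gt0.
Qed.

Definition gauge_cst k : R := unit_ball_volume R k / 2 ^+ k.

Lemma gauge_cst_gt0 k : 0 < gauge_cst k.
Proof. by rewrite divr_gt0 ?unit_ball_volume_gt0 ?exprn_gt0. Qed.

Lemma gauge_set0 n k : hausdorff_gauge k (set0 : set 'rV[R]_n) = 0%E.
Proof. by rewrite /hausdorff_gauge asboolT. Qed.

Lemma gaugeE n k (U : set 'rV[R]_n) : U !=set0 ->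
  hausdorff_gauge k U = ((gauge_cst k)%:E * diameter U ^+ k)%E.
Proof. by move=> /set0P U0; rewrite /hausdorff_gauge asboolF //; apply/eqP. Qed.

Lemma gauge_ge0 n k (U : set 'rV[R]_n) : (0 <= hausdorff_gauge k U)%E.
Proof.
have [->|/set0P U0] := eqVneq U set0; first by rewrite gauge_set0.
rewrite gaugeE // mule_ge0 ?expe_ge0 ?diam_ge0 // lee_fin ltW //.
exact: gauge_cst_gt0.
Qed.

(** Serves for Lipschitz images and, with [L] equal to 1, for subsets. The hypothesis is conditional
    on [U] being nonempty because the empty set has gauge 0 but diameter -oo. *)
Lemma gauge_le n m k (U : set 'rV[R]_n) (V : set 'rV[R]_m) (L : R) : 0 <= L ->
  (U !=set0 -> V !=set0 /\ (diameter U <= L%:E * diameter V)%E) ->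
  (hausdorff_gauge k U <= (L ^+ k)%:E * hausdorff_gauge k V)%E.
Proof.
move=> L0 h; have [->|/set0P U0] := eqVneq U set0.
  by rewrite gauge_set0 mule_ge0 ?lee_fin ?exprn_ge0 ?gauge_ge0.
have [V0 UV] := h U0; rewrite !gaugeE // muleCA lee_pmul2l ?lte_fin ?gauge_cst_gt0 //.
by rewrite EFin_expe -expeM expe_le // diam_ge0.
Qed.

Lemma gauge_le_fin n k (U : set 'rV[R]_n) (e : R) : 0 <= e ->
  (diameter U <= e%:E)%E ->
  (hausdorff_gauge k U <= (gauge_cst k * e ^+ k)%:E)%E.
Proof.
move=> e0 h; have [->|/set0P U0] := eqVneq U set0.
  rewrite gauge_set0 lee_fin; apply: mulr_ge0; last exact: exprn_ge0.
  exact/ltW/gauge_cst_gt0.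
rewrite gaugeE // [leRHS]EFinM lee_pmul2l ?lte_fin ?gauge_cst_gt0 // EFin_expe.
by rewrite expe_le // diam_ge0.
Qed.
End Gauge.

Section Mesh.
Variables (R : realType) (n k : nat).
Implicit Types (A B : set 'rV[R]_n).

Let T : Type := 'rV[R]_n.
(** In the sigma-algebra of all subsets every cover is measurable, so [mu_ext] ranges over arbitrary
    covers. *)
Let D := g_sigma_algebraType [set: set T].
Let all_meas (A : set D) : measurable A.
Proof. exact: sub_sigma_algebra. Qed.

(** An infinite cost for sets of diameter above [delta] moves the size constraint of
    [hausdorff_mesh] into the cost; the mesh is then an outer measure of the form [mu_ext]. *)
Definition gauge_delta (delta : R) (U : set 'rV[R]_n) : \bar R :=
  if `[< (diameter U <= delta%:E)%E >] then hausdorff_gauge k U else +oo%E.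

Lemma gauge_delta_ge0 delta U : (0 <= gauge_delta delta U)%E.
Proof. by rewrite /gauge_delta; case: asboolP => // _; exact: gauge_ge0. Qed.

Lemma gauge_delta0 delta : gauge_delta delta set0 = 0%E.
Proof. by rewrite /gauge_delta diam_set0 asboolT ?leNye // gauge_set0. Qed.

Lemma meshE delta A : hausdorff_mesh k delta A =
  mu_ext (gauge_delta delta : set D -> \bar R) A.
Proof.
apply/eqP; rewrite eq_le; apply/andP; split.
- apply: le_ereal_inf_tmp => _ [U [_ AU] <-].
  have [small|] := pselect (forall i, (diameter (U i) <= delta%:E)%E).
    apply: ge_ereal_inf; exists (\sum_(0 <= i <oo) hausdorff_gauge k (U i))%E.
      by exists U.
    apply: lee_nneseries => [i _ _|i _]; first exact: gauge_ge0.
    by rewrite /gauge_delta asboolT.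
  move=> /existsNP[i Ui].
  rewrite (@nneseries_pinfty _ _ xpredT i) ?leey // => [m _|].
    exact: gauge_delta_ge0.
  by rewrite /gauge_delta asboolF.
- apply: le_ereal_inf_tmp => _ [U [small AU] <-].
  apply: ge_ereal_inf.
  exists (\sum_(i <oo) gauge_delta delta (U i))%E; first by exists U.
  apply: lee_nneseries => [i _ _|i _]; first exact: gauge_delta_ge0.
  by rewrite /gauge_delta asboolT.
Qed.

Lemma mesh_ge0 delta A : (0 <= hausdorff_mesh k delta A)%E.
Proof. by rewrite meshE; apply: mu_ext_ge0 => U; exact: gauge_delta_ge0. Qed.

Lemma mesh_set0 delta : hausdorff_mesh k delta (set0 : set 'rV[R]_n) = 0%E.
Proof.
rewrite meshE; apply: mu_ext0 => [|U]; [exact: gauge_delta0|].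
exact: gauge_delta_ge0.
Qed.

Lemma le_mesh delta A B :
  A `<=` B -> (hausdorff_mesh k delta A <= hausdorff_mesh k delta B)%E.
Proof. by move=> AB; rewrite !meshE; exact: le_mu_ext. Qed.

Lemma mesh_sigma_subadditive delta (A : nat -> set 'rV[R]_n) :
  (hausdorff_mesh k delta (\bigcup_i A i) <=
   \sum_(i <oo) hausdorff_mesh k delta (A i))%E.
Proof.
rewrite meshE; under eq_eseriesr do rewrite meshE.
apply: mu_ext_sigma_subadditive => U; exact: gauge_delta_ge0.
Qed.

Lemma mesh_anti delta delta' A : delta <= delta' ->
  (hausdorff_mesh k delta' A <= hausdorff_mesh k delta A)%E.
Proof.
move=> dd'; apply: ereal_inf_le_tmp => _ [U [small AU] <-]; exists U => //.
by split=> // i; rewrite (le_trans (small i)) // lee_fin.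
Qed.

Lemma mesh_le_hausdorff delta A : 0 < delta ->
  (hausdorff_mesh k delta A <= hausdorff k A)%E.
Proof. by move=> d0; apply: ereal_sup_ubound; exists delta. Qed.

Lemma hausdorff_le A (x : \bar R) :
  (forall delta : R, 0 < delta -> (hausdorff_mesh k delta A <= x)%E) ->
  (hausdorff k A <= x)%E.
Proof. by move=> h; apply: ge_ereal_sup => _ [delta d0 <-]; exact: h. Qed.

Lemma hausdorff_ge0 A : (0 <= hausdorff k A)%E.
Proof. exact: le_trans (mesh_ge0 1 A) (mesh_le_hausdorff _ ltr01). Qed.

Lemma hausdorff_set0 : hausdorff k (set0 : set 'rV[R]_n) = 0%E.
Proof.
apply/eqP; rewrite eq_le hausdorff_ge0 andbT; apply: hausdorff_le => d _.
by rewrite mesh_set0.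
Qed.

Lemma le_hausdorff A B : A `<=` B -> (hausdorff k A <= hausdorff k B)%E.
Proof.
move=> AB; apply: hausdorff_le => d d0.
exact: le_trans (le_mesh _ AB) (mesh_le_hausdorff _ d0).
Qed.

Lemma hausdorff_sigma_subadditive :
  sigma_subadditive (@hausdorff R n k).
Proof.
move=> A; apply: hausdorff_le => d d0.
apply: le_trans (mesh_sigma_subadditive d A) _.
apply: lee_nneseries => [i _ _|i _]; first exact: mesh_ge0.
exact: mesh_le_hausdorff.
Qed.

HB.instance Definition _ := isOuterMeasure.Build R 'rV[R]_n (@hausdorff R n k)
  hausdorff_set0 hausdorff_ge0 le_hausdorff hausdorff_sigma_subadditive.

Lemma hausdorff_null_sub A B :
  A `<=` B -> hausdorff k B = 0%E -> hausdorff k A = 0%E.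
Proof.
move=> AB B0; apply/eqP; rewrite eq_le hausdorff_ge0 andbT -B0.
exact: le_hausdorff.
Qed.

Lemma hausdorff_leU A B :
  (hausdorff k (A `|` B) <= hausdorff k A + hausdorff k B)%E.
Proof. exact: (outer_measureU2 (@hausdorff R n k)). Qed.

Lemma hausdorff_nullU A B :
  hausdorff k A = 0%E -> hausdorff k B = 0%E -> hausdorff k (A `|` B) = 0%E.
Proof.
move=> A0 B0; apply/eqP; rewrite eq_le hausdorff_ge0 andbT.
by have := hausdorff_leU A B; rewrite A0 B0 adde0.
Qed.

Lemma hausdorff_null_bigcup (A : nat -> set 'rV[R]_n) :
  (forall i, hausdorff k (A i) = 0%E) -> hausdorff k (\bigcup_i A i) = 0%E.
Proof.
move=> A0; apply/eqP; rewrite eq_le hausdorff_ge0 andbT.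
apply: le_trans (hausdorff_sigma_subadditive A) _.
by rewrite eseries0.
Qed.
End Mesh.

(** * Carathéodory measurability of half-spaces for Hausdorff measure *)

Lemma ereal_sup_add (R : realType) (S T : set (\bar R)) (c : \bar R) :
  S !=set0 -> T !=set0 ->
  (forall x, S x -> (0 <= x)%E) -> (forall y, T y -> (0 <= y)%E) ->
  (forall x y, S x -> T y -> (x + y <= c)%E) ->
  (ereal_sup S + ereal_sup T <= c)%E.
Proof.
move=> [x0 Sx0] [y0 Ty0] S0 T0 h.
have key (U : set (\bar R)) (y : \bar R) : (0 <= y)%E ->
    (forall x, U x -> (x + y <= c)%E) -> U !=set0 ->
    (forall x, U x -> (0 <= x)%E) -> (ereal_sup U + y <= c)%E.
  move=> y0' hU [u Uu] U0; case: y y0' hU => [y| |] // y0' hU.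
    by rewrite -leeBrDr //; apply: ge_ereal_sup => x Ux; rewrite leeBrDr // hU.
  have := hU _ Uu; rewrite addey; last by rewrite -ltNye (lt_le_trans (ltNyr 0) (U0 _ Uu)).
  by rewrite leye_eq => /eqP->; rewrite leey.
apply: (key) => //; last by exists x0.
  by apply: le_trans (T0 _ Ty0) _; exact: ereal_sup_ubound.
move=> x Sx; rewrite addeC; apply: (key) => //; [exact: S0| |by exists y0].
by move=> y Ty; rewrite addeC; exact: h.
Qed.

Section MetricMeasure.
Variables (R : realType) (n k : nat).
Implicit Types (A B : set 'rV[R]_n).

Definition lipschitz_fun (f : 'rV[R]_n -> R) : Prop :=
  exists2 L : R, 0 < L & forall x y, `|f x - f y| <= L * euclid (x - y).

(** At a mesh small against [(b - a) / L] no set of a cover meets both [A] and [B], so a cover of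
    the union splits into a cover of each. *)
Lemma hausdorff_separated (f : 'rV[R]_n -> R) A B (a b : R) : lipschitz_fun f ->
  a < b -> (forall x, A x -> f x <= a) -> (forall x, B x -> b <= f x) ->
  (hausdorff k A + hausdorff k B <= hausdorff k (A `|` B))%E.
Proof.
move=> [L L0 fL] ab fA fB; rewrite {1 2}/hausdorff.
apply: ereal_sup_add.
- by exists (hausdorff_mesh k 1 A), 1 => //=; exact: ltr01.
- by exists (hausdorff_mesh k 1 B), 1 => //=; exact: ltr01.
- by move=> _ [d _ <-]; exact: mesh_ge0.
- by move=> _ [d _ <-]; exact: mesh_ge0.
move=> _ _ [d1 d10 <-] [d2 d20 <-].
pose d := Num.min (Num.min d1 d2) ((b - a) / (2 * L)).
have d0 : 0 < d.
  by rewrite !lt_min d10 d20 /= divr_gt0 ?subr_gt0 // mulr_gt0.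
have dd1 : d <= d1 by rewrite !ge_min lexx.
have dd2 : d <= d2 by rewrite !ge_min lexx !orbT.
have dab : d <= (b - a) / (2 * L) by rewrite ge_min lexx orbT.
apply: le_trans (mesh_le_hausdorff _ _ d0).
apply: le_trans (leeD (mesh_anti _ _ dd1) (mesh_anti _ _ dd2)) _.
apply: le_ereal_inf_tmp => _ [U [small ABU] <-].
pose V i := if `[< U i `&` A !=set0 >] then U i else set0.
pose W i := if `[< U i `&` A !=set0 >] then set0 else U i.
have -> : (\sum_(0 <= i <oo) hausdorff_gauge k (U i) =
    \sum_(0 <= i <oo) hausdorff_gauge k (V i) +
    \sum_(0 <= i <oo) hausdorff_gauge k (W i))%E.
  rewrite -nneseriesD; [|by move=> *; exact: gauge_ge0..].
  apply: eq_eseriesr => i _; rewrite /V /W; case: asboolP => _.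
    by rewrite gauge_set0 adde0.
  by rewrite gauge_set0 add0e.
apply: leeD; apply: ereal_inf_lbound.
- exists V => //; split=> [i|x Ax].
    by rewrite /V; case: asboolP => // _; rewrite diam_set0 leNye.
  have [i _ Ux] := ABU _ (or_introl Ax); exists i => //.
  by rewrite /V asboolT //; exists x.
- exists W => //; split=> [i|x Bx].
    by rewrite /W; case: asboolP => // _; rewrite diam_set0 leNye.
  have [i _ Ux] := ABU _ (or_intror Bx); exists i => //.
  rewrite /W; case: asboolP => // -[y [Uy Ay]]; exfalso.
  have := le_trans (diam_ge Ux Uy) (small i); rewrite lee_fin => xyd.
  have := le_trans (ler_norm _) (fL x y).
  have := fA _ Ay; have := fB _ Bx => h1 h2 h3.
  have : b - a <= L * ((b - a) / (2 * L)).
    apply: le_trans (ler_wpM2l (ltW L0) (le_trans xyd dab)).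
    by apply: le_trans h3; lra.
  have -> : L * ((b - a) / (2 * L)) = (b - a) / 2.
    by field; rewrite gt_eqF.
  lra.
Qed.

(** Only every other ring is taken, so that consecutive ones are separated by a gap and
    [hausdorff_separated] adds their measures. *)
Lemma hausdorff_rings (f : 'rV[R]_n -> R) (X : set 'rV[R]_n) (a : nat -> R) N :
  lipschitz_fun f -> {homo a : i j / (i < j)%N >-> j < i} ->
  (\sum_(i < N) hausdorff k (X `&` [set x | (a (i.*2).+1 <= f x <= a i.*2)%R])
    <= hausdorff k X)%E.
Proof.
move=> fL adec.
pose ring (i : nat) := [set x | a (i.*2).+1 <= f x <= a i.*2].
suff h : (\sum_(i < N) hausdorff k (X `&` ring i) <=
   hausdorff k (X `&` [set x | exists2 i, (i < N)%N & ring i x]))%E.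
  by apply: le_trans h _; apply: le_hausdorff => x [].
elim: N => [|N IH]; first by rewrite big_ord0 hausdorff_ge0.
rewrite big_ord_recr /=; apply: le_trans (leeD2r _ IH) _.
rewrite addeC.
(* A lower bound of [f] on the previous rings; for [N] equal to 0 there are none and any value above
   [a 0] will do. *)
pose c := if N is M.+1 then a (M.*2).+1 else a 0 + 1.
have cN : a N.*2 < c.
  by rewrite {IH}/c {c}; case: N => [|M]; rewrite ?ltrDl //; apply: adec.
apply: le_trans (hausdorff_separated fL cN _ _) _.
- by move=> x [_ /andP[]].
- move=> x [_ [i iN /andP[+ _]]]; apply: le_trans; rewrite /c.
  case: N {IH c cN} iN => // M; rewrite ltnS leq_eqVlt => /predU1P[->//|iM].
  by apply/ltW/adec; rewrite !ltnS ltn_double.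
- apply: le_hausdorff => x [[Xx Rx]|[Xx [i iN Rx]]]; split => //.
    by exists N.
  by exists i => //; rewrite ltnS ltnW.
Qed.

(** Carathéodory's argument. The layers of [X] between the levels 1 / (i + 2) and 1 / (i + 1) have
    summable measures, so outside the half-space [X] is, up to [e], the part above a positive level,
    which is separated from the half-space. *)
Lemma hausdorff_halfspace (f : 'rV[R]_n -> R) : lipschitz_fun f ->
  (@hausdorff R n k).-caratheodory [set x | f x <= 0].
Proof.
move=> fL; apply: le_caratheodory_measurable => X.
rewrite -![OuterMeasure.sort _]/(@hausdorff R n k).
have [->|Xfin] := eqVneq (hausdorff k X) +oo%E; first by rewrite leey.
have Hfin A : A `<=` X -> hausdorff k A \is a fin_num.
  move=> AX; rewrite ge0_fin_numE ?hausdorff_ge0 //.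
  apply: le_lt_trans (le_hausdorff _ AX) _.
  by rewrite ltey.
pose a (i : nat) : R := i.+1%:R^-1.
have adec : {homo a : i j / (i < j)%N >-> j < i}.
  by move=> i j ij; rewrite /a ltf_pV2 ?posrE ?ltr_nat ?ltnS.
pose ring i := X `&` [set x | a i.+1 <= f x <= a i].
pose r i := fine (hausdorff k (ring i)).
have rE i : hausdorff k (ring i) = (r i)%:E by rewrite fineK // Hfin // => x [].
have r0 i : 0 <= r i by rewrite fine_ge0 ?hausdorff_ge0.
pose h := fine (hausdorff k X).
have hE : hausdorff k X = h%:E by rewrite fineK // Hfin.
have even_le N : \sum_(i < N) r i.*2 <= h.
  rewrite -lee_fin -hE -sumEFin; apply: le_trans (hausdorff_rings X N fL adec).
  by apply: lee_sum => i _; rewrite -rE.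
have odd_le N : \sum_(i < N) r (i.*2).+1 <= h.
  rewrite -lee_fin -hE -sumEFin.
  have adec' : {homo (a \o succn) : i j / (i < j)%N >-> j < i}.
    by move=> i j ij; apply: adec.
  apply: le_trans (hausdorff_rings X N fL adec').
  by apply: lee_sum => i _; rewrite -rE.
have sum_le N : \sum_(i < N) r i <= 2 * h.
  have split2 M : \sum_(i < M.*2) r i =
      \sum_(i < M) r i.*2 + \sum_(i < M) r (i.*2).+1.
    elim: M => [|M IH]; first by rewrite !big_ord0 addr0.
    by rewrite doubleS !big_ord_recr /= IH; ring.
  apply: (@le_trans _ _ (\sum_(i < N.*2) r i)).
    have NN : (N <= N.*2)%N by rewrite -addnn leq_addr.
    by rewrite -!(big_mkord predT) [leRHS](big_cat_nat _ NN) //= lerDl sumr_ge0.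
  by rewrite split2; have := even_le N; have := odd_le N; lra.
have tail e : 0 < e -> exists N, forall M, \sum_(N <= i < M) r i <= e.
  move=> e0; have cv : cvgn (series r).
    apply: nondecreasing_is_cvgn.
      by apply/nondecreasing_seqP => i; rewrite /series /= big_nat_recr //= lerDl.
    by exists (2 * h) => _ [N _ <-]; rewrite /series /= big_mkord sum_le.
  have /cvgrPdist_le /(_ _ e0) [N _ hN] := cv.
  exists N => M; have [NM|MN] := leqP N M; last first.
    by rewrite big_geq ?ltW // ltnW.
  have le_lim : series r M <= limn (series r).
    apply: nondecreasing_cvgn_le => //.
    by apply/nondecreasing_seqP => i; rewrite /series /= big_nat_recr //= lerDl.
  have := hN N (leqnn N); rewrite /= => /(le_trans (ler_norm _)).
  suff : \sum_(N <= i < M) r i = series r M - series r N by move=> ->; lra.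
  by rewrite /series /= (big_cat_nat (n := N) (m := 0) (p := M)) //= addrAC subrr add0r.
apply/lee_addgt0Pr => e e0.
have [N hN] := tail e e0.
pose U := X `&` [set x | a N < f x].
have posle : (hausdorff k (X `&` ~` [set x | (f x <= 0)%R]) <=
    hausdorff k U + e%:E)%E.
  have sub : X `&` ~` [set x | f x <= 0] `<=`
      U `|` \bigcup_i ring (N + i)%N.
    move=> x [Xx /negP]; rewrite -ltNge => fx0.
    have [fxa|fxa] := ltP (a N) (f x); [by left; split|right].
    have [m am] : exists m, a (N + m)%N < f x.
      exists (Num.truncn (f x)^-1).+1.
      rewrite /a -[X in _ < X]invrK ltf_pV2 ?posrE ?invr_gt0 //.
      apply: lt_le_trans (Num.Theory.truncnS_gt _) _.
      by rewrite ler_nat ltnS (leq_trans (leqnSn _)) ?leq_addl.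
    elim: m am => [|m IH] am; first by move: am; rewrite addn0 ltNge fxa.
    have [/IH//|fm] := ltP (a (N + m)%N) (f x).
    by exists m => //; split => //=; rewrite fm -addnS ltW.
  apply: le_trans (le_hausdorff _ sub) _.
  apply: le_trans (hausdorff_leU _ _ _) _.
  apply: leeD => //.
  apply: (le_trans (@hausdorff_sigma_subadditive R n k _)).
  apply: lime_le.
    by apply: is_cvg_nneseries => i _ _; exact: hausdorff_ge0.
  apply: nearW => M; rewrite big_mkord.
  under eq_bigr do rewrite rE.
  rewrite sumEFin lee_fin.
  have := hN (N + M)%N; rewrite -{1}[N]add0n big_addn.
  by rewrite (_ : N + M - N = M)%N ?big_mkord; [under eq_bigr do rewrite addnC|lia].
apply: le_trans (leeD2l _ posle) _; rewrite addeA leeD2r //.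
have a0 : 0 < a N by rewrite /a invr_gt0.
apply: le_trans (hausdorff_separated fL a0 _ _) _.
- by move=> x [_].
- by move=> x [_ /ltW].
- by apply: le_hausdorff => x [[]|[]].
Qed.
End MetricMeasure.

(** * Affine functionals and Borel sets *)

Section Affine.
Variables (R : realType) (d : nat).
Implicit Types (x y : 'rV[R]_d) (phi : 'cV[R]_(d + 1)).

(* Points, or rows of points, in homogeneous coordinates. *)
Definition hmat m (t : 'M[R]_(m, d)) : 'M[R]_(m, d + 1) :=
  row_mx t (const_mx 1).

Definition aff phi x : R := (hmat x *m phi) ord0 ord0.

Lemma affE phi x : aff phi x =
  \sum_i x ord0 i * phi (lshift 1 i) ord0 + phi (rshift d ord0) ord0.
Proof.
rewrite /aff mxE big_split_ord /= big_ord1 row_mxEr mxE mul1r; congr (_ + _).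
by apply: eq_bigr => i _; rewrite row_mxEl.
Qed.

Lemma aff_lip phi : lipschitz_fun (aff phi).
Proof.
exists (1 + \sum_(i < d) `|phi (lshift 1 i) ord0|).
  by rewrite ltr_pwDl // sumr_ge0.
move=> x y; rewrite !affE opprD addrACA subrr addr0 -sumrB.
apply: le_trans (ler_norm_sum _ _ _) _.
rewrite mulrDl mul1r mulr_suml ler_wpDl ?euclid_ge0 //.
apply: ler_sum => i _; rewrite -mulrBl normrM mulrC ler_wpM2l //.
by have := coord_le_euclid (x - y) i; rewrite !mxE.
Qed.

Lemma affN phi x : aff (- phi) x = - aff phi x.
Proof. by rewrite /aff mulmxN mxE. Qed.

Definition coordf (i : 'I_d) (s : R) : 'cV[R]_(d + 1) :=
  col_mx (delta_mx i ord0) (const_mx (- s)).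

Lemma coordfE i s x : aff (coordf i s) x = x ord0 i - s.
Proof.
rewrite affE /coordf col_mxEd mxE; congr (_ + _).
rewrite (bigD1 i) //= col_mxEu mxE !eqxx mulr1 big1 ?addr0 // => j ji.
by rewrite col_mxEu mxE (negbTE ji) mulr0.
Qed.

Lemma aff_rows m (t : 'M[R]_(m, d)) phi i :
  aff phi (row i t) = (hmat t *m phi) i ord0.
Proof.
rewrite affE mxE big_split_ord /= big_ord1 row_mxEr mxE mul1r; congr (_ + _).
by apply: eq_bigr => j _; rewrite row_mxEl mxE.
Qed.

Lemma hmat_comb m k (w : 'M[R]_(m, k)) (t : 'M[R]_(k, d)) :
  (forall i, \sum_j w i j = 1) -> hmat (w *m t) = w *m hmat t.
Proof.
move=> w1; rewrite /hmat mul_mx_row; congr row_mx; apply/matrixP => i j.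
by rewrite !mxE -[LHS](w1 i); apply: eq_bigr => l _; rewrite mxE mulr1.
Qed.

Lemma hmat_combP m k (w : 'M[R]_(m, k)) (t : 'M[R]_(k, d)) (u : 'M[R]_(m, d)) :
  hmat u = w *m hmat t -> u = w *m t /\ (forall i, \sum_j w i j = 1).
Proof.
rewrite /hmat mul_mx_row => /eq_row_mx[-> h]; split=> // i.
by have /matrixP /(_ i ord0) := h; rewrite !mxE => ->; apply: eq_bigr => j _;
  rewrite mxE mulr1.
Qed.

Lemma aff_comb k (w : 'rV[R]_k) (t : 'M[R]_(k, d)) phi : \sum_j w ord0 j = 1 ->
  aff phi (w *m t) = \sum_j w ord0 j * aff phi (row j t).
Proof.
move=> w1; rewrite /aff hmat_comb => [|i]; last by rewrite ord1.
by rewrite -mulmxA mxE; apply: eq_bigr => j _; congr (_ * _); rewrite -aff_rows.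
Qed.

Lemma aff_seg phi x y (a : R) :
  aff phi ((1 - a) *: x + a *: y) = (1 - a) * aff phi x + a * aff phi y.
Proof.
rewrite !affE !mulrDr.
rewrite addrACA -[X in _ = _ + X]mulrDl subrK mul1r; congr (_ + _).
by rewrite !mulr_sumr -big_split /=; apply: eq_bigr => i _; rewrite !mxE; ring.
Qed.

Lemma ball_rV x y (e : R) : 0 < e ->
  ball x e y <-> forall i, `|x ord0 i - y ord0 i| < e.
Proof.
move=> e0; split=> [[_ h] i|h]; first exact: h.
by split=> // i j; rewrite ord1; exact: h.
Qed.

Lemma lipschitz_open (f : 'rV[R]_d -> R) (c : R) : lipschitz_fun f ->
  open [set x | f x < c].
Proof.
move=> [L L0 fL]; rewrite openE => x /= fx; apply/nbhs_ballP.
pose e := (c - f x) / (L * d.+1%:R).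
have e0 : 0 < e by rewrite divr_gt0 ?subr_gt0 // mulr_gt0.
exists e => //= y /(ball_rV _ _ e0) xy.
have := fL y x => /(le_trans (ler_norm _)) h.
have le1 : euclid (y - x) <= d%:R * e.
  apply: euclid_le_coord => [|i]; first exact: ltW.
  by rewrite !mxE distrC ltW.
have : L * euclid (y - x) < c - f x.
  apply: (@le_lt_trans _ _ (L * (d%:R * e))); first by rewrite ler_wpM2l // ltW.
  have -> : c - f x = L * (d.+1%:R * e).
    by rewrite /e mulrA mulrC divfK // mulf_neq0 ?pnatr_eq0 // gt_eqF.
  by rewrite ltr_pM2l // ltr_pM2r // ltr_nat.
by rewrite /= => h2; have := le_lt_trans h h2; rewrite ltrBlDr subrK.
Qed.

Lemma borel_open U : open U -> @borel R d U.
Proof. exact: sub_sigma_algebra. Qed.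

Lemma borelC A : @borel R d A -> borel (~` A).
Proof. exact: sigma_algebraC. Qed.

Lemma borel_bigcup (A : nat -> set 'rV[R]_d) :
  (forall i, borel (A i)) -> borel (\bigcup_i A i).
Proof. exact: sigma_algebra_bigcup. Qed.

Lemma borel0 : @borel R d set0. Proof. exact: sigma_algebra0. Qed.

Let BT := g_sigma_algebraType [set U : set 'rV[R]_d | open U].

Lemma borelU A B : @borel R d A -> borel B -> borel (A `|` B).
Proof. exact: (@measurableU _ BT). Qed.

Lemma borelI A B : @borel R d A -> borel B -> borel (A `&` B).
Proof. exact: (@measurableI _ BT). Qed.

Lemma borelD A B : @borel R d A -> borel B -> borel (A `\` B).
Proof. exact: (@measurableD _ BT). Qed.

Lemma lipschitz_borel (f : 'rV[R]_d -> R) (c : R) : lipschitz_fun f ->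
  borel [set x | f x <= c].
Proof.
move=> [L L0 fL]; rewrite (_ : mkset _ = ~` [set x | - f x < - c]).
  apply: borelC; apply: borel_open; apply: (@lipschitz_open (fun x => - f x)); exists L => // x y.
  by rewrite -opprD normrN.
by apply/seteqP; split=> x /=; rewrite ltrN2 leNgt => /negP.
Qed.

Lemma borel_halfspace phi : borel [set x | aff phi x <= 0].
Proof. exact: lipschitz_borel (aff_lip _). Qed.
End Affine.

Section BorelGenerators.
Variables (R : realType) (d : nat) (D : 'I_d -> set R).
Hypothesis Ddense : forall i (a b : R), a < b -> exists2 s, D i s & a < s < b.

(** The levels range over a dense set because the properties proved with this lemma hold for
    half-spaces at all but countably many levels. An open set is a countable union of half-open
    boxes with faces at such levels. *)
Lemma borel_generated (S : set (set 'rV[R]_d)) : sigma_algebra setT S ->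
  (forall i s, D i s -> S [set x | x ord0 i <= s]) ->
  forall E, borel E -> S E.
Proof.
move=> Salg Shalf.
pose ST := g_sigma_algebraType S.
have mS (A : set ST) : measurable A = S A.
  by rewrite /measurable /= sigma_algebra_id.
suff Sopen U : open U -> S U.
  move=> E bE; have : <<s [set U : set 'rV[R]_d | open U] >> `<=` S.
    by apply: smallest_sub => // U; exact: Sopen.
  exact.
move=> Uopen.
(* One level of [D] is fixed between any two rationals: the boxes are then indexed by rational data,
   hence countable, while their faces stay at levels in [D]. *)
have [g gP] : {g : 'I_d * rat * rat -> R | forall i p q, (p < q)%R ->
    D i (g (i, p, q)) /\ ratr p < g (i, p, q) < ratr q}.
  have H (z : 'I_d * rat * rat) : exists s : R, z.1.2 < z.2 ->
      D z.1.1 s /\ ratr z.1.2 < s < ratr z.2.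
    have [pq|] := ltP z.1.2 z.2; last by exists 0.
    have : (ratr z.1.2 : R) < ratr z.2 by rewrite ltr_rat.
    by move=> /(Ddense z.1.1)[s]; exists s.
  have [g hg] := choice H.
  by exists g => i p q pq; exact: (hg (i, p, q)).
pose idx := {ffun 'I_d -> (rat * rat) * (rat * rat)}.
pose lo (c : idx) i := g (i, (c i).1.1, (c i).1.2).
pose hi (c : idx) i := g (i, (c i).2.1, (c i).2.2).
pose bx (c : idx) : set 'rV[R]_d :=
  [set x | forall i, (lo c i < x ord0 i) && (x ord0 i <= hi c i)].
pose ok (c : idx) := (forall i, (c i).1.1 < (c i).1.2 /\ (c i).2.1 < (c i).2.2)
   /\ bx c `<=` U.
have -> : U = \bigcup_c (if `[< ok c >] then bx c else set0).
  apply/seteqP; split=> [x Ux|x [c _]]; last first.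
    by case: asboolP => // -[_ h]; exact: h.
  have : nbhs x U by move: Uopen; rewrite openE; exact.
  move=> /nbhs_ballP[e /= e0 xeU].
  have H i : exists c : (rat * rat) * (rat * rat),
      [/\ c.1.1 < c.1.2, c.2.1 < c.2.2,
          x ord0 i - e < ratr c.1.1 /\ ratr c.1.2 < x ord0 i,
          x ord0 i < ratr c.2.1 &
          (ratr c.2.2 : R) < x ord0 i + e].
    have r2 (a b : R) : a < b -> exists p q : rat,
        [/\ (p < q)%R, a < ratr p & ratr q < b].
      move=> ab; have [p /andP[ap pb]] := rat_in_itvoo ab.
      have [q /andP[pq qb]] := rat_in_itvoo pb.
      by exists p, q; split=> //; rewrite -(ltr_rat R).
    have [p [q [pq h1 h2]]] := r2 (x ord0 i - e) (x ord0 i) ltac:(lra).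
    have [p' [q' [pq' h1' h2']]] := r2 (x ord0 i) (x ord0 i + e) ltac:(lra).
    by exists ((p, q), (p', q')); split.
  have [c hc] := choice H.
  pose c' : idx := [ffun i => c i].
  have hlo i : x ord0 i - e < lo c' i < x ord0 i.
    have [h1 h2 [h3 h4] h5 h6] := hc i.
    have [_ /andP[h7 h8]] := gP i _ _ h1.
    by rewrite /lo !ffunE (lt_trans h3 h7) (lt_trans h8 h4).
  have hhi i : x ord0 i < hi c' i < x ord0 i + e.
    have [h1 h2 [h3 h4] h5 h6] := hc i.
    have [_ /andP[h7 h8]] := gP i _ _ h2.
    by rewrite /hi !ffunE (lt_trans h5 h7) (lt_trans h8 h6).
  have okc : ok c'.
    split=> [i|y hy]; first by have [h1 h2 _ _ _] := hc i; rewrite !ffunE.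
    apply: xeU; apply/ball_rV => // i.
    have /andP[h1 h2] := hlo i; have /andP[h3 h4] := hhi i.
    have /andP[h5 h6] := hy i; rewrite distrC ltr_norml; apply/andP; split; lra.
  exists c' => //; rewrite asboolT // => i.
  have /andP[h1 h2] := hlo i; have /andP[h3 h4] := hhi i.
  by rewrite h2 ltW.
rewrite -mS; apply: (@countable_bigcupT_measurable _ ST) => [|c]; first exact: countableP.
case: asboolP => [[okc _]|_]; last exact: measurable0.
have -> : bx c = \bigcap_(i in [set: 'I_d])
    ([set x | x ord0 i <= hi c i] `&` ~` [set x | x ord0 i <= lo c i]).
  apply/seteqP; split=> x h.
    move=> i _; have /andP[h1 h2] := h i; split=> //=.
    by apply/negP; rewrite -ltNge.
  by move=> i; have [h1 /negP] := h i I; rewrite -ltNge => ->.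
apply: (@fin_bigcap_measurable _ ST) => // i _; have [h1 h2] := okc i.
apply: measurableI; last apply: measurableC; rewrite mS; apply: Shalf.
- by have [] := gP i _ _ h2.
- by have [] := gP i _ _ h1.
Qed.
End BorelGenerators.

Section HausdorffBorel.
Variables (R : realType) (n k : nat).

Lemma lipschitz_coord (i : 'I_n) (s : R) :
  lipschitz_fun (fun x : 'rV[R]_n => x ord0 i - s).
Proof.
exists 1 => // x y; rewrite mul1r opprB addrA subrK.
by have := coord_le_euclid (x - y) i; rewrite !mxE.
Qed.

Lemma hausdorff_borel (A : set 'rV[R]_n) : borel A ->
  (@hausdorff R n k).-caratheodory A.
Proof.
apply: (@borel_generated R n (fun=> setT)) => [i a b ab||i s _].
- by exists ((a + b) / 2) => //; apply/andP; split; lra.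
- split; first exact: caratheodory_measurable_set0.
    by move=> B mB; rewrite setTD; exact: caratheodory_measurable_setC.
  by move=> F mF; exact: caratheodory_measurable_bigcup.
- rewrite (_ : mkset _ = [set x | x ord0 i - s <= 0]); last first.
    by apply/seteqP; split=> x /=; rewrite subr_le0.
  exact/hausdorff_halfspace/lipschitz_coord.
Qed.

Lemma hausdorffID (A X : set 'rV[R]_n) : borel A ->
  hausdorff k X = (hausdorff k (X `&` A) + hausdorff k (X `\` A))%E.
Proof. by move=> mA; exact: hausdorff_borel. Qed.

Lemma hausdorff_nullD (X N : set 'rV[R]_n) : hausdorff k N = 0%E ->
  hausdorff k (X `\` N) = hausdorff k X.
Proof.
move=> N0; apply/eqP; rewrite eq_le; apply/andP; split.
  by apply: le_hausdorff => x [].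
rewrite -[leRHS]adde0 -N0; apply: le_trans (hausdorff_leU _ _ _).
by apply: le_hausdorff => x Xx; have [Nx|Nx] := pselect (N x); [right|left].
Qed.

Lemma hausdorff_null_eq (X Y N : set 'rV[R]_n) : hausdorff k N = 0%E ->
  X `<=` Y `|` N -> Y `<=` X `|` N -> hausdorff k X = hausdorff k Y.
Proof.
move=> N0 XY YX.
have h A B : A `<=` B `|` N -> (hausdorff k A <= hausdorff k B)%E.
  move=> AB; apply: le_trans (le_hausdorff _ AB) _.
  by apply: le_trans (hausdorff_leU _ _ _) _; rewrite N0 adde0.
by apply/eqP; rewrite eq_le !h.
Qed.

(** Carathéodory's criterion splits off one set at a time; its overlaps with the remaining ones form
    the null set [N]. *)
Lemma hausdorff_sum (I : eqType) (s : seq I) (X : set 'rV[R]_n)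
    (A : I -> set 'rV[R]_n) :
  uniq s -> (forall i, i \in s -> borel (A i)) ->
  (forall i j, i \in s -> j \in s -> i != j ->
     hausdorff k (A i `&` A j) = 0%E) ->
  hausdorff k (X `&` [set x | exists2 i, i \in s & A i x]) =
  (\sum_(i <- s) hausdorff k (X `&` A i))%E.
Proof.
elim: s X => [|i s IH] X /=.
  move=> _ _ _; rewrite big_nil (_ : _ `&` _ = set0) ?hausdorff_set0 //.
  by rewrite -subset0 => x [_ [i]]; rewrite in_nil.
move=> /andP[is_ us] mA nA; rewrite big_cons.
rewrite (@hausdorffID (A i)); last by apply: mA; rewrite mem_head.
congr (_ + _)%E.
  congr hausdorff; apply/seteqP; split=> x.
    by move=> [[Xx _] Ax].
  by move=> [Xx Ax]; split=> //; split=> //; exists i => //; rewrite mem_head.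
rewrite -IH //; last 2 first.
- by move=> j js; apply: mA; rewrite inE js orbT.
- by move=> j l js ls; apply: nA; rewrite inE ?js ?ls orbT.
pose N := [set x | exists2 j, j \in s & (A i `&` A j) x].
apply: (@hausdorff_null_eq _ _ N).
- rewrite {}/N; elim: s is_ us nA {IH mA} => [|j s IH] is_ us nA.
    by rewrite (_ : mkset _ = set0) ?hausdorff_set0 // -subset0 => x [j].
  apply: (@hausdorff_null_sub _ _ _ _
    ((A i `&` A j) `|` [set x | exists2 j, j \in s & (A i `&` A j) x])).
    move=> x [l]; rewrite inE => /predU1P[->|ls] Ax; [by left|].
    by right; exists l.
  apply: hausdorff_nullU.
    apply: nA; rewrite ?inE ?eqxx ?orbT //.
    by apply: contraNneq is_ => ->; rewrite mem_head.
  move: is_ us; rewrite inE negb_or /= => /andP[_ is_] /andP[_ us].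
  apply: IH => // l m; rewrite !inE => h1 h2; apply: nA; rewrite !inE.
    by case/orP: h1 => ->; rewrite ?orbT.
  by case/orP: h2 => ->; rewrite ?orbT.
- move=> x [[Xx [j]]]; rewrite inE => /predU1P[->//|js] Ax _; left; split=> //.
  by exists j.
- move=> x [Xx [j js Ax]]; have [Aix|Aix] := pselect (A i x).
    by right; exists j.
  by left; split=> //; split=> //; exists j => //; rewrite inE js orbT.
Qed.
End HausdorffBorel.

(** * Estimates of Hausdorff measure *)

Section Lipschitz.
Variables (R : realType).

Lemma hausdorff_lipschitz n m k (f : 'rV[R]_n -> 'rV[R]_m) (A : set 'rV[R]_n)
    (L : R) : 0 < L ->
  (forall x y, A x -> A y -> euclid (f x - f y) <= L * euclid (x - y)) ->
  (hausdorff k (f @` A) <= (L ^+ k)%:E * hausdorff k A)%E.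
Proof.
move=> L0 fL; apply: hausdorff_le => d d0.
have dL : 0 < d / L by rewrite divr_gt0.
apply: (@le_trans _ _ ((L ^+ k)%:E * hausdorff_mesh k (d / L) A)%E); last first.
  by rewrite lee_pmul2l ?lte_fin ?exprn_gt0 // mesh_le_hausdorff.
rewrite -lee_pdivrMl ?exprn_gt0 //.
apply: le_ereal_inf_tmp => _ [U [small AU] <-].
rewrite lee_pdivrMl ?exprn_gt0 //.
rewrite -nneseriesZl => [|i _]; last exact: gauge_ge0.
have dV (V : set 'rV[R]_n) : (diameter (f @` (V `&` A)) <= L%:E * diameter V)%E.
  apply: diam_le => _ _ [x [Vx Ax] <-] [y [Vy Ay] <-].
  apply: (@le_trans _ _ (L%:E * (euclid (x - y))%:E)%E).
    by rewrite -EFinM lee_fin fL.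
  by rewrite lee_pmul2l ?lte_fin // diam_ge.
apply: ge_ereal_inf.
exists (\sum_(0 <= i <oo) hausdorff_gauge k (f @` (U i `&` A)))%E.
  exists (fun i => f @` (U i `&` A)) => //; split=> [i|_ [x Ax <-]].
    apply: le_trans (dV _) _.
    by rewrite -lee_pdivlMl // -EFinM mulrC small.
  by have [i _ Ux] := AU _ Ax; exists i => //; exists x.
apply: lee_nneseries => [i _ _|i _]; first exact: gauge_ge0.
apply: gauge_le => [|[_ [x [Ux Ax] _]]]; first exact: ltW.
by split; [exists x | exact: dV].
Qed.

Lemma hausdorff_translate n k (A : set 'rV[R]_n) (v : 'rV[R]_n) :
  hausdorff k [set x + v | x in A] = hausdorff k A.
Proof.
have h (B : set 'rV[R]_n) (w : 'rV[R]_n) :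
    (hausdorff k [set (x + w)%R | x in B] <= hausdorff k B)%E.
  rewrite -[leRHS]mul1e -(expr1n R k); apply: hausdorff_lipschitz => // x y _ _.
  by rewrite mul1r opprD addrACA subrr addr0.
apply/eqP; rewrite eq_le h /=.
have {1}-> : A = [set x + - v | x in [set x + v | x in A]]; last exact: h.
apply/seteqP; split=> [x Ax|_ [_ [x Ax <-] <-]]; last by rewrite addrK.
by exists (x + v); [exists x | rewrite addrK].
Qed.

Lemma nsqZ n (c : R) (x : 'rV[R]_n) : nsq (c *: x) = c ^+ 2 * nsq x.
Proof. by rewrite /nsq mulr_sumr; apply: eq_bigr => i _; rewrite mxE exprMn. Qed.

Lemma euclidZ n (c : R) (x : 'rV[R]_n) : euclid (c *: x) = `|c| * euclid x.
Proof. by rewrite !euclidE nsqZ sqrtrM ?sqr_ge0 // sqrtr_sqr. Qed.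

Lemma lipschitz_mulmx n m (M : 'M[R]_(n, m)) :
  exists2 L : R, 0 < L & forall x : 'rV[R]_n, euclid (x *m M) <= L * euclid x.
Proof.
pose B := \sum_i \sum_j `|M i j|.
have B0 : 0 <= B by apply: sumr_ge0 => i _; exact: sumr_ge0.
exists (m%:R * B + 1) => [|x]; first by rewrite ltr_wpDl // mulr_ge0.
have h : euclid (x *m M) <= m%:R * (B * euclid x).
  apply: euclid_le_coord => [|j]; first by rewrite mulr_ge0 ?euclid_ge0.
  rewrite mxE; apply: le_trans (ler_norm_sum _ _ _) _.
  rewrite /B mulr_suml; apply: ler_sum => i _.
  rewrite normrM mulrC ler_pM ?coord_le_euclid //.
  by rewrite (bigD1 j) //= lerDl sumr_ge0.
by apply: le_trans h _; rewrite mulrA mulrDl lerDl mul1r euclid_ge0.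
Qed.

Lemma mesh_finite_cover n k (I : finType) (A : set 'rV[R]_n)
    (U : I -> set 'rV[R]_n) (e delta : R) : 0 <= e -> e <= delta ->
  A `<=` \bigcup_i U i -> (forall i, (diameter (U i) <= e%:E)%E) ->
  (hausdorff_mesh k delta A <= (#|I|%:R * (gauge_cst R k * e ^+ k))%:E)%E.
Proof.
move=> e0 ed AU dU.
pose V (i : nat) := if insub i is Some j then U (enum_val (j : 'I_#|I|)) else set0.
apply: ge_ereal_inf; exists (\sum_(0 <= i <oo) hausdorff_gauge k (V i))%E.
  exists V => //; split=> [i|x Ax].
    rewrite /V; case: insubP => [j _ _|_]; last by rewrite diam_set0 leNye.
    by apply: le_trans (dU _) _; rewrite lee_fin.
  have [i _ Ux] := AU _ Ax; exists (enum_rank i) => //.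
  by rewrite /V valK enum_rankK.
apply: lime_le; first by apply: is_cvg_nneseries => i _ _; exact: gauge_ge0.
apply: nearW => N.
set c := gauge_cst R k * e ^+ k.
have c0 : 0 <= c.
  by apply: mulr_ge0; [exact/ltW/gauge_cst_gt0|exact: exprn_ge0].
apply: (@le_trans _ _ (\sum_(0 <= i < N) (if (i < #|I|)%N then c else 0)%:E)%E).
  apply: lee_sum => i _; rewrite /V; case: insubP => [j -> _|/negbTE ->].
    exact: gauge_le_fin.
  by rewrite gauge_set0.
rewrite sumEFin lee_fin.
apply: (@le_trans _ _ (\sum_(0 <= i < N + #|I|) (if (i < #|I|)%N then c else 0))).
  rewrite [leRHS](big_cat_nat _ (leq_addr _ _)) //= lerDl sumr_ge0 // => i _.
  by case: ifP.
rewrite (big_cat_nat _ (leq_addl N #|I|)) //= [X in _ + X]big_nat_cond.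
rewrite [X in _ + X]big1 => [|i /andP[/andP[]]]; last by rewrite leqNgt => /negbTE->.
rewrite addr0 big_nat_cond.
under eq_bigr => i /andP[/andP[_ ->]] _ do over.
by rewrite -big_nat_cond sumr_const_nat subn0 mulr_natl.
Qed.

(** With N + 1 in place of N, a cover by N^j sets of diameter C / N costs a constant times N^(j -
    k), which is bounded for j = k and tends to 0 for j < k. *)
Lemma hausdorff_grid_cover n k j (A : set 'rV[R]_n) (C : R) : 0 <= C ->
  (j <= k)%N ->
  (forall N, exists2 U : {ffun 'I_j -> 'I_N.+1} -> set 'rV[R]_n,
     A `<=` \bigcup_i U i & forall i, (diameter (U i) <= (C / N.+1%:R)%:E)%E) ->
  (hausdorff k A < +oo)%E /\ ((j < k)%N -> hausdorff k A = 0%E).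
Proof.
move=> C0 jk cover; set c := gauge_cst R k.
have c0 : 0 < c by exact: gauge_cst_gt0.
have bound delta : 0 < delta -> exists M, forall N, (M <= N)%N ->
    (hausdorff_mesh k delta A <= (c * C ^+ k / N.+1%:R ^+ (k - j))%:E)%E.
  move=> d0; exists (Num.truncn (C / delta)).+1 => N MN.
  have N0 : 0 < N.+1%:R :> R by [].
  have [U AU dU] := cover N.
  have ed : C / N.+1%:R <= delta.
    rewrite ler_pdivrMr // mulrC -ler_pdivrMr // ltW //.
    by rewrite (lt_le_trans (Num.Theory.truncnS_gt _)) // ler_nat ltnW.
  have e0 : 0 <= C / N.+1%:R by rewrite divr_ge0.
  apply: le_trans (mesh_finite_cover k e0 ed AU dU) _; rewrite lee_fin -/c.
  rewrite card_ffun !card_ord natrX exprMn exprVn.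
  rewrite (_ : N.+1%:R ^+ k = N.+1%:R ^+ j * N.+1%:R ^+ (k - j) :> R); last first.
    by rewrite -exprD subnKC.
  rewrite invfM [leLHS](_ : _ = c * C ^+ k * (N.+1%:R ^+ j / N.+1%:R ^+ j)
    / N.+1%:R ^+ (k - j)); last by ring.
  by rewrite divff ?mulr1 // expf_neq0 // gt_eqF.
split.
  apply: (@le_lt_trans _ _ (c * C ^+ k)%:E); last by rewrite ltry.
  apply: hausdorff_le => delta /bound[M /(_ M (leqnn _))] h.
  apply: le_trans h _; rewrite lee_fin ler_piMr //.
    by rewrite mulr_ge0 ?exprn_ge0 // ltW.
  by rewrite invf_le1 ?exprn_gt0 // exprn_ege1 // ler1n.
move=> jk'; apply/eqP; rewrite eq_le hausdorff_ge0 andbT.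
apply: hausdorff_le => delta /bound[M hM].
apply/lee_addgt0Pr => e e0; rewrite add0e.
pose N := maxn M (Num.truncn (c * C ^+ k / e)).+1.
apply: le_trans (hM N (leq_maxl _ _)) _; rewrite lee_fin.
have N0 : 0 < N.+1%:R :> R by [].
rewrite ler_pdivrMr ?exprn_gt0 // [e * _]mulrC -ler_pdivrMr // ltW //.
apply: lt_le_trans (Num.Theory.truncnS_gt _) _.
apply: (@le_trans _ _ N.+1%:R).
  by rewrite ler_nat (leq_trans (leq_maxr M _)).
have -> : (k - j = (k - j).-1.+1)%N by rewrite prednK // subn_gt0.
by rewrite exprS ler_peMr ?ler0n // exprn_ege1 // ler1n.
Qed.

Definition ucube n : set 'rV[R]_n := [set x | forall i, 0 <= x ord0 i <= 1].

Lemma hausdorff_ucube_image n j k (f : 'rV[R]_j -> 'rV[R]_n) (L : R) : 0 < L ->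
  (j <= k)%N ->
  (forall x y, @ucube j x -> @ucube j y ->
     euclid (f x - f y) <= L * euclid (x - y)) ->
  (hausdorff k (f @` @ucube j) < +oo)%E /\
  ((j < k)%N -> hausdorff k (f @` @ucube j) = 0%E).
Proof.
move=> L0 jk fL.
apply: (@hausdorff_grid_cover _ _ j _ (L * j%:R)) => // [|N].
  by rewrite mulr_ge0 // ltW.
have N0 : 0 < N.+1%:R :> R by [].
pose cell (u : {ffun 'I_j -> 'I_N.+1}) : set 'rV[R]_j :=
  [set x | @ucube j x /\ forall i, (u i)%:R / N.+1%:R <= x ord0 i <= (u i).+1%:R / N.+1%:R].
exists (fun u => f @` cell u) => [_ [x x01 <-]|u].
  (* The minimum with [N] puts the coordinate 1 into the last cell. *)
  exists [ffun i => inord (minn N (Num.truncn (x ord0 i * N.+1%:R)))] => //.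
  exists x => //; split=> // i; have /andP[xi0 xi1] := x01 i.
  rewrite ffunE inordK ?ltnS ?geq_minl //; set m := Num.truncn _.
  have x0 : 0 <= x ord0 i * N.+1%:R by rewrite mulr_ge0.
  have /andP[m1 m2] := Num.Theory.truncn_itv x0.
  rewrite ler_pdivrMr // ler_pdivlMr //; apply/andP; split.
    by apply: le_trans m1; rewrite ler_nat geq_minr.
  have [Nm|mN] := leqP N m; last by rewrite ltW.
  by rewrite -[leRHS]mul1r ler_wpM2r // ltW.
apply: diam_le => _ _ [x [x01 xu] <-] [y [y01 yu] <-]; rewrite lee_fin.
apply: le_trans (fL _ _ x01 y01) _; rewrite -!mulrA ler_pM2l //.
apply: euclid_le_coord => [|i]; first by rewrite invr_ge0 ltW.
have /andP[h1 h2] := xu i; have /andP[h3 h4] := yu i; rewrite !mxE.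
have h5 : (u i).+1%:R / N.+1%:R = (u i)%:R / N.+1%:R + N.+1%:R^-1 :> R.
  by rewrite -natr1 mulrDl mul1r.
rewrite h5 in h2 h4; move: h1 h2 h3 h4; set p := (u i)%:R / _; set q := N.+1%:R^-1.
by move=> *; rewrite ler_norml; apply/andP; split; lra.
Qed.
End Lipschitz.

Local Opaque gauge_cst.

(** * Slices by coordinate hyperplanes: Eilenberg's inequality *)

Section Eilenberg.
Variables (R : realType) (n k : nat) (i : 'I_n).
Implicit Types (A : set 'rV[R]_n).

Definition slice A (s : R) := A `&` [set x | x ord0 i = s].

(** A cover set of diameter r meets only hyperplanes at levels in an interval of length 2 r, whence
    the 2; the quotient converts the gauge of dimension k + 1 into that of dimension k. *)
Definition eilenberg_cst : R := 2 * gauge_cst R k / gauge_cst R k.+1.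

Lemma eilenberg_cst_gt0 : 0 < eilenberg_cst.
Proof.
by apply: divr_gt0; [apply: mulr_gt0|]; rewrite ?gauge_cst_gt0.
Qed.

Local Notation mu := (@lebesgue_measure R).

Lemma integral_indicT (A : set R) : measurable A ->
  (\int[mu]_s (\1_A s)%:E = lebesgue_measure A)%E.
Proof.
move=> mA; rewrite -[in RHS](setIT A).
exact: (@integral_indic _ _ _ mu setT measurableT A mA).
Qed.

Lemma lebesgue_measure_oo (a b : R) : a < b ->
  mu (`]a, b[%classic : set R) = (b - a)%:E.
Proof.
by move=> ab; have := lebesgue_measure_itv `]a, b[; rewrite /= lte_fin ab -EFinB.
Qed.

(** The mesh of a slice is not known to be measurable in the level, so a majorant [h] is built: each
    cover set contributes its k-gauge on the interval [J l] of levels that it can meet. Integration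
    turns r^k into 2 r^(k + 1). *)
Lemma eilenberg_cover (delta e : R) A : 0 < delta -> 0 < e ->
  (hausdorff k.+1 A < +oo)%E ->
  exists h : R -> \bar R,
    [/\ measurable_fun setT h, forall s, (0 <= h s)%E,
        forall s, (hausdorff_mesh k delta (slice A s) <= h s)%E &
        (\int[mu]_s h s <= eilenberg_cst%:E * (hausdorff k.+1 A + e%:E))%E].
Proof.
move=> d0 e0 Afin.
have Hfin : hausdorff k.+1 A \is a fin_num by rewrite ge0_fin_numE ?hausdorff_ge0.
have mfin : hausdorff_mesh k.+1 delta A \is a fin_num.
  rewrite ge0_fin_numE ?mesh_ge0 //.
  exact: le_lt_trans (mesh_le_hausdorff _ _ d0) Afin.
have [_ [U [small AU] <-] Ue] := lb_ereal_inf_adherent e0 mfin.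
have dfin l : U l !=set0 -> exists2 r : R, 0 <= r & diameter (U l) = r%:E.
  move=> U0; have := small l; have := diam_ge0 U0.
  by case: diameter => // r; rewrite !lee_fin => r0 _; exists r.
pose r l := fine (diameter (U l)).
pose p l := xget 0 (U l).
pose J l : set R := if `[< U l = set0 >] then set0 else
  `[(p l) ord0 i - r l, (p l) ord0 i + r l]%classic.
pose w l := fine (hausdorff_gauge k (U l)).
have w0 l : 0 <= w l by rewrite fine_ge0 ?gauge_ge0.
have mJ l : measurable (J l) by rewrite /J; case: asboolP.
pose h s := (\sum_(0 <= l <oo) (w l)%:E * (\1_(J l) s)%:E)%E.
have t0 l s : (0 <= (w l)%:E * (\1_(J l) s)%:E :> \bar R)%E.
  by rewrite mule_ge0 // lee_fin // w0.
have m1 l : measurable_fun setT (fun s => (\1_(J l) s)%:E : \bar R).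
  by apply/measurable_EFinP; exact: measurable_indic.
have mt l : measurable_fun setT (fun s => (w l)%:E * (\1_(J l) s)%:E : \bar R)%E.
  exact: measurable_funeM.
exists h; split.
- by apply: ge0_emeasurable_sum => // l s _ _; exact: t0.
- by move=> s; apply: nneseries_ge0 => l _ _; exact: t0.
- move=> s; apply: ge_ereal_inf.
  pose V l := U l `&` [set x | x ord0 i = s].
  exists (\sum_(0 <= l <oo) hausdorff_gauge k (V l))%E.
    exists V => //; split=> [l|x [Ax xs]].
      by apply: le_trans (small l); apply: le_diam => x [].
    by have [l _ Ux] := AU _ Ax; exists l.
  apply: lee_nneseries => [l _ _|l _]; first exact: gauge_ge0.
  have [V0|/set0P[x [Ux xs]]] := eqVneq (V l) set0.
    by rewrite V0 gauge_set0 t0.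
  have U0 : U l !=set0 by exists x.
  have [rl rl0 rE] := dfin l U0.
  have Up : U l (p l) by exact: xgetPex.
  have -> : \1_(J l) s = 1 :> R.
    rewrite indicE mem_set // /J asboolF; last first.
      by move=> U0'; move: Ux; rewrite U0'.
    have := diam_ge Ux Up; rewrite rE lee_fin => h1.
    have := coord_le_euclid (x - p l) i; rewrite !mxE xs => h2.
    have := le_trans h2 h1; rewrite ler_norml /= in_itv /= /r rE /=.
    by move=> /andP[h3 h4]; apply/andP; split; lra.
  rewrite mule1 /w fineK; last first.
    by rewrite gaugeE // rE -EFin_expe -EFinM.
  have := @gauge_le R n n k (V l) (U l) 1 ler01.
  rewrite expr1n !mul1e; apply=> _; split=> //.
  by apply: le_diam => y [].
- rewrite integral_nneseries //=.
  apply: (@le_trans _ _ (\sum_(0 <= l <oo)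
      eilenberg_cst%:E * hausdorff_gauge k.+1 (U l))%E).
    apply: lee_nneseries => [l _ _|l _].
      by apply: integral_ge0 => s _; exact: t0.
    rewrite ge0_integralZl_EFin //; last first.
      exact: m1.
    rewrite integral_indicT // /J; case: asboolP => [->|U0].
      by rewrite measure0 mule0 gauge_set0 mule0.
    have {}U0 : U l !=set0 by exact/set0P/eqP.
    have [rl rl0 rE] := dfin l U0.
    have wE : w l = gauge_cst R k * rl ^+ k.
      by rewrite /w gaugeE // rE -EFin_expe -EFinM.
    have rlE : r l = rl by rewrite /r rE.
    rewrite lebesgue_measure_itv /= lte_fin wE rlE gaugeE // rE -EFin_expe.
    rewrite -[X in (_ <= _ * X)%E]EFinM -[leRHS]EFinM; case: ifP => _; last first.
      rewrite mule0 lee_fin; apply: mulr_ge0; first exact/ltW/eilenberg_cst_gt0.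
      by apply: mulr_ge0; [exact/ltW/gauge_cst_gt0|exact: exprn_ge0].
    rewrite -EFinB -EFinM lee_fin /eilenberg_cst exprS.
    rewrite [leLHS](_ : _ = 2 * gauge_cst R k * (rl * rl ^+ k)); last by ring.
    rewrite [leRHS](_ : _ = (gauge_cst R k.+1 / gauge_cst R k.+1) *
      (2 * gauge_cst R k * (rl * rl ^+ k))); last by ring.
    by rewrite divff ?mul1r // gt_eqF ?gauge_cst_gt0.
  rewrite nneseriesZl => [|l _]; last exact: gauge_ge0.
  rewrite lee_pmul2l ?lte_fin ?eilenberg_cst_gt0 //.
  apply: le_trans (ltW Ue) _; rewrite leeD2r //.
  exact: mesh_le_hausdorff.
Qed.

Lemma le_limn_einf_tail (u : nat -> \bar R) (x : \bar R) N :
  (forall m, (N <= m)%N -> (x <= u m)%E) -> (x <= limn_einf u)%E.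
Proof.
move=> h; rewrite limn_einf_lim; apply: lime_ge; first exact: is_cvg_einfs.
exists N => // m /= Nm; apply: le_ereal_inf_tmp => _ [l /= ml <-].
by apply: h; exact: leq_trans ml.
Qed.

Lemma limn_einf_le_cst (u : nat -> \bar R) (x : \bar R) :
  (forall m, (u m <= x)%E) -> (limn_einf u <= x)%E.
Proof.
move=> h; rewrite limn_einf_lim; apply: lime_le; first exact: is_cvg_einfs.
apply: nearW => m; apply: le_trans (h m).
by apply: ereal_inf_lbound; exists m => /=.
Qed.

(** Fatou's lemma applied to the majorants at mesh 1 / (m + 1). *)
Lemma eilenberg (e : R) A : 0 < e -> (hausdorff k.+1 A < +oo)%E ->
  exists g : R -> \bar R,
    [/\ measurable_fun setT g, forall s, (0 <= g s)%E,
        forall s, (hausdorff k (slice A s) <= g s)%E &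
        (\int[mu]_s g s <= eilenberg_cst%:E * (hausdorff k.+1 A + e%:E))%E].
Proof.
move=> e0 Afin.
have /choice[h hP] : forall m : nat, exists h : R -> \bar R,
    [/\ measurable_fun setT h, forall s, (0 <= h s)%E,
        forall s, (hausdorff_mesh k (m.+1%:R^-1) (slice A s) <= h s)%E &
        (\int[mu]_s h s <= eilenberg_cst%:E * (hausdorff k.+1 A + e%:E))%E].
  by move=> m; apply: eilenberg_cover => //; rewrite invr_gt0.
have mh m : measurable_fun setT (h m) by have [] := hP m.
have h0 m s : (0 <= h m s)%E by have [_ + _ _] := hP m; exact.
exists (fun s => limn_einf (h^~ s)); split.
- apply: measurableT_comp => //.
  apply: (measurable_fun_limn_esup (f := fun m s => - h m s)%E) => m.
  exact: measurableT_comp.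
- by move=> s; apply: (@le_limn_einf_tail _ _ 0%N) => m _; exact: h0.
- move=> s; apply: hausdorff_le => delta d0.
  pose N := (Num.truncn delta^-1).+1.
  apply: (@le_limn_einf_tail _ _ N) => m Nm.
  have [_ _ + _] := hP m => /(_ s); apply: le_trans; apply: mesh_anti.
  rewrite -[leRHS]invrK lef_pV2 ?posrE ?invr_gt0 //.
  apply: ltW; apply: lt_le_trans (Num.Theory.truncnS_gt _) _.
  by rewrite ler_nat (leq_trans Nm).
- apply: (le_trans (fatou mu measurableT mh _)) => [m s _|]; first exact: h0.
  by apply: limn_einf_le_cst => m; have [] := hP m.
Qed.

(** Mean value argument: if all levels of the interval outside [N] failed, the integral of the sum
    of the majorants would be too large. The sum is sliced at one level common to all the sets. *)
Lemma exists_slice (I : Type) (r : seq I) (c : I -> R) (A : I -> set 'rV[R]_n)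
    (M e a b : R) (N : set R) :
  (forall j, 0 <= c j) -> (forall j, (hausdorff k.+1 (A j) < +oo)%E) ->
  (\sum_(j <- r) (c j)%:E * hausdorff k.+1 (A j) <= M%:E)%E ->
  0 < e -> a < b -> countable N ->
  exists s, [/\ a < s < b, ~ N s &
    (\sum_(j <- r) (c j)%:E * hausdorff k (slice (A j) s)
      <= (eilenberg_cst * (M + e) / (b - a))%:E)%E].
Proof.
move=> c0 Afin AM e0 ab cN.
pose C := \sum_(j <- r) c j.
have C0 : 0 <= C by exact: sumr_ge0.
(* The errors of the single majorants then add up to at most [e / 2], which leaves room for a strict
   inequality. *)
pose e' := e / (2 * (C + 1)).
have e'0 : 0 < e' by rewrite divr_gt0 // mulr_gt0 // ltr_wpDl.
have /choice[g gP] := fun j => eilenberg e'0 (Afin j).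
pose G s := (\sum_(j <- r) (c j)%:E * g j s)%E.
have mG j : measurable_fun setT (fun s => (c j)%:E * g j s)%E.
  by apply: measurable_funeM; have [] := gP j.
have G0 j s : (0 <= (c j)%:E * g j s)%E.
  by have [_ h _ _] := gP j; rewrite mule_ge0 ?lee_fin.
have intG : (\int[mu]_s G s <= (eilenberg_cst * (M + e / 2))%:E)%E.
  rewrite ge0_integral_sum //.
  apply: (@le_trans _ _ (\sum_(j <- r)
      eilenberg_cst%:E * ((c j)%:E * hausdorff k.+1 (A j) + (c j * e')%:E))%E).
    apply: lee_sum => j _; have [h1 h2 h3 h4] := gP j.
    rewrite ge0_integralZl_EFin //.
    have Hfin : hausdorff k.+1 (A j) \is a fin_num.
      by rewrite ge0_fin_numE ?hausdorff_ge0.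
    apply: le_trans (lee_wpmul2l _ h4) _; first by rewrite lee_fin.
    by rewrite -(fineK Hfin) -?EFinM -?EFinD -?EFinM -?EFinD -?EFinM lee_fin; rewrite le_eqVlt; apply/orP; left; apply/eqP; ring.
  rewrite -ge0_sume_distrr; last first.
    move=> j _; rewrite adde_ge0 ?mule_ge0 ?lee_fin ?hausdorff_ge0 //.
    by rewrite mulr_ge0 // ltW.
  rewrite [leRHS]EFinM lee_pmul2l ?lte_fin ?eilenberg_cst_gt0 // big_split /= EFinD.
  apply: leeD => //; rewrite sumEFin lee_fin -mulr_suml -/C /e'.
  have C1 : 0 < C + 1 by rewrite ltr_wpDl.
  rewrite mulrA ler_pdivrMr ?mulr_gt0 //.
  rewrite [leRHS](_ : _ = (C + 1) * e); last by field.
  by rewrite ler_pM2r // lerDl.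
apply: contrapT => nex.
pose v := eilenberg_cst * (M + e) / (b - a).
have Gv s : (`]a, b[%classic `\` N) s -> (v%:E <= G s)%E.
  move=> [sab Ns]; rewrite leNgt; apply/negP => Gs; apply: nex.
  exists s; split => //.
  apply: le_trans (ltW Gs); apply: lee_sum => j _.
  by apply: lee_wpmul2l; [rewrite lee_fin | have [_ _ + _] := gP j; exact].
have mN : measurable N by apply: countable_measurable => // t; exact: measurable_set1.
have mD : measurable (`]a, b[%classic `\` N) by exact: measurableD.
have M0 : 0 <= M.
  rewrite -lee_fin; apply: le_trans AM; apply: sume_ge0 => j _.
  by rewrite mule_ge0 ?hausdorff_ge0 ?lee_fin.
have v0 : 0 <= v.
  rewrite /v divr_ge0 ?subr_ge0 ?(ltW ab) // mulr_ge0 ?(ltW eilenberg_cst_gt0) //.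
  by rewrite addr_ge0 // ltW.
have : (v%:E * mu (`]a, b[%classic `\` N) <=
    (eilenberg_cst * (M + e / 2))%:E)%E.
  apply: le_trans intG; rewrite -integral_cst //.
  apply: (@le_trans _ _ (\int[mu]_(s in `]a, b[%classic `\` N) G s)%E).
    apply: ge0_le_integral => //.
    apply: measurable_funTS; exact: emeasurable_sum.
  apply: ge0_subset_integral => //; first exact: emeasurable_sum.
  by move=> s _; apply: sume_ge0.
have -> : mu (`]a, b[%classic `\` N) = (b - a)%:E.
  have E := lebesgue_measure_oo ab.
  have Efin : (mu (`]a, b[%classic : set R) < +oo)%E by rewrite E ltry.
  have Z : mu (`]a, b[%classic `&` N) = 0%E.
    apply: countable_lebesgue_measure0; apply: sub_countable cN.
    by apply: subset_card_le => x [].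
  apply: (etrans (@measureD _ _ _ mu `]a, b[%classic N (measurable_itv _) mN Efin)).
  transitivity ((b - a)%:E - 0)%E; last exact: sube0.
  by congr (_ - _)%E; [exact: E|exact: Z].
rewrite -EFinM lee_fin /v.
rewrite divfK ?gt_eqF ?subr_gt0 // ler_pM2l ?eilenberg_cst_gt0 //.
by have := e0; lra.
Qed.
End Eilenberg.

Local Opaque gauge_cst.

Section UnitCube.
Variables (R : realType).

Lemma col'0_nsq n (x : 'rV[R]_n.+1) : nsq (col' ord0 x) <= nsq x.
Proof.
rewrite {2}/nsq big_ord_recl /= [X in _ <= _ + X](_ : _ = nsq (col' ord0 x)).
  by rewrite lerDr sqr_ge0.
by apply: eq_bigr => i _; rewrite mxE.
Qed.

Lemma cons_mx0 n (a : R) (u : 'rV[R]_n) :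
  (row_mx (const_mx a : 'rV_1) u : 'rV_n.+1) ord0 ord0 = a.
Proof. by rewrite mxE; case: splitP => j //= _; rewrite mxE. Qed.

Lemma cons_mxS n (a : R) (u : 'rV[R]_n) i :
  (row_mx (const_mx a : 'rV_1) u : 'rV_n.+1) ord0 (lift ord0 i) = u ord0 i.
Proof.
rewrite mxE; case: splitP => j /= ij; first by case: j ij => -[].
by congr (u _ _); apply: val_inj; move: ij => /= [].
Qed.

(** Induction by slicing: if the cube of dimension n + 1 were null, [exists_slice] would give a
    slice of measure at most half that of the cube of dimension n, of which it is a copy. *)
Lemma hausdorff_ucube_gt0 n : (0 < hausdorff n (@ucube R n))%E.
Proof.
elim: n => [|n IH].
  apply: lt_le_trans (mesh_le_hausdorff _ _ (ltr01 : 0 < 1 :> R)).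
  apply: (@lt_le_trans _ _ (gauge_cst R 0)%:E); first by rewrite lte_fin gauge_cst_gt0.
  apply: le_ereal_inf_tmp => _ [U [_ AU] <-].
  have [|i _ Ui] := AU 0; first by case.
  rewrite (nneseriesD1 (n := i)) // => [|l _]; last exact: gauge_ge0.
  rewrite gaugeE; last by exists 0.
  by rewrite expe0 mule1 leeDl //; apply: nneseries_ge0 => l _ _; exact: gauge_ge0.
rewrite lt_neqAle hausdorff_ge0 andbT eq_sym; apply/eqP => H0.
have [m m0 mH] : exists2 m : R, 0 < m & (m%:E <= hausdorff n (@ucube R n))%E.
  case: (hausdorff n (@ucube R n)) IH => [r| |] //.
    by rewrite lte_fin; exists r.
  by exists 1 => //; rewrite leey.
pose e := m / (2 * eilenberg_cst R n).
have C0 := eilenberg_cst_gt0 R n.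
have e0 : 0 < e by rewrite divr_gt0 // mulr_gt0.
have [|||s [/andP[s0 s1] _]] := @exists_slice R n.+1 n ord0 unit [:: tt]
  (fun=> 1) (fun=> @ucube R n.+1) 0 e 0 1 set0 _ _ _ e0 ltr01 (countable0 _).
- by [].
- by move=> _; rewrite H0 ltry.
- by rewrite big_seq1 H0 mule0.
rewrite big_seq1 mul1e add0r subr0 divr1 /e.
have -> : eilenberg_cst R n * (m / (2 * eilenberg_cst R n)) = m / 2.
  by field; rewrite gt_eqF.
apply/negP; rewrite -ltNge.
apply: (@lt_le_trans _ _ m%:E); first by rewrite lte_fin ltr_pdivrMr //; lra.
apply: le_trans mH _.
rewrite -[leRHS]mul1e -(expr1n R n).
(* Deleting the coordinate 0 is 1-Lipschitz and maps the slice onto the cube of dimension n. *)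
apply: le_trans (@hausdorff_lipschitz R n.+1 n n (col' ord0) _ 1 ltr01 _).
- apply: le_hausdorff => x x01.
  exists (row_mx (const_mx s : 'rV_1) x).
    split=> [i|] /=; last exact: cons_mx0.
    case: (unliftP ord0 i) => [j ->|->]; first by rewrite cons_mxS.
    by rewrite cons_mx0 (ltW s0) (ltW s1).
  by apply/rowP => j; rewrite mxE cons_mxS.
- move=> x y _ _; rewrite mul1r !euclidE ler_sqrt ?nsq_ge0 //.
  rewrite (_ : col' ord0 x - col' ord0 y = col' ord0 (x - y)) ?col'0_nsq //.
  by apply/rowP => j; rewrite !mxE.
Qed.
End UnitCube.

(** * Simplexes *)

Section Simplex.
Variables (R : realType) (d : nat).
Implicit Types (x y : 'rV[R]_d) (phi : 'cV[R]_(d + 1)).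

Definition edges k (t : 'M[R]_(k.+1, d)) : 'M[R]_(k, d) :=
  \matrix_(i < k, j < d) (t (lift ord0 i) j - t ord0 j).

Lemma affinely_independentE k (t : 'M[R]_(k.+1, d)) :
  affinely_independent t = row_free (edges t).
Proof. by []. Qed.

Definition par k (t : 'M[R]_(k.+1, d)) (u : 'rV[R]_k) : 'rV[R]_d :=
  row ord0 t + u *m edges t.

Lemma parE k (t : 'M[R]_(k.+1, d)) (w : 'rV[R]_k.+1) :
  \sum_i w ord0 i = 1 -> w *m t = par t (\row_i w ord0 (lift ord0 i)).
Proof.
move=> w1; apply/rowP => j; rewrite !mxE big_ord_recl.
have -> : w ord0 ord0 = 1 - \sum_i w ord0 (lift ord0 i).
  by rewrite -w1 big_ord_recl addrK.
rewrite mulrBl mul1r mulr_suml -addrA; congr (_ + _).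
by rewrite addrC -sumrB; apply: eq_bigr => i _; rewrite !mxE mulrBr.
Qed.

(** Affine independence becomes linear independence in homogeneous coordinates, so that [pinvmx] of
    [hmat t] yields barycentric coordinates. *)
Lemma affinely_independent_hmat k (t : 'M[R]_(k.+1, d)) :
  affinely_independent t = row_free (hmat t).
Proof.
rewrite affinely_independentE; apply/idP/idP => h.
- apply/row_freeP; have [D ED] := row_freeP h.
  suff inj (w : 'rV[R]_k.+1) : w *m hmat t = 0 -> w = 0.
    have : row_free (hmat t).
      by rewrite -kermx_eq0; apply/eqP/row_matrixP => i; rewrite row0; apply: inj;
        rewrite -row_mul mulmx_ker row0.
    exact: row_freeP.
  rewrite /hmat mul_mx_row => /(congr1 (fun M => (lsubmx M, rsubmx M))).
  rewrite row_mxKl row_mxKr => -[wt ws].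
  have {ws}ws : \sum_i w ord0 i = 0.
    have /rowP/(_ ord0) := ws; rewrite !mxE /=.
    by move=> {2}<-; apply: eq_bigr => i _; rewrite mxE mulr1.
  pose u : 'rV[R]_k := \row_i w ord0 (lift ord0 i).
  have w0 : w ord0 ord0 = - \sum_i u ord0 i.
    move: ws; rewrite big_ord_recl => /eqP; rewrite addr_eq0 => /eqP ->.
    by congr (- _); apply: eq_bigr => i _; rewrite mxE.
  have uE : u *m edges t = 0.
    have <- : w *m t = 0 by rewrite wt; apply/matrixP => i j; rewrite !mxE.
    apply/rowP => j.
    rewrite !mxE [RHS]big_ord_recl w0 mulNr mulr_suml addrC -sumrB.
    by apply: eq_bigr => i _; rewrite !mxE mulrBr.
  have u0 : u = 0 by rewrite -[u]mulmx1 -ED mulmxA uE mul0mx.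
  apply/rowP => i; rewrite mxE.
  case: (unliftP ord0 i) => [j ->|->].
    by have /rowP/(_ j) := u0; rewrite !mxE.
  by rewrite w0 u0 big1 ?oppr0 // => j _; rewrite mxE.
- have [D ED] := row_freeP h; rewrite -kermx_eq0; apply/eqP/row_matrixP => l.
  rewrite row0; set u := row l _.
  have uE : u *m edges t = 0 by rewrite -row_mul mulmx_ker row0.
  pose w : 'rV[R]_k.+1 := row_mx (const_mx (- \sum_i u ord0 i) : 'rV_1) u.
  have w0 : w ord0 ord0 = - \sum_i u ord0 i by exact: cons_mx0.
  have wS i : w ord0 (lift ord0 i) = u ord0 i by exact: cons_mxS.
  have w_0 : w *m hmat t = 0.
    rewrite /hmat mul_mx_row -row_mx0; congr row_mx; apply/rowP => j.
      rewrite -uE !mxE big_ord_recl w0 mulNr mulr_suml addrC -sumrB.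
      by apply: eq_bigr => i _; rewrite wS !mxE mulrBr.
    rewrite !mxE big_ord_recl w0 mxE mulr1 addrC; apply/eqP; rewrite subr_eq0.
    by apply/eqP/eq_bigr => i _; rewrite wS [const_mx _ _ _]mxE mulr1.
  have {}w_0 : w = 0 by rewrite -[w]mulmx1 -ED mulmxA w_0 mul0mx.
  by apply/rowP => i; rewrite -wS w_0 !mxE.
Qed.

Lemma hullP k (t : 'M[R]_(k.+1, d)) x :
  hull t x <-> exists2 w : 'rV[R]_k.+1, (forall i, 0 <= w ord0 i) &
    hmat x = w *m hmat t.
Proof.
split=> [[w [w0 w1] <-]|[w w0 xw]].
  by exists w => //; rewrite hmat_comb // => i; rewrite ord1.
by have [-> w1] := hmat_combP xw; exists w => //; split.
Qed.

Definition vert k (phi : 'cV[R]_(d + 1)) (t : 'M[R]_(k.+1, d)) i : R :=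
  (hmat t *m phi) i ord0.

Lemma aff_hull k (t : 'M[R]_(k.+1, d)) x : hull t x ->
  exists2 w : 'rV[R]_k.+1, (forall i, 0 <= w ord0 i) /\ \sum_i w ord0 i = 1 &
    forall phi, aff phi x = \sum_i w ord0 i * vert phi t i.
Proof.
move=> [w [w0 w1] <-]; exists w => // phi.
by rewrite aff_comb //; apply: eq_bigr => i _; rewrite aff_rows.
Qed.

Lemma vert_hull k (t : 'M[R]_(k.+1, d)) i : hull t (row i t).
Proof.
exists (delta_mx ord0 i); last by rewrite -rowE.
split=> [j|]; first by rewrite mxE ler0n.
rewrite (bigD1 i) //= mxE !eqxx big1 ?addr0 // => j ji.
by rewrite mxE (negbTE ji) andbF.
Qed.

Lemma vert_aff k phi (t : 'M[R]_(k.+1, d)) i : vert phi t i = aff phi (row i t).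
Proof. by rewrite aff_rows. Qed.

Definition bary k (t : 'M[R]_(k.+1, d)) : 'rV[R]_d :=
  (const_mx k.+1%:R^-1 : 'rV[R]_k.+1) *m t.

Lemma bary_weights k : \sum_(i < k.+1) (const_mx k.+1%:R^-1 : 'rV[R]_k.+1) ord0 i = 1.
Proof.
under eq_bigr do rewrite mxE.
by rewrite sumr_const card_ord -[LHS]mulr_natl mulfV ?pnatr_eq0.
Qed.

Lemma bary_hull k (t : 'M[R]_(k.+1, d)) : hull t (bary t).
Proof.
exists (const_mx k.+1%:R^-1) => //; split; last exact: bary_weights.
by move=> i; rewrite mxE invr_ge0.
Qed.

Lemma aff_bary k phi (t : 'M[R]_(k.+1, d)) :
  aff phi (bary t) = k.+1%:R^-1 * \sum_i vert phi t i.
Proof.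
rewrite /bary aff_comb ?bary_weights // mulr_sumr.
by apply: eq_bigr => i _; rewrite mxE aff_rows.
Qed.

Definition sided k (phi : 'cV[R]_(d + 1)) (t : 'M[R]_(k.+1, d)) : Prop :=
  (forall i, 0 <= vert phi t i) \/ (forall i, vert phi t i <= 0).

Lemma aff_hull_ge0 k phi (t : 'M[R]_(k.+1, d)) x :
  (forall i, 0 <= vert phi t i) -> hull t x -> 0 <= aff phi x.
Proof.
by move=> h /aff_hull[w [w0 _] ->]; apply: sumr_ge0 => i _; rewrite mulr_ge0.
Qed.

Lemma aff_hull_le0 k phi (t : 'M[R]_(k.+1, d)) x :
  (forall i, vert phi t i <= 0) -> hull t x -> aff phi x <= 0.
Proof.
move=> h /aff_hull[w [w0 _] ->]; apply: sumr_le0 => i _.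
by rewrite mulr_ge0_le0.
Qed.

Lemma vertN k phi (t : 'M[R]_(k.+1, d)) i : vert (- phi) t i = - vert phi t i.
Proof. by rewrite /vert mulmxN mxE. Qed.

Lemma sidedN k phi (t : 'M[R]_(k.+1, d)) : sided phi t -> sided (- phi) t.
Proof.
by move=> [h|h]; [right|left] => i; rewrite vertN ?oppr_le0 ?oppr_ge0.
Qed.

(** The barycentre has positive weights, so if [phi] takes values of one sign at the vertices, its
    sign at the barycentre decides which. This makes [bary] the test point for inclusions
    throughout. *)
Lemma bary_ge0 k phi (t : 'M[R]_(k.+1, d)) :
  sided phi t -> 0 <= aff phi (bary t) -> forall i, 0 <= vert phi t i.
Proof.
move=> [//|h]; rewrite aff_bary pmulr_rge0 ?invr_gt0 // => s0 i.
have : \sum_i - vert phi t i == 0.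
  rewrite sumrN oppr_eq0 eq_le s0 andbT; apply: sumr_le0 => j _; exact: h.
rewrite psumr_eq0 => [/allP/(_ i (mem_index_enum _))|j _]; last by rewrite oppr_ge0.
by rewrite oppr_eq0 => /eqP ->.
Qed.

Lemma bary_lt0 k phi (t : 'M[R]_(k.+1, d)) : sided phi t -> aff phi (bary t) < 0 ->
  (forall i, vert phi t i <= 0) /\ exists i, vert phi t i < 0.
Proof.
move=> [h|h] b0.
  by have := aff_hull_ge0 h (bary_hull t); rewrite leNgt b0.
split=> //; apply: contrapT => /forallNP h'.
have : 0 <= aff phi (bary t).
  by apply: aff_hull_ge0 (bary_hull t) => i; rewrite leNgt; apply/negP/h'.
by rewrite leNgt b0.
Qed.

Lemma bary_le0 k phi (t : 'M[R]_(k.+1, d)) :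
  sided phi t -> aff phi (bary t) <= 0 -> forall i, vert phi t i <= 0.
Proof.
move=> /sidedN h b0 i; rewrite -oppr_ge0 -vertN.
by apply: bary_ge0 => //; rewrite affN oppr_ge0.
Qed.

Lemma bary_gt0 k phi (t : 'M[R]_(k.+1, d)) :
  (forall i, 0 <= vert phi t i) -> (exists i, vert phi t i != 0) ->
  0 < aff phi (bary t).
Proof.
move=> h [i hi]; rewrite lt_neqAle (aff_hull_ge0 h (bary_hull t)) andbT.
apply: contra hi; rewrite eq_sym => /eqP b0.
have h' := bary_le0 (or_introl h) (eq_ind _ (fun z => z <= 0) (lexx 0) _ (esym b0)).
by rewrite eq_le h h'.
Qed.

(* Functionals defining the hull of a nondegenerate simplex: barycentric
   coordinates and equations of its affine span. *)
Definition facets k (p : 'M[R]_(k.+1, d)) : seq 'cV[R]_(d + 1) :=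
  let D := pinvmx (hmat p) in let N := 1%:M - D *m hmat p in
  [seq col j D | j <- enum 'I_k.+1] ++
  [seq col j N | j <- enum 'I_(d + 1)] ++ [seq - col j N | j <- enum 'I_(d + 1)].

Lemma aff_col m (M : 'M[R]_(d + 1, m)) j x :
  aff (col j M) x = (hmat x *m M) ord0 j.
Proof.
by rewrite /aff [LHS]mxE [RHS]mxE; apply: eq_bigr => i _; rewrite [col _ _ _ _]mxE.
Qed.

Lemma hmat_pinv k (p : 'M[R]_(k.+1, d)) : affinely_independent p ->
  hmat p *m pinvmx (hmat p) = 1%:M.
Proof. by rewrite affinely_independent_hmat => /mulmxVp. Qed.

Lemma hull_facets k (p : 'M[R]_(k.+1, d)) x : affinely_independent p ->
  hull p x <-> forall phi, phi \in facets p -> 0 <= aff phi x.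
Proof.
move=> pfree; have pE := hmat_pinv pfree.
have pN : hmat p *m (1%:M - pinvmx (hmat p) *m hmat p) = 0.
  by rewrite mulmxBr mulmx1 mulmxA pE mul1mx subrr.
split.
  move=> /hullP[w w0 xw] phi; rewrite !mem_cat => /or3P[] /mapP[j _ ->].
  - by rewrite aff_col xw -mulmxA pE mulmx1.
  - by rewrite aff_col xw -mulmxA pN mulmx0 mxE.
  - by rewrite affN aff_col xw -mulmxA pN mulmx0 mxE oppr0.
move=> h; apply/hullP; exists (hmat x *m pinvmx (hmat p)) => [i|].
  rewrite -aff_col; apply: h; rewrite mem_cat; apply/orP; left.
  by apply/mapP; exists i; rewrite ?mem_enum.
apply/eqP; rewrite -subr_eq0 -mulmxA -[X in X - _]mulmx1 -mulmxBr.
apply/eqP/rowP => j; rewrite -aff_col [RHS]mxE; apply/eqP.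
rewrite eq_le; apply/andP; split; last first.
  apply: h; rewrite !mem_cat; apply/or3P; apply: Or32.
  by apply/mapP; exists j; rewrite ?mem_enum.
rewrite -oppr_ge0 -affN; apply: h; rewrite !mem_cat; apply/or3P; apply: Or33.
by apply/mapP; exists j; rewrite ?mem_enum.
Qed.

Lemma hull_borel k (p : 'M[R]_(k.+1, d)) : affinely_independent p ->
  borel (hull p).
Proof.
move=> pfree; rewrite (_ : hull p = \bigcap_(phi in [set phi | phi \in facets p])
    [set x | aff (- phi) x <= 0]).
  apply: (@fin_bigcap_measurable _
    (g_sigma_algebraType [set U : set 'rV[R]_d | open U])).
    exact: finite_seq.
  by move=> phi _; exact: borel_halfspace.
apply/seteqP; split=> x.
  by move=> /(hull_facets _ pfree) h phi /h /=; rewrite affN oppr_le0.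
by move=> h; apply/(hull_facets _ pfree) => phi /h /=; rewrite affN oppr_le0.
Qed.

Lemma par_lipschitz k (t : 'M[R]_(k.+1, d)) (a b : R) :
  exists2 L : R, 0 < L & forall u v : 'rV[R]_k,
    euclid (par t (a *: u + const_mx b) - par t (a *: v + const_mx b))
      <= L * euclid (u - v).
Proof.
have [L L0 hL] := lipschitz_mulmx (edges t).
exists (L * (1 + `|a|)) => [|u v]; first by rewrite mulr_gt0 // ltr_pwDl.
rewrite /par opprD addrACA subrr add0r -mulmxBl opprD addrACA subrr addr0.
rewrite -scalerBr; apply: le_trans (hL _) _; rewrite -mulrA ler_pM2l //.
by rewrite euclidZ ler_wpM2r ?euclid_ge0 // lerDr.
Qed.

(** Weights between -1 and 2 leave room for translating the hull along an edge by at most the length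
    of that edge. *)
Definition wide_hull k (t : 'M[R]_(k.+1, d)) : set 'rV[R]_d :=
  [set x | exists2 w : 'rV[R]_k.+1,
     \sum_i w ord0 i = 1 /\ (forall i, -1 <= w ord0 i <= 2) & x = w *m t].

Lemma hull_wide k (t : 'M[R]_(k.+1, d)) : hull t `<=` wide_hull t.
Proof.
move=> _ [w [w0 w1] <-]; exists w => //; split=> // i.
have := w0 i; have : w ord0 i <= 1.
  by rewrite -w1 (bigD1 i) //= lerDl sumr_ge0.
by move=> h1 h2; apply/andP; split; lra.
Qed.

Lemma hausdorff_wide k j (t : 'M[R]_(k.+1, d)) : (k <= j)%N ->
  (hausdorff j (wide_hull t) < +oo)%E /\
  ((k < j)%N -> hausdorff j (wide_hull t) = 0%E).
Proof.
move=> kj; have [L L0 hL] := par_lipschitz t 3 (- 1).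
have sub : wide_hull t `<=`
    (fun u => par t (3 *: u + const_mx (- 1))) @` @ucube R k.
  move=> _ [w [w1 w2] ->].
  exists (\row_i ((w ord0 (lift ord0 i) + 1) / 3)).
    by move=> i; rewrite mxE; have /andP[h1 h2] := w2 (lift ord0 i);
      apply/andP; split; lra.
  rewrite parE //; congr par; apply/rowP => i; rewrite !mxE.
  by rewrite mulrC divfK ?pnatr_eq0 // addrK.
have [h1 h2] := hausdorff_ucube_image L0 kj (fun u v _ _ => hL u v).
split; first by apply: le_lt_trans (le_hausdorff _ sub) h1.
by move=> /h2; exact: hausdorff_null_sub.
Qed.

Lemma hausdorff_hull_fin k (t : 'M[R]_(k.+1, d)) :
  (hausdorff k (hull t) < +oo)%E.
Proof.
exact: le_lt_trans (le_hausdorff _ (@hull_wide _ t)) (hausdorff_wide t (leqnn k)).1.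
Qed.

(** The affine coordinates from the first vertex, multiplied by k + 1, form a Lipschitz map whose
    image of the hull contains the unit cube: the weights [u i / (k + 1)] have sum less than 1. *)
Lemma hausdorff_hull_gt0 k (t : 'M[R]_(k.+1, d)) : affinely_independent t ->
  (0 < hausdorff k (hull t))%E.
Proof.
rewrite affinely_independentE => /row_freeP[D ED].
have [L L0 hL] := lipschitz_mulmx D.
pose f (x : 'rV[R]_d) : 'rV[R]_k := k.+1%:R *: ((x - row ord0 t) *m D).
have L'0 : 0 < k.+1%:R * L by rewrite mulr_gt0.
have fL x y : hull t x -> hull t y ->
    euclid (f x - f y) <= k.+1%:R * L * euclid (x - y).
  move=> _ _; rewrite /f -scalerBr -mulmxBl opprB addrA subrK euclidZ ger0_norm //.
  by rewrite -mulrA ler_pM2l.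
have := hausdorff_lipschitz k L'0 fL.
rewrite -lee_pdivrMl ?exprn_gt0 //; apply: lt_le_trans.
rewrite mule_gt0 // ?lte_fin ?invr_gt0 ?exprn_gt0 //.
apply: lt_le_trans (hausdorff_ucube_gt0 R k) _; apply: le_hausdorff => u u01.
pose s := \sum_i u ord0 i.
have s0 : 0 <= s by apply: sumr_ge0 => i _; case/andP: (u01 i).
have sk : s <= k%:R.
  rewrite -[X in _ <= X%:R]card_ord -sumr_const /s.
  by apply: ler_sum => i _; case/andP: (u01 i).
pose w : 'rV[R]_k.+1 :=
  row_mx (const_mx (1 - s / k.+1%:R) : 'rV_1) (k.+1%:R^-1 *: u).
have w0 : w ord0 ord0 = 1 - s / k.+1%:R.
  exact: cons_mx0.
have wS i : w ord0 (lift ord0 i) = k.+1%:R^-1 * u ord0 i.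
  by rewrite cons_mxS mxE.
have w1 : \sum_i w ord0 i = 1.
  rewrite big_ord_recl w0; under eq_bigr do rewrite wS.
  by rewrite -mulr_sumr -/s mulrC subrK.
exists (w *m t).
  exists w => //; split=> // i; case: (unliftP ord0 i) => [j ->|->].
    by rewrite wS mulr_ge0 ?invr_ge0 //; case/andP: (u01 j).
  by rewrite w0 subr_ge0 ler_pdivrMr // mul1r (le_trans sk) // ler_nat.
rewrite parE // /f /par addrAC subrr add0r -mulmxA ED mulmx1.
by apply/rowP => i; rewrite mxE [X in _ * X]mxE wS mulrA mulfV ?mul1r // pnatr_eq0.
Qed.

(** If [phi] has the same nonzero value at all vertices the section is empty. Otherwise its
    translates along an edge on which [phi] varies are disjoint, of equal measure, and infinitely
    many of them lie in [wide_hull t], which has finite measure. *)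
Lemma hausdorff_hull_null k (t : 'M[R]_(k.+1, d)) phi : affinely_independent t ->
  (exists i, vert phi t i != 0) ->
  hausdorff k (hull t `&` [set x | aff phi x = 0]) = 0%E.
Proof.
move=> tfree [i0 c0]; set A := _ `&` _.
have [[i1 c1]|same] := pselect (exists i1, vert phi t i1 != vert phi t i0); last first.
  rewrite (_ : A = set0) ?hausdorff_set0 // -subset0 => x [] /aff_hull[w [w0 w1]].
  move=> /(_ phi) h; rewrite /= h => /eqP.
  rewrite (eq_bigr (fun i => w ord0 i * vert phi t i0)) => [|i _]; last first.
    by congr (_ * _); apply: contrapT => /eqP c; apply: same; exists i.
  by rewrite -mulr_suml w1 mul1r (negbTE c0).
have wfin : hausdorff k (wide_hull t) \is a fin_num.
  by rewrite ge0_fin_numE ?hausdorff_ge0 // (hausdorff_wide t (leqnn k)).1.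
pose e : 'rV[R]_d := row i1 t - row i0 t.
have e0 x (a : R) : aff phi (x + a *: e) =
    aff phi x + a * (vert phi t i1 - vert phi t i0).
  have -> : vert phi t i1 - vert phi t i0 =
      \sum_i e ord0 i * phi (lshift 1 i) ord0.
    rewrite /vert -!aff_rows !affE opprD addrACA subrr addr0 -sumrB.
    by apply: eq_bigr => i _; rewrite !mxE mulrBl.
  rewrite !affE mulr_sumr addrAC -big_split /=; congr (_ + _).
  by apply: eq_bigr => i _; rewrite [(x + _) _ _]mxE [(a *: e) _ _]mxE; ring.
have de0 : vert phi t i1 - vert phi t i0 != 0 by rewrite subr_eq0.
pose a (n : nat) : R := n.+1%:R^-1.
pose B (n : nat) := [set x + a n *: e | x in A].
have BA n : hausdorff k (B n) = hausdorff k A by exact: hausdorff_translate.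
pose t' n : 'M[R]_(k.+1, d) := t + \matrix_(i, j) (a n *: e) ord0 j.
have t'free n : affinely_independent (t' n).
  move: tfree; rewrite !affinely_independentE (_ : edges (t' n) = edges t) //.
  by apply/matrixP => i j; rewrite !mxE; ring.
have t'w n (w : 'rV[R]_k.+1) : \sum_i w ord0 i = 1 ->
    w *m t' n = w *m t + a n *: e.
  move=> w1; rewrite mulmxDr; congr (_ + _); apply/rowP => j; rewrite mxE.
  by under eq_bigr do rewrite mxE; rewrite -mulr_suml w1 mul1r.
have BE n : B n = hull (t' n) `&`
    [set x | aff phi x = a n * (vert phi t i1 - vert phi t i0)].
  apply/seteqP; split=> [_ [x [[w [w0 w1] <-] x0] <-]|x].
    by split=> /=; [exists w => //; rewrite t'w | rewrite e0 x0 add0r].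
  move=> [[w [w0 w1] <-]]; rewrite /= t'w // e0 => x0.
  exists (w *m t) => //; split; first by exists w.
  by move: x0 => /eqP; rewrite -subr_eq0 addrK => /eqP.
have mB n : borel (B n).
  rewrite BE; apply: borelI; first exact: hull_borel.
  set c := _ * _; have [L L0 hL] := aff_lip phi.
  rewrite (_ : mkset _ = [set x | aff phi x <= c] `&` [set x | - aff phi x <= - c]).
    apply: borelI; apply: lipschitz_borel; first by exists L.
    by exists L => // x y; rewrite -opprD normrN.
  apply/seteqP; split=> x /=; rewrite lerN2; first by move=> ->.
  by move=> [h1 h2]; apply/eqP; rewrite eq_le h1.
have Bw n : B n `<=` wide_hull t.
  move=> _ [_ [[w [w0 w1] <-] _] <-].
  exists (w + a n *: (delta_mx ord0 i1 - delta_mx ord0 i0)); last first.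
    by rewrite mulmxDl -scalemxAl mulmxBl -!rowE.
  split=> [|i].
    under eq_bigr do rewrite !mxE !eqxx /=.
    rewrite big_split /= w1 -mulr_sumr sumrB.
    have S1 l : \sum_(i < k.+1) (i == l)%:R = 1 :> R.
      by rewrite (bigD1 l) //= eqxx big1 ?addr0 // => i /negbTE ->.
    by rewrite !S1 subrr mulr0 addr0.
  have h0 := w0 i; have h1 : w ord0 i <= 1.
    by rewrite -w1 (bigD1 i) //= lerDl sumr_ge0.
  have a0 : 0 <= a n by rewrite invr_ge0.
  have a1 : a n <= 1 by rewrite invf_le1 // ler1n.
  rewrite !mxE !eqxx /=; case: eqP => _; case: eqP => _ /=;
    rewrite ?subr0 ?subrr ?sub0r ?mulr0 ?mulr1 ?mulrN1; apply/andP; split; lra.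
have Bsum N : (\sum_(n <- iota 0 N) hausdorff k A <= hausdorff k (wide_hull t))%E.
  rewrite (eq_bigr (fun n => hausdorff k (wide_hull t `&` B n))); last first.
    by move=> n _; rewrite setIidr // BA.
  rewrite -hausdorff_sum ?iota_uniq //; first by apply: le_hausdorff => x [].
  move=> n m _ _ nm; rewrite (_ : _ `&` _ = set0) ?hausdorff_set0 //.
  rewrite -subset0 !BE => x [[_ /= ->] [_ /= /(mulIf de0) /invr_inj /eqP]].
  by rewrite eqr_nat eqSS (negbTE nm).
have Afin : hausdorff k A \is a fin_num.
  rewrite ge0_fin_numE ?hausdorff_ge0 //.
  apply: (le_lt_trans _ (hausdorff_hull_fin t)); apply: le_hausdorff => x [].
  exact.
move: Bsum; rewrite -(fineK Afin) -(fineK wfin).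
set r := fine _; set M := fine _ => Bsum.
have r0 : 0 <= r by rewrite fine_ge0 ?hausdorff_ge0.
congr (_%:E); apply/eqP; rewrite eq_le r0 andbT leNgt; apply/negP => rpos.
have := Bsum (Num.truncn (M / r)).+1.
rewrite sumEFin lee_fin big_const_seq count_predT size_iota iter_addr addr0.
rewrite -[leLHS]mulr_natl -ler_pdivlMr // leNgt.
by rewrite Num.Theory.truncnS_gt.
Qed.
End Simplex.

(** * Orientation as the sign of a determinant *)

Section Orientation.
Variables (R : realType) (d : nat).

Definition bmx k (s t : 'M[R]_(k.+1, d)) : 'M[R]_k.+1 :=
  hmat t *m pinvmx (hmat s).

(** The plane of [t] lies in that of [s]; for nondegenerate [t] the dimensions force the two planes
    to coincide, see [cospan_sym]. *)
Definition cospan k (s t : 'M[R]_(k.+1, d)) : Prop := (hmat t <= hmat s)%MS.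

Lemma bmxE k (s t : 'M[R]_(k.+1, d)) : cospan s t -> hmat t = bmx s t *m hmat s.
Proof. by move=> st; rewrite /bmx mulmxKpV. Qed.

Lemma bmx_unique k (s t : 'M[R]_(k.+1, d)) B : affinely_independent s ->
  hmat t = B *m hmat s -> bmx s t = B.
Proof. by move=> sfree E; rewrite /bmx E -mulmxA hmat_pinv // mulmx1. Qed.

Lemma det_bmx_mul k (p s t : 'M[R]_(k.+1, d)) : affinely_independent p ->
  cospan p s -> cospan s t -> \det (bmx p t) = \det (bmx s t) * \det (bmx p s).
Proof.
move=> pfree ps st; rewrite -det_mulmx; congr (\det _); apply: bmx_unique => //.
by rewrite -mulmxA -bmxE // -bmxE.
Qed.

Lemma det_bmx_neq0 k (s t : 'M[R]_(k.+1, d)) : affinely_independent t ->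
  cospan s t -> \det (bmx s t) != 0.
Proof.
move=> tfree st; have E : bmx s t *m (hmat s *m pinvmx (hmat t)) = 1%:M.
  by rewrite mulmxA -bmxE // hmat_pinv.
by have [+ _] := mulmx1_unit E; rewrite unitmxE unitfE.
Qed.

Lemma cospan_sym k (s t : 'M[R]_(k.+1, d)) : affinely_independent t ->
  cospan s t -> cospan t s.
Proof.
move=> tfree st; have := det_bmx_neq0 tfree st; rewrite -unitfE -unitmxE => u.
by rewrite /cospan -[hmat s](mulKmx u) -bmxE // submxMl.
Qed.

Lemma cospan_trans k (p s t : 'M[R]_(k.+1, d)) : cospan p s -> cospan s t -> cospan p t.
Proof. by move=> ps st; exact: submx_trans st ps. Qed.

Lemma hmat_row k (t : 'M[R]_(k.+1, d)) i : row i (hmat t) = hmat (row i t).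
Proof. by rewrite /hmat row_row_mx row_const. Qed.

Lemma hull_cospan k (p t : 'M[R]_(k.+1, d)) : hull t `<=` hull p -> cospan p t.
Proof.
move=> tp; apply/row_subP => i; rewrite hmat_row.
by have /hullP[w _ ->] := tp _ (vert_hull t i); exact: submxMl.
Qed.

Lemma same_orientationE k (s t : 'M[R]_(k.+1, d)) : affinely_independent s ->
  cospan s t -> same_orientation s t <-> 0 < \det (bmx s t).
Proof.
move=> sfree st; split.
  by move=> [B [B1 tE dB]]; rewrite (@bmx_unique _ _ _ B) // tE hmat_comb.
move=> h; have [tE B1] := hmat_combP (bmxE st).
by exists (bmx s t); split.
Qed.

(** The determinants of the changes of basis multiply, and [==] on booleans is the product of
    signs. *)
Lemma same_orientation_trans k (p s t : 'M[R]_(k.+1, d)) :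
  affinely_independent p -> affinely_independent s -> affinely_independent t ->
  cospan p s -> cospan s t ->
  `[< same_orientation p t >] =
    (`[< same_orientation p s >] == `[< same_orientation s t >]).
Proof.
move=> pfree sfree tfree ps st; have pt := cospan_trans ps st.
have sE a b : affinely_independent a -> cospan a b ->
    `[< @same_orientation R d k a b >] = (0 < \det (bmx a b)).
  by move=> afree ab; apply/asboolP/idP => /(same_orientationE afree ab).
rewrite !sE // (det_bmx_mul pfree ps st).
have := det_bmx_neq0 sfree ps; have := det_bmx_neq0 tfree st.
case: (ltrgtP 0 (\det (bmx s t))) => // h1 _;
  case: (ltrgtP 0 (\det (bmx p s))) => // h2 _.
- by rewrite mulr_gt0.
- by rewrite pmulr_rgt0 // ltNge ltW.
- by rewrite nmulr_rgt0 // ltNge ltW.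
- by rewrite nmulr_rgt0.
Qed.
End Orientation.

(** * Cutting simplexes by hyperplanes *)

Section Subdivision.
Variables (R : realType) (d : nat).
Implicit Types (phi : 'cV[R]_(d + 1)) (F : seq 'cV[R]_(d + 1)).

Definition overlap_null k (u v : 'M[R]_(k.+1, d)) : bool :=
  `[< hausdorff k (hull u `&` hull v) = 0%E >].

(** No hyperplane of [F] cuts [t]. When [F] contains the facets of a simplex [p], the hull of [t]
    either lies in that of [p] or overlaps it in a null set, and the barycentre of [t] decides. *)
Definition adapted k F (t : 'M[R]_(k.+1, d)) : Prop :=
  affinely_independent t /\ forall phi, phi \in F -> sided phi t.

Lemma adapted_cat k F F' (t : 'M[R]_(k.+1, d)) :
  adapted (F ++ F') t -> adapted F t /\ adapted F' t.
Proof.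
by move=> [tf h]; split; split=> // phi pF; apply: h; rewrite mem_cat pF ?orbT.
Qed.

Lemma sided_sub k phi (u t : 'M[R]_(k.+1, d)) : hull u `<=` hull t ->
  sided phi t -> sided phi u.
Proof.
move=> ut [h|h]; [left|right] => i; rewrite vert_aff.
  by apply: aff_hull_ge0 h _; apply/ut/vert_hull.
by apply: aff_hull_le0 h _; apply/ut/vert_hull.
Qed.

Lemma vert_hull_sub k (t p : 'M[R]_(k.+1, d)) : affinely_independent p ->
  (forall phi, phi \in facets p -> forall i, 0 <= vert phi t i) ->
  hull t `<=` hull p.
Proof.
move=> pf h x tx; apply/(hull_facets _ pf) => phi phip.
exact: aff_hull_ge0 (h _ phip) tx.
Qed.

Lemma adapted_bary_sub k (t p : 'M[R]_(k.+1, d)) : affinely_independent p ->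
  adapted (facets p) t -> hull p (bary t) -> hull t `<=` hull p.
Proof.
move=> pf [_ ta] /(hull_facets _ pf) h; apply: vert_hull_sub => // phi phip.
by apply: bary_ge0; [exact: ta|exact: h].
Qed.

Lemma adapted_not_sub k (t p : 'M[R]_(k.+1, d)) : affinely_independent p ->
  adapted (facets p) t -> ~ hull t `<=` hull p ->
  exists2 phi, phi \in facets p &
    (forall i, vert phi t i <= 0) /\ exists i, vert phi t i < 0.
Proof.
move=> pf ta tp; apply: contrapT => nex; apply: tp.
apply: adapted_bary_sub => //; apply/(hull_facets _ pf) => phi phip.
rewrite leNgt; apply/negP => b0; apply: nex; exists phi => //.
exact: bary_lt0 (ta.2 _ phip) b0.
Qed.

(** Some facet functional of [p] is nonpositive on [t] and negative at a vertex, so the overlap lies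
    in a null section of [t]. *)
Lemma adapted_overlap k (t p : 'M[R]_(k.+1, d)) : affinely_independent p ->
  adapted (facets p) t -> ~ hull t `<=` hull p -> overlap_null t p.
Proof.
move=> pf ta tp; have [phi phip [h [i hi]]] := adapted_not_sub pf ta tp.
apply/asboolP; apply: hausdorff_null_sub (hausdorff_hull_null (phi := phi) ta.1 _).
  move=> x [tx /(hull_facets _ pf)/(_ _ phip) px]; split=> //=.
  by apply/eqP; rewrite eq_le px andbT; exact: aff_hull_le0 h tx.
by exists i; rewrite lt_eqF.
Qed.

Lemma overlap_nullC k (u v : 'M[R]_(k.+1, d)) : overlap_null u v = overlap_null v u.
Proof. by rewrite /overlap_null setIC. Qed.

Lemma overlap_null_sub k (u v u' v' : 'M[R]_(k.+1, d)) : hull u' `<=` hull u ->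
  hull v' `<=` hull v -> overlap_null u v -> overlap_null u' v'.
Proof.
move=> uu vv /asboolP h; apply/asboolP; apply: hausdorff_null_sub h.
exact: setISS.
Qed.

Lemma overlap_nullN k (u v w : 'M[R]_(k.+1, d)) : affinely_independent w ->
  hull w `<=` hull u -> hull w `<=` hull v -> overlap_null u v -> False.
Proof.
move=> wf wu wv /asboolP h; have := hausdorff_hull_gt0 wf.
by rewrite (hausdorff_null_sub _ h) ?ltxx // => x wx; split; [exact: wu|exact: wv].
Qed.

Definition subdivision k (t : 'M[R]_(k.+1, d)) (s : seq 'M[R]_(k.+1, d)) : Prop :=
  [/\ forall u, u \in s -> affinely_independent u /\ hull u `<=` hull t,
      pairwise (@overlap_null k) s &
      forall x, hull t x -> exists2 u, u \in s & hull u x].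

Lemma subdivision_id k (t : 'M[R]_(k.+1, d)) :
  affinely_independent t -> subdivision t [:: t].
Proof.
move=> tf; split=> // [u|x tx]; first by rewrite inE => /eqP ->; split.
by exists t; rewrite ?mem_head.
Qed.

Lemma pairwise_flatten_map (I J : eqType) (r : rel J) (s : seq I) (f : I -> seq J) (r' : rel I) :
  pairwise r' s -> (forall i, i \in s -> pairwise r (f i)) ->
  (forall i j x y, i \in s -> j \in s -> r' i j -> x \in f i -> y \in f j -> r x y) ->
  pairwise r (flatten (map f s)).
Proof.
elim: s => //= i s IH /andP[is_ ps] hf hr.
rewrite pairwise_cat hf ?mem_head // IH //=; last 2 first.
- by move=> j js; apply: hf; rewrite inE js orbT.
- by move=> j l x y js ls; apply: hr; rewrite inE ?js ?ls orbT.
rewrite andbT; apply/allrelP => x y xi /flattenP[_ /mapP[j js ->]] yj.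
by apply: (hr i j) => //; rewrite ?mem_head ?inE ?js ?orbT //; exact: (allP is_).
Qed.

Lemma subdivision_trans k (t : 'M[R]_(k.+1, d)) s f :
  subdivision t s -> (forall u, u \in s -> subdivision u (f u)) ->
  subdivision t (flatten (map f s)).
Proof.
move=> [h1 h2 h3] hf; split.
- move=> v /flattenP[_ /mapP[u us ->] vu]; have [g1 _ _] := hf _ us.
  by have [? vu'] := g1 _ vu; split=> //; apply: subset_trans vu' (h1 _ us).2.
- apply: pairwise_flatten_map h2 _ _ => [u us|u v x y us vs uv xu yv].
    by have [] := hf _ us.
  have [g1 _ _] := hf _ us; have [g2 _ _] := hf _ vs.
  exact: overlap_null_sub (g1 _ xu).2 (g2 _ yv).2 uv.
- move=> x /h3[u us ux]; have [_ _ g] := hf _ us; have [v vu vx] := g _ ux.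
  by exists v => //; apply/flattenP; exists (f u) => //; exact: map_f.
Qed.

(** Moves the vertex [i] along the edge towards the vertex [j], by the fraction [a]. *)
Definition slide k (t : 'M[R]_(k.+1, d)) i j (a : R) : 'M[R]_(k.+1, d) :=
  \matrix_(l, m) if l == i then (1 - a) * t i m + a * t j m else t l m.

Definition slide_mx k (i j : 'I_k.+1) (a : R) : 'M[R]_k.+1 :=
  \matrix_(l, m) if l == i then (1 - a) * (m == i)%:R + a * (m == j)%:R
                 else (m == l)%:R.

Lemma sum_delta k (f : 'I_k -> R) (i : 'I_k) : \sum_m (m == i)%:R * f m = f i.
Proof.
rewrite (bigD1 i) //= eqxx mul1r big1 ?addr0 // => j /negbTE ->.
by rewrite mul0r.
Qed.

Lemma slide_row k (M : 'M[R]_(k.+1, d + 1)) i j a l :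
  forall m, (slide_mx i j a *m M) l m =
    if l == i then (1 - a) * M i m + a * M j m else M l m.
Proof.
move=> m; rewrite mxE; under eq_bigr do rewrite mxE.
case: eqP => _; last exact: (sum_delta (fun l => M l m)).
under eq_bigr do rewrite mulrDl -!mulrA.
by rewrite big_split /= -!mulr_sumr !(sum_delta (fun l => M l m)).
Qed.

Lemma hmat_slide k (t : 'M[R]_(k.+1, d)) i j a :
  hmat (slide t i j a) = slide_mx i j a *m hmat t.
Proof.
apply/matrixP => l m; rewrite slide_row.
case: (split_ordP m) => n ->; rewrite ?row_mxEl ?row_mxEr !mxE //.
by case: eqP => // _; rewrite !mulr1 subrK.
Qed.

Lemma vert_slide k phi (t : 'M[R]_(k.+1, d)) i j a l :
  vert phi (slide t i j a) l =
    if l == i then (1 - a) * vert phi t i + a * vert phi t j else vert phi t l.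
Proof.
rewrite /vert hmat_slide -mulmxA mxE; under eq_bigr do rewrite mxE.
case: eqP => _; last exact: (sum_delta (fun l => (hmat t *m phi) l ord0)).
under eq_bigr do rewrite mulrDl -!mulrA.
by rewrite big_split /= -!mulr_sumr !(sum_delta (fun l => (hmat t *m phi) l ord0)).
Qed.

Lemma slide_free k (t : 'M[R]_(k.+1, d)) i j a : i != j -> a < 1 ->
  affinely_independent t -> affinely_independent (slide t i j a).
Proof.
move=> ij a1; rewrite !affinely_independent_hmat hmat_slide => tf.
have -> : row_free (slide_mx i j a *m hmat t) = row_free (slide_mx i j a).
  by rewrite /row_free mxrankMfree.
rewrite -kermx_eq0; apply/eqP/row_matrixP => r; rewrite row0.
set w := row r _; have w0 : w *m slide_mx i j a = 0 by rewrite -row_mul mulmx_ker row0.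
have wE m : \sum_l w ord0 l * slide_mx i j a l m = 0.
  by have /rowP/(_ m) := w0; rewrite mxE [RHS]mxE.
have wi : w ord0 i = 0.
  have := wE i; rewrite (bigD1 i) //= big1 => [|l li].
    rewrite addr0 [slide_mx _ _ _ _ _]mxE !eqxx (negbTE ij) mulr1 mulr0 addr0.
    by move=> /eqP; rewrite mulf_eq0 [_ - _ == 0]gt_eqF ?subr_gt0 ?orbF // => /eqP.
  by rewrite [slide_mx _ _ _ _ _]mxE (negbTE li) eq_sym (negbTE li) mulr0.
apply/rowP => m; rewrite [RHS]mxE; have [->//|mi] := eqVneq m i.
have := wE m; rewrite (bigD1 m) //= big1 => [|l lm].
  by rewrite addr0 [slide_mx _ _ _ _ _]mxE (negbTE mi) eqxx mulr1.
have [->|li] := eqVneq l i; first by rewrite wi mul0r.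
by rewrite [slide_mx _ _ _ _ _]mxE (negbTE li) eq_sym (negbTE lm) mulr0.
Qed.

(** In the weights of [t], this piece is given by one linear inequality; the complementary piece
    [slide t j i (1 - a)] is given by the reverse inequality, which yields [bisection]. *)
Lemma slide_hullP k (t : 'M[R]_(k.+1, d)) i j a x : i != j -> 0 <= a -> a < 1 ->
  hull (slide t i j a) x <->
  exists w : 'rV[R]_k.+1, [/\ forall l, 0 <= w ord0 l, hmat x = w *m hmat t &
    a * w ord0 i <= (1 - a) * w ord0 j].
Proof.
move=> ij a0 a1.
have key (u : 'rV[R]_k.+1) l : (u *m slide_mx i j a) ord0 l =
    if l == i then (1 - a) * u ord0 i
    else if l == j then a * u ord0 i + u ord0 j else u ord0 l.
  rewrite mxE (bigD1 i) //= [slide_mx _ _ _ _ _]mxE eqxx.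
  rewrite (eq_bigr (fun m => (m == l)%:R * (if m == i then 0 else u ord0 m))); last first.
    move=> m mi; rewrite [slide_mx _ _ _ _ _]mxE (negbTE mi) mulrC.
    by rewrite [in LHS]eq_sym.
  have -> : \sum_(m < k.+1 | m != i) (m == l)%:R * (if m == i then 0 else u ord0 m)
      = \sum_m (m == l)%:R * (if m == i then 0 else u ord0 m).
    by rewrite [RHS](bigD1 i) //= eqxx mulr0 add0r.
  rewrite (sum_delta (fun m => if m == i then 0 else u ord0 m)).
  have [->|li] := eqVneq l i; first by rewrite (negbTE ij) mulr1 mulr0 !addr0 mulrC.
  by have [->|lj] := eqVneq l j => /=; ring.
split.
  move=> /hullP[u u0 xu]; exists (u *m slide_mx i j a).
  rewrite -mulmxA -hmat_slide; split=> // [l|].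
    rewrite key; case: eqP => _; first by rewrite mulr_ge0 // subr_ge0 ltW.
    by case: eqP => _ //; rewrite addr_ge0 // mulr_ge0.
  rewrite !key eqxx (negbTE (_ : j != i)) 1?eq_sym // eqxx.
  by rewrite mulrCA ler_pM2l ?subr_gt0 // lerDl.
move=> [w [w0 xw h]]; apply/hullP.
have a1' : 0 < 1 - a by rewrite subr_gt0.
pose u : 'rV[R]_k.+1 := \row_l (if l == i then w ord0 i / (1 - a)
    else if l == j then w ord0 j - a * w ord0 i / (1 - a) else w ord0 l).
exists u => [l|].
  rewrite mxE; case: eqP => _; first by rewrite divr_ge0 // ltW.
  case: eqP => _ //; rewrite subr_ge0 ler_pdivrMr // [leRHS]mulrC //.
rewrite hmat_slide mulmxA xw; congr (_ *m _); apply/rowP => l.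
rewrite key !mxE eqxx (negbTE (_ : j != i)) 1?eq_sym // eqxx.
case: eqP => [->|_]; first by rewrite mulrC divfK // gt_eqF.
by case: eqP => [->|//]; rewrite mulrA addrC subrK.
Qed.

Lemma bisection k (t : 'M[R]_(k.+1, d)) i j a : i != j -> 0 < a < 1 ->
  affinely_independent t ->
  subdivision t [:: slide t i j a; slide t j i (1 - a)].
Proof.
move=> ij /andP[a0 a1] tf; have ji : j != i by rewrite eq_sym.
have a1' : 0 < 1 - a by rewrite subr_gt0.
have a0' : 1 - a < 1 by rewrite ltrBlDr ltrDl.
have aa : 1 - (1 - a) = a by rewrite opprB addrC subrK.
split.
- move=> u; rewrite !inE => /orP[] /eqP ->; split; try exact: slide_free.
    by move=> x /(slide_hullP _ _ ij (ltW a0) a1)[w [w0 xw _]]; apply/hullP; exists w.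
  by move=> x /(slide_hullP _ _ ji (ltW a1') a0')[w [w0 xw _]]; apply/hullP; exists w.
- rewrite /= !andbT; apply/asboolP.
  pose D := pinvmx (hmat t); pose psi := a *: col i D - (1 - a) *: col j D.
  have pt := hmat_pinv tf.
  have psiE x (w : 'rV[R]_k.+1) : hmat x = w *m hmat t ->
      aff psi x = a * w ord0 i - (1 - a) * w ord0 j.
    move=> xw; rewrite /aff /psi mulmxBr -!scalemxAr [LHS]mxE [X in X + _]mxE.
    rewrite [X in _ + X]mxE [X in _ - X]mxE -!/(aff _ x) !aff_col xw -mulmxA pt.
    by rewrite mulmx1.
  apply: hausdorff_null_sub (hausdorff_hull_null (phi := psi) tf _).
    move=> x [/(slide_hullP _ _ ij (ltW a0) a1)[w [w0 xw h]]].
    move=> /(slide_hullP _ _ ji (ltW a1') a0')[w' [w'0 xw' h']].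
    have ww' : w' = w.
      by rewrite -[w]mulmx1 -[w']mulmx1 -pt !mulmxA -xw -xw'.
    split; first by apply/hullP; exists w.
    rewrite /= (psiE _ _ xw); rewrite aa ww' in h'.
    by apply/eqP; rewrite subr_eq0 eq_le h h'.
  exists i; rewrite vert_aff (psiE _ (delta_mx ord0 i)).
    by rewrite !mxE !eqxx (negbTE ji) andbF mulr0 subr0 mulr1 gt_eqF.
  by rewrite -hmat_row rowE.
- move=> x /hullP[w w0 xw]; have [h|h] := leP (a * w ord0 i) ((1 - a) * w ord0 j).
    exists (slide t i j a); rewrite ?mem_head //.
    by apply/slide_hullP => //; [exact: ltW|exists w].
  exists (slide t j i (1 - a)); first by rewrite !inE eqxx orbT.
  apply/slide_hullP => //; [exact: ltW|exists w].
  by rewrite aa; split=> //; exact: ltW.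
Qed.

(** An edge whose ends have opposite signs is cut at the zero of [phi]. Both pieces have fewer
    vertices off the hyperplane, so at most k + 1 generations of bisections are made; the count
    enters [cut_count]. *)
Lemma cut_simplex k phi (t : 'M[R]_(k.+1, d)) : affinely_independent t ->
  exists2 s, subdivision t s &
    (forall u, u \in s -> sided phi u) /\ (size s <= 2 ^ k.+1)%N.
Proof.
pose nz (u : 'M[R]_(k.+1, d)) := #|[pred i | vert phi u i != 0]|.
suff h n u : affinely_independent u -> (nz u <= n)%N ->
    exists2 s, subdivision u s & (forall v, v \in s -> sided phi v) /\ (size s <= 2 ^ n)%N.
  by move=> tf; apply: h => //; rewrite -[leqRHS]card_ord max_card.
elim: n u => [|n IH] u uf un.
  exists [:: u]; first exact: subdivision_id.
  split=> // v; rewrite inE => /eqP ->; left => i.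
  move: un; rewrite /nz leqn0 => /eqP/card0_eq/(_ i).
  by rewrite !inE => /negbFE/eqP ->.
have [us|us] := pselect (sided phi u).
  exists [:: u]; first exact: subdivision_id.
  by split=> [v|]; [rewrite inE => /eqP -> | rewrite expn_gt0].
have [i ui] : exists i, vert phi u i < 0.
  apply: contrapT => /forallNP h; apply: us; left => i.
  by rewrite leNgt; apply/negP/h.
have [j uj] : exists j, 0 < vert phi u j.
  apply: contrapT => /forallNP h; apply: us; right => j.
  by rewrite leNgt; apply/negP/h.
have ij : i != j by apply: contraTneq ui => ->; rewrite -leNgt ltW.
have ji : j != i by rewrite eq_sym.
set fi := vert phi u i in ui; set fj := vert phi u j in uj.
have fji : 0 < fj - fi by rewrite subr_gt0 (lt_trans ui).
pose a := - fi / (fj - fi).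
have a01 : 0 < a < 1.
  by rewrite divr_gt0 ?oppr_gt0 //= ltr_pdivrMr // mul1r ltrDr.
have [a0 a1] := andP a01.
have am : (1 - a) * fi + a * fj = 0.
  by rewrite /a; field; rewrite gt_eqF.
have sub1 : slide u i j a \in [:: slide u i j a; slide u j i (1 - a)] by rewrite mem_head.
have sub2 : slide u j i (1 - a) \in [:: slide u i j a; slide u j i (1 - a)].
  by rewrite !inE eqxx orbT.
have bis := bisection ij a01 uf.
have [b1 _ _] := bis.
have nz1 : (nz (slide u i j a) <= n)%N.
  rewrite -ltnS; apply: leq_trans un; apply: proper_card; apply/properP; split.
    apply/fintype.subsetP => l; rewrite !inE vert_slide.
    by have [_|//] := eqVneq l i; rewrite -/fi -/fj am eqxx.
  by exists i; rewrite !inE; [rewrite lt_eqF|rewrite vert_slide eqxx -/fi -/fj am eqxx].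
have nz2 : (nz (slide u j i (1 - a)) <= n)%N.
  have am' : (1 - (1 - a)) * fj + (1 - a) * fi = 0 by rewrite -am; ring.
  rewrite -ltnS; apply: leq_trans un; apply: proper_card; apply/properP; split.
    apply/fintype.subsetP => l; rewrite !inE vert_slide.
    by have [_|//] := eqVneq l j; rewrite -/fi -/fj am' eqxx.
  by exists j; rewrite !inE; [rewrite gt_eqF|rewrite vert_slide eqxx -/fi -/fj am' eqxx].
have [s1 d1 [w1 z1]] := IH _ (b1 _ sub1).1 nz1.
have [s2 d2 [w2 z2]] := IH _ (b1 _ sub2).1 nz2.
pose f v := if v == slide u i j a then s1 else s2.
have fE : f (slide u i j a) = s1 by rewrite /f eqxx.
exists (flatten (map f [:: slide u i j a; slide u j i (1 - a)])).
  apply: subdivision_trans bis _ => v; rewrite !inE /f => /orP[/eqP ->|/eqP ->].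
    by rewrite eqxx.
  by case: eqP => [->|_].
split=> [v|].
  rewrite /= cats0 mem_cat fE /f; case: ifP => _ /orP[] vs;
    by [exact: w1 vs|exact: w2 vs].
rewrite /= cats0 size_cat fE /f expnS mul2n -addnn.
by case: ifP => _; exact: leq_add.
Qed.

Lemma adapted_subdivision k F (t : 'M[R]_(k.+1, d)) : affinely_independent t ->
  exists2 s, subdivision t s & forall u, u \in s -> adapted F u.
Proof.
move=> tf; elim: F => [|phi F [s st sF]].
  exists [:: t]; first exact: subdivision_id.
  by move=> u; rewrite inE => /eqP ->; split.
have /choice[f hf] : forall u : 'M[R]_(k.+1, d),
    exists s' : seq 'M[R]_(k.+1, d), affinely_independent u ->
    subdivision u s' /\ (forall v, v \in s' -> sided phi v).
  move=> u; have [uf|] := pselect (affinely_independent u); last by exists [::].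
  by have [s' h1 [h2 _]] := cut_simplex phi uf; exists s'.
have [sf _ _] := st.
exists (flatten (map f s)).
  by apply: subdivision_trans st _ => u us; exact: (hf _ (sf _ us).1).1.
move=> v /flattenP[_ /mapP[u us ->] vu].
have [[h1 _ _] h2] := hf _ (sf _ us).1; have [vf vsub] := h1 _ vu.
split=> // psi; rewrite inE => /predU1P[->|psiF]; first exact: h2.
by have [_ /(_ _ psiF)] := sF _ us; exact: sided_sub.
Qed.
End Subdivision.

(** * Common refinements *)

Section Refinement.
Variables (R : realType) (d : nat).
Implicit Types (phi : 'cV[R]_(d + 1)) (F : seq 'cV[R]_(d + 1)).

Lemma near0_seg_lt0 (a b : R) : a < 0 ->
  \forall u \near (0 : R)^'+, (1 - u) * a + u * b < 0.
Proof.
move=> a0; pose c := - a / (`|a| + `|b| + 1).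
have D0 : 0 < `|a| + `|b| + 1 by rewrite ltr_wpDl // addr_ge0.
have c0 : 0 < c by rewrite divr_gt0 // oppr_gt0.
near=> u.
have u0 : 0 < u by near: u; exact: nbhs_right_gt.
have uc : u < c by near: u; exact: nbhs_right_lt.
have : u * (`|a| + `|b| + 1) < - a by rewrite -ltr_pdivlMr.
have : u * (b - a) <= u * (`|a| + `|b| + 1).
  rewrite ler_pM2l //; have := ler_norm b; have := ler_norm (- a).
  by rewrite normrN; lra.
lra.
Unshelve. all: by end_near. Qed.

Lemma near_all_seq (I : eqType) (s : seq I) (P : I -> R -> Prop) :
  (forall i, i \in s -> \forall u \near (0 : R)^'+, P i u) ->
  \forall u \near (0 : R)^'+, forall i, i \in s -> P i u.
Proof.
elim: s => [|i s IH] h; first by near=> u.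
have h1 := h i (mem_head _ _).
have h2 : \forall u \near (0 : R)^'+, forall j, j \in s -> P j u.
  by apply: IH => j js; apply: h; rewrite inE js orbT.
near=> u => j; rewrite inE => /predU1P[->|js]; first by near: u.
by move: j js; near: u.
Unshelve. all: by end_near. Qed.

Definition seg (x y : 'rV[R]_d) (u : R) : 'rV[R]_d := (1 - u) *: x + u *: y.

Lemma near0_seg_notin k (vs : seq 'M[R]_(k.+1, d)) x y :
  (forall v, v \in vs -> affinely_independent v) ->
  \forall u \near (0 : R)^'+, forall v, v \in vs ->
    ~ hull v x -> ~ hull v (seg x y u).
Proof.
move=> vf; apply: near_all_seq => v /vf {}vf.
have [vx|vx] := pselect (hull v x); first by near=> u.
have [phi phiv xphi] : exists2 phi, phi \in facets v & aff phi x < 0.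
  apply: contrapT => nex; apply: vx; apply/(hull_facets _ vf) => phi phiv.
  by rewrite leNgt; apply/negP => h; apply: nex; exists phi.
have := near0_seg_lt0 (aff phi y) xphi; apply: filterS => u h _.
by move=> /(hull_facets _ vf)/(_ _ phiv); rewrite aff_seg leNgt h.
Unshelve. all: by end_near. Qed.

Lemma hull_seg k (t : 'M[R]_(k.+1, d)) x y (u : R) : 0 <= u <= 1 ->
  hull t x -> hull t y -> hull t (seg x y u).
Proof.
move=> /andP[u0 u1] [w [w0 w1] <-] [z [z0 z1] <-].
exists ((1 - u) *: w + u *: z); last by rewrite mulmxDl -!scalemxAl.
split=> [i|]; first by rewrite !mxE addr_ge0 // mulr_ge0 // subr_ge0.
under eq_bigr do rewrite !mxE.
by rewrite big_split /= -!mulr_sumr w1 z1 !mulr1 subrK.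
Qed.

Lemma cospan_zero k phi (p u v : 'M[R]_(k.+1, d)) : affinely_independent u ->
  cospan p u -> cospan p v ->
  (forall i, vert phi u i = 0) -> forall i, vert phi v i = 0.
Proof.
move=> uf pu pv u0 i; have up := cospan_sym uf pu.
rewrite /vert (bmxE (cospan_trans up pv)) -mulmxA mxE big1 // => j _.
by rewrite [X in _ * X]u0 mulr0.
Qed.

(* A piece [u] of [p'] lying inside [p] may be replaced by the pieces of [p]
   near [x]: these meet the interior of [u], so that they lie in [p']. *)
Lemma cover_switch k (p p' u : 'M[R]_(k.+1, d)) (vs : seq 'M[R]_(k.+1, d)) x :
  affinely_independent p' -> affinely_independent u ->
  hull u `<=` hull p' -> hull u `<=` hull p -> hull u x ->
  subdivision p vs -> (forall v, v \in vs -> adapted (facets p') v) ->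
  exists2 v, v \in vs & hull v x /\ hull v `<=` hull p'.
Proof.
move=> p'f uf up' up ux [vs1 _ vs3] vsa.
have vsf v : v \in vs -> affinely_independent v by move=> /vs1[].
have [w [w01 hw]] : exists w : R, 0 < w < 1 /\
    forall v, v \in vs -> ~ hull v x -> ~ hull v (seg x (bary u) w).
  near (0 : R)^'+ => w; exists w; split.
    by apply/andP; split; near: w; [exact: nbhs_right_gt|exact: nbhs_right_lt].
  by near: w; exact: near0_seg_notin.
have yu : hull u (seg x (bary u) w).
  by apply: hull_seg => //; [by case/andP: w01 => ? ?; rewrite !ltW|exact: bary_hull].
have [v vin vy] := vs3 _ (up _ yu).
exists v => //; split; first by apply: contrapT => vx; exact: (hw _ vin vx).
apply: vert_hull_sub => // phi phip.
have u0 i : 0 <= vert phi u i.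
  by rewrite vert_aff; move/(hull_facets _ p'f): (up' _ (vert_hull u i)); apply.
(* A facet functional of [p'] vanishing on [u] vanishes on the common plane, hence on [v]; any other
   is positive at the point [seg x (bary u) w] of [v], so it cannot be nonpositive on [v]. *)
have [i|nz] := pselect (forall i, vert phi u i = 0).
  move=> l; rewrite (@cospan_zero k phi p u v uf (hull_cospan up) _ i l) //.
  by apply: hull_cospan; have [] := vs1 _ vin.
have [_ /(_ _ phip)[//|h]] := vsa _ vin.
have := aff_hull_le0 h vy; rewrite aff_seg leNgt => /negP[].
rewrite ltr_wpDl //.
  apply: mulr_ge0; last exact: aff_hull_ge0 u0 ux.
  by rewrite subr_ge0 ltW //; case/andP: w01.
rewrite mulr_gt0 //; first by case/andP: w01.
by apply: bary_gt0 => //; move/existsNP: nz => [i /eqP ui]; exists i.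
Unshelve. all: by end_near. Qed.

(** The simplexes are inserted one at a time: a fine subdivision of the new one is added and the old
    pieces inside it are dropped. By [cover_switch], what a dropped piece covered is covered by new
    pieces lying in the same old simplex. *)
Lemma common_refinement k F (ps : seq 'M[R]_(k.+1, d)) :
  (forall p, p \in ps -> affinely_independent p) ->
  exists s, [/\
    forall u, u \in s -> adapted F u /\ exists2 p, p \in ps & hull u `<=` hull p,
    pairwise (@overlap_null R d k) s &
    forall p, p \in ps -> forall x, hull p x ->
      exists2 u, u \in s & hull u x /\ hull u `<=` hull p].
Proof.
move=> pf; pose F' := F ++ flatten [seq facets p | p <- ps].
have F'p p : p \in ps -> forall u : 'M[R]_(k.+1, d), adapted F' u -> adapted (facets p) u.
  move=> pps u [uf h]; split=> // phi phip; apply: h; rewrite mem_cat; apply/orP.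
  by right; apply/flattenP; exists (facets p) => //; exact: map_f.
have F'F (u : 'M[R]_(k.+1, d)) : adapted F' u -> adapted F u.
  by move=> /adapted_cat[].
suff [s [h1 h2 h3]] : exists s, [/\
    forall u, u \in s -> adapted F' u /\ exists2 p, p \in ps & hull u `<=` hull p,
    pairwise (@overlap_null R d k) s &
    forall p, p \in ps -> forall x, hull p x ->
      exists2 u, u \in s & hull u x /\ hull u `<=` hull p].
  by exists s; split=> // u /h1[uF' ?]; split=> //; exact: F'F.
(* The list already inserted is generalised for the induction, while [F'] keeps the facets of all of
   [ps]. *)
have {F'F} : {subset ps <= ps} by [].
move: {1 3 4}ps => qs; elim: qs => [|q qs IH] qps.
  by exists [::]; split.
have [|s' [h1 h2 h3]] := IH.
  by move=> p pq; apply: qps; rewrite inE pq orbT.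
have qin : q \in ps by apply: qps; rewrite mem_head.
have [vs vsub vsa] := adapted_subdivision F' (pf _ qin).
have [v1 v2 v3] := vsub.
exists (vs ++ [seq u <- s' | ~~ `[< hull u `<=` hull q >]]); split.
- move=> u; rewrite mem_cat mem_filter => /orP[uv|/andP[_ /h1[ua [p pq up]]]].
    by split; [exact: vsa|exists q; [rewrite mem_head|case: (v1 _ uv)]].
  by split=> //; exists p => //; rewrite inE pq orbT.
- rewrite pairwise_cat v2 /=; apply/andP; split; last exact: pairwise_filter.
  apply/allrelP => v u vin; rewrite mem_filter => /andP[/asboolPn uq us].
  apply: overlap_null_sub (v1 _ vin).2 (@subset_refl _ _) _.
  rewrite overlap_nullC; apply: adapted_overlap uq; first exact: pf.
  by apply: F'p => //; case: (h1 _ us).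
- move=> p pq x px; move: (pq); rewrite {1}inE => /predU1P[E|pqs].
    rewrite E in px *; have [u uv ux] := v3 _ px.
    by exists u; [rewrite mem_cat uv|split; last by case: (v1 _ uv)].
  have [u us [ux up]] := h3 _ pqs _ px.
  have [uq|uq] := pselect (hull u `<=` hull q); last first.
    exists u => //; rewrite mem_cat mem_filter us andbT; apply/orP; right.
    exact/asboolPn.
  have pps := qps _ pq.
  have [|v vin [vx vp]] := cover_switch (pf _ pps) (h1 _ us).1.1 up uq ux vsub.
    by move=> v /vsa; exact: F'p.
  by exists v => //; rewrite mem_cat vin.
Qed.

Lemma overlap_null_uniq k (s : seq 'M[R]_(k.+1, d)) :
  (forall u, u \in s -> affinely_independent u) ->
  pairwise (@overlap_null R d k) s -> uniq s.
Proof.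
elim: s => //= u s IH sf /andP[us ss]; rewrite IH // ?andbT; last first.
  by move=> v vs; apply: sf; rewrite inE vs orbT.
apply/negP => uin; have uf := sf _ (mem_head u s).
exact: (overlap_nullN uf (@subset_refl _ _) (@subset_refl _ _) (allP us _ uin)).
Qed.

Lemma overlap_null_mem k (s : seq 'M[R]_(k.+1, d)) u v :
  pairwise (@overlap_null R d k) s -> u \in s -> v \in s -> u != v ->
  overlap_null u v.
Proof.
elim: s => //= w s IH /andP[/allP h ss]; rewrite !inE.
move=> /predU1P[->|us] /predU1P[->|vs] uv.
- by rewrite eqxx in uv.
- by apply/asboolP; exact: h.
- by apply/asboolP; rewrite -/(overlap_null u w) overlap_nullC; exact: h.
- by apply/asboolP; exact: IH.
Qed.
End Refinement.

(** * Polyhedral chains *)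

Section Chains.
Variables (R : realType) (G : zmodType) (d : nat).
Variables (nrm : G -> R) (nrmP : group_norm nrm).

Lemma nrm_ge0 g : 0 <= nrm g. Proof. by case: nrmP. Qed.
Lemma nrm_eq0 g : nrm g = 0 <-> g = 0. Proof. by case: nrmP. Qed.
Lemma nrmN g : nrm (- g) = nrm g. Proof. by case: nrmP. Qed.
Lemma nrmD g h : nrm (g + h) <= nrm g + nrm h. Proof. by case: nrmP. Qed.
Lemma nrm0 : nrm 0 = 0. Proof. exact/nrm_eq0. Qed.

Lemma nrm_sign (b : bool) g : nrm (if b then g else - g) = nrm g.
Proof. by case: b; rewrite ?nrmN. Qed.

Section Dimension.
Variable k : nat.
Implicit Types (P Q : chain R G d k) (s : seq 'M[R]_(k.+1, d)) (t : 'M[R]_(k.+1, d)).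

Definition nondeg P : Prop := forall p, p \in P -> affinely_independent p.2.

Lemma nondeg_cat P Q : nondeg P -> nondeg Q -> nondeg (P ++ Q).
Proof. by move=> hP hQ p; rewrite mem_cat => /orP[/hP|/hQ]. Qed.

Lemma nondeg_opp P : nondeg P -> nondeg (chain_opp P).
Proof. by move=> hP p /mapP[q /hP h ->]. Qed.

Lemma nondeg_sub P Q : nondeg P -> nondeg Q -> nondeg (chain_sub P Q).
Proof. by move=> hP hQ; apply: nondeg_cat => //; exact: nondeg_opp. Qed.

Lemma coef_nil t : coefficient ([::] : chain R G d k) t = 0.
Proof. by rewrite /coefficient big_nil. Qed.

Lemma coef_cat P Q t : coefficient (P ++ Q) t = coefficient P t + coefficient Q t.
Proof. by rewrite /coefficient big_cat. Qed.

Lemma coefficient_cons p P t : coefficient (p :: P) t = coefficient [:: p] t + coefficient P t.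
Proof. by rewrite -cat1s coef_cat. Qed.

Lemma coef_single (g : G) (p t : 'M[R]_(k.+1, d)) : coefficient [:: (g, p)] t =
  if `[< hull t `<=` hull p >]
  then (if `[< same_orientation p t >] then g else - g) else 0.
Proof. by rewrite /coefficient big_cons big_nil addr0. Qed.

Lemma coef_opp P t : coefficient (chain_opp P) t = - coefficient P t.
Proof.
rewrite /coefficient big_map /= -sumrN; apply: eq_bigr => p _.
by case: asboolP.
Qed.

Lemma coef_sub P Q t :
  coefficient (chain_sub P Q) t = coefficient P t - coefficient Q t.
Proof. by rewrite coef_cat coef_opp. Qed.

Lemma coef_eq0 P t : (forall p, p \in P -> ~ hull t `<=` hull p.2) ->
  coefficient P t = 0.
Proof.
move=> h; rewrite /coefficient big_seq_cond big1 // => p /andP[/h np /asboolP].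
by move=> /np.
Qed.

Lemma coef_perm P Q t : perm_eq P Q -> coefficient P t = coefficient Q t.
Proof. by move=> PQ; exact: perm_big. Qed.

Definition orient (b : bool) (g : G) : G := if b then g else - g.

Lemma coef_sub_orient P u t : nondeg P -> affinely_independent u ->
  affinely_independent t -> cospan u t ->
  (forall p, p \in P -> hull t `<=` hull p.2 <-> hull u `<=` hull p.2) ->
  coefficient P t = orient `[< same_orientation u t >] (coefficient P u).
Proof.
move=> Pf uf tf ut h.
have -> : orient `[< same_orientation u t >] (coefficient P u) =
    \sum_(p <- P | `[< hull u `<=` hull p.2 >]) orient `[< same_orientation u t >]
      (if `[< same_orientation p.2 u >] then p.1 else - p.1).
  by rewrite /orient; case: asboolP => // _; rewrite sumrN.
rewrite /coefficient big_seq_cond [RHS]big_seq_cond.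
have E : (fun p => (p \in P) && `[< hull t `<=` hull p.2 >]) =1
    (fun p => (p \in P) && `[< hull u `<=` hull p.2 >]).
  move=> p /=; case: (boolP (p \in P)) => //= /h e.
  by apply/asboolP/asboolP; rewrite e.
rewrite (eq_bigl _ _ E); apply: eq_bigr => p /andP[pP /asboolP up].
have pu := hull_cospan up.
rewrite (same_orientation_trans (Pf _ pP) uf tf pu ut) /orient.
by case: asboolP => _; case: asboolP => _ //=; rewrite opprK.
Qed.

Definition vol t : R := fine (hausdorff k (hull t)).

Lemma volE t : hausdorff k (hull t) = (vol t)%:E.
Proof. by rewrite fineK // ge0_fin_numE ?hausdorff_ge0 // hausdorff_hull_fin. Qed.

Lemma vol_ge0 t : 0 <= vol t.
Proof. by rewrite fine_ge0 // hausdorff_ge0. Qed.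

Definition nonoverlapping s : Prop := pairwise (@overlap_null R d k) s.

Lemma refinementP P s : refinement P s <->
  [/\ forall t, t \in s -> affinely_independent t, nonoverlapping s,
      forall t, t \in s -> exists2 p, p \in P & hull t `<=` hull p.2 &
      forall p, p \in P -> forall x, hull p.2 x ->
        exists2 t, t \in s & hull t x /\ hull t `<=` hull p.2].
Proof.
split=> [[h1 h2 h3 h4]|[h1 h2 h3 h4]]; split=> //.
- apply/(pairwiseP 0) => i j; rewrite !inE => si sj ij.
  by apply: h2; rewrite ij.
- move=> p pP x px; move: (px); rewrite {1}(h4 _ pP) => -[t [ts tp] tx].
  by exists t.
- move=> i j /andP[ij js]; have /(pairwiseP 0)/(_ i j) := h2.
  have si := ltn_trans ij js; have : overlap_null (nth 0 s i) (nth 0 s j).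
    by have /(pairwiseP 0) := h2; apply.
  by move/asboolP.
- move=> p pP; apply/seteqP; split=> [x /(h4 _ pP)[t ts [tx tp]]|x [t [_ tp]] tx].
    by exists t.
  exact: tp.
Qed.

Lemma refinement_exists (F : seq 'cV[R]_(d + 1)) P : nondeg P ->
  exists2 s, refinement P s & forall t, t \in s -> adapted F t.
Proof.
move=> Pf; have [|s [h1 h2 h3]] := @common_refinement R d k F (map snd P).
  by move=> _ /mapP[p /Pf h ->].
exists s; last by move=> t /h1[].
apply/refinementP; split=> // [t /h1[[]]//|t /h1[_ [_ /mapP[p pP ->]]]|p pP x px].
  by exists p.
by apply: h3 px; exact: map_f.
Qed.

Definition facets_of (ps : seq 'M[R]_(k.+1, d)) : seq 'cV[R]_(d + 1) :=
  flatten [seq facets p | p <- ps].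

Lemma adapted_facets_of ps p t : p \in ps -> adapted (facets_of ps) t ->
  adapted (facets p) t.
Proof.
move=> pps [tf h]; split=> // phi phip; apply: h.
by apply/flattenP; exists (facets p) => //; exact: map_f.
Qed.

(** The piece is found at the barycentre of [t]; two distinct ones would overlap in the hull of [t],
    which has positive measure. *)
Lemma refinement_locate P s t : refinement P s ->
  adapted (facets_of s) t -> (exists2 p, p \in P & hull t `<=` hull p.2) ->
  exists2 u, u \in s & hull t `<=` hull u /\
    forall v, v \in s -> hull t `<=` hull v -> v = u.
Proof.
move=> /refinementP[h1 h2 h3 h4] ta [p pP tp].
have [u us [ut up]] := h4 _ pP _ (tp _ (bary_hull t)).
have tu : hull t `<=` hull u.
  by apply: adapted_bary_sub ut; [exact: h1|exact: adapted_facets_of ta].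
exists u => //; split=> // v vs tv.
apply/eqP; apply: contraT => vu.
have : overlap_null v u by exact: (overlap_null_mem h2 vs us vu).
by move=> /(overlap_nullN ta.1 tv tu).
Qed.

Lemma refinement_coef P s t u : nondeg P -> refinement P s ->
  adapted (facets_of s) t -> u \in s -> hull t `<=` hull u ->
  coefficient P t = orient `[< same_orientation u t >] (coefficient P u).
Proof.
move=> Pf sref ta us tu; have /refinementP[h1 h2 h3 h4] := sref.
apply: coef_sub_orient => //; [exact: h1|exact: ta.1|exact: hull_cospan|].
move=> p pP; split=> [tp|]; last exact: subset_trans.
have [v vs [vt vp]] := h4 _ pP _ (tp _ (bary_hull t)).
have tv : hull t `<=` hull v.
  by apply: adapted_bary_sub vt; [exact: h1|exact: adapted_facets_of ta].
have [q qP uq] := h3 _ us.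
have [|z _ [_ hz]] := refinement_locate sref ta.
  by exists q => //; exact: subset_trans tu uq.
by rewrite (hz _ us tu) -(hz _ vs tv).
Qed.

Lemma nrm_orient b g : nrm (orient b g) = nrm g.
Proof. exact: nrm_sign. Qed.

Lemma vol_refine P s s' u : refinement P s -> refinement P s' ->
  (forall t, t \in s' -> adapted (facets_of s) t) -> u \in s ->
  vol u = \sum_(t <- s' | `[< hull t `<=` hull u >]) vol t.
Proof.
move=> /refinementP[h1 h2 h3 h4] /refinementP[g1 g2 g3 g4] s'a us.
apply: EFin_inj; rewrite -volE -sumEFin.
have [p pP up] := h3 _ us.
transitivity (\sum_(t <- s') hausdorff k (hull u `&` hull t))%E.
  rewrite -hausdorff_sum.
  - congr hausdorff; apply/seteqP; split=> [x ux|x []//]; split=> //.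
    by have [t ts [tx _]] := g4 _ pP _ (up _ ux); exists t.
  - exact: overlap_null_uniq g1 g2.
  - by move=> t /g1; exact: hull_borel.
  - by move=> v w vs ws vw; apply/asboolP; exact: (overlap_null_mem g2 vs ws vw).
rewrite [RHS]big_mkcond; apply: eq_big_seq => t ts.
case: asboolP => [tu|tu]; first by rewrite setIidr // volE.
apply/asboolP; rewrite -/(overlap_null u t) overlap_nullC.
by apply: adapted_overlap tu; [exact: h1|exact: adapted_facets_of (s'a _ ts)].
Qed.

Lemma mass_sum_refine P s s' : nondeg P -> refinement P s -> refinement P s' ->
  (forall t, t \in s' -> adapted (facets_of s) t) ->
  \sum_(u <- s) nrm (coefficient P u) * vol u =
  \sum_(t <- s') nrm (coefficient P t) * vol t.
Proof.
move=> Pf sP s'P s'a.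
have /refinementP[h1 h2 h3 h4] := sP; have /refinementP[g1 g2 g3 g4] := s'P.
transitivity (\sum_(u <- s) \sum_(t <- s')
    if `[< hull t `<=` hull u >] then nrm (coefficient P t) * vol t else 0).
  apply: eq_big_seq => u us; rewrite (vol_refine sP s'P s'a us) mulr_sumr.
  rewrite big_mkcond; apply: eq_big_seq => t ts; case: asboolP => // tu.
  by rewrite (refinement_coef Pf sP (s'a _ ts) us tu) nrm_orient.
rewrite exchange_big /=; apply: eq_big_seq => t ts.
have [u us [tu hu]] := refinement_locate sP (s'a _ ts) (g3 _ ts).
rewrite (bigD1_seq u) ?overlap_null_uniq //= asboolT // big1_seq ?addr0 //.
move=> v /andP[vu vs]; rewrite asboolF // => tv.
by rewrite (hu _ vs tv) eqxx in vu.
Qed.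

(** Any other refinement [s'] is compared with [s] through a third one, adapted to the facets of
    both. *)
Lemma massE P s : nondeg P -> refinement P s ->
  mass nrm P = (\sum_(t <- s) nrm (coefficient P t) * vol t)%:E.
Proof.
move=> Pf sP; rewrite /mass (_ : [set _ | _ in _] =
  [set (\sum_(t <- s) nrm (coefficient P t) * vol t)%:E]) ?ereal_inf1 //.
have E s' : (\sum_(t <- s') (nrm (coefficient P t))%:E * hausdorff k (hull t))%E =
    (\sum_(t <- s') nrm (coefficient P t) * vol t)%:E.
  by rewrite -sumEFin; apply: eq_bigr => t _; rewrite volE EFinM.
apply/seteqP; split=> [_ [s' s'P <-]|_ ->]; last by exists s; rewrite ?E.
rewrite /= E; have [r rP ra] := refinement_exists (facets_of s ++ facets_of s') Pf.
rewrite (mass_sum_refine Pf s'P rP) => [|t /ra/adapted_cat[]//].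
by rewrite (mass_sum_refine Pf sP rP) // => t /ra/adapted_cat[].
Qed.

Definition M P : R := fine (mass nrm P).

Lemma ME P : nondeg P -> mass nrm P = (M P)%:E.
Proof.
by move=> Pf; have [s sP _] := refinement_exists [::] Pf; rewrite /M (massE Pf sP).
Qed.

Lemma M_refinement P s : nondeg P -> refinement P s ->
  M P = \sum_(t <- s) nrm (coefficient P t) * vol t.
Proof. by move=> Pf sP; rewrite /M (massE Pf sP). Qed.

(** One family of simplexes computes the masses of several chains at once; inequalities between
    masses then reduce to inequalities between coefficients on each simplex. *)
Lemma common_mass F (Ps : seq (chain R G d k)) :
  (forall P, P \in Ps -> nondeg P) ->
  exists s, [/\ forall t, t \in s -> adapted F t, nonoverlapping s &
    forall P, P \in Ps -> M P = \sum_(t <- s) nrm (coefficient P t) * vol t].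
Proof.
move=> Pf; have Af : nondeg (flatten Ps).
  by move=> p /flattenP[P /Pf]; apply.
have [s sP sa] := refinement_exists F Af.
have /refinementP[h1 h2 h3 h4] := sP.
exists s; split=> // P PPs.
pose b t := `[< exists2 p, p \in P & hull t `<=` hull p.2 >].
rewrite (@M_refinement P [seq t <- s | b t]); last 2 first.
- exact: Pf.
- apply/refinementP; split.
  + by move=> t; rewrite mem_filter => /andP[_ /h1].
  + exact: pairwise_filter.
  + by move=> t; rewrite mem_filter => /andP[/asboolP].
  + move=> p pP x px; have pA : p \in flatten Ps by apply/flattenP; exists P.
    have [t ts [tx tp]] := h4 _ pA _ px; exists t => //.
    by rewrite mem_filter ts andbT; apply/asboolP; exists p.
rewrite big_filter big_mkcond; apply: eq_bigr => t _; case: ifPn => // /asboolPn bt.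
rewrite coef_eq0 ?nrm0 ?mul0r // => p pP tp; apply: bt; by exists p.
Qed.

(* [Q] holds for all simplexes which finitely many hyperplanes do not cut: chains
   are compared through their coefficients on such simplexes, which avoids
   choosing common refinements. *)
Definition evt (Q : 'M[R]_(k.+1, d) -> Prop) : Prop :=
  exists F, forall t, adapted F t -> Q t.

Lemma evt_mono (Q Q' : 'M[R]_(k.+1, d) -> Prop) :
  (forall t, affinely_independent t -> Q t -> Q' t) -> evt Q -> evt Q'.
Proof. by move=> h [F hF]; exists F => t ta; apply: h (hF _ ta); case: ta. Qed.

Lemma evtI (Q Q' : 'M[R]_(k.+1, d) -> Prop) :
  evt Q -> evt Q' -> evt (fun t => Q t /\ Q' t).
Proof.
move=> [F h] [F' h']; exists (F ++ F') => t /adapted_cat[/h ? /h' ?].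
by split.
Qed.

Lemma evtT (Q : 'M[R]_(k.+1, d) -> Prop) : (forall t, Q t) -> evt Q.
Proof. by move=> h; exists [::]. Qed.

Definition eqv P Q : Prop := evt (fun t => coefficient P t = coefficient Q t).

Lemma M_ge0 P : 0 <= M P.
Proof.
rewrite fine_ge0 //; apply: le_ereal_inf_tmp => _ [s _ <-].
by apply: sume_ge0 => t _; rewrite mule_ge0 ?lee_fin ?nrm_ge0 ?hausdorff_ge0.
Qed.

Lemma M_le2 P P1 P2 : nondeg P -> nondeg P1 -> nondeg P2 ->
  evt (fun t => nrm (coefficient P t) <=
    nrm (coefficient P1 t) + nrm (coefficient P2 t)) -> M P <= M P1 + M P2.
Proof.
move=> Pf P1f P2f [F hF]; have [|s [sa _ sM]] := @common_mass F [:: P; P1; P2].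
  by move=> Q; rewrite !inE => /or3P[] /eqP ->.
rewrite !sM ?inE ?eqxx ?orbT // -big_split /=.
rewrite big_seq [leRHS]big_seq; apply: ler_sum => t /sa /hF h.
by rewrite -mulrDl ler_wpM2r ?vol_ge0.
Qed.

Lemma M_eq2 P P1 P2 : nondeg P -> nondeg P1 -> nondeg P2 ->
  evt (fun t => nrm (coefficient P t) =
    nrm (coefficient P1 t) + nrm (coefficient P2 t)) -> M P = M P1 + M P2.
Proof.
move=> Pf P1f P2f [F hF]; have [|s [sa _ sM]] := @common_mass F [:: P; P1; P2].
  by move=> Q; rewrite !inE => /or3P[] /eqP ->.
rewrite !sM ?inE ?eqxx ?orbT // -big_split /=.
by apply: eq_big_seq => t /sa /hF ->; rewrite mulrDl.
Qed.

Lemma M_nil : M [::] = 0.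
Proof. by rewrite (@M_refinement [::] [::]) ?big_nil //; apply/refinementP; split. Qed.

Lemma M_le P P1 : nondeg P -> nondeg P1 ->
  evt (fun t => nrm (coefficient P t) <= nrm (coefficient P1 t)) -> M P <= M P1.
Proof.
move=> Pf P1f h; rewrite -[leRHS]addr0 -M_nil; apply: M_le2 => //.
by apply: evt_mono h => t _; rewrite coef_nil nrm0 addr0.
Qed.

Lemma M_eqv P P1 : nondeg P -> nondeg P1 -> eqv P P1 -> M P = M P1.
Proof.
move=> Pf P1f h; apply/eqP; rewrite eq_le.
by rewrite !M_le //; apply: evt_mono h => t _ ->.
Qed.

Lemma M_cat P Q : nondeg P -> nondeg Q -> M (P ++ Q) <= M P + M Q.
Proof.
move=> Pf Qf; apply: M_le2 => //; first exact: nondeg_cat.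
by apply: evtT => t; rewrite coef_cat nrmD.
Qed.

Lemma M_opp P : nondeg P -> M (chain_opp P) = M P.
Proof.
move=> Pf; apply/eqP; rewrite eq_le !M_le //; try exact: nondeg_opp;
  by apply: evtT => t; rewrite coef_opp nrmN.
Qed.

Lemma M_sub P Q : nondeg P -> nondeg Q -> M (chain_sub P Q) <= M P + M Q.
Proof. by move=> Pf Qf; rewrite -(M_opp Qf) M_cat //; exact: nondeg_opp. Qed.

Lemma M1 (g : G) p : affinely_independent p -> M [:: (g, p)] = nrm g * vol p.
Proof.
move=> pf; rewrite (@M_refinement _ [:: p]).
- by rewrite big_seq1 coef_single asboolT // nrm_sign.
- by move=> q; rewrite inE => /eqP ->.
- apply/refinementP; split=> //.
  + by move=> t; rewrite inE => /eqP ->.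
  + by move=> t; rewrite inE => /eqP ->; exists (g, p); rewrite ?mem_head.
  + by move=> q; rewrite inE => /eqP -> x px; exists p; [rewrite mem_head|split].
Qed.

Definition subchain P s (b : pred 'M[R]_(k.+1, d)) : chain R G d k :=
  [seq (coefficient P t, t) | t <- s & b t].

Lemma nondeg_subchain P s b : refinement P s -> nondeg (subchain P s b).
Proof.
move=> /refinementP[h1 _ _ _] p /mapP[t].
by rewrite mem_filter => /andP[_ /h1 tf] ->.
Qed.

Lemma coef_subchain P s b t : nondeg P -> refinement P s ->
  adapted (facets_of s) t -> coefficient (subchain P s b) t =
  if `[< exists2 u, u \in s & hull t `<=` hull u /\ b u >]
  then coefficient P t else 0.
Proof.
move=> Pf sP ta; have /refinementP[h1 h2 h3 h4] := sP.
rewrite /coefficient /subchain big_map big_filter_cond /=.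
have [[p pP tp]|nex] := pselect (exists2 p, p \in P & hull t `<=` hull p.2);
    last first.
  rewrite big_seq_cond big1 => [|u /and3P[us _ /asboolP tu]]; last first.
    by case: nex; have [p pP up] := h3 _ us; exists p => //; exact: subset_trans up.
  case: asboolP => // _; rewrite big_seq_cond big1 // => p /andP[pP /asboolP tp].
  by case: nex; exists p.
have [|u us [tu hu]] := refinement_locate sP ta; first by exists p.
rewrite -/(coefficient P t) (refinement_coef Pf sP ta us tu) big_mkcond.
rewrite (bigD1_seq u) ?overlap_null_uniq //= big1_seq ?addr0; last first.
  move=> v /andP[vu vs]; case: ifP => // /andP[_ /asboolP tv].
  by rewrite (hu _ vs tv) eqxx in vu.
rewrite (asboolT tu) andbT; case: (boolP (b u)) => bu.
  by rewrite (asboolT (ex_intro2 _ _ u us (conj tu bu))).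
by rewrite asboolF // => -[v vs [tv bv]]; move: bu; rewrite -(hu _ vs tv) bv.
Qed.
End Dimension.
End Chains.

(** * Boundaries *)

Section Faces.
Variables (R : realType) (d : nat).

Definition cone k (y : 'rV[R]_d) (w : 'M[R]_(k.+1, d)) : 'M[R]_(k.+2, d) :=
  \matrix_(l, m) if unlift ord0 l is Some i then w i m else y ord0 m.

Lemma row0_cone k y (w : 'M[R]_(k.+1, d)) : row ord0 (cone y w) = y.
Proof. by apply/rowP => m; rewrite !mxE unlift_none. Qed.

Lemma rowS_cone k y (w : 'M[R]_(k.+1, d)) i :
  row (lift ord0 i) (cone y w) = row i w.
Proof. by apply/rowP => m; rewrite !mxE liftK. Qed.

Lemma row'0_cone k y (w : 'M[R]_(k.+1, d)) : row' ord0 (cone y w) = w.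
Proof. by apply/matrixP => i m; rewrite !mxE liftK. Qed.

Lemma mulmx_cone k y (w : 'M[R]_(k.+1, d)) (u : 'rV[R]_k.+2) :
  u *m hmat (cone y w) = u ord0 ord0 *: hmat y +
    (\row_i u ord0 (lift ord0 i)) *m hmat w.
Proof.
rewrite !mulmx_sum_row big_ord_recl; congr (_ *: _ + _).
  by rewrite hmat_row row0_cone.
by apply: eq_bigr => i _; rewrite mxE !hmat_row rowS_cone.
Qed.

Lemma cone_free k y (w : 'M[R]_(k.+1, d)) : affinely_independent w ->
  ~~ (hmat y <= hmat w)%MS -> affinely_independent (cone y w).
Proof.
rewrite !affinely_independent_hmat => wf yw; have [D ED] := row_freeP wf.
rewrite -kermx_eq0; apply/eqP/row_matrixP => r; rewrite row0.
set u := row r _; have : u *m hmat (cone y w) = 0 by rewrite -row_mul mulmx_ker row0.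
rewrite mulmx_cone; set u' := \row_i _ => E.
have u0 : u ord0 ord0 = 0.
  apply: contraNeq yw => u0; rewrite -[hmat y](scalerK u0).
  rewrite (_ : u ord0 ord0 *: hmat y = - u' *m hmat w).
    by rewrite scalemxAl submxMl.
  by apply/eqP; rewrite mulNmx -addr_eq0 E.
have u'0 : u' = 0.
  rewrite -[u']mulmx1 -ED mulmxA (_ : u' *m hmat w = 0) ?mul0mx //.
  by move: E; rewrite u0 scale0r add0r.
apply/rowP => i; rewrite [RHS]mxE; case: (unliftP ord0 i) => [j ->|-> //].
by have /rowP/(_ j) := u'0; rewrite !mxE.
Qed.

Lemma hmat_row' k (q : 'M[R]_(k.+2, d)) i : hmat (row' i q) = row' i (hmat q).
Proof.
apply/matrixP => a b; rewrite [RHS]mxE.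
by case: (split_ordP b) => c ->; rewrite ?row_mxEl ?row_mxEr !mxE.
Qed.

Lemma vert_row' k phi (q : 'M[R]_(k.+2, d)) i j :
  vert phi (row' i q) j = vert phi q (lift i j).
Proof.
rewrite /vert hmat_row' !mxE; apply: eq_bigr => l _; congr (_ * _).
by rewrite [LHS]mxE.
Qed.

(** The barycentric coordinate of the vertex [i], extended to a functional on the whole space. *)
Definition lam k (q : 'M[R]_(k.+1, d)) i : 'cV[R]_(d + 1) := col i (pinvmx (hmat q)).

Lemma hmat_seg (x y : 'rV[R]_d) (u : R) :
  hmat (seg x y u) = (1 - u) *: hmat x + u *: hmat y.
Proof.
rewrite /hmat !scale_row_mx add_row_mx; congr row_mx.
by apply/matrixP => i j; rewrite !mxE; ring.
Qed.

Lemma lam_facets k (q : 'M[R]_(k.+1, d)) i : lam q i \in facets q.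
Proof.
by rewrite mem_cat; apply/orP; left; apply/mapP; exists i; rewrite ?mem_enum.
Qed.

Lemma lamE k (q : 'M[R]_(k.+1, d)) (w : 'rV[R]_k.+1) x i : affinely_independent q ->
  hmat x = w *m hmat q -> aff (lam q i) x = w ord0 i.
Proof. by move=> qf xw; rewrite aff_col xw -mulmxA hmat_pinv // mulmx1. Qed.

Lemma vert_lam k (q : 'M[R]_(k.+1, d)) i j : affinely_independent q ->
  vert (lam q i) q j = (i == j)%:R.
Proof.
move=> qf; rewrite vert_aff (lamE (w := delta_mx ord0 j)) // ?mxE ?eqxx //.
by rewrite -hmat_row rowE.
Qed.

Lemma lam_span k (q : 'M[R]_(k.+1, d)) x : (hmat x <= hmat q)%MS ->
  hmat x = (\row_i aff (lam q i) x) *m hmat q.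
Proof.
move=> h; rewrite -{1}(mulmxKpV h); congr (_ *m _).
by apply/rowP => i; rewrite [RHS]mxE aff_col.
Qed.

Lemma hull_lam k (q : 'M[R]_(k.+1, d)) x : affinely_independent q ->
  (hmat x <= hmat q)%MS -> hull q x <-> forall i, 0 <= aff (lam q i) x.
Proof.
move=> qf xq; split=> [/(hull_facets _ qf) h i|h].
  exact/h/lam_facets.
apply/hullP; exists (\row_i aff (lam q i) x); last exact: lam_span.
by move=> i; rewrite mxE.
Qed.

Lemma hull_span k (q : 'M[R]_(k.+1, d)) x : hull q x -> (hmat x <= hmat q)%MS.
Proof. by move=> /hullP[w _ ->]; exact: submxMl. Qed.

Lemma row'_free k (q : 'M[R]_(k.+2, d)) i : affinely_independent q ->
  affinely_independent (row' i q).
Proof.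
rewrite !affinely_independent_hmat hmat_row' => /row_freeP[D ED].
apply/row_freeP; exists (col' i D); rewrite -[1%:M](_ : row' i (col' i 1%:M) = _).
  by rewrite -ED; apply/matrixP => a b; rewrite !mxE; apply: eq_bigr => l _; rewrite !mxE.
by apply/matrixP => a b; rewrite !mxE (inj_eq lift_inj).
Qed.

Lemma hull_row' k (q : 'M[R]_(k.+2, d)) i x : affinely_independent q ->
  hull (row' i q) x <-> hull q x /\ aff (lam q i) x = 0.
Proof.
move=> qf.
have wE (w : 'rV[R]_k.+2) : w ord0 i = 0 ->
    w *m hmat q = (\row_j w ord0 (lift i j)) *m hmat (row' i q).
  move=> wi; rewrite hmat_row' !mulmx_sum_row (bigD1 i) //= wi scale0r add0r.
  rewrite (reindex_omap (lift i) (unlift i)) /=; last first.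
    by move=> j; rewrite eq_sym => /unlift_some[l -> ->].
  rewrite (eq_bigl predT) => [|j]; last by rewrite liftK eqxx eq_sym neq_lift.
  apply: eq_bigr => j _; rewrite mxE; congr (_ *: _).
  by apply/rowP => m; rewrite !mxE.
split.
  move=> /hullP[u u0 xu].
  pose w : 'rV[R]_k.+2 := \row_l if unlift i l is Some j then u ord0 j else 0.
  have wi : w ord0 i = 0 by rewrite mxE unlift_none.
  have xw : hmat x = w *m hmat q.
    by rewrite xu wE //; congr (_ *m _); apply/rowP => j; rewrite !mxE liftK.
  split; last by rewrite (lamE _ qf xw).
  by apply/hullP; exists w => // l; rewrite mxE; case: unliftP.
move=> [/hullP[w w0 xw]]; rewrite (lamE _ qf xw) => wi; apply/hullP.
by exists (\row_j w ord0 (lift i j)) => [j|]; [rewrite mxE|rewrite xw wE].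
Qed.

Lemma hull_row'_sub k (q : 'M[R]_(k.+2, d)) i : affinely_independent q ->
  hull (row' i q) `<=` hull q.
Proof. by move=> qf x /(hull_row' _ _ qf)[]. Qed.

Lemma hull_sub_sided k m (w : 'M[R]_(k.+1, d)) (q : 'M[R]_(m.+1, d)) :
  affinely_independent q -> (forall phi, phi \in facets q -> sided phi w) ->
  hull q (bary w) -> hull w `<=` hull q.
Proof.
move=> qf ws /(hull_facets _ qf) bq x wx; apply/(hull_facets _ qf) => phi phiq.
by apply: aff_hull_ge0 wx; apply: bary_ge0; [exact: ws|exact: bq].
Qed.

Lemma sided_zero k phi (w : 'M[R]_(k.+1, d)) : sided phi w ->
  aff phi (bary w) = 0 -> forall i, vert phi w i = 0.
Proof.
move=> ws b0 i; apply/eqP; rewrite eq_le bary_ge0 ?b0 // andbT.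
by apply: bary_le0; rewrite ?b0.
Qed.

Lemma sub_row' k (w : 'M[R]_(k.+1, d)) (q : 'M[R]_(k.+2, d)) i :
  affinely_independent q -> (forall phi, phi \in facets q -> sided phi w) ->
  hull w `<=` hull (row' i q) <-> hull q (bary w) /\ aff (lam q i) (bary w) = 0.
Proof.
move=> qf ws; split=> [h|[bq b0] x wx].
  exact/hull_row'/h/bary_hull.
apply/hull_row' => //; split; first exact: hull_sub_sided bq x wx.
have [u _ h] := aff_hull wx; rewrite h big1 // => l _.
by rewrite (sided_zero (ws _ (lam_facets q i)) b0) mulr0.
Qed.

(** If two coordinates vanished at the barycentre of [w], then [w] would lie in a null section of a
    facet of [q], although it has positive measure. *)
Lemma lam_zero_unique k (w : 'M[R]_(k.+1, d)) (q : 'M[R]_(k.+2, d)) i j :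
  affinely_independent q -> affinely_independent w ->
  (forall phi, phi \in facets q -> sided phi w) -> hull q (bary w) ->
  aff (lam q i) (bary w) = 0 -> aff (lam q j) (bary w) = 0 -> i = j.
Proof.
move=> qf wf ws bq i0 j0; apply/eqP; apply: contraT => ij.
have wi : hull w `<=` hull (row' i q) by exact/(sub_row' i qf ws).
have [j' jE] : exists j', j = lift i j'.
  by case: (unliftP i j) ij => [j' ->|->]; [exists j'|rewrite eqxx].
have := hausdorff_hull_gt0 wf.
rewrite (@hausdorff_null_sub _ _ _ _ (hull (row' i q) `&`
  [set x | aff (lam q j) x = 0])) ?ltxx //.
  move=> x wx; split; first exact: wi.
  have [u _ h] := aff_hull wx; rewrite /= h big1 // => l _.
  by rewrite (sided_zero (ws _ (lam_facets q j)) j0) mulr0.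
apply: hausdorff_hull_null; first exact: row'_free.
by exists j'; rewrite vert_row' -jE vert_lam // eqxx oner_neq0.
Qed.
End Faces.

Section Boundary.
Variables (R : realType) (G : zmodType) (d : nat).

Lemma orientN b (g : G) : orient b (- g) = - orient b g.
Proof. by case: b. Qed.

Lemma orientK b c (g : G) : orient b (orient c g) = orient (b == c) g.
Proof. by case: b; case: c => //=; rewrite opprK. Qed.

Lemma orient0 b : orient b (0 : G) = 0.
Proof. by case: b; rewrite //= oppr0. Qed.

Lemma orient_sum b (I : Type) (r : seq I) (P : pred I) (f : I -> G) :
  orient b (\sum_(i <- r | P i) f i) = \sum_(i <- r | P i) orient b (f i).
Proof. by case: b => //=; rewrite sumrN. Qed.

Definition face_coef k (g : G) (q : 'M[R]_(k.+2, d)) (w : 'M[R]_(k.+1, d)) : G :=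
  \sum_(i < k.+2) if `[< hull w `<=` hull (row' i q) >] then
    orient `[< same_orientation (row' i q) w >] (orient (~~ odd i) g) else 0.

Lemma coef_boundary k (P : chain R G d k.+1) (w : 'M[R]_(k.+1, d)) :
  coefficient (boundary P : chain R G d k) w = \sum_(p <- P) face_coef p.1 p.2 w.
Proof.
rewrite /coefficient /= big_mkcond big_allpairs_dep /=; apply: eq_bigr => p _.
rewrite big_enum /=; apply: eq_bigr => i _.
by case: asboolP => // _; rewrite /orient if_neg.
Qed.

Lemma nondeg_boundary k (P : chain R G d k.+1) :
  nondeg P -> nondeg (boundary P : chain R G d k).
Proof. by move=> Pf _ /allpairsPdep[p [i [pP _ ->]]]; exact/row'_free/Pf. Qed.

(** Expansion along column [i], where only the entry of the vertex 0 of [r] is nonzero. *)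
Lemma bmx_row' k (q r : 'M[R]_(k.+2, d)) i : affinely_independent q ->
  cospan q r -> (forall l, aff (lam q i) (row (lift ord0 l) r) = 0) ->
  \det (bmx q r) = aff (lam q i) (row ord0 r) * (-1) ^+ i *
    \det (bmx (row' i q) (row' ord0 r)).
Proof.
move=> qf qr r0; set B := bmx q r.
have BE l a : B l a = aff (lam q a) (row l r).
  by rewrite aff_col -hmat_row -row_mul [RHS]mxE.
rewrite (expand_det_col _ i) (bigD1 ord0) //= big1 ?addr0; last first.
  move=> l; case: (unliftP ord0 l) => [l' ->|->]; last by rewrite eqxx.
  by rewrite BE r0 mul0r.
rewrite BE -mulrA; congr (_ * _); rewrite /cofactor add0n; congr (_ * \det _).
apply/esym/bmx_unique; first exact: row'_free.
apply/matrixP => l m; rewrite !hmat_row' [LHS]mxE (bmxE qr) -/B.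
rewrite [LHS]mxE [RHS]mxE (bigD1 i) //= BE r0 mul0r add0r.
rewrite (reindex_omap (lift i) (unlift i)) /=; last first.
  by move=> j; rewrite eq_sym => /unlift_some[a -> ->].
rewrite (eq_bigl predT) => [|j]; last by rewrite liftK eqxx eq_sym neq_lift.
by apply: eq_bigr => j _; rewrite !mxE.
Qed.

(** Signs in [bmx_row']: the power of -1 is the sign of the face [i] in the boundary, and the sign
    of the coordinate tells on which side of that face the vertex 0 of [r] lies. *)
Lemma same_orientation_cone k (q r : 'M[R]_(k.+2, d)) i : affinely_independent q ->
  affinely_independent r -> cospan q r ->
  cospan (row' i q) (row' ord0 r) ->
  (forall l, aff (lam q i) (row (lift ord0 l) r) = 0) ->
  `[< same_orientation q r >] = ((0 < aff (lam q i) (row ord0 r)) ==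
    (`[< same_orientation (row' i q) (row' ord0 r) >] == ~~ odd i)).
Proof.
move=> qf rf qr qr' r0.
have sE m (a b : 'M[R]_(m.+1, d)) : affinely_independent a -> cospan a b ->
    `[< same_orientation a b >] = (0 < \det (bmx a b)).
  by move=> af ab; apply/asboolP/idP => /(same_orientationE af ab).
rewrite !sE //; last exact: row'_free.
have D0 := det_bmx_neq0 rf qr.
have := bmx_row' qf qr r0; set x := aff _ _; set D' := \det (bmx (row' i q) (row' ord0 r)).
move=> E; rewrite E in D0 *.
have [x0 D'0] : x != 0 /\ D' != 0.
  by move: D0; rewrite !mulf_eq0 !negb_or => /andP[/andP[]].
rewrite -signr_odd.
case: (ltrgtP 0 x) x0 => // hx _; case: (ltrgtP 0 D') D'0 => // hD _;
  case: (odd i) => /=; rewrite ?expr1 ?expr0 ?mulr1 ?mulrN1 ?mulNr ?oppr_gt0.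
- by rewrite ltNge ltW // mulr_gt0.
- by rewrite mulr_gt0.
- by rewrite pmulr_rlt0.
- by rewrite ltNge ltW // pmulr_rlt0.
- by rewrite nmulr_rlt0.
- by rewrite ltNge ltW // nmulr_rlt0.
- by rewrite ltNge ltW // nmulr_rgt0.
- by rewrite nmulr_rgt0.
Qed.
End Boundary.

(** * The boundary respects equality of chains *)

Section BoundaryEquivalence.
Variables (R : realType) (G : zmodType) (d k : nat).
Implicit Types (Z : chain R G d k.+1) (w : 'M[R]_(k.+1, d)).

(** The coefficient of [Z] at a point of its plane that lies on no face, orientations being compared
    with [r]. *)
Definition coef_at Z (r : 'M[R]_(k.+2, d)) (x : 'rV[R]_d) : G :=
  \sum_(p <- Z) if `[< hull p.2 x >] then
    orient `[< same_orientation p.2 r >] p.1 else 0.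

(* The coefficient of the boundary on [w] is the jump of the coefficient of the
   chain across [w]; here for one simplex, [x] and [x'] lying on both sides. *)
Lemma face_coef_jump (g : G) (q r : 'M[R]_(k.+2, d)) w (b x x' y : 'rV[R]_d) (u : R) :
  affinely_independent q -> affinely_independent r -> affinely_independent w ->
  (forall phi, phi \in facets q -> sided phi w) ->
  r = cone y w -> cospan q r -> b = bary w ->
  0 < u -> x = seg b y u -> x' = seg b (seg y b 2) u ->
  (~ hull q b -> ~ hull q x /\ ~ hull q x') ->
  (forall j, 0 < aff (lam q j) b -> 0 < aff (lam q j) x /\ 0 < aff (lam q j) x') ->
  face_coef g q w =
    (if `[< hull q x >] then orient `[< same_orientation q r >] g else 0) -
    (if `[< hull q x' >] then orient `[< same_orientation q r >] g else 0) /\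
  (forall j, hull q x -> 0 < aff (lam q j) x) /\
  (forall j, hull q x' -> 0 < aff (lam q j) x').
Proof.
move=> qf rf wf ws rE qr bE u0 xE x'E out pos.
have [bq|bq] := pselect (hull q b); last first.
  have [xq x'q] := out bq; rewrite !asboolF // subr0; split; last by split=> j h; [case: (xq h)|case: (x'q h)].
  rewrite /face_coef big1 // => i _; rewrite asboolF // => /sub_row'.
  by move=> /(_ qf ws)[]; rewrite -bE.
have b0 j : 0 <= aff (lam q j) b.
  by move/(hull_facets _ qf): bq; apply; exact: lam_facets.
have yq : (hmat y <= hmat q)%MS.
  by rewrite -(row0_cone y w) -rE -hmat_row (submx_trans _ qr) // row_sub.
have bspan : (hmat b <= hmat q)%MS by exact: hull_span bq.
have hseg z z' a : (hmat z <= hmat q)%MS -> (hmat z' <= hmat q)%MS ->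
    (hmat (seg z z' a) <= hmat q)%MS.
  by move=> zq z'q; rewrite hmat_seg addmx_sub // scalemx_sub.
have xq : (hmat x <= hmat q)%MS by rewrite xE hseg.
have x'q : (hmat x' <= hmat q)%MS by rewrite x'E !hseg.
have affx j : aff (lam q j) x = (1 - u) * aff (lam q j) b + u * aff (lam q j) y.
  by rewrite xE aff_seg.
(* [seg y b 2] is 2 b - y, so that [x] and [x'] are symmetric about [b]. *)
have affx' j : aff (lam q j) x' = aff (lam q j) b - u * (aff (lam q j) y - aff (lam q j) b).
  by rewrite x'E !aff_seg; ring.
have [allpos|] := pselect (forall j, 0 < aff (lam q j) b).
  have ix : hull q x by apply/hull_lam => // j; case: (pos j (allpos j)) => /ltW.
  have ix' : hull q x' by apply/hull_lam => // j; case: (pos j (allpos j)) => _ /ltW.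
  rewrite (asboolT ix) (asboolT ix') subrr; split; last by split=> j _; case: (pos j (allpos j)).
  rewrite /face_coef big1 // => i _; rewrite asboolF // => /sub_row'.
  by move=> /(_ qf ws)[_]; rewrite -bE => b0i; have := allpos i; rewrite b0i ltxx.
(* In the remaining case [w] lies in exactly one facet [i], and exactly one of [x] and [x'] belongs
   to [q], according to the side of [y]. *)
move=> /existsNP[i /negP]; rewrite -leNgt => bi.
have {}bi : aff (lam q i) b = 0 by apply/eqP; rewrite eq_le bi b0.
have wi : hull w `<=` hull (row' i q) by apply/sub_row'; rewrite -?bE.
have r0 l : aff (lam q i) (row (lift ord0 l) r) = 0.
  rewrite rE rowS_cone -vert_aff.
  by apply: sided_zero; [exact/ws/lam_facets|rewrite -bE].
have qr' : cospan (row' i q) (row' ord0 r) by rewrite rE row'0_cone; exact: hull_cospan.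
have so := same_orientation_cone qf rf qr qr' r0.
have r0y : row ord0 r = y by rewrite rE row0_cone.
have r'w : row' ord0 r = w by rewrite rE row'0_cone.
rewrite r0y r'w in so.
have yi : aff (lam q i) y != 0.
  apply/eqP => yi; have := det_bmx_neq0 rf qr; rewrite (bmx_row' qf qr r0).
  by rewrite rE row0_cone yi !mul0r eqxx.
have bpos j : j != i -> 0 < aff (lam q j) b.
  move=> ji; rewrite lt_neqAle b0 andbT eq_sym; apply: contra ji => /eqP bj.
  by apply/eqP; apply: (lam_zero_unique qf wf ws); rewrite -?bE.
have fE : face_coef g q w = orient `[< same_orientation (row' i q) w >] (orient (~~ odd i) g).
  rewrite /face_coef (bigD1 i) //= asboolT // big1 ?addr0 // => j ji.
  rewrite asboolF // => /(sub_row' j qf ws)[_]; rewrite -bE => bj.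
  by have := bpos _ ji; rewrite bj ltxx.
have xi : aff (lam q i) x = u * aff (lam q i) y by rewrite affx bi mulr0 add0r.
have x'i : aff (lam q i) x' = - (u * aff (lam q i) y) by rewrite affx' bi subr0 sub0r.
rewrite fE orientK so.
case: (ltrgtP 0 (aff (lam q i) y)) yi => // yi _.
- have ui : 0 < u * aff (lam q i) y by rewrite mulr_gt0.
  have ix : hull q x.
    apply/hull_lam => // j; have [->|ji] := eqVneq j i; first by rewrite xi ltW.
    by case: (pos j (bpos _ ji)) => /ltW.
  have ix' : ~ hull q x'.
    move=> /(hull_facets _ qf)/(_ _ (lam_facets q i)); rewrite x'i oppr_ge0.
    by rewrite leNgt ui.
  rewrite (asboolT ix) (asboolF ix') subr0; split; first by case: (_ == _).
  split=> j; last by move=> /ix'.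
  move=> _; have [->|ji] := eqVneq j i; first by rewrite xi.
  by case: (pos j (bpos _ ji)).
- have ui : u * aff (lam q i) y < 0 by rewrite pmulr_rlt0.
  have ix' : hull q x'.
    apply/hull_lam => // j; have [->|ji] := eqVneq j i.
      by rewrite x'i oppr_ge0 ltW.
    by case: (pos j (bpos _ ji)) => _ /ltW.
  have ix : ~ hull q x.
    move=> /(hull_facets _ qf)/(_ _ (lam_facets q i)); rewrite xi.
    by rewrite leNgt ui.
  rewrite (asboolT ix') (asboolF ix) sub0r; split; first by case: (_ == _); rewrite /= ?opprK.
  split=> j; first by move=> /ix.
  move=> _; have [->|ji] := eqVneq j i; first by rewrite x'i oppr_gt0.
  by case: (pos j (bpos _ ji)).
Qed.

(** No coordinate vanishes at [x] in the simplexes that contain it, so a fine enough piece [t]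
    containing [x] lies in exactly these simplexes; [coef_at] is then the coefficient on [t], up to
    orientation. *)
Lemma coef_at_zero Z r x : nondeg Z -> affinely_independent r ->
  (forall p, p \in Z -> cospan p.2 r) ->
  (forall p j, p \in Z -> hull p.2 x -> 0 < aff (lam p.2 j) x) ->
  evt (fun t => coefficient Z t = 0) -> coef_at Z r x = 0.
Proof.
move=> Zf rf Zr pos [F0 Z0].
have [[p0 p0Z p0x]|no] := pselect (exists2 p, p \in Z & hull p.2 x); last first.
  rewrite /coef_at big_seq big1 // => p pZ; rewrite asboolF // => px.
  by apply: no; exists p.
have [s [sub _ cov] sad] := adapted_subdivision (F0 ++ facets_of (map snd Z)) (Zf _ p0Z).
have [t ts tx] := cov _ p0x; have [tf tp0] := sub _ ts.
have [tF0 tF] := adapted_cat (sad _ ts).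
have tr : cospan t r.
  by apply: cospan_trans (Zr _ p0Z); apply: cospan_sym => //; exact: hull_cospan.
have tE p : p \in Z -> hull t `<=` hull p.2 <-> hull p.2 x.
  move=> pZ; split=> [|px]; first exact.
  have pf := Zf _ pZ.
  have tpF : adapted (facets p.2) t by apply: adapted_facets_of tF; exact: map_f.
  have pt : cospan p.2 t.
    by apply: cospan_trans (Zr _ pZ) _; exact: cospan_sym.
  move=> z tz; apply/hull_lam => //.
    by apply: submx_trans pt; exact: hull_span.
  move=> j; apply: aff_hull_ge0 tz; have [//|le0] := tpF.2 _ (lam_facets p.2 j).
  by have := pos _ j pZ px; rewrite ltNge (aff_hull_le0 le0 tx).
have -> : coef_at Z r x = orient `[< same_orientation t r >] (coefficient Z t).
  rewrite /coef_at /coefficient orient_sum [RHS]big_mkcond big_seq [RHS]big_seq.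
  apply: eq_bigr => p pZ; rewrite (asbool_equiv_eq (tE p pZ)).
  case: asboolP => // px; rewrite -/(orient _ _) orientK.
  rewrite (same_orientation_trans (Zf _ pZ) tf rf) //; last exact/hull_cospan/tE.
  by rewrite [X in orient X _]eq_sym.
by rewrite Z0 // orient0.
Qed.

(** On a generic [w] meeting a simplex of [Z] at its barycentre, the boundary coefficient is the
    difference of the coefficients of [Z] at two nearby points on either side of [w], and both are
    zero. *)
Lemma boundary_zero_coplanar Z : nondeg Z ->
  (forall p p', p \in Z -> p' \in Z -> cospan p.2 p'.2) ->
  evt (fun t => coefficient Z t = 0) ->
  evt (fun w => coefficient (boundary Z : chain R G d k) w = 0).
Proof.
move=> Zf Zc Z0; exists (facets_of (map snd Z)) => w [wf wF]; rewrite coef_boundary.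
have ws p : p \in Z -> forall phi, phi \in facets p.2 -> sided phi w.
  move=> pZ phi phip; apply: wF; apply/flattenP; exists (facets p.2) => //.
  exact/map_f/map_f.
set b := bary w.
have [[p0 p0Z p0b]|no] := pselect (exists2 p, p \in Z & hull p.2 b); last first.
  rewrite big_seq big1 // => p pZ; rewrite /face_coef big1 // => i _.
  rewrite asboolF // => /(sub_row' i (Zf _ pZ) (ws _ pZ))[pb _].
  by apply: no; exists p.
have p0f := Zf _ p0Z.
have wp0 : (hmat w <= hmat p0.2)%MS.
  apply/row_subP => i; rewrite hmat_row; apply: hull_span.
  by apply: (hull_sub_sided p0f (ws _ p0Z) p0b); exact: vert_hull.
(* [w] has one dimension less than [p0.2], so some vertex of the latter is off its plane; the cone
   over [w] from that vertex serves as reference orientation. *)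
have [l lw] : exists l, ~~ (hmat (row l p0.2) <= hmat w)%MS.
  apply/existsP; apply: contraT; rewrite negb_exists => /forallP all.
  have : (hmat p0.2 <= hmat w)%MS.
    by apply/row_subP => i; rewrite hmat_row; have := all i; rewrite negbK.
  move=> /mxrankS; move: p0f wf; rewrite !affinely_independent_hmat => /eqP -> /eqP ->.
  by rewrite ltnn.
set y := row l p0.2; have rf := cone_free wf lw; set r := cone y w in rf.
have p0r : cospan p0.2 r.
  apply/row_subP => i; rewrite hmat_row; case: (unliftP ord0 i) => [j ->|->].
    by rewrite rowS_cone -hmat_row (submx_trans _ wp0) // row_sub.
  by rewrite row0_cone /y -hmat_row row_sub.
have Zr p : p \in Z -> cospan p.2 r.
  by move=> pZ; apply: cospan_trans p0r; exact: Zc.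
pose vs := map snd Z.
have vsf v : v \in vs -> affinely_independent v by move=> /mapP[p /Zf ? ->].
have pos z : \forall u \near (0 : R)^'+, forall phi, phi \in facets_of vs ->
    0 < aff phi b -> 0 < aff phi (seg b z u).
  apply: near_all_seq => phi _; have [b0|b0] := ltrP 0 (aff phi b); last first.
    by near=> u.
  have /near0_seg_lt0 : - aff phi b < 0 by rewrite oppr_lt0.
  move=> /(_ (- aff phi z)); apply: filterS => u h _.
  by rewrite aff_seg -oppr_lt0 opprD -!mulrN.
have near_ex (P : R -> Prop) : (\forall u \near (0 : R)^'+, P u) -> exists u, P u.
  by move=> h; exact: (@filter_ex _ _ (at_right_proper_filter (0 : R)) _ h).
have [u [[[[u0 n1] n2] p1] p2]] : exists u : R, (((0 < u /\
    (forall v, v \in vs -> ~ hull v b -> ~ hull v (seg b y u))) /\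
    (forall v, v \in vs -> ~ hull v b -> ~ hull v (seg b (seg y b 2) u))) /\
    (forall phi, phi \in facets_of vs -> 0 < aff phi b -> 0 < aff phi (seg b y u))) /\
    (forall phi, phi \in facets_of vs -> 0 < aff phi b ->
       0 < aff phi (seg b (seg y b 2) u)).
  apply: near_ex; do ! apply: filterI; [exact: nbhs_right_gt | | | exact: pos..];
    exact: near0_seg_notin.
have lamF p j : p \in Z -> lam p.2 j \in facets_of vs.
  move=> pZ; apply/flattenP; exists (facets p.2); last exact: lam_facets.
  exact/map_f/map_f.
have J p : p \in Z -> _ := fun pZ => @face_coef_jump p.1 p.2 r w b (seg b y u)
  (seg b (seg y b 2) u) y u (Zf _ pZ) rf wf (ws _ pZ) erefl (Zr _ pZ) erefl u0 erefl erefl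
  (fun h => conj (n1 _ (map_f snd pZ) h) (n2 _ (map_f snd pZ) h))
  (fun j h => conj (p1 _ (lamF _ j pZ) h) (p2 _ (lamF _ j pZ) h)).
have -> : \sum_(p <- Z) face_coef p.1 p.2 w =
    coef_at Z r (seg b y u) - coef_at Z r (seg b (seg y b 2) u).
  rewrite /coef_at -sumrB big_seq [RHS]big_seq; apply: eq_bigr => p pZ.
  by have [-> _] := J p pZ.
rewrite !coef_at_zero ?subrr // => p j pZ px; have [_ [h1 h2]] := J p pZ;
  by [exact: h1|exact: h2].
Unshelve. all: by end_near. Qed.

(** The simplexes in the plane of the first one are split off. A nondegenerate simplex lies only in
    simplexes of its own plane, so the two parts of [Z] vanish separately and induction on the size
    applies to the second. *)
Lemma evt_boundary_zero Z : nondeg Z -> evt (fun t => coefficient Z t = 0) ->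
  evt (fun w => coefficient (boundary Z : chain R G d k) w = 0).
Proof.
have [n] := ubnP (size Z); elim: n Z => // n IH [|p Z].
  by move=> *; exists [::] => w _; rewrite coef_nil.
rewrite [size _]/= ltnS => szZ pZf pZ0.
pose c (p' : G * 'M[R]_(k.+2, d)) := `[< cospan p.2 p'.2 >].
have pf : affinely_independent p.2 by apply: pZf; rewrite mem_head.
have cp : c p by apply/asboolP; exact: submx_refl.
set C := [seq p' <- p :: Z | c p']; set D := [seq p' <- p :: Z | predC c p'].
have Cf : nondeg C by move=> q; rewrite mem_filter => /andP[_ /pZf].
have Df : nondeg D by move=> q; rewrite mem_filter => /andP[_ /pZf].
have coefC t : affinely_independent t -> coefficient C t =
    if `[< cospan p.2 t >] then coefficient (p :: Z) t else 0.
  move=> tf; rewrite /coefficient big_filter_cond; case: asboolP => pt.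
    rewrite big_seq_cond [RHS]big_seq_cond; apply: eq_bigl => q.
    have [qZ|//] := boolP (q \in _) => /=.
    case: (asboolP (hull t `<=` _)) => [tq|]; last by rewrite andbF.
    rewrite andbT; apply/asboolP; apply: cospan_trans pt _.
    by apply: cospan_sym => //; exact: hull_cospan.
  rewrite big1_seq // => q /andP[/andP[/asboolP pq /asboolP tq] _]; case: pt.
  by apply: cospan_trans pq _; exact: hull_cospan.
have coefD t : coefficient (p :: Z) t = coefficient C t + coefficient D t.
  rewrite -coef_cat; apply: coef_perm; rewrite perm_sym; apply/permPl; exact: perm_filterC.
have C0 : evt (fun t => coefficient C t = 0).
  by apply: evt_mono pZ0 => t tf t0; rewrite coefC // t0 if_same.
have D0 : evt (fun t => coefficient D t = 0).
  apply: evt_mono (evtI C0 pZ0) => t tf [t0]; by rewrite coefD t0 add0r.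
have bC : evt (fun w => coefficient (boundary C : chain R G d k) w = 0).
  apply: boundary_zero_coplanar => // q q'; rewrite !mem_filter.
  move=> /andP[/asboolP pq qZ] /andP[/asboolP pq' _]; apply: cospan_trans pq'.
  by apply: cospan_sym => //; exact: pZf.
have bD : evt (fun w => coefficient (boundary D : chain R G d k) w = 0).
  apply: IH => //; rewrite /D /= cp /=.
  by apply: leq_ltn_trans szZ; rewrite size_filter count_size.
apply: evt_mono (evtI bC bD) => w wf []; rewrite !coef_boundary => eC eD.
by rewrite -(perm_big _ (introT permPl (perm_filterC c (p :: Z)))) /= big_cat /= eC eD addr0.
Qed.

Lemma boundary_cat (Z Z' : chain R G d k.+1) :
  boundary (Z ++ Z') = (boundary Z ++ boundary Z' : chain R G d k).
Proof. by rewrite /boundary allpairs_cat. Qed.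

Lemma coef_boundary_sub Z Z' w :
  coefficient (boundary (chain_sub Z Z') : chain R G d k) w =
  coefficient (boundary Z : chain R G d k) w -
  coefficient (boundary Z' : chain R G d k) w.
Proof.
rewrite !coef_boundary big_cat; congr (_ + _); rewrite big_map -sumrN.
apply: eq_bigr => p _; rewrite /face_coef -sumrN; apply: eq_bigr => i _.
by case: ifP => _; rewrite ?oppr0 // !orientN.
Qed.

Lemma eqv_boundary Z Z' : nondeg Z -> nondeg Z' -> eqv Z Z' ->
  eqv (boundary Z : chain R G d k) (boundary Z').
Proof.
move=> Zf Z'f ZZ'.
have : evt (fun w => coefficient (boundary (chain_sub Z Z') : chain R G d k) w = 0).
  apply: evt_boundary_zero; first exact: nondeg_sub.
  by apply: evt_mono ZZ' => t _ E; rewrite coef_sub E subrr.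
apply: evt_mono => w _ /eqP; rewrite coef_boundary_sub subr_eq0 => /eqP.
exact.
Qed.
End BoundaryEquivalence.

(** * The boundary of a boundary *)

Lemma sum_antisymmetric (G : zmodType) n (g : 'I_n -> 'I_n -> G) :
  (forall a b : 'I_n, (a < b)%N -> g b a = - g a b) ->
  \sum_a \sum_(b | b != a) g a b = 0.
Proof.
move=> anti; rewrite pair_big_dep /=.
rewrite (bigID (fun p : 'I_n * 'I_n => (p.1 < p.2)%N)) /=.
rewrite [X in _ + X](reindex_inj (h := fun p : 'I_n * 'I_n => (p.2, p.1))) /=; last first.
  by move=> [a b] [c e] /= [-> ->].
rewrite [X in _ + X](eq_bigl (fun p : 'I_n * 'I_n => (p.2 != p.1) && (p.1 < p.2)%N)).
  rewrite -big_split big1 //= => -[a b] /= /andP[_ ab].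
  by rewrite (anti a b) ?subrr.
move=> [a b] /=; rewrite -leqNgt (eq_sym a) leq_eqVlt andb_orr.
by rewrite (_ : (b != a) && (a == b :> nat) = false) //= -val_eqE /= eq_sym andNb.
Qed.

Section BoundaryBoundary.
Variables (R : realType) (G : zmodType) (d k : nat).

Definition signed_face (f : 'M[R]_(k.+1, d) -> G) (q : 'M[R]_(k.+3, d)) (a b : 'I_k.+3) : G :=
  if unlift a b is Some j then
    orient (~~ odd j) (orient (~~ odd a) (f (row' j (row' a q)))) else 0.

(** Deleting the vertices [a] and [b] in either order leaves the same face, but deleting [a] first
    shifts the index of [b] by one, which changes the sign. *)
Lemma signed_face_anti f q (a b : 'I_k.+3) : (a < b)%N ->
  signed_face f q b a = - signed_face f q a b.
Proof.
move=> ab; rewrite /signed_face.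
case: (unliftP a b) => [j bE|bE]; last by rewrite bE ltnn in ab.
case: (unliftP b a) => [l aE|aE]; last by rewrite -aE ltnn in ab.
have jE : b = j.+1 :> nat.
  by have := congr1 val bE; rewrite /= /bump; case: leqP => // h E; move: ab; rewrite E ltnNge ltnW.
have lE : a = l :> nat.
  have := congr1 val aE; rewrite /= /bump; case: leqP => // h E.
  by move: ab; rewrite E add1n ltnNge (leq_trans h).
have key (i m x : nat) : (i <= m)%N -> bump m.+1 (bump i x) = bump i (bump m x).
  move=> im; rewrite /bump; case: (leqP i x) => h1; case: (leqP m x) => h2;
    rewrite ?add1n ?add0n; by case: leqP => h3; case: leqP => h4; lia.
have -> : row' l (row' b q) = row' j (row' a q).
  apply/matrixP => x y; rewrite !mxE; congr (q _ y); apply/val_inj => /=.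
  by rewrite jE -lE key // -ltnS -jE.
rewrite jE -lE /= !orientK -orientN; case: (odd a); case: (odd j) => //=.
all: by rewrite ?opprK.
Qed.

Lemma coef_boundary_boundary (Q : chain R G d k.+2) (t : 'M[R]_(k.+1, d)) :
  coefficient (boundary (boundary Q : chain R G d k.+1) : chain R G d k) t = 0.
Proof.
rewrite coef_boundary /boundary big_allpairs_dep /= big1 // => -[g q] _ /=.
pose f m := if `[< hull t `<=` hull m >] then orient `[< same_orientation m t >] g else 0.
rewrite -[RHS](sum_antisymmetric (signed_face_anti f q)) big_enum /=.
apply: eq_bigr => i _; rewrite /face_coef.
rewrite (reindex_omap (lift i) (unlift i)) /=; last first.
  by move=> j; case: (unliftP i j) => [l ->|->]; rewrite ?eqxx // liftK.
rewrite [RHS](eq_bigl predT) => [|j]; last by rewrite liftK eqxx eq_sym neq_lift.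
apply: eq_bigr => j _; rewrite /signed_face liftK /f.
case: asboolP => _; last by rewrite !orient0.
have -> : (if odd i then - g else g) = orient (~~ odd i) g by rewrite /orient if_neg.
by rewrite !orientK; congr (orient _ g); case: `[< _ >]; case: (odd i); case: (odd j).
Qed.
End BoundaryBoundary.

(** * Restriction of chains *)

Section PolySets.
Variables (R : realType) (d : nat).
Implicit Types (A B : set 'rV[R]_d).

(* Sets which fine enough simplexes do not cross. *)
Definition polyset A : Prop := borel A /\
  exists F, forall k (t : 'M[R]_(k.+1, d)), adapted F t ->
    (A (bary t) -> hausdorff k (hull t `\` A) = 0%E) /\
    (~ A (bary t) -> hausdorff k (hull t `&` A) = 0%E).

Lemma polysetC A : polyset A -> polyset (~` A).
Proof.
move=> [bA [F AF]]; split; first exact: borelC.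
exists F => k t /AF[h1 h2]; split; first by rewrite setDE setCK; exact: h2.
by move=> /contrapT /h1; rewrite setDE.
Qed.

Lemma polysetI A B : polyset A -> polyset B -> polyset (A `&` B).
Proof.
move=> [bA [F AF]] [bB [F' BF]]; split; first exact: borelI.
exists (F ++ F') => k t /adapted_cat[/AF[h1 h2] /BF[h3 h4]]; split.
  move=> [/h1 tA /h3 tB]; rewrite setDIr; exact: hausdorff_nullU.
move=> /not_andP[/h2|/h4]; apply: hausdorff_null_sub => x [tx [ax bx]]; by split.
Qed.

Lemma polysetD A B : polyset A -> polyset B -> polyset (A `\` B).
Proof. by move=> pA pB; rewrite setDE; apply: polysetI => //; exact: polysetC. Qed.

Lemma polysetU A B : polyset A -> polyset B -> polyset (A `|` B).
Proof.
move=> pA pB; rewrite -[A `|` B]setCK setCU.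
by apply/polysetC/polysetI; exact: polysetC.
Qed.

Lemma halfspace_adapted phi k (t : 'M[R]_(k.+1, d)) : adapted [:: phi] t ->
  let A := [set x : 'rV[R]_d | aff phi x <= 0] in
  (A (bary t) -> hausdorff k (hull t `\` A) = 0%E) /\
  (~ A (bary t) -> hausdorff k (hull t `&` A) = 0%E).
Proof.
move=> [tf ts] A.
have {}ts : sided phi t by apply: ts; rewrite mem_head.
split=> [b0|/negP].
  apply: hausdorff_null_sub (hausdorff_set0 _ _ _) => x [tx]; apply.
  by apply: aff_hull_le0 tx; exact: bary_le0.
rewrite -ltNge => b0; have ge0 := bary_ge0 ts (ltW b0).
apply: hausdorff_null_sub (@hausdorff_hull_null _ _ _ t phi tf _).
  by move=> x [tx x0]; split=> //; apply/eqP; rewrite eq_le x0 (aff_hull_ge0 ge0 tx).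
apply/not_existsP => all0; move: b0; rewrite aff_bary big1 ?mulr0 ?ltxx // => i _.
by apply/eqP/negPn/negP; exact: all0.
Qed.

Lemma polyset_halfspace phi : polyset [set x : 'rV[R]_d | aff phi x <= 0].
Proof.
split; first exact: borel_halfspace.
by exists [:: phi] => k t; exact: halfspace_adapted.
Qed.

Lemma polyset_halfspaceC phi : polyset [set x : 'rV[R]_d | 0 < aff phi x].
Proof.
rewrite (_ : mkset _ = ~` [set x | aff phi x <= 0]).
  exact/polysetC/polyset_halfspace.
by apply/seteqP; split => x /=; [rewrite ltNge => /negP|move=> /negP; rewrite -ltNge].
Qed.

Lemma polysetT : polyset [set: 'rV[R]_d].
Proof.
rewrite (_ : setT = [set x | aff 0 x <= 0]); first exact: polyset_halfspace.
by apply/seteqP; split=> x //= _; rewrite /aff mulmx0 mxE.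
Qed.

Lemma polyset_bigI (I : eqType) (r : seq I) (A : I -> set 'rV[R]_d) :
  (forall i, i \in r -> polyset (A i)) -> polyset [set x | forall i, i \in r -> A i x].
Proof.
elim: r => [|i r IH] rA.
  by rewrite (_ : mkset _ = setT); [exact: polysetT|apply/seteqP; split].
rewrite (_ : mkset _ = A i `&` [set x | forall i, i \in r -> A i x]).
  apply: polysetI; first by apply: rA; rewrite mem_head.
  by apply: IH => j jr; apply: rA; rewrite inE jr orbT.
apply/seteqP; split => x /=.
  move=> h; split; first by apply: h; rewrite mem_head.
  by move=> j jr; apply: h; rewrite inE jr orbT.
by move=> [h1 h2] j; rewrite inE => /predU1P[->|/h2].
Qed.

Lemma polyset_box (a b : 'rV[R]_d) : polyset (box a b).
Proof.
rewrite (_ : box a b = [set x | forall i, i \in enum 'I_d ->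
  ([set x | aff (coordf i (b ord0 i)) x <= 0] `&`
   [set x | aff (- coordf i (a ord0 i)) x <= 0]) x]).
  by apply: polyset_bigI => i _; apply: polysetI; exact: polyset_halfspace.
apply/seteqP; split => x h i => [_|].
  by rewrite /= affN !coordfE oppr_le0 subr_ge0 subr_le0; have /andP[] := h i.
have [] := h i; first by rewrite mem_enum.
by rewrite /= affN !coordfE oppr_le0 subr_ge0 subr_le0 => -> ->.
Qed.
End PolySets.

Section Restriction.
Variables (R : realType) (G : zmodType) (d : nat).
Variables (nrm : G -> R) (nrmP : group_norm nrm).
Local Notation M := (M nrm).

Section Dimension.
Variable k : nat.
Implicit Types (P Q : chain R G d k) (s : seq 'M[R]_(k.+1, d)) (t : 'M[R]_(k.+1, d)).
Implicit Types A B : set 'rV[R]_d.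

Definition chain_in (S : set 'rV[R]_d) P := forall p, p \in P -> hull p.2 `<=` S.

Definition is_restr A P Q : Prop :=
  evt (fun t => coefficient Q t = if `[< A (bary t) >] then coefficient P t else 0).

Lemma subchain_in K P s b : refinement P s -> chain_in K P ->
  chain_in K (subchain P s b).
Proof.
move=> Ps PK p; have /refinementP[_ _ sub _] := Ps; move=> /mapP[t]; rewrite mem_filter => /andP[_ ts] -> /=.
by have [q qP tq] := sub t ts; apply: (subset_trans tq); exact: PK.
Qed.

Lemma subchain_restr A F P s : nondeg P -> refinement P s ->
  (forall k (t : 'M[R]_(k.+1, d)), adapted F t ->
    (A (bary t) -> hausdorff k (hull t `\` A) = 0%E) /\
    (~ A (bary t) -> hausdorff k (hull t `&` A) = 0%E)) ->
  (forall t, t \in s -> adapted F t) ->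
  is_restr A P (subchain P s (fun t => `[< A (bary t) >])).
Proof.
move=> Pf Ps AF sF; exists (F ++ facets_of s) => t /adapted_cat[tF ts].
rewrite (coef_subchain _ Pf Ps ts).
(* Up to null sets, each of [t] and [u] is inside or outside [A]; as [t] lies in [u] and has
   positive measure, they are on the same side. *)
have same u : u \in s -> hull t `<=` hull u -> A (bary u) <-> A (bary t).
  move=> us tu; have [u1 u2] := AF _ _ (sF _ us); have [t1 t2] := AF _ _ tF.
  have tpos := hausdorff_hull_gt0 tF.1.
  split=> [/u1 h|]; apply: contrapT.
    move=> /t2 h'; move: tpos; rewrite -(setDUK (@subIsetl _ (hull t) A)).
    rewrite hausdorff_nullU ?ltxx //; apply: hausdorff_null_sub h => x [tx nx].
    by split; [exact: tu|move=> ax; exact: nx].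
  move=> /not_implyP[/t1 h /u2 h']; move: tpos.
  rewrite -(setDUK (@subIsetl _ (hull t) A)) hausdorff_nullU ?ltxx //.
    by apply: hausdorff_null_sub h' => x [tx ax]; split => //; exact: tu.
  by apply: hausdorff_null_sub h => x [tx nx]; split => // ax; exact: nx.
have [[p pP tp]|no] := pselect (exists2 p, p \in P & hull t `<=` hull p.2); last first.
  by rewrite (coef_eq0 (P := P)) ?if_same // => p pP tp; apply: no; exists p.
have [u us [tu _]] := refinement_locate Ps ts (ex_intro2 _ _ p pP tp).
rewrite (_ : `[< exists2 u, _ & _ >] = `[< A (bary t) >]) //.
apply/asboolP/asboolP => [[v vs [tv /asboolP vA]]|tA]; first exact/(same v).
by exists u => //; split => //; apply/asboolP/(same u).
Qed.

Lemma restr_exists A P : nondeg P -> polyset A ->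
  exists Q, [/\ nondeg Q, forall K, chain_in K P -> chain_in K Q & is_restr A P Q].
Proof.
move=> Pf [_ [F AF]]; have [s Ps sF] := refinement_exists F Pf.
exists (subchain P s (fun t => `[< A (bary t) >])); split.
- exact: nondeg_subchain.
- by move=> K; exact: subchain_in.
- exact: subchain_restr AF sF.
Qed.

(** A restriction is determined only up to [eqv], hence the choice; [rsP] gives its properties for
    nondegenerate [P] and polyhedral [A]. *)
Definition rs A P : chain R G d k := xget [::]
  [set Q | [/\ nondeg Q, forall K, chain_in K P -> chain_in K Q & is_restr A P Q]].

Lemma rsP A P : nondeg P -> polyset A ->
  [/\ nondeg (rs A P), forall K, chain_in K P -> chain_in K (rs A P) & is_restr A P (rs A P)].
Proof.
move=> Pf pA; have [Q hQ] := restr_exists Pf pA.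
by rewrite /rs; case: xgetP => // /(_ Q).
Qed.

Lemma rs_nondeg A P : nondeg P -> polyset A -> nondeg (rs A P).
Proof. by move=> Pf pA; have [] := rsP Pf pA. Qed.

Lemma rs_coef A P : nondeg P -> polyset A -> is_restr A P (rs A P).
Proof. by move=> Pf pA; have [] := rsP Pf pA. Qed.

Lemma polyhedralE (K : set 'rV[R]_d) P : polyhedral K P <-> nondeg P /\ chain_in K P.
Proof.
split=> [h|[h1 h2] p pP]; first by split=> p /h[].
by split; [exact: h1|exact: h2].
Qed.

Lemma rs_polyhedral K A P : polyhedral K P -> polyset A -> polyhedral K (rs A P).
Proof.
move=> /polyhedralE[Pf PK] pA; have [h1 h2 _] := rsP Pf pA.
by apply/polyhedralE; split => //; exact: h2.
Qed.

Lemma M_rs_split A B P : nondeg P -> polyset A -> polyset B ->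
  M (rs A P) = M (rs (A `&` B) P) + M (rs (A `\` B) P).
Proof.
move=> Pf pA pB; have pI := polysetI pA pB; have pD := polysetD pA pB.
apply: (M_eq2 nrmP); try exact: rs_nondeg.
apply: evt_mono (evtI (rs_coef Pf pA) (evtI (rs_coef Pf pI) (rs_coef Pf pD))).
move=> t _ [-> [-> ->]]; rewrite /setD /setI /=.
rewrite asbool_and asbool_and asbool_neg.
by case: `[< A _ >]; case: `[< B _ >]; rewrite /= ?(nrm0 nrmP) ?addr0 ?add0r.
Qed.

Lemma M_rs_mono A B P : nondeg P -> polyset A -> polyset B -> A `<=` B ->
  M (rs A P) <= M (rs B P).
Proof.
move=> Pf pA pB AB; rewrite (M_rs_split Pf pB pA) (setIidr AB) lerDl.
by apply: (M_ge0 nrmP); exact: rs_nondeg.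
Qed.

Lemma M_rsT P : nondeg P -> M (rs setT P) = M P.
Proof.
move=> Pf; apply: (M_eqv nrmP) => //; first by apply: rs_nondeg => //; exact: polysetT.
by apply: evt_mono (rs_coef Pf (@polysetT _ _)) => t _ ->; rewrite asboolT.
Qed.

Lemma M_rs_le A P : nondeg P -> polyset A -> M (rs A P) <= M P.
Proof. by move=> Pf pA; rewrite -[leRHS]M_rsT // M_rs_mono //; exact: polysetT. Qed.

(** Cancellation between overlapping simplexes is ignored; in exchange the bound is a measure in
    [A], computed on the given simplexes of [P] without a refinement. *)
Lemma M_rs_hausdorff A P : nondeg P -> polyset A ->
  ((M (rs A P))%:E <=
    \sum_(p <- P) (nrm p.1)%:E * hausdorff k (hull p.2 `&` A))%E.
Proof.
move=> Pf pA; have rf := rs_nondeg Pf pA; have [F1 rF] := rs_coef Pf pA.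
have [bA [F2 AF]] := pA.
have [|s [sF sno sM]] := @common_mass _ _ _ _ nrmP k (F1 ++ F2) [:: rs A P].
  by move=> P'; rewrite inE => /eqP ->.
rewrite sM ?inE //.
have sf t : t \in s -> affinely_independent t by move=> /sF[].
rewrite -sumEFin.
apply: (@le_trans _ _ (\sum_(t <- s) \sum_(p <- P)
    if `[< hull t `<=` hull p.2 >] then (nrm p.1)%:E * hausdorff k (hull p.2 `&` A `&` hull t) else 0)%E).
  rewrite big_seq [leRHS]big_seq; apply: lee_sum => t ts.
  have [tF1 tF2] := adapted_cat (sF _ ts); rewrite rF //.
  have rhs0 : (0 <= \sum_(p <- P) if `[< hull t `<=` hull p.2 >] then
      (nrm p.1)%:E * hausdorff k (hull p.2 `&` A `&` hull t) else 0)%E.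
    apply: sume_ge0 => p _; case: ifP => // _.
    by rewrite mule_ge0 ?hausdorff_ge0 // lee_fin nrm_ge0.
  case: asboolP => tA; last by rewrite nrm0 // mul0r.
  rewrite /coefficient; elim: (P) => [|p Q IH]; first by rewrite !big_nil nrm0 // mul0r.
  rewrite !big_cons; case: asboolP => tp; last by rewrite add0e.
  apply: (@le_trans _ _ ((nrm p.1 * vol t)%:E + (nrm (\sum_(p0 <- Q | `[< hull t `<=` hull p0.2 >])
     (if `[< same_orientation p0.2 t >] then p0.1 else - p0.1)) * vol t)%:E)%E).
    rewrite -EFinD lee_fin -mulrDl ler_wpM2r ?vol_ge0 //.
    by apply: le_trans (nrmD nrmP _ _) _; rewrite lerD2r (nrm_sign nrmP).
  apply: leeD => //; rewrite EFinM -volE lee_wpmul2l ?lee_fin ?nrm_ge0 //.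
  rewrite -(hausdorff_nullD (hull t) ((AF _ _ tF2).1 tA)); apply: le_hausdorff.
  move=> x [tx nx]; split => //; split; first exact: tp.
  by apply: contrapT => ax; apply: nx.
rewrite exchange_big /=; apply: lee_sum => p _; rewrite -big_mkcond /=.
rewrite -ge0_sume_distrr; last by move=> t _; exact: hausdorff_ge0.
apply: lee_wpmul2l; first by rewrite lee_fin nrm_ge0.
rewrite -big_filter -hausdorff_sum.
- by apply: le_hausdorff => x [].
- by rewrite filter_uniq // (overlap_null_uniq sf).
- by move=> t; rewrite mem_filter => /andP[_ /sf]; exact: hull_borel.
- move=> t u; rewrite !mem_filter => /andP[_ ts] /andP[_ us] tu.
  by apply/asboolP; exact: (overlap_null_mem sno).
Qed.

Lemma subchain_predT_eqv P s : nondeg P -> refinement P s ->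
  eqv P (subchain P s predT).
Proof.
move=> Pf Ps; exists (facets_of s) => t ts; rewrite (coef_subchain _ Pf Ps ts).
case: asboolP => // no; apply: coef_eq0 => p pP tp; apply: no.
have [u us [tu _]] := refinement_locate Ps ts (ex_intro2 _ _ p pP tp).
by exists u.
Qed.
Lemma nonoverlapping_chain P : nondeg P -> exists Q, [/\ nondeg Q,
  forall K, chain_in K P -> chain_in K Q, eqv P Q &
  M P = \sum_(q <- Q) nrm q.1 * vol q.2].
Proof.
move=> Pf; have [s Ps _] := refinement_exists [::] Pf.
exists (subchain P s predT); split.
- exact: nondeg_subchain.
- by move=> K; exact: subchain_in.
- exact: subchain_predT_eqv.
- by rewrite (M_refinement nrmP Pf Ps) /subchain filter_predT big_map.
Qed.

(** Pieces not cut by the hyperplanes of the faces of the box lie in it as soon as their barycentre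
    does, and otherwise meet it in a null set. *)
Lemma box_restriction_exists (a b : 'rV[R]_d) P : nondeg P ->
  exists S, [/\ box_restriction P (box a b) S, nondeg S,
    forall K, chain_in K P -> chain_in K S & is_restr (box a b) P S].
Proof.
move=> Pf; have [bI [F IF]] := polyset_box a b.
pose F' := F ++ [seq coordf i (b ord0 i) | i <- enum 'I_d] ++
  [seq coordf i (a ord0 i) | i <- enum 'I_d].
have [s Ps sF] := refinement_exists F' Pf.
have sub t : t \in s -> `[< hull t `<=` box a b >] = `[< (box a b) (bary t) >].
  move=> /sF/adapted_cat[tF /adapted_cat[t1 t2]].
  apply/asboolP/asboolP => [h|bt x tx i]; first exact/h/bary_hull.
  have /andP[ai bi] := bt i.
  have c1 : sided (coordf i (a ord0 i)) t by apply: t2.2; apply/mapP; exists i; rewrite ?mem_enum.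
  have c2 : sided (coordf i (b ord0 i)) t by apply: t1.2; apply/mapP; exists i; rewrite ?mem_enum.
  apply/andP; split.
    have : 0 <= aff (coordf i (a ord0 i)) x.
      by apply: aff_hull_ge0 tx; apply: bary_ge0 => //; rewrite coordfE subr_ge0.
    by rewrite coordfE subr_ge0.
  have : aff (coordf i (b ord0 i)) x <= 0.
    by apply: aff_hull_le0 tx; apply: bary_le0 => //; rewrite coordfE subr_le0.
  by rewrite coordfE subr_le0.
exists (subchain P s (fun t => `[< hull t `<=` box a b >])); split.
- exists s; split => // t ts; have [tF _] := adapted_cat (sF _ ts).
  have [h|h] := pselect (box a b (bary t)); [left|right; exact: (IF _ _ tF).2].
  by apply/asboolP; rewrite sub //; exact/asboolP.
- exact: nondeg_subchain.
- by move=> K; exact: subchain_in.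
- rewrite (_ : subchain _ _ _ = subchain P s (fun t => `[< (box a b) (bary t) >])).
    by apply: (subchain_restr Pf Ps IF) => t /sF/adapted_cat[].
  by rewrite /subchain; congr map; apply: eq_in_filter => t; exact: sub.
Qed.

End Dimension.

(** * Restriction to a half-space against boundary *)

Section Commutator.
Variable k : nat.
Implicit Types (Q : chain R G d k.+1) (phi : 'cV[R]_(d + 1)).

Definition slice_mass phi Q : \bar R :=
  (\sum_(q <- Q) (nrm q.1)%:E * hausdorff k (hull q.2 `&` [set x | aff phi x = 0%R]))%E.

(** A simplex of dimension k + 1 is cut into at most 2^(k + 2) pieces, each with k + 2 faces. *)
Definition cut_count : R := (k.+2 * 2 ^ k.+2)%:R.

Lemma slice_mass_ge0 phi Q : (0 <= slice_mass phi Q)%E.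
Proof.
by apply: sume_ge0 => q _; rewrite mule_ge0 ?hausdorff_ge0 // lee_fin nrm_ge0.
Qed.

(** With [C1] and [C2] the pieces below and above the hyperplane, restricting the boundary of [P]
    and subtracting the boundary of [C1] leaves the boundary of [C2] restricted to [A]. The faces of
    [C2] meet [A] only in the hyperplane. *)
Lemma commutator1 phi (g : G) (q : 'M[R]_(k.+2, d)) : affinely_independent q ->
  let A := [set x : 'rV[R]_d | aff phi x <= 0] in let P := [:: (g, q)] in
  exists Q, [/\ nondeg Q, forall K, chain_in K P -> chain_in K Q, is_restr A P Q &
    ((M (chain_sub (rs A (boundary P : chain R G d k)) (boundary Q)))%:E
       <= cut_count%:E * slice_mass phi P)%E].
Proof.
move=> qf A P; have pA : polyset A by exact: polyset_halfspace.
have Pf : nondeg P by move=> p; rewrite inE => /eqP ->.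
have [s sub [sd sz]] := cut_simplex phi qf; have [s1 s2 s3] := sub.
have Ps : refinement P s.
  apply/refinementP; split=> //; first by move=> t /s1[].
    by move=> t /s1[_ tq]; exists (g, q); rewrite ?mem_head.
  move=> p; rewrite inE => /eqP -> x /= /s3[u us ux]; exists u => //; split => //.
  by have [] := s1 _ us.
have sA t : t \in s -> adapted [:: phi] t.
  move=> ts; split; first by have [] := s1 _ ts.
  by move=> psi; rewrite inE => /eqP ->; exact: sd.
pose low (u : 'M[R]_(k.+2, d)) := `[< A (bary u) >].
pose C1 := subchain P s low; pose C2 := subchain P s (predC low).
have C1f : nondeg C1 by exact: nondeg_subchain.
have C2f : nondeg C2 by exact: nondeg_subchain.
exists C1; split=> //.
- by move=> K; exact: subchain_in.
- by apply: (subchain_restr Pf Ps (F := [:: phi])) => // m t; exact: halfspace_adapted.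
have bP : nondeg (boundary P : chain R G d k) by exact: nondeg_boundary.
have bC1 : nondeg (boundary C1 : chain R G d k) by exact: nondeg_boundary.
have bC2 : nondeg (boundary C2 : chain R G d k) by exact: nondeg_boundary.
have E : eqv (boundary P : chain R G d k) (boundary (C1 ++ C2)).
  apply: eqv_boundary => //; first exact: nondeg_cat.
  apply: evt_mono (subchain_predT_eqv Pf Ps) => t _ ->.
  apply: coef_perm; rewrite /subchain filter_predT -map_cat perm_map // perm_sym.
  exact/permPl/perm_filterC.
have -> : M (chain_sub (rs A (boundary P : chain R G d k)) (boundary C1)) =
    M (rs A (boundary C2 : chain R G d k)).
  apply: (M_eqv nrmP); first by apply: nondeg_sub => //; exact: rs_nondeg.
    exact: rs_nondeg.
  apply: evt_mono (evtI E (evtI (rs_coef bP pA) (rs_coef bC2 pA))) => t tf [Et [E1 E2]].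
  rewrite coef_sub E1 E2 Et boundary_cat coef_cat; case: asboolP => tA.
    by rewrite addrC addKr.
  rewrite coef_eq0 ?subrr // => e /allpairsPdep[p [i [pC _ ->]]] /= tu; apply: tA.
  move: pC tu => /mapP[u]; rewrite mem_filter => /andP[/asboolP uA us] -> /= tu.
  have uf : affinely_independent u by have [] := s1 _ us.
  apply: (@aff_hull_le0 _ _ _ phi u); last first.
    exact/(hull_row'_sub (i := i) uf)/tu/bary_hull.
  by apply: bary_le0 => //; exact: sd.
apply: le_trans (M_rs_hausdorff bC2 pA) _.
set h := ((nrm g)%:E * hausdorff k (hull q `&` [set x | aff phi x = 0%R]))%E.
have h0 : (0 <= h)%E by rewrite mule_ge0 ?hausdorff_ge0 // lee_fin nrm_ge0.
have -> : slice_mass phi P = h by rewrite /slice_mass big_seq1.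
apply: (@le_trans _ _ (\sum_(p <- (boundary C2 : chain R G d k)) h)%E).
  rewrite big_seq [leRHS]big_seq; apply: lee_sum => e /allpairsPdep[p [i [pC _ ->]]] /=.
  move: pC => /mapP[u]; rewrite mem_filter => /andP[/= nuA us] -> /=.
  have [uf uq] := s1 _ us.
  rewrite (_ : nrm _ = nrm g); last first.
    have -> : coefficient P u = if `[< same_orientation q u >] then g else - g.
      by rewrite coef_single asboolT.
    by case: ifP => _; rewrite ?(nrmN nrmP) (nrm_sign nrmP).
  apply: lee_wpmul2l; first by rewrite lee_fin nrm_ge0.
  apply: le_hausdorff => x [/(hull_row' _ _ uf)[ux _] /= xA]; split; first exact: uq.
  have u0 : 0 <= aff phi (bary u).
    by rewrite leNgt; apply: contra nuA => /ltW ?; apply/asboolP.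
  by apply/eqP; rewrite eq_le xA; apply: aff_hull_ge0 ux; apply: bary_ge0 => //; exact: sd.
have -> : (\sum_(p <- (boundary C2 : chain R G d k)) h)%E =
    (((size C2) * k.+2)%:R%:E * h)%E.
  rewrite big_const_seq count_predT iter_addr_0 size_allpairs -cardE card_ord.
  by rewrite mule_natl.
apply: lee_wpmul2r => //; rewrite lee_fin ler_nat mulnC leq_mul //.
by rewrite size_map size_filter (leq_trans (count_size _ _)).
Qed.

Lemma commutator phi Q : nondeg Q -> let A := [set x : 'rV[R]_d | aff phi x <= 0] in
  exists Q', [/\ nondeg Q', forall K, chain_in K Q -> chain_in K Q', is_restr A Q Q' &
    ((M (chain_sub (rs A (boundary Q : chain R G d k)) (boundary Q')))%:E
       <= cut_count%:E * slice_mass phi Q)%E].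
Proof.
move=> Qf A; have pA : polyset A by exact: polyset_halfspace.
elim: Q Qf => [|[g q] Q IH] Qf.
  exists [::]; split=> //; first by apply: evtT => t; rewrite !coef_nil if_same.
  rewrite /slice_mass big_nil mule0 lee_fin le_eqVlt; apply/orP; left; apply/eqP.
  have b0 : nondeg (boundary ([::] : chain R G d k.+1) : chain R G d k) by [].
  have -> : 0 = M ([::] : chain R G d k) by rewrite M_nil.
  apply: (M_eqv nrmP) => //.
    by apply: nondeg_sub => //; exact: rs_nondeg.
  by apply: evt_mono (rs_coef b0 pA) => t _; rewrite coef_sub => ->; rewrite !coef_nil if_same subrr.
have qf : affinely_independent q by apply: (Qf (g, q)); rewrite mem_head.
have [Q1 [Q1f Q1K Q1A Q1M]] := commutator1 phi g qf.
have Q0f : nondeg Q by move=> p pQ; apply: Qf; rewrite inE pQ orbT.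
have [Q2 [Q2f Q2K Q2A Q2M]] := IH Q0f.
have P1f : nondeg [:: (g, q)] by move=> p; rewrite inE => /eqP ->.
exists (Q1 ++ Q2); split; first exact: nondeg_cat.
- move=> K QK p; rewrite mem_cat => /orP[]; [apply: Q1K|apply: Q2K] => p' p'Q; apply: QK.
    by rewrite inE -mem_seq1 p'Q.
  by rewrite inE p'Q orbT.
- apply: evt_mono (evtI Q1A Q2A) => t _ [E1 E2]; rewrite coef_cat E1 E2 [in RHS]coefficient_cons.
  by case: ifP => _ //; rewrite addr0.
rewrite /slice_mass big_cons -/(slice_mass phi Q) muleDr //; last first.
  by apply: ge0_adde_def; rewrite inE ?slice_mass_ge0 // mule_ge0 ?hausdorff_ge0 // lee_fin nrm_ge0.
rewrite (_ : ((nrm _)%:E * _)%E = slice_mass phi [:: (g, q)]); last by rewrite /slice_mass big_seq1.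
apply: le_trans (leeD Q1M Q2M); rewrite -EFinD lee_fin.
have b1 : nondeg (boundary [:: (g, q)] : chain R G d k) by exact: nondeg_boundary.
have b2 : nondeg (boundary Q : chain R G d k) by exact: nondeg_boundary.
have b3 : nondeg (boundary ((g, q) :: Q) : chain R G d k) by exact: nondeg_boundary.
have bQ1 : nondeg (boundary Q1 : chain R G d k) by exact: nondeg_boundary.
have bQ2 : nondeg (boundary Q2 : chain R G d k) by exact: nondeg_boundary.
have sf (X Y : chain R G d k) : nondeg X -> nondeg Y -> nondeg (chain_sub (rs A X) Y).
  by move=> Xf Yf; apply: nondeg_sub => //; exact: rs_nondeg.
rewrite -/(cat [:: (g, q)] Q) in b3 *.
apply: le_trans (M_cat nrmP (sf _ _ b1 bQ1) (sf _ _ b2 bQ2)).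
have -> : M (chain_sub (rs A (boundary ((g, q) :: Q) : chain R G d k)) (boundary (Q1 ++ Q2))) =
  M (chain_sub (rs A (boundary [:: (g, q)] : chain R G d k)) (boundary Q1) ++
     chain_sub (rs A (boundary Q : chain R G d k)) (boundary Q2)) => //.
apply: (M_eqv nrmP).
- by apply: sf => //; rewrite boundary_cat; exact: nondeg_cat.
- by apply: nondeg_cat; exact: sf.
apply: evt_mono (evtI (rs_coef b3 pA) (evtI (rs_coef b1 pA) (rs_coef b2 pA))).
move=> t _ [E3 [E1 E2]]; rewrite coef_cat !coef_sub E1 E2 boundary_cat coef_cat E3.
rewrite boundary_cat coef_cat.
by case: ifP => _; rewrite ?sub0r ?opprD // addrACA.
Qed.
End Commutator.
End Restriction.

(** * The flat norm *)

Section Polyhedral.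
Variables (R : realType) (G : zmodType) (d k : nat) (K : set 'rV[R]_d).
Implicit Types (P Q : chain R G d k).
Local Notation poly := (@polyhedral R G d k K).

Lemma polyhedral_nondeg P : poly P -> nondeg P.
Proof. by move=> /polyhedralE[]. Qed.

Lemma polyhedral_cat P Q : poly P -> poly Q -> poly (P ++ Q).
Proof. by move=> PK QK p; rewrite mem_cat => /orP[/PK|/QK]. Qed.

Lemma polyhedral_opp P : poly P -> poly (chain_opp P).
Proof. by move=> PK _ /mapP[p /PK h ->]. Qed.

Lemma polyhedral_sub P Q : poly P -> poly Q -> poly (chain_sub P Q).
Proof. by move=> PK QK; apply: polyhedral_cat => //; exact: polyhedral_opp. Qed.

End Polyhedral.

Section FlatNorm.
Variables (R : realType) (G : zmodType) (d : nat).
Variables (nrm : G -> R) (nrmP : group_norm nrm).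
Variable (K : set 'rV[R]_d).
Local Notation M := (M nrm).

Let nd k (P : chain R G d k) : polyhedral K P -> nondeg P.
Proof. exact: polyhedral_nondeg. Qed.

Let M0 k : M ([::] : chain R G d k) = 0.
Proof. exact: M_nil. Qed.

Section Dimension.
Variable k : nat.
Implicit Types (P Q : chain R G d k).
Local Notation poly := (@polyhedral R G d k K).

Lemma polyhedral_boundary (Q : chain R G d k.+1) :
  polyhedral K Q -> poly (boundary Q).
Proof.
move=> QK e /allpairsPdep[p [i [/QK[pf pK] _ ->]]] /=; split; first exact: row'_free.
exact: subset_trans (hull_row'_sub (i := i) pf) pK.
Qed.

Definition Fl P : R := fine (flat nrm K P).

Lemma flat_ge0 P : poly P -> (0 <= flat nrm K P)%E.
Proof.
move=> PK; apply: le_ereal_inf_tmp => _ [Q /= QK <-].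
have h := polyhedral_sub PK (polyhedral_boundary QK).
rewrite !(ME nrmP); [|exact: nd..].
by rewrite lee_fin addr_ge0 // (M_ge0 nrmP) //; exact: nd.
Qed.

Lemma flat_le P (Q : chain R G d k.+1) : poly P -> polyhedral K Q ->
  (flat nrm K P <= (M Q + M (chain_sub P (boundary Q)))%:E)%E.
Proof.
move=> PK QK; have h := polyhedral_sub PK (polyhedral_boundary QK).
rewrite EFinD -!(ME nrmP); [|exact: nd..].
by apply: ereal_inf_lbound; exists Q.
Qed.

Lemma flatE P : poly P -> flat nrm K P = (Fl P)%:E.
Proof.
move=> PK; rewrite /Fl fineK // ge0_fin_numE ?flat_ge0 //.
by apply: le_lt_trans (flat_le PK (Q := [::]) _) (ltry _) => p.
Qed.

Lemma Fl_ge0 P : poly P -> 0 <= Fl P.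
Proof. by move=> PK; rewrite -lee_fin -flatE ?flat_ge0. Qed.

Lemma Fl_le P (Q : chain R G d k.+1) : poly P -> polyhedral K Q ->
  Fl P <= M Q + M (chain_sub P (boundary Q)).
Proof. by move=> PK QK; rewrite -lee_fin -flatE ?flat_le. Qed.

Lemma Fl_lt P (e : R) : poly P -> Fl P < e ->
  exists2 Q : chain R G d k.+1, polyhedral K Q & M Q + M (chain_sub P (boundary Q)) < e.
Proof.
move=> PK; rewrite -lte_fin -flatE // => /ereal_inf_lt[_ [Q /= QK <-]] lt.
exists Q => //; move: lt; have h := polyhedral_sub PK (polyhedral_boundary QK).
by rewrite !(ME nrmP); [rewrite -EFinD lte_fin|exact: nd..].
Qed.

Lemma Fl_le_M P : poly P -> Fl P <= M P.
Proof.
move=> PK; have Pf := nd PK.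
have nilK : polyhedral K ([::] : chain R G d k.+1) by [].
apply: le_trans (Fl_le PK nilK) _.
rewrite M0 add0r le_eqVlt; apply/orP; left; apply/eqP.
apply: (M_eqv nrmP) => //; first by apply: nondeg_sub.
by apply: evtT => t; rewrite coef_sub /= coef_nil subr0.
Qed.

(** Stated through coefficients so as to give at once the triangle inequality for [dF] and the
    invariance of [Fl] under [eqv]. *)
Lemma Fl_add P P1 P2 : poly P -> poly P1 -> poly P2 ->
  evt (fun t => coefficient P t = coefficient P1 t + coefficient P2 t) ->
  Fl P <= Fl P1 + Fl P2.
Proof.
move=> PK P1K P2K E; apply/ler_addgt0Pr => e e0.
have e2 : 0 < e / 2 by rewrite divr_gt0.
have [|Q1 Q1K l1] := @Fl_lt P1 (Fl P1 + e / 2) P1K; first by rewrite ltrDl.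
have [|Q2 Q2K l2] := @Fl_lt P2 (Fl P2 + e / 2) P2K; first by rewrite ltrDl.
have QK := polyhedral_cat P1K P2K.
have Q12K : polyhedral K (Q1 ++ Q2) by move=> p; rewrite mem_cat => /orP[/Q1K|/Q2K].
have b1 := polyhedral_boundary Q1K; have b2 := polyhedral_boundary Q2K.
apply: le_trans (Fl_le PK Q12K) _.
have m1 : M (Q1 ++ Q2) <= M Q1 + M Q2.
  by apply: (M_cat nrmP); [move=> p /Q1K[]|move=> p /Q2K[]].
have m2 : M (chain_sub P (boundary (Q1 ++ Q2))) <=
    M (chain_sub P1 (boundary Q1)) + M (chain_sub P2 (boundary Q2)).
  apply: (M_le2 nrmP).
  - exact: nd (polyhedral_sub PK (polyhedral_boundary Q12K)).
  - by apply: nd; exact: polyhedral_sub.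
  - by apply: nd; exact: polyhedral_sub.
  apply: evt_mono E => t _ E; rewrite !coef_sub boundary_cat coef_cat E.
  by rewrite opprD addrACA; exact: nrmD.
lra.
Qed.

Lemma Fl_eqv P P1 : poly P -> poly P1 -> eqv P P1 -> Fl P = Fl P1.
Proof.
have Fl0 : Fl [::] = 0.
  apply/eqP; rewrite eq_le Fl_ge0 // andbT.
  by apply: le_trans (Fl_le_M _) _ => //; rewrite M0.
move=> PK P1K E; apply/eqP; rewrite eq_le; apply/andP; split.
  rewrite -[leRHS]addr0 -Fl0; apply: Fl_add => //.
  by apply: evt_mono E => t _ ->; rewrite coef_nil addr0.
rewrite -[leRHS]addr0 -Fl0; apply: Fl_add => //.
by apply: evt_mono E => t _ ->; rewrite coef_nil addr0.
Qed.

Lemma Fl_opp P P1 : poly P -> poly P1 ->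
  evt (fun t => coefficient P t = - coefficient P1 t) -> Fl P <= Fl P1.
Proof.
move=> PK P1K E; apply/ler_addgt0Pr => e e0.
have [|Q QK lt] := @Fl_lt P1 (Fl P1 + e) P1K; first by rewrite ltrDl.
have oK : polyhedral K (chain_sub [::] Q) by move=> p /mapP[q /QK h ->].
apply/ltW; apply: le_lt_trans lt; apply: le_trans (Fl_le PK oK) _.
apply: lerD; first by rewrite (M_opp nrmP) // => p /QK[].
apply: (M_le nrmP).
- exact: nd (polyhedral_sub PK (polyhedral_boundary oK)).
- exact: nd (polyhedral_sub P1K (polyhedral_boundary QK)).
apply: evt_mono E => t _ E; rewrite !coef_sub coef_boundary_sub E /= coef_nil sub0r.
by rewrite -opprD (nrmN nrmP).
Qed.

Definition dF P Q : R := Fl (chain_sub P Q).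

Lemma dF_ge0 P Q : poly P -> poly Q -> 0 <= dF P Q.
Proof. by move=> PK QK; apply: Fl_ge0; exact: polyhedral_sub. Qed.

Lemma dF_sym P Q : poly P -> poly Q -> dF P Q = dF Q P.
Proof.
move=> PK QK; apply/eqP; rewrite eq_le; apply/andP; split; apply: Fl_opp;
  try exact: polyhedral_sub; by apply: evtT => t; rewrite !coef_sub opprB.
Qed.

Lemma dF_tri Q P P' : poly P -> poly Q -> poly P' -> dF P P' <= dF P Q + dF Q P'.
Proof.
move=> PK QK P'K; apply: Fl_add; try exact: polyhedral_sub.
by apply: evtT => t; rewrite !coef_sub addrA subrK.
Qed.

Lemma dF_le_M P Q : poly P -> poly Q -> dF P Q <= M (chain_sub P Q).
Proof. by move=> PK QK; apply: Fl_le_M; exact: polyhedral_sub. Qed.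

Lemma dF_eqv0 P Q : poly P -> poly Q -> eqv P Q -> dF P Q = 0.
Proof.
move=> PK QK E; apply/eqP; rewrite eq_le dF_ge0 // andbT.
apply: le_trans (dF_le_M PK QK) _; rewrite -(M0 k) le_eqVlt; apply/orP; left; apply/eqP.
apply: (M_eqv nrmP) => //; first by apply: nd; exact: polyhedral_sub.
by apply: evt_mono E => t _ E; rewrite coef_sub E subrr coef_nil.
Qed.

Lemma dFxx P : poly P -> dF P P = 0.
Proof. by move=> PK; apply: dF_eqv0 => //; exact: evtT. Qed.

Implicit Types (T S : nat -> chain R G d k).

Definition fcauchy T : Prop := (forall n, poly (T n)) /\
  forall e : R, 0 < e -> exists N, forall m n, (N <= m)%N -> (N <= n)%N ->
    dF (T m) (T n) < e.

Lemma flat_chainE T : flat_chain nrm K T <-> fcauchy T.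
Proof.
split=> -[TK h]; split=> // e /h[N hN]; exists N => m n Nm Nn; have := hN _ _ Nm Nn;
  rewrite flatE ?lte_fin //; exact: polyhedral_sub.
Qed.

Definition fclose T S : Prop :=
  forall e : R, 0 < e -> exists N, forall n, (N <= n)%N -> dF (T n) (S n) < e.

Lemma fclose_sym T S : (forall n, poly (T n)) -> (forall n, poly (S n)) ->
  fclose T S -> fclose S T.
Proof.
by move=> TK SK h e /h[N hN]; exists N => n /hN; rewrite dF_sym.
Qed.

Lemma fclose_trans S T T' : (forall n, poly (T n)) -> (forall n, poly (S n)) ->
  (forall n, poly (T' n)) -> fclose T S -> fclose S T' -> fclose T T'.
Proof.
move=> TK SK T'K h h' e e0; have e2 : 0 < e / 2 by rewrite divr_gt0.
have [N1 h1] := h _ e2; have [N2 h2] := h' _ e2; exists (maxn N1 N2) => n.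
rewrite geq_max => /andP[/h1 {}h1 /h2 {}h2].
by apply: le_lt_trans (dF_tri (TK n) (SK n) (T'K n)) _; lra.
Qed.

Lemma fclose_eqv T S : (forall n, poly (T n)) -> (forall n, poly (S n)) ->
  (forall n, eqv (T n) (S n)) -> fclose T S.
Proof. by move=> TK SK E e e0; exists 0%N => n _; rewrite dF_eqv0. Qed.

Lemma fclose_cauchy T S : fcauchy T -> (forall n, poly (S n)) -> fclose S T -> fcauchy S.
Proof.
move=> [TK h] SK h'; split => // e e0; have e3 : 0 < e / 3 by rewrite divr_gt0.
have [N1 h1] := h _ e3; have [N2 h2] := h' _ e3; exists (maxn N1 N2) => m n.
rewrite !geq_max => /andP[m1 m2] /andP[n1 n2].
have := dF_tri (SK m) (TK m) (SK n); have := dF_tri (TK m) (TK n) (SK n).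
have := h1 _ _ m1 n1; have := h2 _ m2; have := h2 _ n2; rewrite (dF_sym (SK n)) //; lra.
Qed.

Lemma cvg_EFin0 (u : nat -> R) : (forall n, 0 <= u n) ->
  (fun n => (u n)%:E) @ \oo --> 0%E <->
  forall e, 0 < e -> exists N, forall n, (N <= n)%N -> u n < e.
Proof.
move=> u0; split.
  move=> /fine_cvgP[_ /cvgrPdist_lt h] e e0; have [N _ hN] := h _ e0.
  exists N => n Nn; have := hN n Nn; rewrite /= sub0r normrN ger0_norm //.
move=> h; apply/fine_cvgP; split; first by apply: nearW.
apply/cvgrPdist_lt => e /h[N hN]; exists N => // n /= Nn.
by rewrite sub0r normrN ger0_norm //; exact: hN.
Qed.

Lemma flat_eqE T S : (forall n, poly (T n)) -> (forall n, poly (S n)) ->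
  flat_eq nrm K T S <-> fclose T S.
Proof.
move=> TK SK; rewrite /flat_eq.
rewrite (_ : (fun m => _) = fun m => (dF (T m) (S m))%:E).
  by apply: cvg_EFin0 => n; exact: dF_ge0.
by apply/funext => m; rewrite flatE //; exact: polyhedral_sub.
Qed.

Lemma flat_normE P T : poly P -> fcauchy T -> exists l : R,
  flat_norm nrm K (flat_sub (fun=> P) T) = l%:E /\
  forall e N, (forall m n, (N <= m)%N -> (N <= n)%N -> dF (T m) (T n) < e) ->
    forall m, (N <= m)%N -> `|l - dF P (T m)| <= e.
Proof.
move=> PK [TK TC]; pose u m := dF P (T m).
have uT m n : `|u m - u n| <= dF (T m) (T n).
  rewrite ler_norml; have := dF_tri PK (TK m) (TK n); have := dF_tri PK (TK n) (TK m).
  rewrite (dF_sym (TK n)) // /u; lra.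
have cu : cvg (u @ \oo).
  apply/cauchy_cvgP/cauchy_exP => e e0; have [N hN] := TC _ e0.
  exists (u N); exists N => // n /= Nn; rewrite /ball /= (le_lt_trans (uT _ _)) //.
  exact: hN.
exists (lim (u @ \oo)); split.
  rewrite /flat_norm (_ : (fun m => _) = EFin \o u); first by rewrite EFin_lim.
  by apply/funext => m /=; rewrite /flat_sub flatE //; exact: polyhedral_sub.
move=> e N hN m Nm.
have : (fun n => `|u n - u m|) @ \oo --> `|lim (u @ \oo) - u m|.
  by apply: cvg_norm; apply: cvgB => //; exact: cvg_cst.
move=> /cvg_lim <- //; apply: limr_le.
  apply/cvg_ex; eexists; apply: cvg_norm; apply: cvgB; [exact: cu|exact: cvg_cst].
by exists N => // n /= Nn; rewrite (le_trans (uT _ _)) // ltW // hN.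
Qed.

Lemma flat_cvgE (P T : nat -> chain R G d k) : (forall n, poly (P n)) -> fcauchy T ->
  flat_cvg nrm K P T <-> fclose P T.
Proof.
move=> PK TC; rewrite /flat_cvg; have [TK hT] := TC.
have [l lP] := choice (fun n => flat_normE (PK n) TC).
have l0 n : 0 <= l n.
  rewrite leNgt; apply/negP => ln.
  have [_ h] := lP n; have [|N hN] := hT (- l n / 2); first by lra.
  by have := h _ _ hN N (leqnn _); have := dF_ge0 (PK n) (TK N); rewrite ler_norml; lra.
rewrite (_ : (fun n => _) = fun n => (l n)%:E); last by apply/funext => n; case: (lP n).
split=> [/(cvg_EFin0 l0) h|h]; [|apply/(cvg_EFin0 l0)] => e e0;
  have e2 : 0 < e / 2 by [rewrite divr_gt0|rewrite divr_gt0];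
  have [N1 h1] := h _ e2; have [N2 h2] := hT _ e2; exists (maxn N1 N2) => n;
  rewrite geq_max => /andP[/h1 {}h1 n2]; have [_ /(_ _ _ h2 n n2)] := lP n;
  rewrite ler_norml; lra.
Qed.

(** Closeness of [P] to the flat chain represented by [T], without passing to the limit in the flat
    norm. *)
Definition fnear P T (e : R) : Prop := exists N, forall j, (N <= j)%N -> dF P (T j) < e.

Lemma flat_mass_le T (c : R) : fcauchy T ->
  (forall e, 0 < e -> exists P, [/\ poly P, M P < c + e & fnear P T e]) ->
  (flat_mass nrm K T <= c%:E)%E.
Proof.
move=> TC h; have [TK hT] := TC; apply/lee_addgt0Pr => e e0.
(* The bound [e] controls all the masses, the bound 1 / (n + 1) makes the sequence converge to
   [T]. *)
have hn n : exists P, [/\ poly P, M P < c + Num.min e n.+1%:R^-1 &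
    fnear P T (Num.min e n.+1%:R^-1)].
  by apply: h; rewrite lt_min e0 invr_gt0 ltr0n.
have [P hP] := choice hn.
have PK n : poly (P n) by case: (hP n).
apply: (@le_trans _ _ (limn_einf (fun n => mass nrm (P n)))).
  apply: ereal_inf_lbound; exists P => //; split => //; apply/flat_cvgE => // e' e'0.
  have e2 : 0 < e' / 2 by rewrite divr_gt0.
  have [N1 h1] := hT _ e2.
  have [N2 _ h2] := near_infty_natSinv_lt (PosNum e2).
  exists (maxn N1 N2) => n; rewrite geq_max => /andP[n1 n2].
  have [_ _ [j0 hj]] := hP n; pose j := maxn j0 n.
  have := hj j (leq_maxl _ _); rewrite lt_min => /andP[_ l1].
  have l2 := h1 j n (leq_trans n1 (leq_maxr _ _)) n1.
  have := dF_tri (PK n) (TK j) (TK n); have l3 : n.+1%:R^-1 < e' / 2 := h2 n n2; by move: l1 l3; set z := n.+1%:R^-1; lra.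
apply: limn_einf_le_cst => n; rewrite (ME nrmP); last exact: nd.
have [_ + _] := hP n; rewrite lee_fin => /ltW/le_trans; apply.
by rewrite lerD2l ge_min lexx.
Qed.

Lemma flat_mass_ge0 T : (0 <= flat_mass nrm K T)%E.
Proof.
apply: le_ereal_inf_tmp => _ [P [PK _] <-].
apply: (@le_limn_einf_tail _ _ _ 0%N) => n _.
rewrite (ME nrmP); last exact: nd.
by rewrite lee_fin (M_ge0 nrmP) //; exact: nd.
Qed.

Lemma flat_mass_approx T (c : R) : fcauchy T -> (flat_mass nrm K T <= c%:E)%E ->
  forall e, 0 < e -> exists P, [/\ poly P, M P < c + e & fnear P T e].
Proof.
move=> TC le e e0; have [TK hT] := TC.
have : (flat_mass nrm K T < (c + e)%:E)%E by rewrite (le_lt_trans le) // lte_fin ltrDl.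
move=> /ereal_inf_lt[_ [P [PK PT] <-]] lt.
have {}PT : fclose P T by apply/flat_cvgE.
have e2 : 0 < e / 2 by rewrite divr_gt0.
have [N1 h1] := PT _ e2; have [N2 h2] := hT _ e2; pose N := maxn N1 N2.
have [n Nn Mn] : exists2 n, (N <= n)%N & M (P n) < c + e.
  apply: contrapT => no; move: lt; apply/negP; rewrite -leNgt.
  apply: (@le_limn_einf_tail _ _ _ N) => n Nn.
  rewrite (ME nrmP); last exact: nd.
  by rewrite lee_fin leNgt; apply/negP => Mn; apply: no; exists n.
move: Nn; rewrite geq_max => /andP[n1 n2].
exists (P n); split=> //; exists N2 => j jN.
have := dF_tri (PK n) (TK n) (TK j); have := h1 _ n1; have := h2 _ _ n2 jN; lra.
Qed.

(** Lower semicontinuity of mass: cheaper chains arbitrarily near [T] would lower the relaxed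
    mass. *)
Lemma flat_mass_lsc T (m : R) : fcauchy T -> flat_mass nrm K T = m%:E ->
  forall e, 0 < e -> exists2 de, 0 < de &
    forall P, poly P -> fnear P T de -> m - e < M P.
Proof.
move=> TC Tm e e0; apply: contrapT => no.
suff : (flat_mass nrm K T <= (m - e)%:E)%E by rewrite Tm lee_fin; lra.
apply: flat_mass_le => // de de0.
apply: contrapT => no'; apply: no; exists de => // P PK PT.
rewrite ltNge; apply/negP => MP; apply: no'; exists P; split => //; lra.
Qed.

Lemma nearT_close P S T (e e' : R) : poly P -> (forall n, poly (S n)) -> (forall n, poly (T n)) ->
  fclose S T -> fnear P S e -> e < e' -> fnear P T e'.
Proof.
move=> PK SK TK ST [N hN] ee'; have [|N' hN'] := ST (e' - e); first by lra.
exists (maxn N N') => j; rewrite geq_max => /andP[/hN h1 /hN' h2].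
have := dF_tri PK (SK j) (TK j); lra.
Qed.

Lemma cauchy_nearT T (e : R) : fcauchy T -> 0 < e ->
  exists N, forall n, (N <= n)%N -> fnear (T n) T e.
Proof. by move=> [_ h] /h[N hN]; exists N => n Nn; exists N => j; exact: hN. Qed.

End Dimension.

End FlatNorm.

(** * Slicing *)

Section Slicing.
Variables (R : realType) (G : zmodType) (d : nat).
Variables (nrm : G -> R) (nrmP : group_norm nrm).
Variable (K : set 'rV[R]_d) (k : nat).
Local Notation M := (M nrm).
Local Notation poly := (@polyhedral R G d k K).
Local Notation dF := (dF nrm K).
Local Notation Fl := (Fl nrm K).
Local Notation fcauchy := (fcauchy nrm K).
Local Notation fclose := (fclose nrm K).
Implicit Types (P Q W : chain R G d k) (X Y T : nat -> chain R G d k).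
Implicit Types (A B : set 'rV[R]_d) (i : 'I_d) (b : bool) (s : R).

Let nd m (P : chain R G d m) : polyhedral K P -> nondeg P.
Proof. exact: polyhedral_nondeg. Qed.

Definition hs b i s : 'cV[R]_(d + 1) := if b then coordf i s else - coordf i s.

Definition HS b i s : set 'rV[R]_d := [set x | aff (hs b i s) x <= 0].

Lemma HSE b i s : HS b i s =
  if b then [set x | x ord0 i <= s] else [set x | s <= x ord0 i].
Proof.
by case: b; apply/seteqP; split => x; rewrite /HS /hs /= ?affN coordfE ?oppr_le0 ?subr_le0 ?subr_ge0.
Qed.

Lemma polyset_HS b i s : polyset (HS b i s).
Proof. exact: polyset_halfspace. Qed.

Definition slab i s (de : R) : set 'rV[R]_d := [set x | s - de <= x ord0 i <= s + de].

Lemma polyset_slab i s de : polyset (slab i s de).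
Proof.
rewrite (_ : slab i s de = HS true i (s + de) `&` HS false i (s - de)).
  by apply: polysetI; exact: polyset_HS.
by rewrite !HSE; apply/seteqP; split => x /=; [move=> /andP[]|move=> [h1 h2]; apply/andP].
Qed.

Hint Resolve polyset_HS polyset_slab : core.

Definition slice_cst : R := cut_count R k * eilenberg_cst R k.

Lemma slice_cst_ge0 : 0 <= slice_cst.
Proof. by rewrite mulr_ge0 ?ler0n // ltW // eilenberg_cst_gt0. Qed.

(** Write [P] as a remainder plus the boundary of some [Q], of small total mass. At a level where
    the slice of [Q] is small, restricting [Q] and restricting its boundary differ by little, so the
    restriction of [P] has small flat norm as well. *)
Lemma slice_flat b i P (eta u v : R) : poly P -> Fl P < eta -> u < v ->
  exists2 s, u < s < v & Fl (rs (HS b i s) P) <= eta * (1 + slice_cst / (v - u)).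
Proof.
move=> PK Peta uv; have [Q QK lt] := Fl_lt nrmP PK Peta.
(* [slice_mass] is a sum over the listed simplexes, so [Q] is rewritten without overlaps to make
   such sums comparable with its mass. *)
have Qf := nd QK; have [Q1 [Q1f Q1K QQ1 MQ]] := nonoverlapping_chain nrmP Qf.
have {}Q1K : polyhedral K Q1.
  by apply/polyhedralE; split => //; apply: Q1K; have /polyhedralE[] := QK.
have MQ1 : M Q1 = M Q by apply/esym/(M_eqv nrmP).
have bQ := polyhedral_boundary QK; have bQ1 := polyhedral_boundary Q1K.
have MR : M (chain_sub P (boundary Q1)) = M (chain_sub P (boundary Q)).
  apply: (M_eqv nrmP); try by apply: nd; exact: polyhedral_sub.
  by apply: evt_mono (eqv_boundary Qf Q1f QQ1) => t _; rewrite !coef_sub => ->.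
have R0 : 0 <= M (chain_sub P (boundary Q)).
  by apply: (M_ge0 nrmP); apply: nd; exact: polyhedral_sub.
have Q0 : 0 <= M Q by exact: (M_ge0 nrmP).
pose e := eta - M Q - M (chain_sub P (boundary Q)).
have e0 : 0 < e by rewrite /e; lra.
have HM : (\sum_(q <- Q1) (nrm q.1)%:E * hausdorff k.+1 (hull q.2) <= (M Q)%:E)%E.
  by rewrite MQ -sumEFin; apply: lee_sum => q _; rewrite EFinM volE.
have [s [uvs _ Hs]] := @exists_slice R d k i _ Q1 (fun q => nrm q.1) (fun q => hull q.2)
  (M Q) e u v set0 (fun q => nrm_ge0 nrmP q.1) (fun q => hausdorff_hull_fin q.2)
  HM e0 uv (countable0 _).
exists s => //; pose phi := hs b i s.
have [Q' [Q'f Q'K Q'A Q'M]] := commutator nrmP phi Q1f.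
have {}Q'K : polyhedral K Q'.
  by apply/polyhedralE; split => //; apply: Q'K; have /polyhedralE[] := Q1K.
have pA := polyset_HS b i s; set A := HS b i s in pA *.
have rK := rs_polyhedral PK pA; have bQ' := polyhedral_boundary Q'K.
apply: le_trans (Fl_le nrmP rK Q'K) _.
have m1 : M Q' <= M Q.
  rewrite -MQ1; apply: (M_le nrmP) => //; apply: evt_mono Q'A => t _ ->.
  by case: ifP => // _; rewrite (nrm0 nrmP) nrm_ge0.
have rb := rs_polyhedral bQ1 pA; have sK := polyhedral_sub PK bQ1.
have m2 : M (chain_sub (rs A P) (boundary Q')) <=
    M (rs A (chain_sub P (boundary Q1))) +
    M (chain_sub (rs A (boundary Q1 : chain R G d k)) (boundary Q')).
  apply: (M_le2 nrmP).
  - by apply: nd; exact: polyhedral_sub.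
  - by apply: nd; exact: rs_polyhedral.
  - by apply: nd; exact: polyhedral_sub.
  apply: evt_mono (evtI (rs_coef (nd PK) pA) (evtI (rs_coef (nd sK) pA) (rs_coef (nd bQ1) pA))).
  move=> t _ [E1 [E2 E3]]; rewrite !coef_sub E1 E2 E3 coef_sub.
  set x := coefficient P t; set y := coefficient (boundary Q1) t; set z := coefficient _ t.
  case: ifP => _; last by rewrite !sub0r (nrm0 nrmP) add0r.
  by rewrite -[x - z](subrKA y); exact: nrmD.
have m3 : M (rs A (chain_sub P (boundary Q1))) <= M (chain_sub P (boundary Q)).
  by rewrite -MR; apply: M_rs_le => //; exact: nd.
have m4 : M (chain_sub (rs A (boundary Q1 : chain R G d k)) (boundary Q')) <=
    cut_count R k * (eilenberg_cst R k * eta / (v - u)).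
  rewrite -lee_fin; apply: le_trans Q'M _; rewrite EFinM.
  apply: lee_wpmul2l; first by rewrite lee_fin ler0n.
  apply: le_trans (le_trans _ Hs) _.
    rewrite /slice_mass; apply: lee_sum => q _; apply: lee_wpmul2l.
      by rewrite lee_fin nrm_ge0.
    apply: le_hausdorff => x [hx /eqP]; rewrite /phi /hs /= => x0; split => //=.
    apply/eqP; move: x0; case: (b); rewrite ?affN coordfE ?oppr_eq0 subr_eq0 //.
  rewrite lee_fin ler_wpM2r ?invr_ge0 ?subr_ge0 ?(ltW uv) //.
  rewrite ler_wpM2l ?(ltW (eilenberg_cst_gt0 _ _)) //; rewrite /e; lra.
rewrite mulrDr mulr1 /slice_cst.
have -> : eta * (cut_count R k * eilenberg_cst R k / (v - u)) =
    cut_count R k * (eilenberg_cst R k * eta / (v - u)) by ring.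
lra.
Qed.

Lemma M_rs_diff A B S W : nondeg W -> polyset A -> polyset B -> polyset S ->
  (forall x, ~ S x -> A x <-> B x) ->
  M (chain_sub (rs A W) (rs B W)) <= M (rs S W).
Proof.
move=> Wf pA pB pS AB; apply: (M_le nrmP).
- by apply: nondeg_sub; exact: rs_nondeg.
- exact: rs_nondeg.
apply: evt_mono (evtI (rs_coef Wf pA) (evtI (rs_coef Wf pB) (rs_coef Wf pS))).
move=> t _ [E1 [E2 E3]]; rewrite coef_sub E1 E2 E3.
have [St|/AB ab] := pselect (S (bary t)).
  rewrite (asboolT St); case: ifP => _; case: ifP => _; rewrite ?subr0 ?sub0r ?subrr ?(nrmN nrmP) //;
    by rewrite (nrm0 nrmP) nrm_ge0.
by rewrite (asbool_equiv_eq ab) subrr (nrm0 nrmP) nrm_ge0.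
Qed.

Lemma M_rs_sub S P Q : nondeg P -> nondeg Q -> polyset S ->
  M (rs S (chain_sub P Q)) <= M (rs S P) + M (rs S Q).
Proof.
move=> Pf Qf pS; have sf := nondeg_sub Pf Qf.
apply: (M_le2 nrmP); try exact: rs_nondeg.
apply: evt_mono (evtI (rs_coef sf pS) (evtI (rs_coef Pf pS) (rs_coef Qf pS))).
move=> t _ [-> [-> ->]]; rewrite coef_sub; case: ifP => _.
  by rewrite -(nrmN nrmP (coefficient Q t)); exact: nrmD.
by rewrite (nrm0 nrmP) addr0.
Qed.

Lemma rs_sub_eqv A P Q : nondeg P -> nondeg Q -> polyset A ->
  eqv (rs A (chain_sub P Q)) (chain_sub (rs A P) (rs A Q)).
Proof.
move=> Pf Qf pA; have sf := nondeg_sub Pf Qf.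
apply: evt_mono (evtI (rs_coef sf pA) (evtI (rs_coef Pf pA) (rs_coef Qf pA))).
by move=> t _ [-> [E1 E2]]; rewrite !coef_sub E1 E2; case: ifP => _ //; rewrite subr0.
Qed.

Lemma rs_rs_eqv A B P : nondeg P -> polyset A -> polyset B ->
  eqv (rs A (rs B P)) (rs (A `&` B) P).
Proof.
move=> Pf pA pB; have Bf := rs_nondeg Pf pB; have pAB := polysetI pA pB.
apply: evt_mono (evtI (rs_coef Bf pA) (evtI (rs_coef Pf pB) (rs_coef Pf pAB))).
move=> t _ [-> [-> ->]]; rewrite /setI /= asbool_and.
by case: `[< A _ >].
Qed.

Lemma HS_slab b i s s' de : s < s' < s + de -> forall x, ~ slab i s de x ->
  HS b i s x <-> HS b i s' x.
Proof.
move=> /andP[s1 s2] x /negP; rewrite negb_and -!ltNge !HSE => h.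
by case: b => /=; split=> h'; case/orP: h => h; lra.
Qed.

(** The prescribed level [s] is replaced by a good one just above it; the two restrictions differ
    only inside the slab. *)
Lemma rs_halfspace_estimate b i s (de eta : R) P Q : poly P -> poly Q -> dF P Q < eta ->
  0 < de -> dF (rs (HS b i s) P) (rs (HS b i s) Q) <=
    eta * (1 + slice_cst / de) + (M (rs (slab i s de) P) + M (rs (slab i s de) Q)).
Proof.
move=> PK QK PQ de0; have WK := polyhedral_sub PK QK.
have [|s' /andP[s1 s2] l1] := slice_flat b i WK PQ (u := s) (v := s + de); first lra.
rewrite (_ : s + de - s = de) in l1; last by ring.
have pS := polyset_slab i s de; have Wf := nd WK; set W := chain_sub P Q in WK Wf l1 *.
have pA := polyset_HS b i s; have pB := polyset_HS b i s'.
have r1 := rs_polyhedral WK pA; have r2 := rs_polyhedral WK pB.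
have -> : dF (rs (HS b i s) P) (rs (HS b i s) Q) = Fl (rs (HS b i s) W).
  apply: (Fl_eqv nrmP) => //; first by apply: polyhedral_sub; exact: rs_polyhedral.
  by apply: evt_mono (rs_sub_eqv (nd PK) (nd QK) pA) => t _ ->.
have t1 : Fl (rs (HS b i s) W) <= Fl (rs (HS b i s') W) + dF (rs (HS b i s) W) (rs (HS b i s') W).
  apply: (Fl_add nrmP) => //; first exact: polyhedral_sub.
  by apply: evtT => t; rewrite coef_sub addrC subrK.
have t2 := dF_le_M nrmP r1 r2.
have t3 := M_rs_diff Wf pA pB pS (HS_slab b (introT andP (conj s1 s2))).
have t4 := M_rs_sub (nd PK) (nd QK) pS.
by apply: (le_trans t1); apply: lerD => //; exact: le_trans t2 (le_trans t3 t4).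
Qed.

(** The uniform form of the statement that the limit of [Y] has no mass on the hyperplane at level
    [s]. *)
Definition slabgood Y i s : Prop := forall e : R, 0 < e ->
  exists2 de, 0 < de & exists N, forall n, (N <= n)%N -> M (rs (slab i s de) (Y n)) <= e.

(** The width [de] is chosen first, for the slab terms, and then [eta] small against the factor that
    contains 1 / [de]. *)
Lemma rs_halfspace_uniform b i s (e : R) X Y : (forall n, poly (X n)) -> (forall n, poly (Y n)) ->
  slabgood X i s -> slabgood Y i s -> 0 < e ->
  exists2 eta : R, 0 < eta & exists N, forall m n, (N <= m)%N -> (N <= n)%N ->
    dF (X m) (Y n) < eta -> dF (rs (HS b i s) (X m)) (rs (HS b i s) (Y n)) < e.
Proof.
move=> XK YK gX gY e0; have e4 : 0 < e / 4 by rewrite divr_gt0.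
have [d1 d10 [N1 h1]] := gX _ e4; have [d2 d20 [N2 h2]] := gY _ e4.
pose de := Num.min d1 d2; have de0 : 0 < de by rewrite lt_min d10.
have sub d' : de <= d' -> slab i s de `<=` slab i s d'.
  by move=> le x /andP[x1 x2]; apply/andP; split; lra.
have c0 : 0 < 1 + slice_cst / de.
  by rewrite ltr_pwDl // divr_ge0 ?slice_cst_ge0 // ltW.
exists (e / 4 / (1 + slice_cst / de)); first by rewrite divr_gt0.
exists (maxn N1 N2) => m n; rewrite !geq_max => /andP[m1 _] /andP[_ n2] lt.
have := rs_halfspace_estimate b i s (XK m) (YK n) lt de0; rewrite divfK ?gt_eqF // => l.
have l1 : M (rs (slab i s de) (X m)) <= e / 4.
  by apply: le_trans (h1 _ m1); apply: M_rs_mono => //; [exact: nd|apply: sub; rewrite ge_min lexx].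
have l2 : M (rs (slab i s de) (Y n)) <= e / 4.
  by apply: le_trans (h2 _ n2); apply: M_rs_mono => //; [exact: nd|apply: sub; rewrite ge_min lexx orbT].
lra.
Qed.

Lemma rs_halfspace_close b i s X Y : (forall n, poly (X n)) -> (forall n, poly (Y n)) ->
  slabgood X i s -> slabgood Y i s -> fclose X Y ->
  fclose (fun n => rs (HS b i s) (X n)) (fun n => rs (HS b i s) (Y n)).
Proof.
move=> XK YK gX gY XY e e0.
have [eta eta0 [N hN]] := rs_halfspace_uniform b XK YK gX gY e0.
have [N' hN'] := XY _ eta0; exists (maxn N N') => n; rewrite geq_max => /andP[n1 n2].
by apply: hN => //; exact: hN'.
Qed.

Lemma rs_halfspace_cauchy b i s X : fcauchy X -> slabgood X i s ->
  fcauchy (fun n => rs (HS b i s) (X n)).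
Proof.
move=> [XK XC] gX; split=> [n|e e0]; first exact: rs_polyhedral.
have [eta eta0 [N hN]] := rs_halfspace_uniform b XK XK gX gX e0.
have [N' hN'] := XC _ eta0; exists (maxn N N') => m n.
rewrite !geq_max => /andP[m1 m2] /andP[n1 n2].
by apply: hN => //; exact: hN'.
Qed.

(** For a Cauchy sequence: the limit has mass [m] and the masses [M (X n)] tend to it. The first
    clause is lower semicontinuity, the second an upper bound. *)
Definition optimal X (m : R) : Prop :=
  (forall e, 0 < e -> exists2 de, 0 < de &
     forall P, poly P -> fnear nrm K P X de -> m - e < M P) /\
  (forall e, 0 < e -> exists N, forall n, (N <= n)%N -> M (X n) < m + e).

(** Gluing argument: [X p] below an intermediate level and [X n] above it form a chain near the
    limit, so its mass is almost at least [m]. Since [X n] has mass at most about [m], it cannot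
    have much more mass than [X p] below that level. *)
Lemma optimal_halfspace X (m : R) i s s' (e : R) : fcauchy X -> optimal X m ->
  s < s' -> 0 < e -> exists N, forall p n, (N <= p)%N -> (N <= n)%N ->
    M (rs (HS true i s) (X n)) <= M (rs (HS true i s') (X p)) + e.
Proof.
move=> XC [lsc up] ss e0; have [XK hX] := XC; have e2 : 0 < e / 2 by rewrite divr_gt0.
have [de de0 hde] := lsc _ e2; have [N1 h1] := up _ e2.
have c0 : 0 < 1 + slice_cst / (s' - s).
  by rewrite ltr_pwDl // divr_ge0 ?slice_cst_ge0 // subr_ge0 ltW.
pose eta := Num.min (de / 3) (de / 3 / (1 + slice_cst / (s' - s))).
have d3 : 0 < de / 3 by rewrite divr_gt0.
have eta0 : 0 < eta by rewrite lt_min d3 divr_gt0.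
have [N2 h2] := hX _ eta0; exists (maxn N1 N2) => p n.
rewrite !geq_max => /andP[_ p2] /andP[n1 n2].
have WK := polyhedral_sub (XK p) (XK n); set W := chain_sub _ _ in WK.
have [t /andP[t1 t2] lt] := slice_flat true i WK (h2 _ _ p2 n2) ss.
have pA := polyset_HS true i t; set A := HS true i t in pA lt; have pC := polysetC pA.
have r1 := rs_polyhedral (XK p) pA; have r2 := rs_polyhedral (XK n) pC.
(* [P - X n] is the restriction of [X p - X n] to [A], which [slice_flat] makes small at the level
   [t]. *)
pose P := rs A (X p) ++ rs (~` A) (X n); have PK : poly P by exact: polyhedral_cat.
have PX : dF P (X n) <= Fl (rs A W).
  rewrite le_eqVlt; apply/orP; left; apply/eqP; apply: (Fl_eqv nrmP).
  - exact: polyhedral_sub.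
  - exact: rs_polyhedral.
  apply: evt_mono (evtI (rs_coef (nd WK) pA) (evtI (rs_coef (nd (XK p)) pA) (rs_coef (nd (XK n)) pC))).
  move=> u _ [-> [E1 E2]]; rewrite coef_sub coef_cat E1 E2 coef_sub /setC /= asbool_neg.
  by case: ifP => _ /=; rewrite ?addr0 ?add0r ?subrr.
have leta : eta * (1 + slice_cst / (s' - s)) <= de / 3.
  by rewrite -ler_pdivlMr // ge_min lexx orbT.
have nP : fnear nrm K P X de.
  exists N2 => j j2; have := dF_tri nrmP PK (XK n) (XK j); have := h2 _ _ n2 j2.
  have he : eta <= de / 3 by rewrite ge_min lexx.
  by move=> /lt_le_trans/(_ he); lra.
have := hde _ PK nP; have := M_cat nrmP (nd r1) (nd r2); rewrite -/P.
have := h1 _ n1; have := M_rs_split nrmP (nd (XK n)) (@polysetT R d) pA.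
rewrite (M_rsT nrmP (nd (XK n))) setTI setTD.
have : M (rs (HS true i s) (X n)) <= M (rs A (X n)).
  by apply: M_rs_mono => //; [exact: nd|rewrite /A !HSE => x /=; lra].
have : M (rs A (X p)) <= M (rs (HS true i s') (X p)).
  by apply: M_rs_mono => //; [exact: nd|rewrite /A !HSE => x /=; lra].
lra.
Qed.
End Slicing.

(** * Discontinuities of monotone functions *)

Section Jumps.
Variable (R : realType).

Definition small_jumps (f : R -> R) (s : R) : Prop :=
  forall e, 0 < e -> exists2 de, 0 < de & f (s + de) - f (s - de) < e.

(** A rational in the gap of each jump; gaps at different points are disjoint because [f] is
    monotone. *)
Lemma countable_jumps (f : R -> R) : {homo f : x y / x <= y} ->
  countable [set s | ~ small_jumps f s].
Proof.
move=> mono.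
have ex s : ~ small_jumps f s -> exists q : rat,
    (forall x, x < s -> f x < ratr q) /\ (forall x, s < x -> ratr q < f x).
  move=> /existsNP[e /not_implyP[e0 no]].
  have jump x y : x < s -> s < y -> f x + e <= f y.
    move=> xs sy; rewrite leNgt; apply/negP => lt; apply: no.
    exists (Num.min (s - x) (y - s)); first by rewrite lt_min !subr_gt0 xs.
    have : f (s + Num.min (s - x) (y - s)) <= f y.
      by apply: mono; rewrite addrC -lerBrDr ge_min lexx orbT.
    have : f x <= f (s - Num.min (s - x) (y - s)).
      by apply: mono; rewrite lerBrDr addrC -lerBrDr ge_min lexx.
    lra.
  pose L := sup [set f x | x in [set x | x < s]].
  have hs : has_sup [set f x | x in [set x | x < s]].
    split; first by exists (f (s - 1)), (s - 1) => //=; lra.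
    exists (f (s + 1)) => _ [x /= xs <-]; apply: mono; lra.
  have [q] := @rat_in_itvoo R (L + e / 3) (L + 2 * e / 3) ltac:(lra).
  rewrite in_itv /= => /andP[q1 q2]; exists q; split=> x xs.
    have : f x <= L by apply: sup_upper_bound => //; exists x.
    lra.
  have : L + e <= f x.
    rewrite -lerBrDr; apply: sup_le_ub; first by case: hs.
    by move=> _ [y /= ys <-]; rewrite lerBrDr; exact: jump.
  lra.
have ex' s : exists q : rat, ~ small_jumps f s ->
    (forall x, x < s -> f x < ratr q) /\ (forall x, s < x -> ratr q < f x).
  have [h|h] := pselect (small_jumps f s); first by exists 0.
  by have [q hq] := ex _ h; exists q.
have [q hq] := choice ex'.
apply/countable_injP; exists (fun s => pickle (q s)) => s s'; rewrite !inE /= => bs bs'.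
move=> /(pcan_inj pickleK) qE; have [h1 h2] := hq _ bs; have [h1' h2'] := hq _ bs'.
have aux u v : u < v -> ratr (q u) < f ((u + v) / 2) -> f ((u + v) / 2) < ratr (q v) ->
  q u = q v -> False.
  by move=> _ a b E; rewrite E in a; have := lt_trans a b; rewrite ltxx.
case: (ltgtP s s') => // lt; exfalso.
  by apply: (aux s s') => //; [apply: h2|apply: h1']; lra.
by apply: (aux s' s) => //; [apply: h2'|apply: h1]; lra.
Qed.
End Jumps.

(** * Finite Borel measures *)

Section Ultralimit.
Variables (R : realType) (U : set_system nat) (UU : UltraFilter U).

Lemma ultra_bounded_cvg (u : nat -> R) (B : R) : (forall n, 0 <= u n <= B) ->
  cvg (u @ U).
Proof.
move=> uB; have PF : ProperFilter (u @ U) by exact: fmap_proper_filter.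
have : (u @ U) `[0, B]%classic.
  have FU : Filter U by exact: _.
  by apply: (@filterS _ U FU setT) (filterT) => n _ /=; rewrite in_itv /=; exact: uB.
move=> /(@segment_compact R 0 B _ PF)[p [_ cp]]; apply/cvg_ex; exists p => V pV.
have [//|nV] := in_ultra_setVsetC (u @^-1` V) UU.
have [x [/= nVx Vx]] := cp (~` V) V nV pV; by have := nVx Vx.
Qed.

(** Masses in a fixed set are bounded but need not converge. An ultrafilter gives limits for all
    sets simultaneously and keeps additivity. *)
Definition ul (u : nat -> R) : R := lim (u @ U).

Lemma ul_le (u v : nat -> R) B B' : (forall n, 0 <= u n <= B) ->
  (forall n, 0 <= v n <= B') -> (forall n, u n <= v n) -> ul u <= ul v.
Proof.
move=> uB vB uv; apply: ler_lim; [exact: ultra_bounded_cvg uB|exact: ultra_bounded_cvg vB|].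
by apply: nearW.
Qed.

Lemma ulD (u v : nat -> R) B B' : (forall n, 0 <= u n <= B) ->
  (forall n, 0 <= v n <= B') -> ul (fun n => u n + v n) = ul u + ul v.
Proof.
move=> uB vB; apply: limD; [exact: ultra_bounded_cvg uB|exact: ultra_bounded_cvg vB].
Qed.

Lemma ul_cst (c : R) : ul (fun=> c) = c.
Proof. exact: lim_cst. Qed.

Lemma ul_near (u : nat -> R) B (e : R) : (forall n, 0 <= u n <= B) -> 0 < e ->
  U [set n | `|ul u - u n| < e].
Proof.
move=> uB e0; have /cvgrPdist_lt := ultra_bounded_cvg uB; exact.
Qed.

Hypothesis Uoo : \oo `<=` U.

Lemma ul_often (S : set nat) N : U S -> exists2 n, (N <= n)%N & S n.
Proof.
move=> US; have UN : U [set n | (N <= n)%N] by apply: Uoo; exists N.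
by have [n [Sn Nn]] := filter_ex (filterI US UN); exists n.
Qed.

Lemma ul_eventually_le (u : nat -> R) B (c : R) N : (forall n, 0 <= u n <= B) ->
  (forall n, (N <= n)%N -> u n <= c) -> ul u <= c.
Proof.
move=> uB le; apply: limr_le; first exact: ultra_bounded_cvg uB.
by apply: Uoo; exists N.
Qed.
End Ultralimit.

Section BorelMeasure.
Variables (R : realType) (d : nat).
Implicit Types (A B E X : set 'rV[R]_d) (m : set 'rV[R]_d -> \bar R).

Definition borel_outer m : Prop :=
  [/\ m set0 = 0%E, {homo m : A B / A `<=` B >-> (A <= B)%E}, sigma_subadditive m,
      (m setT < +oo)%E &
      forall E X, borel E -> m X = (m (X `&` E) + m (X `\` E))%E].

Section Fixed.
Variables (m : set 'rV[R]_d -> \bar R) (mP : borel_outer m).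

Lemma bo_ge0 A : (0 <= m A)%E.
Proof. by case: mP => m0 mono _ _ _; rewrite -m0; exact: mono. Qed.

Lemma bo_fin A : m A \is a fin_num.
Proof.
rewrite ge0_fin_numE ?bo_ge0 //; case: mP => _ mono _ fin _.
by apply: le_lt_trans fin; exact: mono.
Qed.

Definition fm A : R := fine (m A).

Lemma fmE A : m A = (fm A)%:E. Proof. by rewrite /fm fineK // bo_fin. Qed.

Lemma fm_ge0 A : 0 <= fm A. Proof. by rewrite -lee_fin -fmE bo_ge0. Qed.

Lemma fm0 : fm set0 = 0. Proof. by rewrite /fm; case: mP => ->. Qed.

Lemma fm_mono A B : A `<=` B -> fm A <= fm B.
Proof. by move=> AB; rewrite -lee_fin -!fmE; case: mP => _ + _ _ _; exact. Qed.

Lemma fm_split E X : borel E -> fm X = fm (X `&` E) + fm (X `\` E).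
Proof.
by move=> bE; case: mP => _ _ _ _ /(_ _ X bE); rewrite !fmE -EFinD => -[].
Qed.

Lemma fm_sigma (A : nat -> set 'rV[R]_d) (c : R) :
  (forall n, \sum_(i < n) fm (A i) <= c) -> fm (\bigcup_i A i) <= c.
Proof.
move=> le; rewrite -lee_fin -fmE; case: mP => _ _ sub _ _.
apply: le_trans (sub A) _; apply: lime_le.
  by apply: is_cvg_nneseries => *; exact: bo_ge0.
apply: nearW => n; rewrite big_mkord; under eq_bigr do rewrite fmE.
by rewrite sumEFin lee_fin.
Qed.

Lemma fmU A B : fm (A `|` B) <= fm A + fm B.
Proof.
have -> : A `|` B = \bigcup_i nth set0 [:: A; B] i.
  apply/seteqP; split => [x [Ax|Bx]|x [[|[|i]] _ /=]]; [by exists 0%N|by exists 1%N|..].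
  - by left.
  - by right.
  - by rewrite nth_nil.
apply: fm_sigma => -[|[|n]].
- by rewrite big_ord0 addr_ge0 ?fm_ge0.
- by rewrite big_ord1 lerDl fm_ge0.
rewrite 2!big_ord_recl /= big1 ?addr0 // => i _.
by rewrite /= nth_nil fm0.
Qed.

Lemma fmU_disj A B : borel A -> A `&` B = set0 -> fm (A `|` B) = fm A + fm B.
Proof.
move=> bA AB; rewrite (fm_split _ bA); congr (fm _ + fm _).
  by rewrite setUK.
apply/seteqP; split => x; first by move=> [[]].
by move=> Bx; split; [right|move=> Ax; have : (A `&` B) x by []; rewrite AB].
Qed.

Lemma fm_bigsum (E : nat -> set 'rV[R]_d) n : (forall i, borel (E i)) ->
  trivIset setT E -> fm (\big[setU/set0]_(i < n) E i) = \sum_(i < n) fm (E i).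
Proof.
move=> bE tE; elim: n => [|n IH]; first by rewrite !big_ord0 fm0.
rewrite !big_ord_recr /= setUC fmU_disj //; first by rewrite IH addrC.
apply/seteqP; split => // x [En]; rewrite -bigcup_mkord => -[i /= lin Ei].
have : n = i by apply: tE => //; exists x.
by move=> E'; rewrite E' ltnn in lin.
Qed.

Lemma fm_tail (E : nat -> set 'rV[R]_d) (e : R) : (forall i, borel (E i)) ->
  trivIset setT E -> 0 < e ->
  exists N, forall n, (N <= n)%N -> fm (\bigcup_i E (n + i)%N) <= e.
Proof.
move=> bE tE e0; pose S n := \sum_(i < n) fm (E i).
have SB n : S n <= fm setT by rewrite /S -fm_bigsum //; exact: fm_mono.
have Smono n p : S n <= S (n + p)%N.
  elim: p => [|p IH]; first by rewrite addn0.
  by rewrite addnS /S big_ord_recr /= (le_trans IH) // lerDl fm_ge0.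
have hs : has_sup (range S) by split; [exists (S 0%N), 0%N|exists (fm setT) => _ [n _ <-]].
have [_ [N _ <-] SN] := sup_adherent e0 hs.
exists N => n Nn; apply: fm_sigma => p.
have -> : \sum_(i < p) fm (E (n + i)%N) = S (n + p)%N - S n.
  rewrite /S big_split_ord /= addrAC subrr add0r; by apply: eq_bigr.
have : S (n + p)%N <= sup (range S) by apply: sup_upper_bound => //; exists (n + p)%N.
have : S N <= S n by rewrite -(subnKC Nn).
lra.
Qed.

(** A finite measure gives more than 1 / (n + 1) to only finitely many of the disjoint sets. This is
    what makes the height of a cone selectable in [fold_simplex]. *)
Lemma fm_disjoint_countable (D : R -> set 'rV[R]_d) (P : set R) : (forall t, P t -> borel (D t)) ->
  (forall s t, P s -> P t -> s != t -> D s `&` D t = set0) ->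
  countable [set t | P t /\ fm (D t) <> 0].
Proof.
move=> bD dD; pose A n := [set t | P t /\ n.+1%:R^-1 < fm (D t)].
have -> : [set t | P t /\ fm (D t) <> 0] = \bigcup_n A n.
  apply/seteqP; split => [t [Pt /eqP t0]|t [n _ [Pt lt]]]; last first.
    by split => // E; move: lt; rewrite E invr_lt0 ltrn0.
  have tpos : 0 < fm (D t) by rewrite lt_neqAle eq_sym t0 fm_ge0.
  have [N _ hN] := near_infty_natSinv_lt (PosNum tpos).
  by exists N => //; split => //; exact: (hN N (leqnn N)).
apply: bigcup_countable => // n _; apply/finite_set_countable.
apply/finite_setPn => /pcard_leP[f].
have fi i j : f i = f j -> i = j by apply: (@inj _ _ _ f); rewrite inE.
have fA i : A n (f i) by exact: (@funS _ _ _ _ f).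
pose E i := D (f i).
have bE i : borel (E i) by apply: bD; case: (fA i).
have tE : trivIset setT E.
  move=> i j _ _ [x [xi xj]]; apply/eqP/contraT => ij.
  have [Pi _] := fA i; have [Pj _] := fA j.
  have : (D (f i) `&` D (f j)) x by [].
  by rewrite dD //; apply: contra ij => /eqP/fi ->.
have [p hp] : exists p : nat, fm setT < p%:R * n.+1%:R^-1.
  exists (Num.bound (fm setT * n.+1%:R)); rewrite -ltr_pdivrMr ?invr_gt0 ?ltr0n //.
  by rewrite invrK; apply: archi_boundP; rewrite mulr_ge0 ?fm_ge0 ?ler0n.
have h1 : \sum_(i < p) n.+1%:R^-1 <= \sum_(i < p) fm (E i).
  by apply: ler_sum => i _; apply/ltW; case: (fA i).
rewrite sumr_const card_ord -[_ *+ p]mulr_natl -fm_bigsum // in h1.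
have h2 : fm (\big[setU/set0]_(i < p) E i) <= fm setT by exact: fm_mono.
by have := lt_le_trans hp (le_trans h1 h2); rewrite ltxx.
Qed.

Lemma borel_coord i (s : R) : borel [set x : 'rV[R]_d | x ord0 i <= s].
Proof.
rewrite (_ : mkset _ = [set x | aff (coordf i s) x <= 0]); first exact: borel_halfspace.
by apply/seteqP; split => x; rewrite /= coordfE subr_le0.
Qed.

(** The measure of a slab is controlled by the increment of the distribution function in the
    coordinate [i], which is monotone. *)
Lemma borel_outer_slab i :
  countable [set s : R | ~ forall e, 0 < e -> exists2 de, 0 < de & fm (slab i s de) <= e].
Proof.
pose f s := fm [set x : 'rV[R]_d | x ord0 i <= s].
have fmono : {homo f : s t / s <= t}.
  by move=> s t st; apply: fm_mono => x /= xs; exact: le_trans xs st.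
apply: sub_countable (countable_jumps fmono); apply: subset_card_le => s /= no ok; apply: no.
move=> e e0; have [de de0 lt] := ok e e0; exists (de / 2); first by rewrite divr_gt0.
have := fm_split [set x : 'rV[R]_d | x ord0 i <= s + de] (borel_coord i (s - de)).
rewrite (_ : [set x : 'rV[R]_d | x ord0 i <= s + de] `&` _ =
  [set x | x ord0 i <= s - de]); last first.
  by apply/seteqP; split => x /=; [case|move=> h; split => //; lra].
have : fm (slab i s (de / 2)) <= fm ([set x : 'rV[R]_d | x ord0 i <= s + de]
    `\` [set x | x ord0 i <= s - de]).
  by apply: fm_mono => x /= /andP[x1 x2]; split => /=; lra.
rewrite -/(f (s + de)) -/(f (s - de)); lra.
Qed.
End Fixed.

Lemma borel_outerD m m' : borel_outer m -> borel_outer m' ->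
  borel_outer (fun A => m A + m' A)%E.
Proof.
move=> mP m'P; have [m0 mono sub fin car] := mP; have [m0' mono' sub' fin' car'] := m'P.
split=> [|A B AB|A||E X bE].
- by rewrite m0 m0' adde0.
- by apply: leeD; [exact: mono|exact: mono'].
- rewrite nneseriesD => *; [|exact: bo_ge0 mP _|exact: bo_ge0 m'P _].
  by apply: leeD; [exact: sub|exact: sub'].
- exact: lte_add_pinfty.
- by rewrite (car E X bE) (car' E X bE) addeACA.
Qed.

Lemma borel_outer_series (mu : nat -> set 'rV[R]_d -> \bar R) :
  (forall j, borel_outer (mu j)) -> (\sum_(j <oo) mu j setT < +oo)%E ->
  borel_outer (fun A => \sum_(j <oo) mu j A)%E.
Proof.
move=> muP fin; split=> [|A B AB|A||E X bE] //.
- by apply: eseries0 => j _ _; case: (muP j).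
- apply: lee_nneseries => [j _ _|j _]; first exact: bo_ge0 (muP j) _.
  by case: (muP j) => _ + _ _ _; exact.
- rewrite nneseries_interchange; last by move=> i j; exact: bo_ge0 (muP j) _.
  apply: lee_nneseries => [j _ _|j _]; first exact: bo_ge0 (muP j) _.
  by case: (muP j) => _ _ sub _ _; exact: sub.
- rewrite -nneseriesD => [|j _ _|j _ _]; [|exact: bo_ge0 (muP j) _..].
  by apply: eq_eseriesr => j _; case: (muP j) => _ _ _ _; exact.
Qed.

Lemma borel_outer_hausdorff k (c : R) (S : set 'rV[R]_d) : 0 <= c ->
  (hausdorff k S < +oo)%E -> borel_outer (fun A => c%:E * hausdorff k (S `&` A))%E.
Proof.
move=> c0 fin; split=> [|A B AB|A||E X bE].
- by rewrite setI0 hausdorff_set0 mule0.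
- by apply: lee_wpmul2l; [rewrite lee_fin|apply: le_hausdorff; exact: setIS].
- rewrite nneseriesZl => [|i _]; last exact: hausdorff_ge0.
  apply: lee_wpmul2l; first by rewrite lee_fin.
  by rewrite setI_bigcupr; exact: hausdorff_sigma_subadditive.
- rewrite setIT; apply: lte_mul_pinfty => //; by rewrite lee_fin.
- rewrite (hausdorffID k (S `&` X) bE) ge0_muleDr ?hausdorff_ge0 //.
  by rewrite setIA setIDA.
Qed.
End BorelMeasure.

(** * The mass measure of a limit of chains *)

Section LimitMeasure.
Variables (R : realType) (G : zmodType) (d : nat).
Variables (nrm : G -> R) (nrmP : group_norm nrm).
Variable (K : set 'rV[R]_d) (k : nat).
Hypothesis Kcompact : compact K.
Local Notation M := (M nrm).
Local Notation poly := (@polyhedral R G d k K).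
Variables (U : set_system nat) (UU : UltraFilter U) (Uoo : \oo `<=` U).
Variables (X : nat -> chain R G d k) (XK : forall n, poly (X n)).
Variables (B : R) (XB : forall n, M (X n) <= B).
Implicit Types (A E F : set 'rV[R]_d) (i : 'I_d) (s : R).

Lemma countable_avoid (N : set R) (a b : R) : countable N -> a < b ->
  exists2 s, ~ N s & a < s < b.
Proof.
move=> cN ab; apply: contrapT => no.
have sub : `]a, b[%classic `<=` N.
  move=> s; rewrite /= in_itv /= => sab; apply: contrapT => Ns; apply: no.
  by exists s.
have : (lebesgue_measure (`]a, b[%classic : set R) <= lebesgue_measure N)%E.
  apply: le_measure => //; rewrite inE //; exact: countable_measurable.
rewrite lebesgue_measure_oo // countable_lebesgue_measure0 // lee_fin; lra.
Qed.

Let nd P : poly P -> nondeg P. Proof. exact: polyhedral_nondeg. Qed.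

Definition limit_mass A : R := ul U (fun n => M (rs A (X n))).

Lemma restr_bound A n : polyset A -> 0 <= M (rs A (X n)) <= B.
Proof.
move=> pA; have Xf := nd (@XK n); apply/andP; split.
  by apply: (M_ge0 nrmP); exact: rs_nondeg.
by apply: le_trans (XB n); exact: M_rs_le.
Qed.

Lemma limit_mass_le A A' : polyset A -> polyset A' ->
  (forall n, M (rs A (X n)) <= M (rs A' (X n))) -> limit_mass A <= limit_mass A'.
Proof.
move=> pA pA' le; apply: (ul_le UU (B := B) (B' := B)) => // n; exact: restr_bound.
Qed.

Lemma limit_mass_ge0 A : polyset A -> 0 <= limit_mass A.
Proof.
move=> pA; rewrite -(ul_cst UU 0).
apply: (ul_le UU (B := 0) (B' := B)) => [n|n|n]; rewrite ?lexx //.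
  exact: restr_bound.
by case/andP: (restr_bound n pA).
Qed.

Lemma limit_mass_split A A' : polyset A -> polyset A' ->
  limit_mass A = limit_mass (A `&` A') + limit_mass (A `\` A').
Proof.
move=> pA pA'; rewrite -(ulD UU (B := B) (B' := B)); last 2 first.
- by move=> n; apply: restr_bound; exact: polysetI.
- by move=> n; apply: restr_bound; exact: polysetD.
congr ul; apply/funext => n; apply: M_rs_split => //; exact: nd.
Qed.

Lemma limit_mass_mono A A' : polyset A -> polyset A' -> A `&` K `<=` A' ->
  limit_mass A <= limit_mass A'.
Proof.
move=> pA pA' AA'; apply: limit_mass_le => // n; have Xf := nd (@XK n).
apply: (M_le nrmP); try exact: rs_nondeg.
apply: evt_mono (evtI (rs_coef Xf pA) (rs_coef Xf pA')) => t _ [-> ->].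
case: (asboolP (A _)) => tA; last by rewrite (nrm0 nrmP) nrm_ge0.
case: (asboolP (A' _)) => // tA'; rewrite coef_eq0 // => p /(@XK n)[_ pK] tp.
by apply/tA'/AA'; split => //; exact/pK/tp/bary_hull.
Qed.

Lemma limit_massU A A' : polyset A -> polyset A' ->
  limit_mass (A `|` A') <= limit_mass A + limit_mass A'.
Proof.
move=> pA pA'; have pU := polysetU pA pA'; rewrite (limit_mass_split pU pA).
apply: lerD; apply: limit_mass_mono => //.
- exact: polysetI.
- by move=> x [[]].
- exact: polysetD.
- by move=> x [[[]]].
Qed.

Lemma limit_mass0 : limit_mass set0 = 0.
Proof.
have := limit_mass_split (@polysetT R d) (@polysetT R d).
rewrite setIT setDv; lra.
Qed.

(* Regularity makes the limit of the masses countably subadditive. *)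
Definition reg A : Prop := polyset A /\ forall e, 0 < e -> exists A1 A2 C O,
  [/\ polyset A1 /\ polyset A2, closed C /\ open O, A1 `<=` C /\ C `<=` A,
      A `<=` O /\ O `<=` A2 & limit_mass (A2 `\` A1) <= e].

Lemma regC A : reg A -> reg (~` A).
Proof.
move=> [pA h]; split; first exact: polysetC.
move=> e /h[A1 [A2 [C [V [[p1 p2] [cC oV] [s1 s2] [s3 s4] le]]]]].
exists (~` A2), (~` A1), (~` V), (~` C); split.
- by split; exact: polysetC.
- by split; [exact: open_closedC|exact: closed_openC].
- by split; exact: subsetC.
- by split; exact: subsetC.
by rewrite setDE setCK setIC -setDE.
Qed.

Lemma regI A A' : reg A -> reg A' -> reg (A `&` A').
Proof.
move=> [pA h] [pA' h']; split; first exact: polysetI.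
move=> e e0; have e2 : 0 < e / 2 by rewrite divr_gt0.
have [A1 [A2 [C [V [[p1 p2] [cC oV] [s1 s2] [s3 s4] le]]]]] := h _ e2.
have [A1' [A2' [C' [V' [[p1' p2'] [cC' oV'] [s1' s2'] [s3' s4'] le']]]]] := h' _ e2.
exists (A1 `&` A1'), (A2 `&` A2'), (C `&` C'), (V `&` V'); split.
- by split; exact: polysetI.
- by split; [exact: closedI|exact: openI].
- by split; exact: setISS.
- by split; exact: setISS.
have q := polysetD p2 p1; have q' := polysetD p2' p1'.
have : limit_mass ((A2 `&` A2') `\` (A1 `&` A1')) <= limit_mass ((A2 `\` A1) `|` (A2' `\` A1')).
  apply: limit_mass_mono; [by apply: polysetD; exact: polysetI|exact: polysetU|].
  move=> x [[[x2 x2'] nx] _]; apply: contrapT => /not_orP[n1 n1']; apply: nx.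
  by split; apply: contrapT => nx; [apply: n1|apply: n1'].
have := limit_massU q q'; lra.
Qed.

Lemma regT : reg setT.
Proof.
split; first exact: polysetT.
move=> e e0; exists setT, setT, setT, setT; split => //.
- by split; exact: polysetT.
- by split; [exact: closedT|exact: openT].
by rewrite setDv limit_mass0 ltW.
Qed.

Lemma regD A A' : reg A -> reg A' -> reg (A `\` A').
Proof. by move=> rA rA'; rewrite setDE; apply: regI => //; exact: regC. Qed.

(** Parallel half-spaces at distance [de / 2] on either side are the inner and outer approximations;
    their difference lies in a slab of small mass. *)
Lemma reg_HS b i s : slabgood nrm X i s -> reg (HS b i s).
Proof.
move=> gX; split; first exact: polyset_HS.
move=> e e0; have [de de0 [N hN]] := gX e e0.
pose s1 := if b then s - de / 2 else s + de / 2.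
pose s2 := if b then s + de / 2 else s - de / 2.
have lip c : lipschitz_fun (fun x : 'rV[R]_d => x ord0 i - c) by exact: lipschitz_coord.
have opn c : open [set x : 'rV[R]_d | x ord0 i < c].
  rewrite (_ : [set x : 'rV[R]_d | x ord0 i < c] = [set x | x ord0 i - 0 < c]); first exact: lipschitz_open.
  by apply/seteqP; split => x /=; rewrite subr0.
have opn' c : open [set x : 'rV[R]_d | c < x ord0 i].
  rewrite (_ : [set x : 'rV[R]_d | c < x ord0 i] = [set x | aff (- coordf i 0) x < - c]).
    exact/lipschitz_open/aff_lip.
  by apply/seteqP; split => x /=; rewrite affN coordfE subr0 ltrN2.
have clo c : closed [set x : 'rV[R]_d | x ord0 i <= c].
  have -> : [set x : 'rV[R]_d | x ord0 i <= c] = ~` [set x | c < x ord0 i].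
    by apply/seteqP; split => x /=; [move=> h /lt_geF; rewrite h|move=> /negP; rewrite -leNgt].
  by apply: open_closedC; exact: opn'.
have clo' c : closed [set x : 'rV[R]_d | c <= x ord0 i].
  have -> : [set x : 'rV[R]_d | c <= x ord0 i] = ~` [set x | x ord0 i < c].
    by apply/seteqP; split => x /=; [move=> h /lt_geF; rewrite h|move=> /negP; rewrite -leNgt].
  by apply: open_closedC; exact: opn.
exists (HS b i s1), (HS b i s2), (HS b i s1),
  (if b then [set x : 'rV[R]_d | x ord0 i < s2] else [set x | s2 < x ord0 i]); split.
- by split; exact: polyset_HS.
- split; last by case: (b); [exact: opn|exact: opn'].
  by rewrite HSE; case: (b); [exact: clo|exact: clo'].
- by split => //; rewrite !HSE /s1 => x; case: (b) => /=; lra.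
- by split; rewrite !HSE /s2 => x; case: (b) => /=; lra.
apply: (@le_trans _ _ (limit_mass (slab i s de))).
  apply: limit_mass_mono; [exact/polysetD/polyset_HS/polyset_HS|exact: polyset_slab|].
  rewrite !HSE /s1 /s2 => x [[]]; case: (b) => /= h1 /negP; rewrite -ltNge => h2 _;
    by apply/andP; split; lra.
apply: (ul_eventually_le UU Uoo (B := B) (N := N)) => // n.
exact/restr_bound/polyset_slab.
Qed.

Let D := g_sigma_algebraType [set: set 'rV[R]_d].

Let all_meas (A : set D) : measurable A.
Proof. exact: sub_sigma_algebra. Qed.

Definition reg_cost A : \bar R := if `[< reg A >] then (limit_mass A)%:E else +oo%E.

Lemma reg_cost_ge0 A : (0 <= reg_cost A)%E.
Proof.
rewrite /reg_cost; case: asboolP => // -[pA _].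
by rewrite lee_fin limit_mass_ge0.
Qed.

Lemma reg_cost0 : reg_cost set0 = 0%E.
Proof.
rewrite /reg_cost asboolT ?limit_mass0 // -(setDv setT).
by apply: regD; exact: regT.
Qed.

(** Only covers of the part in [K] are asked for: the chains live there, and compactness of [K] is
    used in [limit_mass_le_kappa]. *)
Definition kappa A : \bar R := mu_ext (reg_cost : set D -> \bar R) (A `&` K).

(** As for Lebesgue measure: [A] is approximated from inside by a closed set, the cover from outside
    by open sets, and compactness of [K] reduces the claim to finite subadditivity of
    [limit_mass]. *)
Lemma limit_mass_le_kappa A : reg A -> ((limit_mass A)%:E <= kappa A)%E.
Proof.
move=> rA; apply: le_ereal_inf_tmp => _ [F [_ cov] <-].
have [rF|] := pselect (forall j, reg (F j)); last first.
  move=> /existsNP[j nF]; rewrite (@nneseries_pinfty _ _ xpredT j) ?leey // => [n _|].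
    exact: reg_cost_ge0.
  by rewrite /reg_cost asboolF.
apply/lee_addgt0Pr => e e0; have e2 : 0 < e / 2 by rewrite divr_gt0.
have [pA /(_ _ e2)[A1 [A2 [C [V [[p1 p2] [cC oV] [s1 s2] [s3 s4] le]]]]]] := rA.
have ex j : exists V : set 'rV[R]_d * set 'rV[R]_d, [/\ polyset V.2, open V.1,
    F j `<=` V.1 /\ V.1 `<=` V.2 & limit_mass V.2 <= limit_mass (F j) + e / 2 / (2 ^ j.+1)%:R].
  have ej : 0 < e / 2 / (2 ^ j.+1)%:R by rewrite divr_gt0 // ltr0n expn_gt0.
  have [pF /(_ _ ej)[F1 [F2 [C' [V' [[q1 q2] [_ oV'] [t1 t2] [t3 t4] le']]]]]] := rF j.
  exists (V', F2); split => //=; rewrite (limit_mass_split q2 q1); apply: lerD => //.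
  apply: limit_mass_mono => //; first exact: polysetI.
  by move=> x [[_ x1] _]; exact/t2/t1.
have [W hV] := choice ex.
have CK : compact (K `&` C) by exact: compact_closedI.
have [D0 _ Dcov] : finite_subset_cover [set: nat] (fun j => (W j).1) (K `&` C).
  move: CK; rewrite compact_cover; apply=> [j _|x [Kx Cx]]; first by case: (hV j).
  have [|j _ Fx] := cov x; first by split => //; exact: s2.
  by exists j => //; case: (hV j) => _ _ [h _] _; exact: h.
pose N := (\max_(j <- finmap.enum_fset D0) j).+1.
have covN : A1 `&` K `<=` \big[setU/set0]_(j < N) (W j).2.
  move=> x [x1 Kx]; have [|j jD Vx] := Dcov x; first by split => //; exact: s1.
  rewrite -(bigcup_mkord N (fun j => (W j).2)); exists j => /=; last by case: (hV j) => _ _ [_ h] _; exact: h.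
  by rewrite ltnS; exact: (@leq_bigmax_seq _ (finmap.enum_fset D0) xpredT (fun j => j) j jD).
have pV n : polyset (\big[setU/set0]_(j < n) (W j).2).
  elim: n => [|n IH]; first by rewrite big_ord0 -(setDv setT); apply: polysetD; exact: polysetT.
  by rewrite big_ord_recr; apply: polysetU => //; case: (hV n).
have subV n : limit_mass (\big[setU/set0]_(j < n) (W j).2) <=
    \sum_(j < n) (limit_mass (F j) + e / 2 / (2 ^ j.+1)%:R).
  elim: n => [|n IH]; first by rewrite !big_ord0 limit_mass0.
  rewrite !big_ord_recr /=; have [pn _ _ le'] := hV n.
  by apply: le_trans (limit_massU (pV n) pn) _; apply: lerD.
have step : limit_mass A <= \sum_(j < N) (limit_mass (F j) + e / 2 / (2 ^ j.+1)%:R) + e / 2.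
  have q : limit_mass A <= limit_mass A1 + limit_mass (A2 `\` A1).
    rewrite (limit_mass_split pA p1); apply: lerD; apply: limit_mass_mono => //.
    - exact: polysetI.
    - by move=> x [[]].
    - exact: polysetD.
    - exact: polysetD.
    by move=> x [[Ax n1] _]; split => //; exact/s4/s3.
  have := limit_mass_mono p1 (pV N) covN; have := subV N; lra.
apply: (@le_trans _ _ ((\sum_(j < N) (limit_mass (F j) + e / 2 / (2 ^ j.+1)%:R))%:E + (e / 2)%:E)%E).
  by rewrite -EFinD lee_fin.
rewrite [in leRHS](splitr e) EFinD addeA; apply: leeD => //.
apply: le_trans (epsilon_trick _ _ (ltW e2)); last by move=> j; exact: reg_cost_ge0.
rewrite -sumEFin -(big_mkord predT (fun j => (limit_mass (F j) + e / 2 / (2 ^ j.+1)%:R)%:E)).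
apply: le_trans (nneseries_lim_ge (u_ := fun j => (reg_cost (F j) + (e / 2 / (2 ^ j.+1)%:R)%:E)%E)
   (P := predT) N _).
  by apply: lee_sum => j _; rewrite /reg_cost asboolT // EFinD.
move=> j _ _; apply: adde_ge0; first exact: reg_cost_ge0.
by rewrite lee_fin divr_ge0 ?ltW // ?ltr0n ?expn_gt0.
Qed.

Hypothesis Xgood : forall i, countable [set s | ~ slabgood nrm X i s].

(** Both parts of a regular cover split by [H] are again regular, and their costs add up exactly. *)
Lemma kappa_caratheodory H A : reg H -> (kappa (A `&` H) + kappa (A `\` H) <= kappa A)%E.
Proof.
move=> rH; apply: le_ereal_inf_tmp => _ [F [_ cov] <-].
have [rF|] := pselect (forall j, reg (F j)); last first.
  move=> /existsNP[j nF]; rewrite (@nneseries_pinfty _ _ xpredT j) ?leey // => [n _|].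
    exact: reg_cost_ge0.
  by rewrite /reg_cost asboolF.
have pH := rH.1.
have -> : (\sum_(j <oo) reg_cost (F j) =
   \sum_(j <oo) reg_cost (F j `&` H) + \sum_(j <oo) reg_cost (F j `\` H))%E.
  rewrite -nneseriesD => [|j _ _|j _ _]; [|exact: reg_cost_ge0..].
  apply: eq_eseriesr => j _; have pF := (rF j).1; rewrite /reg_cost !asboolT //.
  - by rewrite -EFinD (limit_mass_split pF pH).
  - exact: regD.
  - exact: regI.
apply: leeD; apply: ereal_inf_lbound.
  exists (fun j => F j `&` H) => //; split=> // x [[Ax Hx] Kx].
  by have [|j _ Fx] := cov x; [|exists j].
exists (fun j => F j `\` H) => //; split=> // x [[Ax Hx] Kx].
by have [|j _ Fx] := cov x; [|exists j].
Qed.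

(** All but countably many levels are good, hence good levels are dense, and half-spaces at such
    levels are regular: [borel_generated] applies. *)
Lemma kappa_borel_outer : borel_outer kappa.
Proof.
have mu0 : kappa set0 = 0%E by rewrite /kappa set0I mu_ext0 //; [exact: reg_cost0|exact: reg_cost_ge0].
have mono : {homo kappa : A A' / A `<=` A' >-> (A <= A')%E}.
  by move=> A A' AA'; apply: le_mu_ext; exact: setSI.
have sub : sigma_subadditive kappa.
  move=> A; rewrite /kappa setI_bigcupl; apply: mu_ext_sigma_subadditive; exact: reg_cost_ge0.
have ge0 A : (0 <= kappa A)%E by rewrite -mu0; exact: mono.
pose V : {outer_measure set 'rV[R]_d -> \bar R} :=
  HB.pack kappa (isOuterMeasure.Build R 'rV[R]_d kappa mu0 ge0 mono sub).
split => //.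
  apply: (@le_lt_trans _ _ (limit_mass setT)%:E); last exact: ltry.
  apply: ereal_inf_le; exists (\sum_(j <oo) reg_cost (nth set0 [:: setT] j))%E.
    exists (nth set0 [:: setT]) => //; split=> // x _; by exists 0%N.
  apply: lime_le; first by apply: is_cvg_nneseries => *; exact: reg_cost_ge0.
  apply: nearW => -[|n]; first by rewrite big_geq // lee_fin limit_mass_ge0 //; exact: polysetT.
  rewrite big_nat_recl // big1 ?adde0 /= => [|j _]; last by rewrite nth_nil reg_cost0.
  by rewrite /reg_cost asboolT //; exact: regT.
move=> E X0 bE; suff : V.-caratheodory E by exact.
apply: (@borel_generated R d (fun i s => slabgood nrm X i s)) bE.
- by move=> i a b ab; have [s /contrapT ns sab] := countable_avoid (Xgood i) ab; exists s.
- split; first exact: caratheodory_measurable_set0.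
    by move=> A mA; rewrite setTD; exact: caratheodory_measurable_setC.
  by move=> F mF; exact: caratheodory_measurable_bigcup.
- move=> i s gs; apply: le_caratheodory_measurable => A.
  have := kappa_caratheodory A (reg_HS true gs).
  by rewrite HSE.
Qed.
End LimitMeasure.

(** * Restriction to Borel sets *)

Lemma countable_setU (T : Type) (A B : set T) : countable A -> countable B -> countable (A `|` B).
Proof.
move=> cA cB; have -> : A `|` B = \bigcup_(b in [set: bool]) (if b then A else B).
  apply/seteqP; split => [x [Ax|Bx]|x [[] _ h]]; [by exists true|by exists false|by left|by right].
by apply: bigcup_countable => // -[].
Qed.

Lemma borel_bigsetU (R : realType) d (F : nat -> set 'rV[R]_d) n :
  (forall i, borel (F i)) -> borel (\big[setU/set0]_(i < n) F i).
Proof.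
move=> bF; elim: n => [|n IH]; first by rewrite big_ord0; exact: borel0.
by rewrite big_ord_recr; exact: borelU.
Qed.

(** * Almost every box avoids countably many levels *)

Section Hyperplanes.
Variable (R : realType).

(** The hyperplane is exhausted by countably many Lipschitz images of the unit cube of one dimension
    less. *)
Lemma hyperplane_null n (j : 'I_n) (s : R) :
  hausdorff n [set c : 'rV[R]_n | c ord0 j = s] = 0%E.
Proof.
case: n j => [[] //|p] j.
pose f N (u : 'rV[R]_p) : 'rV[R]_p.+1 :=
  \row_l if unlift j l is Some a then 2 * N.+1%:R * u ord0 a - N.+1%:R else s.
apply: (@hausdorff_null_sub _ _ _ _ (\bigcup_N (f N @` ucube (R:=R) (n:=p)))) => [c /= cj|].
  pose N := Num.bound (euclid c); have eN : euclid c < N.+1%:R.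
    by apply: lt_le_trans (archi_boundP (euclid_ge0 c)) _; rewrite ler_nat.
  have N0 : 0 < 2 * N.+1%:R :> R by rewrite mulr_gt0.
  exists N => //; exists (\row_a ((c ord0 (lift j a) + N.+1%:R) / (2 * N.+1%:R))).
    move=> a; rewrite mxE; have := coord_le_euclid c (lift j a).
    rewrite ler_norml => /andP[c1 c2]; apply/andP; split.
      by apply: divr_ge0; [lra|exact: ltW].
    by rewrite ler_pdivrMr // mul1r; lra.
  apply/rowP => l; rewrite mxE; case: unliftP => [a ->|->]; last exact/esym.
  by rewrite mxE mulrC divfK ?gt_eqF // addrK.
apply: hausdorff_null_bigcup => N.
have L0 : 0 < p.+1%:R * (2 * N.+1%:R) :> R by rewrite !mulr_gt0.
apply: (proj2 (hausdorff_ucube_image (f := f N) L0 (leqnSn p) _)) => // x y _ _.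
rewrite -mulrA; apply: euclid_le_coord => [|l].
  by rewrite mulr_ge0 ?euclid_ge0 // mulr_ge0.
rewrite !mxE; case: unliftP => [a _|_]; last first.
  by rewrite subrr normr0 mulr_ge0 ?euclid_ge0 // mulr_ge0.
rewrite (_ : _ - _ = 2 * N.+1%:R * (x - y) ord0 a); last by rewrite !mxE; ring.
by rewrite normrM ger0_norm ?mulr_ge0 // ler_wpM2l ?mulr_ge0 // coord_le_euclid.
Qed.

Lemma countable_coord_null n (j : 'I_n) (C : set R) : countable C ->
  hausdorff n [set c : 'rV[R]_n | C (c ord0 j)] = 0%E.
Proof.
move=> /countable_injP[g gi].
apply: (@hausdorff_null_sub _ _ _ _
  (\bigcup_p [set c : 'rV[R]_n | C (c ord0 j) /\ g (c ord0 j) = p])).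
  by move=> c Cc; exists (g (c ord0 j)).
apply: hausdorff_null_bigcup => p.
have [[s Cs gs]|no] := pselect (exists2 s, C s & g s = p).
  apply: hausdorff_null_sub (hyperplane_null j s) => c [/= Cc gc].
  by apply: gi; rewrite ?inE // gc gs.
apply: hausdorff_null_sub (hausdorff_set0 _ _ _) => c [/= Cc gc]; apply: no.
by exists (c ord0 j).
Qed.

(** Applied in dimension 2 d to pairs of opposite corners: the boxes with some face at one of
    countably many bad levels form a null set. *)
Lemma coords_null n (C : 'I_n -> set R) : (forall j, countable (C j)) ->
  hausdorff n [set c : 'rV[R]_n | exists j, C j (c ord0 j)] = 0%E.
Proof.
move=> cC; apply: (@hausdorff_null_sub _ _ _ _ (\bigcup_p
  (if insub p is Some j then [set c : 'rV[R]_n | C j (c ord0 j)] else set0))).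
  by move=> c [j Cj]; exists (val j) => //; rewrite valK.
apply: hausdorff_null_bigcup => p; case: insubP => [j _ _|_]; last exact: hausdorff_set0.
exact: countable_coord_null.
Qed.
End Hyperplanes.

(** * Hyperplanes without mass in the limit *)

Section GoodSlabs.
Variables (R : realType) (G : zmodType) (d : nat).
Variables (nrm : G -> R) (nrmP : group_norm nrm).
Variable (K : set 'rV[R]_d) (k : nat).
Local Notation M := (M nrm).

(** The mass below level [s] has an ultralimit [f s], monotone in [s]. At points where [f] has no
    jump, [optimal_halfspace] transfers the small increment from one index [p] to all large [n],
    hence the slabs have uniformly small mass. *)
Lemma optimal_slabgood (X : nat -> chain R G d k) (m B : R) i : fcauchy nrm K X ->
  (forall n, M (X n) <= B) -> optimal nrm K X m ->
  countable [set s | ~ slabgood nrm X i s].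
Proof.
have half (x y : R) : 0 < y -> [/\ x + y / 2 < x + y, x - y < x - y / 2, 0 < y / 3 & x - y / 2 <= x + y / 2].
  by move=> y0; split; lra.
have sub3 (x c y : R) : 0 < y -> x - y / 3 <= c -> c <= x + y / 3 ->
    c <= x + y / 2 /\ x - y / 2 < c.
  by move=> y0 c1 c2; split; lra.
(* [fp] and [fm] stand for the ultralimits at levels s + de and s - de, [up] and [um] for the values
   of [X p] there, [hp] and [hm] for those of [X n] at s + de / 2 and s - de / 2, and [S] for the
   mass of the slab. Five errors of one fifth occur. *)
have aux (c fp fm up um hp hm D S : R) : - (c / 5) < fp - up -> fm - um < c / 5 ->
    fp - fm < c / 5 -> hp <= up + c / 5 -> um <= hm + c / 5 -> hp = hm + D -> S <= D -> S <= c.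
  lra.
move=> XC XB Xopt; have XK := XC.1.
have [U [UU Uoo]] := ultraFilterLemma (eventually_filter).
pose u s n := M (rs (HS true i s) (X n)).
have uB s n : 0 <= u s n <= B by exact: (restr_bound nrmP XK XB n (polyset_HS true i s)).
have umono s t n : s <= t -> u s n <= u t n.
  move=> st; apply: M_rs_mono => //; try exact: polyset_HS.
    exact: polyhedral_nondeg (@XK n).
  by rewrite !HSE => x /= xs; exact: le_trans xs st.
pose f s := ul U (u s).
have fmono : {homo f : s t / s <= t}.
  by move=> s t st; apply: (ul_le UU (uB s) (uB t)) => n; exact: umono.
apply: sub_countable (countable_jumps fmono); apply: subset_card_le => s /= no ok; apply: no.
move=> e e0; have e5 : 0 < e / 5 by rewrite divr_gt0.
have [de de0 lt] := ok _ e5.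
have [d1 d2 d3 d4] := half s de de0.
have [N1 h1] := optimal_halfspace nrmP i XC Xopt (s := s + de / 2) (s' := s + de) d1 e5.
have [N2 h2] := optimal_halfspace nrmP i XC Xopt (s := s - de) (s' := s - de / 2) d2 e5.
have [p pN [/= p1 p2]] := ul_often UU Uoo (maxn N1 N2)
  (filterI (ul_near UU (uB (s + de)) e5) (ul_near UU (uB (s - de)) e5)).
exists (de / 3) => //.
exists (maxn N1 N2) => n; move: pN; rewrite !geq_max => /andP[pN1 pN2] /andP[n1 n2].
have q1 := h1 p n pN1 n1; have q2 := h2 n p n2 pN2.
have Xf := polyhedral_nondeg (@XK n).
have pA := polyset_HS true i (s + de / 2); have pB := polyset_HS true i (s - de / 2).
have q3 := M_rs_split nrmP Xf pA pB.
have q4 : M (rs (slab i s (de / 3)) (X n)) <= M (rs (HS true i (s + de / 2) `\` HS true i (s - de / 2)) (X n)).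
  apply: M_rs_mono => //; [exact: polyset_slab|exact: polysetD|].
  rewrite !HSE => x /= /andP[x1 x2]; have [y1 y2] := sub3 _ _ _ de0 x1 x2.
  by split => //=; apply/negP; rewrite -ltNge.
rewrite (_ : HS true i (s + de / 2) `&` HS true i (s - de / 2) = HS true i (s - de / 2)) in q3; last first.
  apply/setIidr; rewrite !HSE => x /= xs; apply: le_trans xs _.
  exact: d4.
move: p1 p2; rewrite !ltr_norml => /andP[p1 p1'] /andP[p2 p2'].
exact: (aux _ _ _ _ _ _ _ _ _ p1 p2' lt q1 q2 q3 q4).
Qed.
End GoodSlabs.

Section BorelRestriction.
Variables (R : realType) (G : zmodType) (d : nat).
Variables (nrm : G -> R) (nrmP : group_norm nrm).
Variable (K : set 'rV[R]_d) (k : nat).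
Hypothesis Kcompact : compact K.
Local Notation M := (M nrm).
Local Notation poly := (@polyhedral R G d k K).
Local Notation dF := (dF nrm K).
Local Notation fcauchy := (fcauchy nrm K).
Local Notation fclose := (fclose nrm K).
Variables (U : set_system nat) (UU : UltraFilter U) (Uoo : \oo `<=` U).
Variables (X : nat -> chain R G d k) (XC : fcauchy X).
Variables (B : R) (XB : forall n, M (X n) <= B).
Hypothesis Xgood : forall i, countable [set s | ~ slabgood nrm X i s].
Variables (nu : set 'rV[R]_d -> \bar R) (nuP : borel_outer nu).
Implicit Types (A E F : set 'rV[R]_d) (i : 'I_d) (s : R) (Y S : nat -> chain R G d k).

Let nd P : poly P -> nondeg P. Proof. exact: polyhedral_nondeg. Qed.
Let XK n : poly (X n). Proof. by case: XC. Qed.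

Local Notation kap := (kappa nrm K U X).

Let kapP : borel_outer kap.
Proof. exact (kappa_borel_outer nrmP UU Uoo (fun n => @XK n) XB Xgood). Qed.

(** [kap] is the mass measure of the limit of [X], and [nu] will be the measure carried by the added
    faces; the sum bounds the mass of every restriction considered below. *)
Definition total A : \bar R := (kap A + nu A)%E.

Lemma total_outer : borel_outer total.
Proof. exact: (borel_outerD kapP nuP). Qed.

Local Notation m := (fm total).

Lemma totalE A : m A = fm kap A + fm nu A.
Proof.
by apply/EFin_inj; rewrite -(fmE total_outer) EFinD -(fmE kapP) -(fmE nuP).
Qed.

(** Domination of the masses in polyhedral sets takes the place of mass convergence, which fails in
    general for the intended sequence [X - Z]. *)
Definition controlled Y : Prop := fcauchy Y /\
  forall A n, polyset A -> M (rs A (Y n)) <= M (rs A (X n)) + fm nu A.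

(** Regularity bounds [limit_mass] by [kap]. The quantification over all controlled sequences makes
    the class stable under intersection, since a restricted controlled sequence is again
    controlled. *)
Definition good A : Prop := reg nrm U X A /\
  forall Y, controlled Y -> fcauchy (fun n => rs A (Y n)).

Lemma good_polyset A : good A -> polyset A. Proof. by move=> [[]]. Qed.

Lemma good_borel A : good A -> borel A. Proof. by move=> /good_polyset[]. Qed.

Lemma dF_sub4 P P' Q Q' : poly P -> poly P' -> poly Q -> poly Q' ->
  dF (chain_sub P Q) (chain_sub P' Q') <= dF P P' + dF Q Q'.
Proof.
move=> PK P'K QK Q'K; rewrite (dF_sym nrmP QK Q'K); apply: (Fl_add nrmP).
- by apply: polyhedral_sub; exact: polyhedral_sub.
- exact: polyhedral_sub.
- exact: polyhedral_sub.
by apply: evtT => t; rewrite !coef_sub opprB [X in _ + X = _]addrC addrACA [X in _ + X = _]addrC.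
Qed.

Lemma fcauchy_sub Y Y' : fcauchy Y -> fcauchy Y' -> fcauchy (fun n => chain_sub (Y n) (Y' n)).
Proof.
move=> [YK h] [Y'K h']; split=> [n|e e0]; first exact: polyhedral_sub.
have e2 : 0 < e / 2 by rewrite divr_gt0.
have [N hN] := h _ e2; have [N' hN'] := h' _ e2; exists (maxn N N') => p n.
rewrite !geq_max => /andP[p1 p2] /andP[n1 n2].
apply: le_lt_trans (dF_sub4 _ _ _ _) _ => //.
by rewrite [e]splitr; apply: ltrD; [exact: hN|exact: hN'].
Qed.

Lemma fcauchy_eqv Y Y' : fcauchy Y -> (forall n, poly (Y' n)) ->
  (forall n, eqv (Y n) (Y' n)) -> fcauchy Y'.
Proof.
move=> YC Y'K E; apply: (fclose_cauchy nrmP YC) => //.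
exact: (fclose_sym nrmP YC.1 Y'K (fclose_eqv nrmP YC.1 Y'K E)).
Qed.

(** What holds along the ultrafilter is only known for arbitrarily large indices; the Cauchy
    property extends it to all large ones. *)
Lemma often_close S S' (e e' : R) : fcauchy S -> fcauchy S' -> e < e' ->
  (forall N, exists2 n, (N <= n)%N & dF (S n) (S' n) < e) ->
  exists N, forall n, (N <= n)%N -> dF (S n) (S' n) < e'.
Proof.
move=> [SK h] [S'K h'] ee' of_; have e2 : 0 < (e' - e) / 2 by rewrite divr_gt0 ?subr_gt0.
have [N hN] := h _ e2; have [N' hN'] := h' _ e2; exists (maxn N N') => n.
have [p] := of_ (maxn N N'); rewrite !geq_max => /andP[p1 p2] lt /andP[n1 n2].
have t1 := dF_tri nrmP (@SK n) (@SK p) (@S'K n); have t2 := dF_tri nrmP (@SK p) (@S'K p) (@S'K n).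
have t3 := hN _ _ n1 p1; have t4 := hN' _ _ p2 n2.
by move: t1 t2 t3 t4 lt; move: (dF _ _) (dF _ _) (dF _ _) (dF _ _) (dF _ _) => *; lra.
Qed.

Lemma rsC_eqv A (P : chain R G d k) : nondeg P -> polyset A -> eqv (chain_sub P (rs A P)) (rs (~` A) P).
Proof.
move=> Pf pA; apply: evt_mono (evtI (rs_coef Pf pA) (rs_coef Pf (polysetC pA))).
move=> t _ [E1 E2]; rewrite coef_sub E1 E2 /setC /= asbool_neg.
by case: ifP => _ /=; rewrite ?subrr ?subr0.
Qed.

Lemma goodC A : good A -> good (~` A).
Proof.
move=> [rA h]; split; first exact: (regC rA).
move=> Y YC; have [YK _] := YC.1; have pA := rA.1.
apply: (fcauchy_eqv (fcauchy_sub YC.1 (h _ YC))) => n.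
  by apply: rs_polyhedral => //; exact: polysetC.
by apply: rsC_eqv => //; exact: nd (@YK n).
Qed.

Lemma controlled_rs A Y : good A -> controlled Y -> controlled (fun n => rs A (Y n)).
Proof.
move=> gA YC; have [YK _] := YC.1; split; first exact: gA.2.
move=> F n pF; have pA := good_polyset gA; have Yf := nd (@YK n).
have pI := polysetI pF pA; apply: le_trans (YC.2 _ _ pF).
rewrite (_ : M _ = M (rs (F `&` A) (Y n))).
  by apply: M_rs_mono => // x [].
apply: (M_eqv nrmP); [|exact: rs_nondeg|exact: rs_rs_eqv].
by do 2 ! apply: rs_nondeg => //.
Qed.

Lemma goodI A A' : good A -> good A' -> good (A `&` A').
Proof.
move=> gA gA'; have pA := good_polyset gA; have pA' := good_polyset gA'.
have XK' n := @XK n; split; first exact: (regI nrmP UU XK' XB gA.1 gA'.1).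
move=> Y YC; have [YK _] := YC.1.
apply: (fcauchy_eqv (gA.2 _ (controlled_rs gA' YC))) => n.
  by apply: rs_polyhedral => //; exact: polysetI.
by apply: rs_rs_eqv => //; exact: nd (@YK n).
Qed.

Lemma goodD A A' : good A -> good A' -> good (A `\` A').
Proof. by move=> gA gA'; rewrite setDE; apply: goodI => //; exact: goodC. Qed.

Lemma goodU A A' : good A -> good A' -> good (A `|` A').
Proof.
by move=> gA gA'; rewrite -[_ `|` _]setCK setCU; apply/goodC/goodI; exact: goodC.
Qed.

Lemma goodT : good setT.
Proof.
have XK' n := @XK n; split; first exact: (regT nrmP UU XK' XB).
move=> Y YC; have [YK _] := YC.1; have pT := @polysetT R d.
apply: (fcauchy_eqv YC.1) => n; first exact: rs_polyhedral.
by apply: evt_mono (rs_coef (nd (@YK n)) pT) => t _ ->; rewrite asboolT.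
Qed.

Lemma good0 : good set0. Proof. by rewrite -(setDv setT); apply: goodD; exact: goodT. Qed.

Definition slab_ok i s : Prop := slabgood nrm X i s /\
  forall e, 0 < e -> exists2 de, 0 < de & fm nu (slab i s de) <= e.

Lemma countable_slab_ok i : countable [set s | ~ slab_ok i s].
Proof.
apply: sub_countable (countable_setU (Xgood i) (borel_outer_slab nuP i)).
by apply: subset_card_le => s /not_andP[h|h]; [left|right].
Qed.

Lemma controlled_slabgood Y i s : controlled Y -> slab_ok i s -> slabgood nrm Y i s.
Proof.
move=> [[YK _] Yc] [gX gnu] e e0; have e2 : 0 < e / 2 by rewrite divr_gt0.
have [d1 d10 [N hN]] := gX _ e2; have [d2 d20 h2] := gnu _ e2.
pose de := Num.min d1 d2; have de0 : 0 < de by rewrite lt_min d10.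
exists de => //; exists N => n Nn.
have sub d' : de <= d' -> slab i s de `<=` slab i s d'.
  by move=> le x /andP[x1 x2]; apply/andP; split; lra.
apply: le_trans (Yc _ _ (polyset_slab i s de)) _; rewrite [e]splitr; apply: lerD.
  apply: le_trans (hN _ Nn); apply: M_rs_mono => //; try exact: polyset_slab.
    exact: nd (@XK n).
  by apply: sub; rewrite ge_min lexx.
apply: le_trans h2; apply: (fm_mono nuP); apply: sub.
by rewrite ge_min lexx orbT.
Qed.

Lemma good_HS b i s : slab_ok i s -> good (HS b i s).
Proof.
move=> ok; have XK' n := @XK n; split; first exact: (reg_HS nrmP UU Uoo XK' XB b ok.1).
by move=> Y YC; apply: rs_halfspace_cauchy => //; [case: YC|exact: controlled_slabgood].
Qed.

Definition sd E A : R := m (E `\` A) + m (A `\` E).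

(** The Borel sets approximable by good sets form a sigma-algebra, which contains the half-spaces at
    the levels allowed by [slab_ok]. *)
Lemma good_approx E : borel E -> forall e, 0 < e -> exists2 A, good A & sd E A < e.
Proof.
have mP := total_outer.
have m0 : m set0 = 0 by exact: fm0.
move=> bE; suff [] : borel E /\ forall e, 0 < e -> exists2 A, good A & sd E A < e by [].
pose Sg : set (set 'rV[R]_d) := fun E =>
  borel E /\ forall e, 0 < e -> exists2 A, good A & sd E A < e.
apply: (@borel_generated R d slab_ok _ Sg) bE => [i a b ab||i s ok].
- by have [s /contrapT ok sab] := countable_avoid (countable_slab_ok i) ab; exists s.
- split=> [|A [bA h]|F hF].
  + split; first exact: borel0.
    by move=> e e0; exists set0; [exact: good0|rewrite /sd setDv m0 addr0].
  + rewrite setTD; split; first exact: borelC.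
    move=> e /h[A' gA' lt]; exists (~` A'); first exact: goodC.
    by rewrite /sd !setDE !setCK addrC setIC -setDE [X in _ + m X]setIC -setDE.
  split; first by apply: borel_bigcup => i; case: (hF i).
  move=> e e0; have e3 : 0 < e / 3 by rewrite divr_gt0.
  have bD (n : nat) : borel (seqDU F n).
    apply: borelD; first by case: (hF n).
    by apply: borel_bigsetU => j; case: (hF j).
  have [N /(_ N (leqnn N)) hN] := fm_tail mP bD (@trivIset_seqDU _ F) e3.
  have eN : 0 < e / 3 / N.+1%:R by rewrite divr_gt0.
  have exA (n : nat) : exists A, good A /\ sd (F n) A < e / 3 / N.+1%:R.
    by have [A gA lt] := (hF n).2 _ eN; exists A.
  have [A hA] := choice exA; exists (\big[setU/set0]_(i < N) A i).
    elim: (N) => [|n IH]; first by rewrite big_ord0; exact: good0.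
    by rewrite big_ord_recr; apply: goodU => //; case: (hA n).
  have b1 n : m ((\big[setU/set0]_(i < n) F i) `\` \big[setU/set0]_(i < n) A i) +
      m ((\big[setU/set0]_(i < n) A i) `\` \big[setU/set0]_(i < n) F i) <= n%:R * (e / 3 / N.+1%:R).
    elim: n => [|n IH]; first by rewrite !big_ord0 setD0 m0 addr0 mul0r.
    rewrite !big_ord_recr /=.
    set F1 := \big[_/_]_(i < n) F i in IH *; set A1 := \big[_/_]_(i < n) A i in IH *.
    have l1 : m ((F1 `|` F n) `\` (A1 `|` A n)) <= m (F1 `\` A1) + m (F n `\` A n).
      apply: le_trans (fmU mP _ _); apply: (fm_mono mP) => x [[h|h] /not_orP[n1 n2]]; by [left|right].
    have l2 : m ((A1 `|` A n) `\` (F1 `|` F n)) <= m (A1 `\` F1) + m (A n `\` F n).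
      apply: le_trans (fmU mP _ _); apply: (fm_mono mP) => x [[h|h] /not_orP[n1 n2]]; by [left|right].
    have [_ l3] := hA n; rewrite /sd in l3; set q := e / 3 / _ in l3 IH *.
    rewrite (_ : n.+1%:R * q = n%:R * q + q); first by move: (n%:R * q) IH => z IH; lra.
    by rewrite -natr1 mulrDl mul1r.
  (* Past the first [N] sets, the union is covered by disjoint pieces, whose total measure is small
     by [fm_tail]. *)
  have FE : \bigcup_i F i = \big[setU/set0]_(i < N) F i `|` \bigcup_i seqDU F (N + i)%N.
    rewrite seqDU_bigcup_eq (bigcup_splitn N); congr (_ `|` _).
    rewrite -!bigcup_mkord; apply/seteqP; split=> x [i /= iN].
      by move=> [Fx _]; exists i.
    move=> Fx; have [j Dx jF] : exists2 j, seqDU F j x & (j <= i)%N.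
      have [j jP jmin] := @ex_minnP (fun j => `[< F j x >]) (ex_intro _ i (asboolT Fx)).
      exists j; last by apply: jmin; exact/asboolP.
      split; first exact/asboolP.
      rewrite -bigcup_mkord => -[l /= lj Fl]; move: lj; rewrite ltnNge => /negP; apply.
      by apply: jmin; exact/asboolP.
    by exists j => //=; exact: leq_ltn_trans iN.
  have := b1 N; rewrite /sd FE.
  set F1 := \big[_/_]_(i < N) F i; set A1 := \big[_/_]_(i < N) A i; set T := \bigcup_i _ in hN *.
  have l1 : m ((F1 `|` T) `\` A1) <= m (F1 `\` A1) + m T.
    apply: le_trans (fmU mP _ _); apply: (fm_mono mP) => x [[h|h] n1]; by [left|right].
  have l2 : m (A1 `\` (F1 `|` T)) <= m (A1 `\` F1).
    by apply: (fm_mono mP) => x [h /not_orP[n1 _]].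
  have l3 : N%:R * (e / 3 / N.+1%:R) <= e / 3.
    apply: (@le_trans _ _ (N.+1%:R * (e / 3 / N.+1%:R))).
      by apply: ler_wpM2r; [exact: ltW|rewrite ler_nat].
    by rewrite mulrC divfK ?pnatr_eq0.
  by move: l1 l2 l3 hN; move: (N%:R * _) => z; lra.
split; first exact: borel_coord.
move=> e e0; exists (HS true i s); first exact: good_HS.
by rewrite HSE /sd setDv m0 addr0.
Qed.

Section Represented.
Variables (Y : nat -> chain R G d k) (YC : controlled Y).
Let YK n : poly (Y n). Proof. by case: YC.1. Qed.

(* [S] represents the restriction of the limit of [Y] to the Borel set [E]. *)
Definition represents E S : Prop := fcauchy S /\ forall e, 0 < e -> exists A,
  [/\ good A, sd E A < e & exists N, forall n, (N <= n)%N -> dF (S n) (rs A (Y n)) < e].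

Lemma rs_good_poly A n : good A -> poly (rs A (Y n)).
Proof. by move=> gA; apply: rs_polyhedral; [exact: YK|exact: good_polyset]. Qed.

(** [kap] bounds only the ultralimit of the masses of [X n] in [A], so the conclusion holds for
    arbitrarily large [n] and not for all of them. *)
Lemma good_mass_often A (c : R) : good A -> m A < c ->
  forall N, exists2 n, (N <= n)%N & M (rs A (Y n)) < c.
Proof.
move=> gA mc N; have pA := good_polyset gA; have XK' n := @XK n.
have e0 : 0 < c - m A by rewrite subr_gt0.
have [n Nn /= lt] := ul_often UU Uoo N
  (ul_near UU (fun n => restr_bound nrmP XK' XB n pA) e0).
exists n => //; have := YC.2 A n pA.
have : limit_mass nrm U X A <= fm kap A.
  rewrite -lee_fin -(fmE kapP).
  exact: (limit_mass_le_kappa nrmP Kcompact UU XK' XB gA.1).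
move: lt mc; rewrite totalE /limit_mass ltr_norml => /andP[+ _].
by move: (M _) (M _) (fm kap A) (fm nu A) (ul _ _) => *; lra.
Qed.

Lemma dF_rs A A' n : good A -> good A' ->
  dF (rs A (Y n)) (rs A' (Y n)) <= M (rs ((A `\` A') `|` (A' `\` A)) (Y n)).
Proof.
move=> gA gA'; have pA := good_polyset gA; have pA' := good_polyset gA'.
apply: le_trans (dF_le_M nrmP (@rs_good_poly _ n gA) (@rs_good_poly _ n gA')) _.
apply: M_rs_diff => //; first exact: nd (@YK n).
  by apply: polysetU; exact: polysetD.
move=> x nx; split=> h; apply: contrapT => h'; apply: nx; by [left|right].
Qed.

Lemma dF_rs_eventually A A' (c : R) : good A -> good A' ->
  m (A `\` A') + m (A' `\` A) < c ->
  exists N, forall n, (N <= n)%N -> dF (rs A (Y n)) (rs A' (Y n)) < c.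
Proof.
move=> gA gA' lt; have mP := total_outer.
pose D := (A `\` A') `|` (A' `\` A).
have gD : good D by apply: goodU; exact: goodD.
have mD : m D <= m (A `\` A') + m (A' `\` A) by exact: fmU.
have hc : (m D + c) / 2 < c by lra.
apply: (often_close (gA.2 _ YC) (gA'.2 _ YC) hc) => N.
have [|n Nn l1] := good_mass_often gD (c := (m D + c) / 2) _ N; first by lra.
by exists n => //; apply: le_lt_trans (dF_rs n gA gA') l1.
Qed.

Lemma sd_dist E A A' : m (A `\` A') + m (A' `\` A) <= sd E A + sd E A'.
Proof.
have mP := total_outer; rewrite /sd.
have l1 : m (A `\` A') <= m (A `\` E) + m (E `\` A').
  apply: le_trans (fmU mP _ _); apply: (fm_mono mP) => x [Ax nx].
  by have [Ex|nE] := pselect (E x); [right|left].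
have l2 : m (A' `\` A) <= m (A' `\` E) + m (E `\` A).
  apply: le_trans (fmU mP _ _); apply: (fm_mono mP) => x [Ax nx].
  by have [Ex|nE] := pselect (E x); [right|left].
lra.
Qed.

(** Diagonal sequence: good sets [A j] approximate [E] within 1 / (j + 1), and [N j] is so large
    that the restriction of [Y (N j)] to [A j] is within 1 / (j + 1) of all later ones. *)
Lemma represents_exists E : borel E -> exists S, represents E S.
Proof.
move=> bE; pose e_ j : R := j.+1%:R^-1.
have e_0 j : 0 < e_ j by rewrite invr_gt0 ltr0n.
have exA j : exists A, good A /\ sd E A < e_ j.
  by have [A gA lt] := good_approx bE (e_0 j); exists A.
have [A hA] := choice exA; have gA j : good (A j) by case: (hA j).
have exN j : exists N, forall p n, (N <= p)%N -> (N <= n)%N ->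
    dF (rs (A j) (Y p)) (rs (A j) (Y n)) < e_ j.
  by have [_ h] := (gA j).2 _ YC; exact: h.
have [N hN] := choice exN; pose S j := rs (A j) (Y (N j)).
have SK j : poly (S j) by exact: rs_good_poly.
have key l j n : (N j <= n)%N -> dF (S l) (rs (A j) (Y n)) <= 2 * e_ l + 2 * e_ j.
  move=> jn; have lt : m (A l `\` A j) + m (A j `\` A l) < e_ l + e_ j.
    by apply: le_lt_trans (sd_dist E _ _) _; apply: ltrD; [case: (hA l)|case: (hA j)].
  have [N0 h0] := dF_rs_eventually (gA l) (gA j) lt.
  pose p := maxn N0 (maxn (N l) (N j)).
  have p0 : (N0 <= p)%N by rewrite leq_maxl.
  have pl : (N l <= p)%N by rewrite /p maxnA maxnAC leq_maxr.
  have pj : (N j <= p)%N by rewrite /p maxnA leq_maxr.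
  have Pl := @rs_good_poly _ p (gA l); have Pj := @rs_good_poly _ p (gA j).
  have t1 := dF_tri nrmP (SK l) Pl (@rs_good_poly _ n (gA j)).
  have t2 := dF_tri nrmP Pl Pj (@rs_good_poly _ n (gA j)).
  have t3 := hN l _ _ (leqnn _) pl; have t4 := h0 _ p0; have t5 := hN j _ _ pj jn.
  rewrite -/(S l) in t3.
  by move: t1 t2 t3 t4 t5; move: (dF _ _) (dF _ _) (dF _ _) (dF _ _) (dF _ _) (e_ l) (e_ j) => *; lra.
have small e : 0 < e -> exists n0, forall n, (n0 <= n)%N -> e_ n < e.
  by move=> e0; have [n0 _ hn] := near_infty_natSinv_lt (PosNum e0); exists n0.
exists S; split; first split=> // e e0.
  have e4 : 0 < e / 4 by rewrite divr_gt0.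
  have [n0 h0] := small _ e4; exists n0 => p n /h0 p0 /h0 q0.
  have := key p n (N n) (leqnn _); rewrite -/(S n); move: p0 q0.
  by move: (e_ p) (e_ n) (dF _ _) => *; lra.
move=> e e0; have e4 : 0 < e / 4 by rewrite divr_gt0.
have [n0 h0] := small _ e4; exists (A n0); split => //.
  have [_ lt] := hA n0; apply: lt_trans lt _; have := h0 _ (leqnn _).
  by move: (e_ n0) => x; lra.
exists (maxn n0 (N n0)) => n; rewrite geq_max => /andP[/h0 n1 n2].
have := key n n0 n n2; have := h0 _ (leqnn _); move: n1.
by move: (e_ n) (e_ n0) (dF _ _) => *; lra.
Qed.

Lemma represents_mass E S : borel E -> represents E S ->
  (flat_mass nrm K S <= (m E)%:E)%E.
Proof.
move=> bE [SC h]; have mP := total_outer; apply: (flat_mass_le nrmP SC) => e e0.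
have e3 : 0 < e / 3 by rewrite divr_gt0.
have [A [gA lt [N hN]]] := h _ e3; have bA := good_borel gA.
have mA : m A <= m E + sd E A.
  rewrite /sd; have := fm_split mP A bE; have : m (A `&` E) <= m E by apply: (fm_mono mP) => x [].
  have := fm_ge0 mP (E `\` A); lra.
have [N' hN'] := SC.2 _ e3.
have mlt : m A < m E + e by lra.
have [n nn Mn] := good_mass_often gA mlt (maxn N N').
move: nn; rewrite geq_max => /andP[n1 n2].
exists (rs A (Y n)); split => //; first exact: rs_good_poly.
have [SK _] := SC; exists N' => j j1.
have t1 := dF_tri nrmP (@rs_good_poly _ n gA) (@SK n) (@SK j).
rewrite (dF_sym nrmP (@rs_good_poly _ n gA) (@SK n)) in t1.
have t2 := hN _ n1; have t3 := hN' _ _ n2 j1.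
by move: t1 t2 t3; move: (dF _ _) (dF _ _) (dF _ _) => *; lra.
Qed.

Lemma represents_good A S : good A -> represents A S -> fclose S (fun n => rs A (Y n)).
Proof.
move=> gA [SC h] e e0; have e2 : 0 < e / 2 by rewrite divr_gt0.
have [A' [gA' lt [N hN]]] := h _ e2; have [SK _] := SC.
have [N' hN'] := dF_rs_eventually gA gA' lt.
exists (maxn N N') => n; rewrite geq_max => /andP[/hN l1 /hN' l2].
have := dF_tri nrmP (@SK n) (@rs_good_poly _ n gA') (@rs_good_poly _ n gA).
rewrite (dF_sym nrmP (@rs_good_poly _ n gA') (@rs_good_poly _ n gA)).
by move: l1 l2; move: (dF _ _) (dF _ _) (dF _ _) => *; lra.
Qed.

Lemma represents_eqv E S S' : (forall n, poly (S' n)) -> (forall n, eqv (S n) (S' n)) ->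
  represents E S -> represents E S'.
Proof.
move=> S'K E' [SC h]; have [SK _] := SC; split; first exact: fcauchy_eqv E'.
move=> e /h[A [gA lt [N hN]]]; exists A; split => //; exists N => n /hN l.
have := dF_tri nrmP (@S'K n) (@SK n) (@rs_good_poly _ n gA).
rewrite (dF_sym nrmP (@S'K n) (@SK n)) (dF_eqv0 nrmP (@SK n) (@S'K n) (E' n)) add0r.
by move=> /le_lt_trans; apply.
Qed.

(** Since [F] lies in [E], the approximation [A'] of [F] exceeds the approximation [A] of [E] by a
    set of small measure, so that restricting to [A] minus restricting to [A'] is nearly restricting
    to their set difference. *)
Lemma represents_sub E F S S' : F `<=` E -> represents E S -> represents F S' ->
  represents (E `\` F) (fun n => chain_sub (S n) (S' n)).
Proof.
move=> FE [SC h] [SC' h']; have mP := total_outer; split; first exact: fcauchy_sub.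
move=> e e0; have e6 : 0 < e / 6 by rewrite divr_gt0.
have [A [gA lt [N hN]]] := h _ e6; have [A' [gA' lt' [N' hN']]] := h' _ e6.
have gD := goodD gA gA'; have gD' := goodD gA' gA.
exists (A `\` A'); split=> //.
  move: lt lt'; rewrite /sd.
  have : m ((E `\` F) `\` (A `\` A')) <= m (E `\` A) + m (A' `\` F).
    apply: le_trans (fmU mP _ _); apply: (fm_mono mP) => x [[Ex nF] nA].
    have [Ax|nAx] := pselect (A x); last by left.
    by right; split => //; apply: contrapT => nA'; exact: nA.
  have : m ((A `\` A') `\` (E `\` F)) <= m (A `\` E) + m (F `\` A').
    apply: le_trans (fmU mP _ _); apply: (fm_mono mP) => x [[Ax nA'] nE].
    have [Ex|nEx] := pselect (E x); last by left.
    by right; split => //; apply: contrapT => nF; exact: nE.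
  have := fm_ge0 mP (E `\` A); have := fm_ge0 mP (A `\` E).
  have := fm_ge0 mP (F `\` A'); have := fm_ge0 mP (A' `\` F).
  by move: (m _) (m _) (m _) (m _) (m _) (m _) => *; lra.
have [SK _] := SC; have [SK' _] := SC'; have YK' n := @YK n.
have mD : m (A' `\` A) < e / 3.
  have : m (A' `\` A) <= m (A' `\` F) + m (E `\` A).
    apply: le_trans (fmU mP _ _); apply: (fm_mono mP) => x [Ax nA].
    by have [Fx|nF] := pselect (F x); [right; split => //; exact: FE|left].
  move: lt lt'; rewrite /sd; have := fm_ge0 mP (A `\` E); have := fm_ge0 mP (F `\` A').
  by move: (m _) (m _) (m _) (m _) (m _) => *; lra.
have hc : e * (5 / 6) < e by lra.
apply: (often_close (fcauchy_sub SC SC') (gD.2 _ YC) hc) => N0.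
have [n nn Mn] := good_mass_often gD' mD (maxn N0 (maxn N N')).
move: nn; rewrite !geq_max => /and3P[n0 n1 n2]; exists n => //.
have pA := good_polyset gA; have pA' := good_polyset gA'.
have pD := good_polyset gD; have pD' := good_polyset gD'.
have P1 := @rs_good_poly _ n gA; have P2 := @rs_good_poly _ n gA'.
have P3 := @rs_good_poly _ n gD; have P4 := @rs_good_poly _ n gD'; have Yf := nd (YK' n).
have P12 := polyhedral_sub P1 P2; have S12 := polyhedral_sub (@SK n) (@SK' n).
have t1 := dF_tri nrmP S12 P12 P3.
have t2 := dF_sub4 (@SK n) P1 (@SK' n) P2.
have t3 : dF (chain_sub (rs A (Y n)) (rs A' (Y n))) (rs (A `\` A') (Y n)) <= M (rs (A' `\` A) (Y n)).
  apply: le_trans (dF_le_M nrmP P12 P3) _; apply: (M_le nrmP).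
  - exact: nd (polyhedral_sub P12 P3).
  - exact: nd P4.
  apply: evt_mono (evtI (rs_coef Yf pA) (evtI (rs_coef Yf pA') (evtI (rs_coef Yf pD) (rs_coef Yf pD')))).
  move=> t _ [E1 [E2 [E3 E4]]]; rewrite !coef_sub E1 E2 E3 E4 /setD /= !asbool_and !asbool_neg.
  case: `[< A _ >]; case: `[< A' _ >]; rewrite /= ?subrr ?subr0 ?sub0r ?subrr ?(nrmN nrmP) //.
have t4 := hN _ n1; have t5 := hN' _ n2.
by move: t1 t2 t3 t4 t5 Mn; move: (dF _ _) (dF _ _) (dF _ _) (dF _ _) (dF _ _) (M _) => *; lra.
Qed.

Definition HSlist (l : seq (bool * 'I_d * R)) : set 'rV[R]_d :=
  foldr (fun h A => HS h.1.1 h.1.2 h.2 `&` A) setT l.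

(** [P] is an arbitrary approximating sequence, which need not be controlled; half-spaces are
    imposed one at a time because [rs_halfspace_close] handles a single level. *)
Lemma restrict_HSlist (P : nat -> chain R G d k) l : (forall n, poly (P n)) -> fclose P Y ->
  (forall h, h \in l -> slabgood nrm P h.1.2 h.2 /\ slab_ok h.1.2 h.2) ->
  good (HSlist l) /\ fclose (fun n => rs (HSlist l) (P n)) (fun n => rs (HSlist l) (Y n)).
Proof.
move=> PK PY; have YK' n := @YK n.
elim: l => [|h l IH] hl.
  have pT := @polysetT R d; split; first exact: goodT.
  have eT (Q : nat -> chain R G d k) : (forall n, poly (Q n)) -> forall n, eqv (Q n) (rs (HSlist [::]) (Q n)).
    by move=> QK n; apply: evt_mono (rs_coef (nd (QK n)) pT) => t _ ->; rewrite asboolT.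
  have rK (Q : nat -> chain R G d k) : (forall n, poly (Q n)) -> forall n, poly (rs (HSlist [::]) (Q n)).
    by move=> QK n; exact: rs_polyhedral.
  refine (fclose_trans nrmP (rK P PK) PK (rK Y YK') _ _).
    exact: (fclose_sym nrmP PK (rK P PK) (fclose_eqv nrmP PK (rK P PK) (eT P PK))).
  refine (fclose_trans nrmP PK YK' (rK Y YK') PY _).
  exact: (fclose_eqv nrmP YK' (rK Y YK') (eT Y YK')).
have [gA cA] := IH (fun h' h'l => hl h' (mem_behead (s := h :: l) h'l)).
have [gP okh] := hl h (mem_head _ _); have gY := controlled_slabgood YC okh.
have gH := good_HS h.1.1 okh; have pA := good_polyset gA; have pH := good_polyset gH.
have g1 := goodI gH gA; have p1 := good_polyset g1; split => //.
have slabA (Q : nat -> chain R G d k) : (forall n, poly (Q n)) -> slabgood nrm Q h.1.2 h.2 ->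
    slabgood nrm (fun n => rs (HSlist l) (Q n)) h.1.2 h.2.
  move=> QK gQ e /gQ[de de0 [N hN]]; exists de => //; exists N => n /hN; apply: le_trans.
  have Qf := nd (QK n); have pS := polyset_slab h.1.2 h.2 de.
  have pI := polysetI pS pA.
  rewrite (_ : M _ = M (rs (slab h.1.2 h.2 de `&` HSlist l) (Q n))).
    by apply: M_rs_mono => // x [].
  apply: (M_eqv nrmP); [|exact: rs_nondeg|exact: rs_rs_eqv].
  by do 2 ! apply: rs_nondeg => //.
have rK (Q : nat -> chain R G d k) A : polyset A -> (forall n, poly (Q n)) -> forall n, poly (rs A (Q n)).
  by move=> pA' QK n; exact: rs_polyhedral.
have eI (Q : nat -> chain R G d k) : (forall n, poly (Q n)) -> forall n,
    eqv (rs (HS h.1.1 h.1.2 h.2) (rs (HSlist l) (Q n))) (rs (HSlist (h :: l)) (Q n)).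
  by move=> QK n; apply: rs_rs_eqv => //; exact: nd (QK n).
have PA := rK P _ pA PK; have YA := rK Y _ pA YK'.
have c1 := rs_halfspace_close nrmP h.1.1 PA YA (slabA P PK gP) (slabA Y YK' gY) cA.
have P1 := rK P _ p1 PK; have Y1 := rK Y _ p1 YK'.
have PHA := rK (fun n => rs (HSlist l) (P n)) _ pH PA; have YHA := rK (fun n => rs (HSlist l) (Y n)) _ pH YA.
refine (fclose_trans nrmP P1 PHA Y1 _ _).
  exact: (fclose_sym nrmP PHA P1 (fclose_eqv nrmP PHA P1 (eI P PK))).
refine (fclose_trans nrmP PHA YHA Y1 c1 _).
exact: (fclose_eqv nrmP YHA Y1 (eI Y YK')).
Qed.

Lemma boxE (a b : 'rV[R]_d) : box a b = HSlist ([seq (true, i, b ord0 i) | i <- enum 'I_d] ++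
  [seq (false, i, a ord0 i) | i <- enum 'I_d]).
Proof.
have HSlistP l x : HSlist l x <-> forall h, h \in l -> HS h.1.1 h.1.2 h.2 x.
  elim: l => [|h l IH]; first by split.
  split=> [[h1 /IH h2] h'|hl]; first by rewrite inE => /predU1P[->|/h2].
  split; first by apply: hl; rewrite mem_head.
  by apply/IH => h' h'l; apply: hl; rewrite inE h'l orbT.
apply/seteqP; split => x.
  move=> bx; apply/HSlistP => h; rewrite mem_cat => /orP[] /mapP[i _ ->]; rewrite HSE /=;
    by have /andP[] := bx i.
move=> /HSlistP h i; apply/andP; split.
  have := h (false, i, a ord0 i); rewrite HSE; apply.
  by rewrite mem_cat map_f ?orbT // mem_enum.
have := h (true, i, b ord0 i); rewrite HSE; apply.
by rewrite mem_cat map_f // mem_enum.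
Qed.

(** By [represents_sub], after [n] subtractions the difference represents the restriction to what is
    left of the union, and its mass is bounded by the vanishing measure of that set. *)
Lemma countable_additivity (rho : set 'rV[R]_d -> nat -> chain R G d k) (E : nat -> set 'rV[R]_d) :
  (forall E, borel E -> represents E (rho E)) ->
  (forall n : nat, borel (E n)) -> trivIset setT E ->
  (fun n => flat_mass nrm K (flat_sub (rho (\bigcup_j E j))
     (fun m => flatten [seq rho (E j) m | j <- iota 0 n]))) @ \oo --> 0%E.
Proof.
move=> rhoP bE tE; set T := \bigcup_j E j; have mP := total_outer.
have bT : borel T by exact: borel_bigcup.
pose D n := T `\` \big[setU/set0]_(j < n) E j.
have bD (n : nat) : borel (D n) by apply: borelD => //; exact: borel_bigsetU.
have RD n : represents (D n) (flat_sub (rho T) (fun m => flatten [seq rho (E j) m | j <- iota 0 n])).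
  have rK (j n' : nat) : poly (rho (E j) n') by have [[]] := rhoP _ (bE j).
  have fK n' p : poly (flatten [seq rho (E j) p | j <- iota 0 n']).
    move=> e /flattenP[_ /mapP[i _ ->]]; exact: rK.
  have TK p : poly (rho T p) by have [[]] := rhoP _ bT.
  elim: n => [|n IH].
    rewrite /D big_ord0 setD0; apply: represents_eqv (rhoP _ bT) => p; first exact: polyhedral_sub.
    by apply: evtT => t; rewrite coef_sub coef_nil subr0.
  have sub : E n `<=` D n.
    move=> x Ex; split; first by exists n.
    rewrite -bigcup_mkord => -[i /= lin Ei].
    by have E' : n = i by [apply: tE => //; exists x]; rewrite E' ltnn in lin.
  have := represents_sub sub IH (rhoP _ (bE n)).
  rewrite /D setDDl (_ : (\big[setU/set0]_(j < n) E j) `|` E n = \big[setU/set0]_(j < n.+1) E j);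
    last by rewrite big_ord_recr.
  apply: represents_eqv => p; first exact/polyhedral_sub/fK.
  apply: evtT => t; rewrite !coef_sub.
  have -> : iota 0 n.+1 = iota 0 n ++ [:: n] by rewrite -addn1 iotaD add0n.
  rewrite map_cat flatten_cat coef_cat /= cats0.
  by rewrite opprD addrA.
pose u n := fine (flat_mass nrm K (flat_sub (rho T) (fun m => flatten [seq rho (E j) m | j <- iota 0 n]))).
have ule n : flat_mass nrm K (flat_sub (rho T) (fun m => flatten [seq rho (E j) m | j <- iota 0 n]))
    = (u n)%:E /\ 0 <= u n <= m (D n).
  have l1 := represents_mass (bD n) (RD n); have l0 := flat_mass_ge0 nrmP K
    (flat_sub (rho T) (fun m => flatten [seq rho (E j) m | j <- iota 0 n])).
  have uE : flat_mass nrm K (flat_sub (rho T) (fun m => flatten [seq rho (E j) m | j <- iota 0 n]))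
    = (u n)%:E.
    by rewrite /u fineK // ge0_fin_numE // (le_lt_trans l1) // ltry.
  by split => //; rewrite -!lee_fin -uE l0.
rewrite (_ : (fun n => flat_mass _ _ _) = EFin \o u); last by apply/funext => n; case: (ule n).
apply/(cvg_EFin0 (fun n => proj1 (andP (ule n).2))) => e e0.
have e2 : 0 < e / 2 by rewrite divr_gt0.
have [N hN] := fm_tail mP bE tE e2; exists N => n Nn.
have [_ /andP[_ le]] := ule n; apply: le_lt_trans le _.
apply: (@le_lt_trans _ _ (e / 2)); last by lra.
apply: le_trans (hN n Nn); apply: (fm_mono mP) => x [[i _ Ei] nx].
have ni : (n <= i)%N.
  by rewrite leqNgt; apply/negP => lt; apply: nx; rewrite -bigcup_mkord; exists i.
by exists (i - n)%N => //; rewrite subnKC.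
Qed.

(** Convergence of masses makes [P] optimal, so that in each direction all but countably many levels
    are good for both [P] and [Y]. A box whose faces are all at good levels is a finite intersection
    of good half-spaces. *)
Lemma optimal_boxes (rho : set 'rV[R]_d -> nat -> chain R G d k) (P : nat -> chain R G d k) :
  (forall E, borel E -> represents E (rho E)) -> (forall n, poly (P n)) ->
  flat_cvg nrm K P Y -> (fun n => mass nrm (P n)) @ \oo --> flat_mass nrm K Y ->
  almost_every_box (fun I => exists2 S : nat -> chain R G d k,
    forall n, box_restriction (P n) I (S n) & flat_cvg nrm K S (rho I)).
Proof.
move=> rhoP PK /(flat_cvgE nrmP PK YC.1) PY cvM; have YK' n := @YK n.
have PC := fclose_cauchy nrmP YC.1 PK PY.
have Yle : (flat_mass nrm K Y <= (B + fm nu setT)%:E)%E.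
  apply: (flat_mass_le nrmP YC.1) => e e0.
  have [N hN] := cauchy_nearT YC.1 e0; exists (Y N); split => //; last exact: hN.
  rewrite -(M_rsT nrmP (nd (YK' N))); have := YC.2 setT N (@polysetT R d).
  rewrite (M_rsT nrmP (nd (@XK N))); have := XB N.
  by move: (M _) (M _) (fm _ _) => *; lra.
have [mY YmY] : exists mY, flat_mass nrm K Y = mY%:E.
  exists (fine (flat_mass nrm K Y)); rewrite fineK // ge0_fin_numE; last exact: flat_mass_ge0.
  by apply: le_lt_trans Yle _; rewrite ltry.
have cvP : (fun n => M (P n)) @ \oo --> mY.
  by move: cvM; rewrite YmY => /fine_cvgP[_].
have Popt : optimal nrm K P mY.
  split=> e e0; last first.
    have /cvgrPdist_lt/(_ _ e0)[N _ hN] := cvP; exists N => n Nn.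
    have := hN n Nn; rewrite /= ltr_norml => /andP[+ _]; lra.
  have [de de0 h] := flat_mass_lsc nrmP YC.1 YmY e0.
  exists (de / 2); first by rewrite divr_gt0.
  move=> Q QK nQ; apply: h => //; apply: (nearT_close nrmP QK PK YK' PY nQ); lra.
have [B' hB'] : exists B', forall n, M (P n) <= B'.
  have /cvgrPdist_lt/(_ _ ltr01)[N _ hN] := cvP.
  exists (mY + 1 + \sum_(i < N) M (P i)) => n.
  have M0 j : 0 <= M (P j) by apply: (M_ge0 nrmP); exact: nd (PK j).
  have S0 : 0 <= \sum_(i < N) M (P i) by apply: sumr_ge0 => j _.
  have [Nn|nN] := leqP N n.
    by have := hN n Nn; rewrite /= ltr_norml => /andP[+ _]; lra.
  rewrite (bigD1 (Ordinal nN)) //=.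
  have : 0 <= \sum_(i < N | i != Ordinal nN) M (P i) by apply: sumr_ge0.
  have : 0 <= mY by rewrite -lee_fin -YmY; exact: flat_mass_ge0.
  lra.
pose bad i := [set s | ~ slab_ok i s] `|` [set s | ~ slabgood nrm P i s].
have cbad i : countable (bad i).
  apply: countable_setU; first exact: countable_slab_ok.
  exact: (optimal_slabgood nrmP i PC hB' Popt).
pose idx (j : 'I_(d + d)) : 'I_d := 
  match fintype.split j with inl l => l | inr l => l end.
apply: hausdorff_null_sub (coords_null (fun j => cbad (idx j))) => c /= nA.
apply: contrapT => no; apply: nA; set a := lsubmx c; set b := rsubmx c.
have okj j : slabgood nrm P (idx j) (c ord0 j) /\ slab_ok (idx j) (c ord0 j).
  by split; apply: contrapT => h; apply: no; exists j; [right|left].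
have idl i : idx (lshift d i) = i by rewrite /idx (unsplitK (inl i)).
have idr i : idx (rshift d i) = i by rewrite /idx (unsplitK (inr i)).
pose l := [seq (true, i, b ord0 i) | i <- enum 'I_d] ++ [seq (false, i, a ord0 i) | i <- enum 'I_d].
have hl h : h \in l -> slabgood nrm P h.1.2 h.2 /\ slab_ok h.1.2 h.2.
  rewrite mem_cat => /orP[] /mapP[i _ ->] /=; rewrite mxE.
    by rewrite -{1 3}(idr i); exact: okj.
  by rewrite -{1 3}(idl i); exact: okj.
have [gI cI] := restrict_HSlist PK PY hl; rewrite -boxE in gI cI.
have exS n : exists Q : chain R G d k, box_restriction (P n) (box a b) Q /\
    (poly Q /\ is_restr (box a b) (P n) Q).
  have [Q [h1 h2 h3 h4]] := box_restriction_exists a b (nd (PK n)).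
  exists Q; split => //; split => //; apply/polyhedralE; split => //; apply: h3.
  by have /polyhedralE[] := PK n.
have [S hS] := choice exS; exists S; first by move=> n; case: (hS n).
have bI := good_borel gI; have pI := good_polyset gI; have [rC _] := rhoP _ bI.
have SK n : poly (S n) by case: (hS n) => _ [].
apply/(flat_cvgE nrmP SK rC).
have PI n : poly (rs (box a b) (P n)) by exact: rs_polyhedral.
have YI n : poly (rs (box a b) (Y n)) by exact: rs_polyhedral.
have [rK _] := rC.
refine (fclose_trans nrmP SK PI rK _ _).
  apply: (fclose_eqv nrmP SK PI) => n; have [_ [_ h]] := hS n.
  by apply: evt_mono (evtI h (rs_coef (nd (PK n)) pI)) => t _ [-> ->].
refine (fclose_trans nrmP PI YI rK cI _).
apply: (fclose_sym nrmP rK YI); exact: represents_good gI (rhoP _ bI).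
Qed.

Lemma represents_restriction E0 S0 : borel E0 -> represents E0 S0 ->
  is_restriction nrm K Y E0 S0.
Proof.
move=> bE0 RS0.
(* The restriction map is a choice of representatives, with the given [S0] imposed at [E0]. *)
have ex E : exists S, (borel E -> represents E S) /\ (E = E0 -> S = S0).
  have [->|nE] := pselect (E = E0); first by exists S0.
  have [bE|nb] := pselect (borel E); last by exists S0.
  by have [S RS] := represents_exists bE; exists S.
have [rho hrho] := choice ex.
have rhoP E : borel E -> represents E (rho E) by case: (hrho E).
exists rho; last first.
  have -> : rho E0 = S0 by have [_] := hrho E0; exact.
  have [[SK _] _] := RS0; apply/(flat_eqE nrmP SK SK) => e e0.
  by exists 0%N => n _; rewrite (dFxx nrmP (@SK n)).
split.
- by move=> E /rhoP[SC _]; exact/(flat_chainE nrmP).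
- by move=> P PK; exact: optimal_boxes rhoP PK.
- by move=> E bE tE; exact: countable_additivity.
Qed.
End Represented.

(** The limit of [X] has no mass off [E], and [nu] none on [E]. So on a good set [A] close to [E],
    restricting [X - Z] loses little of [X] and retains little of [Z]. *)
Lemma represents_difference (Z : nat -> chain R G d k) E : (forall n, poly (Z n)) ->
  (forall A n, polyset A -> M (rs A (Z n)) <= fm nu A) ->
  fcauchy (fun n => chain_sub (X n) (Z n)) -> borel E -> fm kap (~` E) = 0 -> fm nu E = 0 ->
  is_restriction nrm K (fun n => chain_sub (X n) (Z n)) E X.
Proof.
move=> ZK Znu YC bE kE nE; set Y := fun n => chain_sub (X n) (Z n).
have cY : controlled Y.
  split=> // A n pA; apply: le_trans (M_rs_sub nrmP (nd (@XK n)) (nd (ZK n)) pA) _.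
  by apply: lerD => //; exact: Znu.
apply: (represents_restriction cY bE); split=> // e e0.
have e5 : 0 < e / 5 by rewrite divr_gt0.
have [A gA lt] := good_approx bE e5; exists A; split => //; first by lra.
have mP := total_outer; have pA := good_polyset gA.
have k1 : fm kap (~` A) <= fm kap (E `\` A).
  apply: le_trans (_ : _ <= fm kap (~` E) + fm kap (E `\` A)) _; last by rewrite kE add0r.
  apply: le_trans (fmU kapP _ _); apply: (fm_mono kapP) => x nA.
  by have [Ex|] := pselect (E x); [right|left].
have n1 : fm nu A <= fm nu (A `\` E).
  apply: le_trans (_ : _ <= fm nu E + fm nu (A `\` E)) _; last by rewrite nE add0r.
  apply: le_trans (fmU nuP _ _); apply: (fm_mono nuP) => x Ax.
  by have [Ex|] := pselect (E x); [left|right].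
have kn : fm kap (E `\` A) <= m (E `\` A) /\ fm nu (A `\` E) <= m (A `\` E).
  rewrite !totalE; have := fm_ge0 kapP (A `\` E); have := fm_ge0 nuP (E `\` A).
  by move: (fm _ _) (fm _ _) (fm _ _) (fm _ _) => *; split; lra.
have sdE : fm kap (~` A) < e / 5 /\ fm nu A < e / 5.
  move: lt kn k1 n1; rewrite /sd; have := fm_ge0 mP (E `\` A); have := fm_ge0 mP (A `\` E).
  by move: (fm _ _) (fm _ _) (fm _ _) (fm _ _) (fm _ _) (fm _ _) => ? ? ? ? ? ? ? ? ? [? ?] ? ?; split; lra.
have gC := goodC gA; have pC := good_polyset gC; have XK' n := @XK n.
have half : e * (4 / 5) < e by lra.
apply: (often_close XC (gA.2 _ cY) half) => N.
have [n Nn /= ln] := ul_often UU Uoo N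
  (ul_near UU (fun n => restr_bound nrmP XK' XB n pC) e5).
exists n => //.
have lk : limit_mass nrm U X (~` A) <= fm kap (~` A).
  rewrite -lee_fin -(fmE kapP).
  exact: (limit_mass_le_kappa nrmP Kcompact UU XK' XB gC.1).
have YK : poly (Y n) by have [h _] := YC; exact: h.
have Yf := nd YK; have Xf := nd (XK' n); have Zf := nd (ZK n).
have rK := rs_polyhedral YK pA.
apply: le_lt_trans (dF_le_M nrmP (XK' n) rK) _.
have l1 : M (chain_sub (X n) (rs A (Y n))) <= M (rs (~` A) (X n)) + M (rs A (Z n)).
  apply: (M_le2 nrmP); [exact: nd (polyhedral_sub (XK' n) rK)|exact: rs_nondeg|exact: rs_nondeg|].
  apply: evt_mono (evtI (rs_coef Yf pA) (evtI (rs_coef Xf pC) (rs_coef Zf pA))).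
  move=> t _ [E1 [E2 E3]]; rewrite coef_sub E1 E2 E3 coef_sub /setC /= asbool_neg.
  case: ifP => _ /=; last by rewrite subr0 (nrm0 nrmP) addr0.
  by rewrite opprB addrC subrK (nrm0 nrmP) add0r.
move: ln lk l1 sdE (Znu A n pA); rewrite /limit_mass ltr_norml.
by move: (M _) (M _) (M _) (fm _ _) (fm _ _) (ul _ _) => ? ? ? ? ? ? /andP[? ?] ? ? [? ?] ?; lra.
Qed.
End BorelRestriction.

(** * Folding a simplex *)

Section Fold.
Variables (R : realType) (d k : nat).
Implicit Types (s : 'M[R]_(k.+1, d)) (x y z c w : 'rV[R]_d) (tau : R).

Lemma nsq_add_le n (a b : 'rV[R]_n) (t : R) : 0 < t ->
  nsq (a + b) <= (1 + t) * nsq a + (1 + t^-1) * nsq b.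
Proof.
move=> t0; rewrite /nsq !mulr_sumr -big_split /=; apply: ler_sum => i _; rewrite !mxE.
set u := a _ _; set v := b _ _.
have : 0 <= t^-1 * (t * u - v) ^+ 2 by rewrite mulr_ge0 ?invr_ge0 ?sqr_ge0 // ltW.
have -> : t^-1 * (t * u - v) ^+ 2 = t * u ^+ 2 - 2 * (u * v) + t^-1 * v ^+ 2.
  by field; rewrite gt_eqF.
rewrite !mulrDl !mul1r; move: (t * _) (t^-1 * _) => p q; rewrite sqrrD; nra.
Qed.

Lemma shear_lipschitz (phi : 'cV[R]_(d + 1)) y : exists2 C : R, 0 < C &
  forall tau, 0 < tau <= 1 -> forall x x',
    euclid ((x + (tau * aff phi x) *: y) - (x' + (tau * aff phi x') *: y)) <=
      (1 + tau * C) * euclid (x - x').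
Proof.
have [L L0 hL] := aff_lip phi; pose C := L ^+ 2 * nsq y.
have C0 : 0 <= C by rewrite mulr_ge0 ?sqr_ge0 // nsq_ge0.
exists (1 + 2 * C); first by rewrite ltr_pwDl // mulr_ge0.
move=> tau /andP[t0 t1] x x'.
have -> : (x + (tau * aff phi x) *: y) - (x' + (tau * aff phi x') *: y) =
    (x - x') + (tau * (aff phi x - aff phi x')) *: y.
  by rewrite opprD addrACA -scalerBl mulrBr.
have b0 : 0 <= (1 + tau * (1 + 2 * C)) * euclid (x - x').
  by rewrite mulr_ge0 ?euclid_ge0 // addr_ge0 // mulr_ge0 ?ltW // ltr_pwDl // mulr_ge0.
rewrite -(ler_pXn2r (n := 2)) ?nnegrE ?euclid_ge0 // exprMn !euclidE !sqr_sqrtr ?nsq_ge0 //.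
(* Young's inequality is used with the parameter [tau] itself, which keeps the squared Lipschitz
   constant at 1 + O(tau). *)
apply: le_trans (nsq_add_le _ _ t0) _; rewrite nsqZ.
have dle : (aff phi x - aff phi x') ^+ 2 <= L ^+ 2 * nsq (x - x').
  have := hL x x'; rewrite -(ler_pXn2r (n := 2)) ?nnegrE ?normr_ge0 //; last first.
    by rewrite mulr_ge0 ?euclid_ge0 // ltW.
  by rewrite real_normK ?num_real // exprMn euclidE sqr_sqrtr // nsq_ge0.
have n0 := nsq_ge0 (x - x'); have y0 := nsq_ge0 y.
have h1 : (1 + tau^-1) * ((tau * (aff phi x - aff phi x')) ^+ 2 * nsq y) <=
    (tau ^+ 2 + tau) * (C * nsq (x - x')).
  have -> : (1 + tau^-1) * ((tau * (aff phi x - aff phi x')) ^+ 2 * nsq y) =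
      (tau ^+ 2 + tau) * ((aff phi x - aff phi x') ^+ 2 * nsq y).
    by field; rewrite gt_eqF.
  apply: ler_wpM2l; first by rewrite addr_ge0 ?sqr_ge0 // ltW.
  by rewrite /C (mulrAC (L ^+ 2)); apply: ler_wpM2r.
have h2 : (tau ^+ 2 + tau) * (C * nsq (x - x')) <= 2 * tau * (C * nsq (x - x')).
  apply: ler_wpM2r; first exact: mulr_ge0.
  by rewrite expr2; nra.
apply: le_trans (lerD (lexx _) (le_trans h1 h2)) _.
have -> : (1 + tau) * nsq (x - x') + 2 * tau * (C * nsq (x - x')) =
  (1 + tau + 2 * tau * C) * nsq (x - x') by ring.
apply: ler_wpM2r => //; rewrite expr2.
have : 0 <= tau * C by rewrite mulr_ge0 // ltW.
have : 0 <= tau * tau by rewrite mulr_ge0 // ltW.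
nra.
Qed.

Lemma expr1D_le (u : R) n : 0 <= u <= 1 -> (1 + u) ^+ n <= 1 + u * 3 ^+ n.
Proof.
move=> /andP[u0 u1]; elim: n => [|n IH]; first by rewrite !expr0; lra.
rewrite !exprS; have e1 : 1 <= 3 ^+ n :> R by rewrite exprn_ege1 // ler1n.
apply: le_trans (_ : _ <= (1 + u) * (1 + u * 3 ^+ n)) _.
  by apply: ler_wpM2l => //; lra.
have : u * (u * 3 ^+ n) <= u * 3 ^+ n.
  by rewrite ler_piMl // mulr_ge0 // exprn_ge0.
have : u <= u * 3 ^+ n by rewrite ler_peMr.
nra.
Qed.

Lemma hull_weights m (t : 'M[R]_(m.+1, d)) x : hull t x -> exists u : 'rV[R]_m.+1,
  [/\ forall i, 0 <= u ord0 i, \sum_i u ord0 i = 1, x = u *m t & hmat x = u *m hmat t].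
Proof.
move=> [u [u0 u1] <-]; exists u; split=> //.
by rewrite hmat_comb // => i; rewrite (ord1 i).
Qed.

Definition apex s c tau : 'rV[R]_d := seg (bary s) c tau.

(** The faces of the cone other than its base [s]; this one omits the vertex [i] of [s]. *)
Definition side s c tau (i : 'I_k.+1) : 'M[R]_(k.+1, d) :=
  row' (lift ord0 i) (cone (apex s c tau) s).

Lemma hmat_bary s : hmat (bary s) = (const_mx k.+1%:R^-1 : 'rV[R]_k.+1) *m hmat s.
Proof. by apply: hmat_comb => i; rewrite (ord1 i) bary_weights. Qed.

Lemma apex_free s c tau : affinely_independent s -> ~~ (hmat c <= hmat s)%MS ->
  0 < tau -> affinely_independent (cone (apex s c tau) s).
Proof.
move=> sf cs t0; apply: cone_free => //; apply: contra cs; rewrite hmat_seg => h.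
rewrite -[hmat c](scalerK (lt0r_neq0 t0)) scalemx_sub //.
rewrite -[tau *: hmat c](addKr ((1 - tau) *: hmat (bary s))) addmx_sub //.
by rewrite -scalerN scalemx_sub // eqmx_opp hmat_bary submxMl.
Qed.

(* Weights of a point of [side s c tau i]: [u0] on the apex, [u j] on the
   vertices of [s], with [u i = 0]. *)
Lemma side_weights s c tau i z : affinely_independent s -> ~~ (hmat c <= hmat s)%MS ->
  0 < tau -> hull (side s c tau i) z -> exists (u0 : R) (u : 'rV[R]_k.+1),
    [/\ 0 <= u0, forall j, 0 <= u ord0 j, u ord0 i = 0, u0 + \sum_j u ord0 j = 1 &
      hmat z = u0 *: hmat (apex s c tau) + u *m hmat s].
Proof.
move=> sf cs t0; have qf := apex_free sf cs t0.
move=> /(hull_row' _ _ qf)[/hull_weights[v [v0 v1 zE hz]] l0].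
exists (v ord0 ord0), (\row_j v ord0 (lift ord0 j)); split=> //.
- by move=> j; rewrite mxE.
- by move: l0; rewrite (lamE _ qf hz) mxE.
- by rewrite -[RHS]v1 [RHS]big_ord_recl; congr (_ + _); apply: eq_bigr => j _; rewrite mxE.
- by rewrite hz mulmx_cone.
Qed.

(** The part of [s] below [side s c tau i]: the join of the barycentre with the facet opposite to
    the vertex [i]. *)
Definition min_region s (i : 'I_k.+1) : set 'rV[R]_d :=
  [set x | hull s x /\ forall j, aff (lam s i) x <= aff (lam s j) x].

Lemma affB (phi psi : 'cV[R]_(d + 1)) x : aff (phi - psi) x = aff phi x - aff psi x.
Proof. by rewrite /aff mulmxBr !mxE. Qed.

Lemma sum_min_region s : affinely_independent s ->
  (\sum_(i < k.+1) hausdorff k (min_region s i) <= hausdorff k (hull s))%E.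
Proof.
move=> sf.
have mE i : min_region s i = hull s `&`
    [set x | forall j, j \in enum 'I_k.+1 -> [set x | aff (lam s i - lam s j) x <= 0] x].
  apply/seteqP; split=> x [sx h]; split=> // j; last first.
    by have := h j; rewrite mem_enum /= affB subr_le0; exact.
  by move=> _ /=; rewrite affB subr_le0.
have bA i : borel (min_region s i).
  rewrite mE; apply: borelI; first exact: hull_borel.
  by apply: (proj1 (polyset_bigI _)) => j _; exact: polyset_halfspace.
have nul i j : i != j -> hausdorff k (min_region s i `&` min_region s j) = 0%E.
  move=> ij; apply: hausdorff_null_sub (@hausdorff_hull_null _ _ _ s (lam s i - lam s j) sf _).
    move=> x [[sx hi] [_ hj]]; split => //=; rewrite affB; apply/eqP.
    by rewrite subr_eq0 eq_le hi hj.
  exists i; rewrite vert_aff affB -!vert_aff !vert_lam // eqxx.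
  by have /negbTE -> : j != i by [rewrite eq_sym]; rewrite subr0 oner_neq0.
have := @hausdorff_sum R d k _ (enum 'I_k.+1) (hull s) (min_region s) (enum_uniq _)
  (fun i _ => bA i) (fun i j _ _ ij => nul i j ij).
rewrite big_enum /= => E.
have -> : (\sum_(i < k.+1) hausdorff k (min_region s i) =
    \sum_(i < k.+1) hausdorff k (hull s `&` min_region s i))%E.
  by apply: eq_bigr => i _; congr hausdorff; apply/esym/setIidr => x [].
by rewrite -E; apply: le_hausdorff => x [].
Qed.

Lemma hmat_shift x y z (a : R) :
  hmat (x + a *: (y - z)) = hmat x + a *: (hmat y - hmat z).
Proof.
rewrite /hmat opp_row_mx add_row_mx scale_row_mx add_row_mx; congr row_mx.
by apply/matrixP => i j; rewrite !mxE; ring.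
Qed.

(** The coordinate [lam s i] is 0 on the facet opposite to [i] and 1 / (k + 1) at the barycentre.
    With the factor k + 1 the shear fixes that facet and moves the barycentre to the apex. *)
Lemma side_shear s c tau i : affinely_independent s -> ~~ (hmat c <= hmat s)%MS ->
  0 < tau -> hull (side s c tau i) `<=`
    (fun x => x + (tau * aff (lam s i) x) *: (k.+1%:R *: (c - bary s))) @` min_region s i.
Proof.
move=> sf cs t0 z /(side_weights sf cs t0)[u0 [u [u00 uge ui usum hz]]].
pose v : 'rV[R]_k.+1 := u0 *: const_mx k.+1%:R^-1 + u.
have vE j : v ord0 j = u0 * k.+1%:R^-1 + u ord0 j by rewrite !mxE.
have hx : hmat (v *m s) = v *m hmat s.
  apply: hmat_comb => l; rewrite (ord1 l) -usum; under eq_bigr do rewrite vE.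
  rewrite big_split /= -mulr_sumr; congr (_ + _).
  have := bary_weights R k; under eq_bigr do rewrite mxE.
  by move=> ->; rewrite mulr1.
have lE j : aff (lam s j) (v *m s) = u0 * k.+1%:R^-1 + u ord0 j by rewrite (lamE _ sf hx) vE.
exists (v *m s); first split.
- by apply/hullP; exists v => // j; rewrite vE addr_ge0 // mulr_ge0 ?invr_ge0.
- by move=> j; rewrite !lE ui addr0 lerDl.
rewrite lE ui addr0 scalerA mulrA (_ : tau * u0 * _ * _ = u0 * tau); last first.
  by rewrite mulfVK ?pnatr_eq0 // mulrC.
have E : hmat z = hmat (v *m s + (u0 * tau) *: (c - bary s)).
  rewrite hz hmat_seg hmat_shift hx mulmxDl -scalemxAl -hmat_bary.
  move: (hmat _) (hmat c) (_ *m _) => b c' x.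
  by apply/rowP => j; rewrite !mxE; ring.
apply/rowP => j; have /rowP/(_ (lshift 1 j)) := E.
by rewrite /hmat !row_mxEl.
Qed.

(** The Lipschitz constants of the shears tend to 1 with [tau], and the regions that they act on
    divide [s] without overlap. *)
Lemma side_volume s c (e : R) : affinely_independent s -> ~~ (hmat c <= hmat s)%MS ->
  0 < e -> exists2 t0 : R, 0 < t0 <= 1 & forall tau, 0 < tau <= t0 ->
    \sum_(i < k.+1) vol (side s c tau i) <= (1 + e) * vol s.
Proof.
move=> sf cs e0; pose y : 'rV[R]_d := k.+1%:R *: (c - bary s).
have exC i : exists C : R, 0 < C /\ forall tau, 0 < tau <= 1 -> forall x x',
    euclid ((x + (tau * aff (lam s i) x) *: y) - (x' + (tau * aff (lam s i) x') *: y)) <=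
      (1 + tau * C) * euclid (x - x').
  by have [C C0 hC] := shear_lipschitz (lam s i) y; exists C.
have [C hC] := choice exC; pose C1 := \sum_i C i.
have CC1 i : C i <= C1.
  by rewrite /C1 (bigD1 i) //= lerDl sumr_ge0 // => j _; apply/ltW; case: (hC j).
have C10 : 0 < C1 by apply: lt_le_trans (CC1 ord0); case: (hC ord0).
have e3 : 0 < 3 ^+ k :> R by rewrite exprn_gt0.
(* The bound [C1^-1] ensures [tau * C1 <= 1], as [expr1D_le] requires; the last one makes the
   resulting excess at most [e]. *)
pose t0 := Num.min 1 (Num.min C1^-1 (e / 3 ^+ k / C1)).
have t00 : 0 < t0 by rewrite !lt_min ltr01 invr_gt0 C10 !divr_gt0.
have t01 : t0 <= 1 by rewrite ge_min lexx.
exists t0; first by rewrite t00.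
move=> tau /andP[tau0 taut0]; have tau1 := le_trans taut0 t01.
have tC1 : tau * C1 <= 1.
  by rewrite -ler_pdivlMr // div1r (le_trans taut0) // !ge_min lexx orbT.
have tCe : tau * C1 * 3 ^+ k <= e.
  by rewrite -ler_pdivlMr // -ler_pdivlMr // (le_trans taut0) // !ge_min lexx !orbT.
have L1 : (1 + tau * C1) ^+ k <= 1 + e.
  apply: le_trans (expr1D_le k _) _; last by rewrite lerD2l.
  by rewrite tC1 andbT mulr_ge0 ?ltW.
have L0 : 0 < 1 + tau * C1 by rewrite addr_gt0 // mulr_gt0.
rewrite -lee_fin -sumEFin EFinM -volE.
apply: (@le_trans _ _ (\sum_(i < k.+1) ((1 + tau * C1) ^+ k)%:E * hausdorff k (min_region s i))%E).
  apply: lee_sum => i _; rewrite -volE.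
  apply: (@le_trans _ _ (hausdorff k ((fun x => x + (tau * aff (lam s i) x) *: y) @` min_region s i))).
    by apply: le_hausdorff; exact: side_shear.
  apply: (@hausdorff_lipschitz R d d k (fun x => x + (tau * aff (lam s i) x) *: y)
    (min_region s i) _ L0) => x x' _ _.
  have [C0 h] := hC i; apply: le_trans (h tau _ x x') _; first by rewrite tau0.
  by apply: ler_wpM2r; [exact: euclid_ge0|rewrite lerD2l ler_wpM2l // ltW].
rewrite -ge0_sume_distrr; last by move=> i _; exact: hausdorff_ge0.
apply: lee_pmul; rewrite ?lee_fin ?exprn_ge0 ?(ltW L0) //.
  by apply: sume_ge0 => i _; exact: hausdorff_ge0.
exact: sum_min_region.
Qed.

Lemma side_height s c tau i z : affinely_independent s -> ~~ (hmat c <= hmat s)%MS ->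
  0 < tau <= 1 -> hull (side s c tau i) z -> exists u0 : R,
    [/\ 0 <= u0, aff (lam (cone c s) ord0) z = u0 * tau,
      aff (lam (cone c s) (lift ord0 i)) z = u0 * (1 - tau) / k.+1%:R &
      forall j, u0 * (1 - tau) / k.+1%:R <= aff (lam (cone c s) (lift ord0 j)) z].
Proof.
move=> sf cs /andP[t0 t1] /(side_weights sf cs t0)[u0 [u [u00 uge ui usum hz]]].
pose w : 'rV[R]_k.+2 := \row_l if unlift ord0 l is Some j
  then u0 * (1 - tau) / k.+1%:R + u ord0 j else u0 * tau.
have hw : hmat z = w *m hmat (cone c s).
  rewrite mulmx_cone hz hmat_seg scalerDr !scalerA mxE unlift_none addrAC addrC.
  congr (_ + _); rewrite hmat_bary scalemxAl -mulmxDl; congr (_ *m _).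
  by apply/rowP => j; rewrite !mxE liftK.
have rf := cone_free sf cs; exists u0; split => //.
- by rewrite (lamE _ rf hw) mxE unlift_none.
- by rewrite (lamE _ rf hw) mxE liftK ui addr0.
- by move=> j; rewrite (lamE _ rf hw) mxE liftK lerDl.
Qed.

(** Sides of different heights share the boundary of [s]; positivity of the coordinate of [c]
    removes it. *)
Definition raised s c tau : set 'rV[R]_d :=
  [set z | (exists i, hull (side s c tau i) z) /\ 0 < aff (lam (cone c s) ord0) z].

Lemma raised_disjoint s c tau tau' : affinely_independent s -> ~~ (hmat c <= hmat s)%MS ->
  0 < tau <= 1 -> 0 < tau' <= 1 -> tau != tau' -> raised s c tau `&` raised s c tau' = set0.
Proof.
move=> sf cs t t'; apply: contraNeq => /set0P[z [[[i zi] z0] [[i' zi'] _]]].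
have [u0 [u00 h0 h1 h2]] := side_height sf cs t zi.
have [u0' [u00' h0' h1' h2']] := side_height sf cs t' zi'.
have k0 : 0 < k.+1%:R^-1 :> R by rewrite invr_gt0.
have e1 : u0 * (1 - tau) = u0' * (1 - tau').
  apply/eqP; rewrite eq_le; apply/andP; split; rewrite -(ler_pM2r k0).
    by rewrite -h1'; exact: h2.
  by rewrite -h1; exact: h2'.
have e2 : u0 * tau = u0' * tau' by rewrite -h0 -h0'.
have e3 : u0 = u0' by move: e1; rewrite !mulrBr !mulr1 e2 => /addIr.
have u0n : u0 != 0 by apply: contraTneq z0; rewrite h0 => ->; rewrite mul0r ltxx.
by apply/eqP/(mulfI u0n); rewrite e2 e3.
Qed.

Lemma side_free s c tau i : affinely_independent s -> ~~ (hmat c <= hmat s)%MS ->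
  0 < tau -> affinely_independent (side s c tau i).
Proof. by move=> sf cs t0; apply: row'_free; exact: apex_free. Qed.

Lemma raised_borel s c tau : affinely_independent s -> ~~ (hmat c <= hmat s)%MS ->
  0 < tau -> borel (raised s c tau).
Proof.
move=> sf cs t0; apply: borelI; last exact: (proj1 (polyset_halfspaceC _)).
have E : (fun z => exists i, hull (side s c tau i) z) =
    \bigcup_n (if insub n is Some i then hull (side s c tau i) else set0).
  apply/seteqP; split => [z [i zi]|z [n _]]; first by exists (val i) => //; rewrite valK.
  by case: insubP => [i _ _ zi|//]; exists i.
rewrite E; apply: borel_bigcup => n; case: insubP => [i _ _|_]; last exact: borel0.
by apply: hull_borel; exact: side_free.
Qed.

Lemma side_raised s c tau i : affinely_independent s -> ~~ (hmat c <= hmat s)%MS ->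
  0 < tau <= 1 -> hausdorff k (hull (side s c tau i) `\` raised s c tau) = 0%E.
Proof.
move=> sf cs t; have /andP[t0 t1] := t; have rf := cone_free sf cs.
set phi := lam (cone c s) ord0.
apply: hausdorff_null_sub (@hausdorff_hull_null _ _ _ _ phi (side_free i sf cs t0) _).
  move=> z [zi nz]; split => //=; have [u0 [u00 h0 _ _]] := side_height sf cs t zi.
  have ge0 : 0 <= aff phi z by rewrite h0 mulr_ge0 // ltW.
  apply/eqP; rewrite eq_le ge0 andbT leNgt; apply/negP => z0.
  by apply: nz; split; [exists i|exact: z0].
exists ord0; rewrite vert_row' (_ : lift (lift ord0 i) ord0 = ord0); last exact/val_inj.
rewrite vert_aff row0_cone /apex aff_seg.
have hb : hmat (bary s) = (\row_l if unlift ord0 l is Some j then k.+1%:R^-1 else 0) *m hmat (cone c s).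
  rewrite mulmx_cone mxE unlift_none scale0r add0r hmat_bary; congr (_ *m _).
  by apply/rowP => j; rewrite !mxE liftK.
have hc : hmat c = (delta_mx ord0 ord0 : 'rV_k.+2) *m hmat (cone c s).
  by rewrite -rowE hmat_row row0_cone.
rewrite (lamE _ rf hb) (lamE _ rf hc) !mxE unlift_none mulr0 add0r !eqxx mulr1.
by rewrite gt_eqF.
Qed.

Lemma convex_seg (K : set 'rV[R]_d) x y tau : convex_set K -> K x -> K y -> 0 <= tau <= 1 ->
  K (seg x y tau).
Proof.
move=> Kc Kx Ky /andP[t0 t1].
have t' : 0 <= 1 - tau <= 1 by apply/andP; split; lra.
have := Kc x y (Itv01 (proj1 (andP t')) (proj2 (andP t'))); rewrite !inE => /(_ Kx Ky).
move=> h; rewrite (_ : seg x y tau = (1 - tau) *: x + (1 - (1 - tau)) *: y); first exact: h.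
by rewrite /seg (_ : 1 - (1 - tau) = tau) //; ring.
Qed.

Lemma hull_cone (K : set 'rV[R]_d) s w : convex_set K -> hull s `<=` K -> K w ->
  hull (cone w s) `<=` K.
Proof.
move=> Kc sK Kw z /hull_weights[u [u0 u1 zE hz]].
have usum : \sum_i u ord0 (lift ord0 i) = 1 - u ord0 ord0.
  by apply/esym/eqP; rewrite subr_eq -[X in X == _]u1 [X in X == _]big_ord_recl addrC.
have le1 : u ord0 ord0 <= 1.
  by rewrite -subr_ge0 -usum sumr_ge0.
have [e1|n1] := eqVneq (u ord0 ord0) 1.
  have u'0 i : u ord0 (lift ord0 i) = 0.
    apply/eqP; rewrite eq_le u0 andbT -[leRHS](subrr (1 : R)) -[X in _ - X]e1 -usum.
    by rewrite (bigD1 i) //= lerDl sumr_ge0.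
  rewrite (_ : z = w) //; rewrite zE mulmx_sum_row big_ord_recl e1 scale1r row0_cone big1 ?addr0 //.
  by move=> i _; rewrite u'0 scale0r.
have lt1 : 0 < 1 - u ord0 ord0 by rewrite subr_gt0 lt_neqAle n1.
pose v : 'rV[R]_k.+1 := \row_i (u ord0 (lift ord0 i) / (1 - u ord0 ord0)).
have Kv : K (v *m s).
  apply: sK; exists v => //; split=> [i|]; first by rewrite mxE divr_ge0 // ltW.
  under eq_bigr do rewrite mxE.
  by rewrite -mulr_suml usum divff // gt_eqF.
rewrite (_ : z = seg (v *m s) w (u ord0 ord0)).
  by apply: convex_seg => //; rewrite u0.
rewrite zE mulmx_sum_row big_ord_recl row0_cone addrC /seg; congr (_ + _).
rewrite mulmx_sum_row scaler_sumr; apply: eq_bigr => i _.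
by rewrite rowS_cone mxE scalerA mulrC divfK ?gt_eqF.
Qed.

Lemma fold_simplex (K : set 'rV[R]_d) mu s c (e : R) : convex_set K -> borel_outer mu ->
  affinely_independent s -> hull s `<=` K -> K c -> ~~ (hmat c <= hmat s)%MS -> 0 < e ->
  exists w, [/\ affinely_independent (cone w s), hull (cone w s) `<=` K,
    \sum_(i < k.+1) vol (row' (lift ord0 i) (cone w s)) <= (1 + e) * vol s &
    exists D, [/\ borel D, fm mu D = 0 &
      forall i, hausdorff k (hull (row' (lift ord0 i) (cone w s)) `\` D) = 0%E]].
Proof.
move=> Kc muP sf sK Kcc cs e0; have [t0 /andP[t00 t01] ht] := side_volume sf cs e0.
pose P : set R := [set t | 0 < t <= 1].
(* The sets [raised s c t] are pairwise disjoint, so [mu] charges only countably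
   many of them. *)
have cb := @fm_disjoint_countable R d mu muP (raised s c) P
  (fun t Pt => raised_borel sf cs (proj1 (andP Pt)))
  (fun t t' Pt Pt' => raised_disjoint sf cs Pt Pt').
have [tau nb /andP[tau0 tau1]] := countable_avoid cb t00.
have Pt : 0 < tau <= 1 by rewrite tau0 (le_trans (ltW tau1)).
exists (apex s c tau); split.
- exact: apex_free.
- apply: hull_cone => //; apply: convex_seg => //; first exact/sK/bary_hull.
  by rewrite (ltW tau0) (le_trans (ltW tau1)).
- by apply: ht; rewrite tau0 ltW.
exists (raised s c tau); split; first exact: raised_borel.
  by apply: contrapT => h; apply: nb.
by move=> i; exact: side_raised.
Qed.

(** As k < d, some column of the cokernel gives a nonzero affine functional that vanishes on the
    plane of [s]. It cannot vanish on a ball contained in [K]. *)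
Lemma off_plane (K : set 'rV[R]_d) s : (k < d)%N -> interior K !=set0 ->
  affinely_independent s -> exists2 c, K c & ~~ (hmat c <= hmat s)%MS.
Proof.
move=> kd [x0 x0K] sf; apply: contrapT => no.
have all c : K c -> (hmat c <= hmat s)%MS.
  by move=> Kc; apply/negPn/negP => h; apply: no; exists c.
have rk : (\rank (hmat s) <= k.+1)%N by exact: rank_leq_row.
have ck : cokermx (hmat s) != 0.
  rewrite -mxrank_eq0 mxrank_coker subn_eq0 -ltnNge; apply: leq_ltn_trans rk _.
  by rewrite addn1 ltnS.
have [j /eqP nj] : exists j, col j (cokermx (hmat s)) != 0.
  apply/existsP; apply: contraT; rewrite negb_exists => /forallP h; case/eqP: ck.
  apply/matrixP => a b; have := h b; rewrite negbK => /eqP/matrixP/(_ a ord0).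
  by rewrite !mxE.
set phi := col j _ in nj.
have phi0 c : K c -> aff phi c = 0.
  by move=> /all/submxP[D hD]; rewrite /phi aff_col hD -mulmxA mulmx_coker mulmx0 mxE.
have [e e0 he] : exists2 e : R, 0 < e & ball x0 e `<=` K.
  by move: x0K => /nbhs_ballP[e /= e0 he]; exists e.
apply: nj; apply/matrixP => a b; rewrite (ord1 b) [RHS]mxE.
have Kx0 : K x0 by apply: he; exact: ballxx.
have lin i : phi (lshift 1 i) ord0 = 0.
  pose x1 : 'rV[R]_d := \row_l (x0 ord0 l + (if l == i then e / 2 else 0)).
  have Kx1 : K x1.
    apply: he; apply/ball_rV => // l; rewrite mxE opprD addrA subrr add0r normrN.
    by case: ifP => _; rewrite ?normr0 // ger0_norm ?ltW //; lra.
  have key : aff phi x1 = aff phi x0 + e / 2 * phi (lshift 1 i) ord0.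
    rewrite !affE addrAC; congr (_ + _).
    rewrite (eq_bigr (fun l => x0 ord0 l * phi (lshift 1 l) ord0 +
      (if l == i then e / 2 else 0) * phi (lshift 1 l) ord0)); last first.
      by move=> l _; rewrite mxE mulrDl.
    rewrite big_split /=; congr (_ + _); rewrite (bigD1 i) //= eqxx big1 ?addr0 //.
    by move=> l /negbTE ->; rewrite mul0r.
  move/eqP: key; rewrite (phi0 _ Kx1) (phi0 _ Kx0) add0r eq_sym mulf_eq0 => /orP[|/eqP //].
  by rewrite gt_eqF // divr_gt0.
case: (split_ordP a) => i ->; first exact: lin.
have := phi0 _ Kx0; rewrite affE big1 ?add0r => [|l _]; last by rewrite lin mulr0.
by rewrite (ord1 i).
Qed.
End Fold.

Section FoldChain.
Variables (R : realType) (G : zmodType) (d k : nat).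
Variables (nrm : G -> R) (nrmP : group_norm nrm).
Variable (K : set 'rV[R]_d).
Hypotheses (Kconvex : convex_set K) (Kint : interior K !=set0) (kd : (k < d)%N).
Implicit Types (P Q : chain R G d k).

(** An upper bound for the mass that ignores cancellation: folded faces of different simplexes may
    overlap. *)
Definition cost P : R := \sum_(p <- P) nrm p.1 * vol p.2.

Lemma fold_chain mu (e : R) P : borel_outer mu -> 0 < e -> polyhedral K P ->
  exists (V : chain R G d k.+1) Q, [/\ polyhedral K V, polyhedral K Q,
    forall t, coefficient P t = coefficient (boundary V : chain R G d k) t + coefficient Q t,
    cost Q <= (1 + e) * cost P &
    exists D, [/\ borel D, fm mu D = 0 &
      forall q, q \in Q -> hausdorff k (hull q.2 `\` D) = 0%E]].
Proof.
move=> muP e0; elim: P => [|[g s] P IH] PK.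
  exists [::], [::]; split=> //; first by move=> t; rewrite !coef_nil addr0.
    by rewrite /cost !big_nil mulr0.
  by exists set0; split=> //; [exact: borel0|exact: fm0].
have [|V [Q [VK QK E le [D [bD D0 DQ]]]]] := IH.
  by move=> p pP; apply: PK; rewrite inE pP orbT.
have [sf sK] := PK (g, s) (mem_head _ _).
have [c Kc cs] := off_plane kd Kint sf.
have [w [wf wK lew [D' [bD' D'0 D'w]]]] := fold_simplex Kconvex muP sf sK Kc cs e0.
(* The face 0 of the cone is [s] itself; the others pass to the other side of the equation, with the
   opposite of their sign in the boundary. *)
pose q i := (if odd (lift ord0 i) then g else - g, row' (lift ord0 i) (cone w s)).
pose Q1 : chain R G d k := [seq q i | i <- enum 'I_k.+1].
have Q1K : polyhedral K Q1.
  move=> _ /mapP[i _ ->] /=; split; first exact: row'_free.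
  by apply: subset_trans wK; exact: hull_row'_sub.
exists ((g, cone w s) :: V), (Q1 ++ Q); split.
- by move=> p; rewrite inE => /predU1P[->|/VK].
- exact: polyhedral_cat.
- move=> t; rewrite coefficient_cons E coef_cat (coef_boundary ((g, cone w s) :: V)) big_cons.
  rewrite -coef_boundary [RHS]addrACA; congr (_ + _).
  rewrite /face_coef big_ord_recl row'0_cone /=.
  have -> : coefficient Q1 t = - \sum_(i < k.+1)
     (if `[< hull t `<=` hull (row' (lift ord0 i) (cone w s)) >] then
       orient `[< same_orientation (row' (lift ord0 i) (cone w s)) t >]
         (orient (~~ odd (lift ord0 i)) g) else 0).
    rewrite /coefficient big_mkcond big_map big_enum /= -sumrN; apply: eq_bigr => i _.
    case: ifP => _; last by rewrite oppr0.
    by rewrite /orient if_neg /=; case: (odd _); case: `[< _ >]; rewrite ?opprK.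
  by rewrite addrK coef_single.
- rewrite /cost big_cat big_cons mulrDr; apply: lerD => //=.
  rewrite big_map big_enum /= mulrCA.
  rewrite (eq_bigr (fun i => nrm g * vol (row' (lift ord0 i) (cone w s)))); last first.
    by move=> i _; case: ifP => _; rewrite ?(nrmN nrmP).
  by rewrite -mulr_sumr ler_wpM2l ?nrm_ge0.
exists (D' `|` D); split; first exact: borelU.
  apply/eqP; rewrite eq_le fm_ge0 // andbT.
  by apply: le_trans (fmU muP _ _) _; rewrite D'0 D0 addr0.
move=> p; rewrite mem_cat => /orP[/mapP[i _ ->] /=|/DQ h].
  by apply: hausdorff_null_sub (D'w i) => x [px nx]; split => // xD; apply: nx; left.
by apply: hausdorff_null_sub h => x [px nx]; split => // xD; apply: nx; right.
Qed.
End FoldChain.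

(** * Closing a flat chain of finite mass *)

Section Closing.
Variables (R : realType) (G : zmodType) (d k : nat).
Variables (nrm : G -> R) (nrmP : group_norm nrm).
Variable (K : set 'rV[R]_d).
Hypotheses (Kconvex : convex_set K) (Kcompact : compact K).
Hypotheses (Kint : interior K !=set0) (kd : (k < d)%N).
Local Notation M := (M nrm).
Local Notation poly := (@polyhedral R G d k K).
Local Notation cost := (cost nrm).

Let nd m (P : chain R G d m) : polyhedral K P -> nondeg P.
Proof. exact: polyhedral_nondeg. Qed.

Lemma bounded_sums_tail (u : nat -> R) (c e : R) : (forall n, 0 <= u n) ->
  (forall n, \sum_(i < n) u i <= c) -> 0 < e ->
  exists N, forall n p, (N <= n)%N -> \sum_(i < n + p) u i - \sum_(i < n) u i < e.
Proof.
move=> u0 uc e0; pose S n := \sum_(i < n) u i.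
have Smono n p : S n <= S (n + p)%N.
  by rewrite /S big_split_ord /= lerDl sumr_ge0.
have hs : has_sup (range S) by split; [exists (S 0%N), 0%N|exists c => _ [n _ <-]; exact: uc].
have [_ [N _ <-] SN] := sup_adherent e0 hs.
exists N => n p Nn; rewrite -/(S n) -/(S (n + p)%N).
have h1 : S (n + p)%N <= sup (range S) by apply: sup_upper_bound => //; exists (n + p)%N.
have h2 : S N <= S n by rewrite -(subnKC Nn).
by move: h1 h2 SN; move: (sup _) (S n) (S N) (S _) => *; lra.
Qed.

Lemma M_le_cost (P : chain R G d k) : nondeg P -> M P <= cost P.
Proof.
elim: P => [|p P IH] Pf; first by rewrite (M_nil _ nrmP) /cost big_nil.
have pf : affinely_independent p.2 by apply: Pf; rewrite mem_head.
have Pf' : nondeg P by move=> q qP; apply: Pf; rewrite inE qP orbT.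
have p1 : nondeg [:: p] by move=> q; rewrite inE => /eqP ->.
rewrite -cat1s; apply: le_trans (M_cat nrmP p1 Pf') _.
rewrite /cost big_cat big_seq1; apply: lerD; last exact: IH.
by case: p pf {Pf p1} => g s sf; rewrite (M1 nrmP).
Qed.

(** A measure carried by the simplexes of [P] which, by [M_rs_hausdorff], dominates the mass of [P]
    in polyhedral sets. *)
Definition weight (P : chain R G d k) (A : set 'rV[R]_d) : \bar R :=
  (\sum_(p <- P) (nrm p.1)%:E * hausdorff k (hull p.2 `&` A))%E.

Lemma weight_outer P : borel_outer (weight P).
Proof.
elim: P => [|p P IH].
  rewrite (_ : weight [::] = fun=> 0%E); last by apply/funext => A; rewrite /weight big_nil.
  split=> [//|//|A||E X bE]; [by rewrite eseries0|exact: ltry|by rewrite adde0].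
rewrite (_ : weight (p :: P) = fun A =>
  ((nrm p.1)%:E * hausdorff k (hull p.2 `&` A) + weight P A)%E); last first.
  by apply/funext => A; rewrite /weight big_cons.
apply: borel_outerD => //; apply: borel_outer_hausdorff; first exact: nrm_ge0.
exact: hausdorff_hull_fin.
Qed.

Lemma weightT P : weight P setT = (cost P)%:E.
Proof.
by rewrite /weight /cost -sumEFin; apply: eq_bigr => p _; rewrite setIT volE EFinM.
Qed.

Lemma flattenS m (f : nat -> chain R G d m) n :
  flatten [seq f j | j <- iota 0 n.+2] = flatten [seq f j | j <- iota 0 n.+1] ++ f n.+1.
Proof.
have -> : iota 0 n.+2 = iota 0 n.+1 ++ [:: n.+1] by rewrite -[n.+2]addn1 iotaD add0n.
by rewrite map_cat flatten_cat /= cats0.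
Qed.

Lemma flatten_polyhedral m (f : nat -> chain R G d m) n : (forall j, polyhedral K (f j)) ->
  polyhedral K (flatten [seq f j | j <- iota 0 n]).
Proof. by move=> fK p /flattenP[_ /mapP[j _ ->]]; exact: fK. Qed.

(** [A n] telescopes into the sum of the [r j] and of the boundaries of the [s j], and each [r j] is
    folded into a boundary plus [z j]. Subtracting [Z n], the sum of the [z j], leaves the boundary
    of [W n]. *)
Lemma closing (A r : nat -> chain R G d k) (s : nat -> chain R G d k.+1) (mT B c e : R) :
  fcauchy nrm K A -> optimal nrm K A mT -> (forall n, M (A n) <= B) ->
  (forall n, poly (r n)) -> (forall n, polyhedral K (s n)) ->
  evt (fun t => coefficient (A 0%N) t =
    coefficient (r 0%N) t + coefficient (boundary (s 0%N) : chain R G d k) t) ->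
  (forall n, evt (fun t => coefficient (A n.+1) t = coefficient (A n) t +
    (coefficient (r n.+1) t + coefficient (boundary (s n.+1) : chain R G d k) t))) ->
  (forall n, \sum_(j < n) M (r j) <= c) -> 0 < e ->
  exists (T : nat -> chain R G d k) (E : set 'rV[R]_d) (W : nat -> chain R G d k.+1),
    [/\ fcauchy nrm K T, borel E /\ E `<=` K,
      forall n, polyhedral K (W n) /\ eqv (T n) (boundary (W n)),
      is_restriction nrm K T E A & forall n, M (T n) <= M (A n) + (1 + e) * c].
Proof.
move=> AC Aopt AB rK sK E0 ES rc e0; have AK n : poly (A n) by have [h _] := AC; exact: h.
have [U [UU Uoo]] := ultraFilterLemma (eventually_filter).
have Agood i : countable [set a | ~ slabgood nrm A i a] by exact: (optimal_slabgood nrmP i AC AB Aopt).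
(* The mass measure depends on [A] alone and is fixed before folding, since the new faces must be
   null for it. *)
have kapP := kappa_borel_outer nrmP UU Uoo AK AB Agood; set kap := kappa nrm K U A in kapP.
have ex j : exists V : chain R G d k.+1, exists z : chain R G d k, exists D : set 'rV[R]_d,
    [/\ polyhedral K V /\ poly z, evt (fun t => coefficient (r j) t =
         coefficient (boundary V : chain R G d k) t + coefficient z t),
      cost z <= (1 + e) * M (r j), borel D /\ fm kap D = 0 &
      forall q, q \in z -> hausdorff k (hull q.2 `\` D) = 0%E].
  have [q [qf qK rq Mq]] := nonoverlapping_chain nrmP (nd (rK j)).
  have {}qK : poly q by apply/polyhedralE; split => //; apply: qK; have /polyhedralE[] := rK j.
  have [V [z [VK zK E le [D [bD D0 Dz]]]]] := fold_chain nrmP Kconvex Kint kd kapP e0 qK.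
  exists V, z, D; split => //; last by rewrite Mq.
  by apply: evt_mono rq => t _ ->; exact: E.
have [V hV] := choice ex; have [z hz] := choice hV; have [D hD] := choice hz.
have VK j : polyhedral K (V j) by case: (hD j) => -[].
have zK j : poly (z j) by case: (hD j) => -[].
have M0 j : 0 <= M (r j) by apply: (M_ge0 nrmP); exact: nd (rK j).
pose Z n := flatten [seq z j | j <- iota 0 n.+1].
pose W n := flatten [seq (V j ++ s j) | j <- iota 0 n.+1].
have ZK n : poly (Z n) by exact: flatten_polyhedral.
have VsK j : polyhedral K (V j ++ s j) by exact: polyhedral_cat.
have WK n : polyhedral K (W n) by exact: flatten_polyhedral.
have ZS n : Z n.+1 = Z n ++ z n.+1 by exact: flattenS.
have WS n : W n.+1 = W n ++ (V n.+1 ++ s n.+1) by exact: flattenS.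
pose T n := chain_sub (A n) (Z n).
have TK n : poly (T n) by exact: polyhedral_sub.
have TW n : eqv (T n) (boundary (W n)).
  have step j t : coefficient (boundary (V j ++ s j) : chain R G d k) t =
      coefficient (boundary (V j) : chain R G d k) t + coefficient (boundary (s j) : chain R G d k) t.
    by rewrite boundary_cat coef_cat.
  have gen (a b x v y : G) : a + (v + x + y) - (b + x) = a - b + (v + y).
    by rewrite (addrAC v) addrA opprD addrACA subrr addr0 addrAC.
  elim: n => [|n IH].
    rewrite /eqv /T /Z /W /= !cats0; have [_ Ez _ _ _] := hD 0%N.
    apply: evt_mono (evtI E0 Ez) => t _ [e1 e2]; rewrite coef_sub e1 e2 step.
    by rewrite addrAC addrK.
  have [_ Ez _ _ _] := hD n.+1.
  apply: evt_mono (evtI IH (evtI (ES n) Ez)) => t _ [e0' [e1 e2]].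
  rewrite /T ZS WS boundary_cat coef_sub (coef_cat (Z n)) (coef_cat (boundary (W n))) step.
  rewrite e1 e2 -e0' coef_sub.
  exact: gen.
have zM j : M (z j) <= (1 + e) * M (r j).
  by apply: le_trans (M_le_cost (nd (zK j))) _; case: (hD j).
have dZ n p : dF nrm K (Z (n + p)%N) (Z n) <=
    (1 + e) * (\sum_(j < n.+1 + p) M (r j) - \sum_(j < n.+1) M (r j)).
  elim: p => [|p IH].
    by rewrite !addn0 subrr mulr0 (dFxx nrmP).
  rewrite !addnS big_ord_recr /= addrAC mulrDr [leRHS]addrC.
  apply: le_trans (dF_tri nrmP (ZK _) (ZK (n + p)%N) (ZK _)) _; apply: lerD => //.
  apply: le_trans (dF_le_M nrmP (ZK _) (ZK _)) _; apply: le_trans _ (zM _).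
  rewrite le_eqVlt; apply/orP; left; apply/eqP; apply: (M_eqv nrmP).
  - exact: nd (polyhedral_sub (ZK _) (ZK _)).
  - exact: nd (zK _).
  by apply: evtT => t; rewrite coef_sub /Z flattenS coef_cat addrC addKr.
have e1 : 0 < 1 + e by rewrite addr_gt0.
have ZC : fcauchy nrm K Z.
  split=> // a a0; have a2 : 0 < a / (1 + e) by rewrite divr_gt0.
  have [N hN] := bounded_sums_tail M0 rc a2; exists N => m n.
  wlog nm : m n / (n <= m)%N.
    move=> wl Nm Nn; have [h|h] := leqP n m; first exact: wl.
    by rewrite (dF_sym nrmP) //; apply: wl => //; exact: ltnW.
  move=> Nm Nn; rewrite -(subnKC nm); apply: le_lt_trans (dZ _ _) _.
  by rewrite mulrC -ltr_pdivlMr // hN // ltnW.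
have TC : fcauchy nrm K T by exact: fcauchy_sub.
(* Finite because the cost of [z j] is at most [(1 + e) * M (r j)], and these have bounded sums; it
   dominates all the [Z n] at once. *)
pose nu (F : set 'rV[R]_d) := (\sum_(j <oo) weight (z j) F)%E.
have nuP : borel_outer nu.
  apply: borel_outer_series; first by move=> j; exact: weight_outer.
  apply: (@le_lt_trans _ _ ((1 + e) * c)%:E); last exact: ltry.
  apply: lime_le.
    by apply: is_cvg_nneseries => *; exact: bo_ge0 (weight_outer _) _.
  apply: nearW => n; under eq_bigr do rewrite weightT.
  rewrite sumEFin lee_fin big_mkord.
  apply: (@le_trans _ _ ((1 + e) * \sum_(j < n) M (r j))).
    by rewrite mulr_sumr; apply: ler_sum => j _; case: (hD j).
  by rewrite ler_wpM2l // ltW.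
have Znu F n : polyset F -> M (rs F (Z n)) <= fm nu F.
  move=> pF; rewrite -lee_fin -(fmE nuP).
  apply: le_trans (M_rs_hausdorff nrmP (nd (ZK n)) pF) _.
  rewrite /Z big_flatten big_map /=.
  apply: le_trans (nneseries_lim_ge (u_ := fun j => weight (z j) F) (P := predT) n.+1 _).
    by rewrite /index_iota subn0.
  by move=> j _ _; exact: bo_ge0 (weight_outer _) _.
(* The removed sets are null for [kap] and carry all the new faces, so that [kap] vanishes off [E]
   and [nu] on [E]. *)
pose E := K `\` \bigcup_j D j.
have bK : borel K.
  rewrite -[K]setCK; apply: borelC; apply: borel_open; apply: closed_openC.
  exact: compact_closed.
have bE : borel E by apply: borelD => //; apply: borel_bigcup => j; case: (hD j) => _ _ _ [].
have kE : fm kap (~` E) = 0.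
  apply/eqP; rewrite eq_le (fm_ge0 kapP) andbT.
  apply: (@le_trans _ _ (fm kap (\bigcup_j D j))).
    rewrite -lee_fin -!(fmE kapP); apply: le_mu_ext => x [nE Kx]; split => //.
    by apply: contrapT => nD; apply: nE.
  apply: (fm_sigma kapP) => n; rewrite big1 // => j _.
  by case: (hD j) => _ _ _ [].
have nE : fm nu E = 0.
  apply/eqP; rewrite eq_le (fm_ge0 nuP) andbT -lee_fin -(fmE nuP).
  rewrite /nu eseries0 // => j _ _; rewrite /weight big_seq big1 // => p pz.
  have [_ _ _ _ h] := hD j.
  rewrite (@hausdorff_null_sub _ _ _ _ _ _ (h p pz)) ?mule0 // => x [px [_ nD]].
  by split => // Dx; apply: nD; exists j.
exists T, E, W; split=> //.
- by split => // x [].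
- exact: (represents_difference nrmP Kcompact UU Uoo AC AB Agood nuP ZK Znu TC bE kE nE).
move=> n; apply: le_trans (M_sub nrmP (nd (AK n)) (nd (ZK n))) _; rewrite lerD2l.
apply: (@le_trans _ _ ((1 + e) * \sum_(j < n.+1) M (r j))); last by rewrite ler_wpM2l // ltW.
elim: (n) => [|m IH]; first by rewrite /Z /= cats0 big_ord1.
rewrite big_ord_recr /= mulrDr /Z flattenS.
apply: le_trans (M_cat nrmP (nd (ZK m)) (nd (zK _))) _; exact: lerD.
Qed.

(** Consecutive terms of a fast approximation differ by a boundary and a remainder of geometrically
    small mass. The remainder [r 0] is the whole of [A 0], which accounts for the second copy of [m]
    in the bound. *)
Lemma fast_approximation (T : nat -> chain R G d k) (m a : R) : fcauchy nrm K T ->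
  flat_mass nrm K T = m%:E -> 0 < a <= 1 ->
  exists (A r : nat -> chain R G d k) (s : nat -> chain R G d k.+1) (B c : R),
    [/\ fcauchy nrm K A /\ fclose nrm K A T, optimal nrm K A m,
      (forall n, M (A n) <= B) /\ (forall n, \sum_(j < n) M (r j) <= c),
      (forall n, poly (r n)) /\ (forall n, polyhedral K (s n)) /\
      evt (fun t => coefficient (A 0%N) t =
        coefficient (r 0%N) t + coefficient (boundary (s 0%N) : chain R G d k) t) /\
      (forall n, evt (fun t => coefficient (A n.+1) t = coefficient (A n) t +
        (coefficient (r n.+1) t + coefficient (boundary (s n.+1) : chain R G d k) t))) &
      B + (1 + a / 4) * c <= (2 + a) * m].
Proof.
move=> TC Tm /andP[a0 a1]; have TK n : poly (T n) by have [h _] := TC; exact: h.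
have nilK : poly ([::] : chain R G d k) by [].
have m0 : 0 <= m by rewrite -lee_fin -Tm; exact: flat_mass_ge0.
have app b : 0 < b -> exists P, [/\ poly P, M P < m + b & fnear nrm K P T b].
  by apply: flat_mass_approx => //; rewrite Tm.
have lscT := flat_mass_lsc nrmP TC Tm.
(* The errors below are proportional to [m]; for [m] equal to 0 the chain represented by [T] is zero
   and the empty chains approximate it. *)
have [mE|mpos] := eqVneq m 0.
  have nilT : fclose nrm K (fun=> [::] : chain R G d k) T.
    move=> b b0; have b2 : 0 < b / 2 by rewrite divr_gt0.
    have [P [PK MP [N hN]]] := app _ b2; exists N => n /hN h.
    have t1 := dF_tri nrmP nilK PK (TK n).
    have t2 := dF_le_M nrmP nilK PK.
    have t3 : M (chain_sub [::] P) = M P by exact: (M_opp nrmP (nd PK)).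
    move: t1 t2 h MP; rewrite t3 mE add0r; move: (dF _ _ _ _) (dF _ _ _ _) (dF _ _ _ _) (M _) => *; lra.
  have nilC : fcauchy nrm K (fun=> [::] : chain R G d k).
    exact: (fclose_cauchy nrmP TC (fun=> nilK) nilT).
  exists (fun=> [::]), (fun=> [::]), (fun=> [::]), 0, 0; split.
  - by split.
  - split=> b b0; last by exists 0%N => n _; rewrite (M_nil _ nrmP) mE add0r.
    exists 1 => // P PK _; have h : 0 <= M P by apply: (M_ge0 nrmP); exact: nd PK.
    by rewrite mE; move: (M P) h => *; lra.
  - by split=> n; rewrite ?(M_nil _ nrmP) // big1 // => j _; rewrite (M_nil _ nrmP).
  - do 2 ! (split=> //); split=> [|n]; apply: evtT => t; by rewrite !coef_nil ?add0r.
  - by rewrite mE !mulr0 addr0.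
have {}mpos : 0 < m by rewrite lt_neqAle eq_sym mpos.
(* With B = m + eta and c = m + 5 eta, the quantity B + (1 + a / 4) c exceeds 2 m by 11 a m / 20 +
   a^2 m / 16, which is at most a m since a is at most 1. *)
pose eta := a * m / 20; have eta0 : 0 < eta by rewrite !mulr_gt0.
pose de j := eta / 2 ^+ j.
have p2 j : 0 < 2 ^+ j :> R by rewrite exprn_gt0.
have de0 j : 0 < de j by rewrite divr_gt0.
have deS j : de j.+1 = de j / 2 by rewrite /de exprS invfM mulrA mulrAC.
have dele j : de j.+1 <= de j by rewrite deS; have := de0 j; lra.
have de_eta j : de j <= eta.
  by elim: j => [|j IH]; [rewrite /de expr0 divr1|exact: le_trans (dele j) IH].
have desum n : \sum_(j < n) de j = 2 * eta - 2 * de n.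
  elim: n => [|n IH]; first by rewrite big_ord0 /de expr0 divr1 subrr.
  by rewrite big_ord_recr /= IH deS; lra.
have desmall b : 0 < b -> exists N, forall n, (N <= n)%N -> de n < b.
  move=> b0; have cvd : (fun n => de n) @ \oo --> (0 : R).
    have h : `|2^-1 : R| < 1 by rewrite ger0_norm ?invr_ge0 // invf_lt1 // ltr1n.
    apply: cvg_trans (cvg_geometric eta h); apply: near_eq_cvg; apply: nearW => n.
    by rewrite /geometric /= /de exprVn.
  have /cvgrPdist_lt/(_ _ b0)[N _ hN] := cvd; exists N => n Nn.
  by have := hN n Nn; rewrite /= sub0r normrN ger0_norm // ltW.
have [A hA] := choice (fun j => app _ (de0 j)).
have AK n : poly (A n) by case: (hA n).
have AT : fclose nrm K A T.
  move=> b b0; have b2 : 0 < b / 2 by rewrite divr_gt0.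
  have [N1 h1] := desmall _ b2; have [N2 h2] := TC.2 _ b2; exists (maxn N1 N2) => n.
  rewrite geq_max => /andP[n1 n2]; have [_ _ [N hN]] := hA n; pose p := maxn N n.
  have t1 := dF_tri nrmP (AK n) (TK p) (TK n); have t2 := hN p (leq_maxl _ _).
  have t3 := h2 p n (leq_trans n2 (leq_maxr _ _)) n2; have t4 := h1 n n1.
  by move: t1 t2 t3 t4; move: (dF _ _ _ _) (dF _ _ _ _) (dF _ _ _ _) (de n) => *; lra.
(* The two errors [de j.+1] and [de j] together stay below [2 * de j], and these doubled errors sum
   to at most [4 * eta]; adding [m + eta] for the first term gives the bound [m + 5 * eta] on the
   remainders. *)
have AC := fclose_cauchy nrmP TC AK AT.
have dA j : dF nrm K (A j.+1) (A j) < 2 * de j.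
  have [_ _ [N hN]] := hA j; have [_ _ [N' hN']] := hA j.+1; pose p := maxn N N'.
  have t1 := dF_tri nrmP (AK j.+1) (TK p) (AK j).
  have t2 := hN' p (leq_maxr _ _); have t3 := hN p (leq_maxl _ _).
  rewrite (dF_sym nrmP (TK p) (AK j)) in t1; have t4 := dele j.
  by move: t1 t2 t3 t4; move: (dF _ _ _ _) (dF _ _ _ _) (dF _ _ _ _) (de _) (de _) => *; lra.
have exS j : exists Q : chain R G d k.+1, polyhedral K Q /\
    M Q + M (chain_sub (chain_sub (A j.+1) (A j)) (boundary Q)) < 2 * de j.
  by have [Q QK h] := Fl_lt nrmP (polyhedral_sub (AK j.+1) (AK j)) (dA j); exists Q.
have [S hS] := choice exS.
pose s n := if n is j.+1 then S j else [::].
pose r n := if n is j.+1 then chain_sub (chain_sub (A j.+1) (A j)) (boundary (S j)) else A 0%N.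
have sK n : polyhedral K (s n) by case: n => [//|n]; case: (hS n).
have rK n : poly (r n).
  case: n => [|n]; first exact: AK.
  apply: polyhedral_sub; first exact: polyhedral_sub.
  by apply: polyhedral_boundary; case: (hS n).
have MA n : M (A n) <= m + eta.
  by have [_ /ltW h _] := hA n; apply: le_trans h _; rewrite lerD2l.
exists A, r, s, (m + eta), (m + 5 * eta); split.
- by split.
- split=> b b0.
    have [dd dd0 h] := lscT _ b0; exists (dd / 2); first by rewrite divr_gt0.
    move=> P PK nP; apply: h => //; apply: (nearT_close nrmP PK AK TK AT nP); lra.
  have [N hN] := desmall _ b0; exists N => n /hN h; have [_ h' _] := hA n.
  by move: h h'; move: (M _) (de _) => *; lra.
- split=> // -[|n]; first by rewrite big_ord0; lra.
  rewrite big_ord_recl /=.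
  apply: (@le_trans _ _ (m + eta + \sum_(j < n) 2 * de j)).
    apply: lerD => //; apply: ler_sum => j _; have [SK /ltW h] := hS j.
    by apply: le_trans h; rewrite lerDr; apply: (M_ge0 nrmP); exact: nd SK.
  by rewrite -mulr_sumr desum; have := de0 n; move: (de n) => *; lra.
- do 2 ! (split=> //); split=> [|n]; apply: evtT => t.
    by rewrite /r /s /= coef_nil addr0.
  by rewrite /r /s !coef_sub subrK addrC subrK.
have am : 0 < a * m by rewrite mulr_gt0.
have h : a * (a * m) <= a * m by rewrite ger_pMl.
rewrite -subr_ge0 /eta; have -> : (2 + a) * m - (m + a * m / 20 + (1 + a / 4) * (m + 5 * (a * m / 20))) =
  a * m * (9 / 20) - a * (a * m) / 16 by field.
lra.
Qed.

Lemma closed_extension (T : nat -> chain R G d k) (eps : R) : fcauchy nrm K T ->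
  (flat_mass nrm K T < +oo)%E -> 0 < eps ->
  exists (T' : nat -> chain R G d k) (E : set 'rV[R]_d) (W : nat -> chain R G d k.+1),
    [/\ fcauchy nrm K T', borel E /\ E `<=` K,
      forall n, polyhedral K (W n) /\ eqv (T' n) (boundary (W n)),
      is_restriction nrm K T' E T &
      (flat_mass nrm K T' <= (2 + eps)%:E * flat_mass nrm K T)%E].
Proof.
move=> TC Tfin eps0; have TK n : poly (T n) by have [h _] := TC; exact: h.
have [m Tm] : exists m, flat_mass nrm K T = m%:E.
  by exists (fine (flat_mass nrm K T)); rewrite fineK // ge0_fin_numE // flat_mass_ge0.
have m0 : 0 <= m by rewrite -lee_fin -Tm; exact: flat_mass_ge0.
pose a := Num.min 1 eps; have a01 : 0 < a <= 1 by rewrite lt_min ltr01 eps0 ge_min lexx.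
have [A [r [s [B [c [[AC AT] Aopt [AB rc] [rK [sK [E0 ES]]] le]]]]]] := fast_approximation TC Tm a01.
have AK n : poly (A n) by have [h _] := AC; exact: h.
have a40 : 0 < a / 4 by case/andP: a01 => h _; rewrite divr_gt0.
have [T' [E [W [T'C EK TW [rho rhoP Arho] T'M]]]] := closing AC Aopt AB rK sK E0 ES rc a40.
exists T', E, W; split=> //.
(* [A] and [T] represent the same flat chain, so the restriction obtained for [A] is also one for
   [T]. *)
- exists rho => //; have [rC _ _] := rhoP; have /(flat_chainE nrmP)[rK' _] := rC _ EK.1.
  apply/(flat_eqE nrmP TK rK'); refine (fclose_trans nrmP TK AK rK' _ _).
    exact: (fclose_sym nrmP AK TK AT).
  exact/(flat_eqE nrmP AK rK').
rewrite Tm -EFinM; apply: (flat_mass_le nrmP T'C) => e e0.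
have [N hN] := cauchy_nearT T'C e0; exists (T' N); split; [by have [h _] := T'C; exact: h| |exact: hN].
have h1 := T'M N; have h2 := AB N.
have h3 : (2 + a) * m <= (2 + eps) * m by rewrite ler_wpM2r // lerD2l ge_min lexx orbT.
by move: h1 h2 h3 le e0; move: (M _) (M _) (_ * c) (_ * m) (_ * m) => *; lra.
Qed.
End Closing.

Lemma int_norm_group (R : realType) : group_norm (@int_norm R).
Proof.
split=> [g|g|g|g h]; rewrite /int_norm.
- by rewrite ler0z.
- by split=> [/eqP|->]; rewrite ?normr0 // intr_eq0 normr_eq0 => /eqP.
- by rewrite normrN.
- by rewrite -intrD ler_int ler_normD.
Qed.

(** The terms of [T'] are boundaries up to [eqv], so their own boundaries vanish; in the limit the
    boundary of [T'] is zero and has mass zero, which makes [T'] normal. *)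
Lemma closed_normal_extension (R : realType) (G : zmodType) (nrm : G -> R) (d k : nat)
    (K : set 'rV[R]_d) (T : nat -> chain R G d k) (eps : R) : group_norm nrm ->
  convex_set K -> compact K -> interior K !=set0 -> (0 < k < d)%N ->
  flat_chain nrm K T -> (flat_mass nrm K T < +oo)%E -> 0 < eps ->
  exists (T' : nat -> chain R G d k) (E : set 'rV[R]_d),
    [/\ normal_chain nrm K T', borel E /\ E `<=` K,
        flat_eq nrm K (flat_boundary T') (flat_zero R G d k.-1),
        is_restriction nrm K T' E T &
        (flat_mass nrm K T' <= (2 + eps)%:E * flat_mass nrm K T)%E].
Proof.
(* [boundary] is defined by cases on the dimension, so [k], which is positive, is written as a
   successor. *)
move=> nrmP Kconvex Kcompact Kint /andP[k0 kd]; case: k k0 T kd => // k _ T kd.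
move=> /(flat_chainE nrmP) TC Tfin eps0.
have [T' [E [W [T'C EK TW TE T'M]]]] := closed_extension nrmP Kconvex Kcompact Kint kd TC Tfin eps0.
have T'K n : polyhedral K (T' n) by have [h _] := T'C; exact: h.
have nilK : polyhedral K ([::] : chain R G d k) by [].
have bK n : polyhedral K (flat_boundary T' n) by exact: polyhedral_boundary.
have b0 n : eqv (flat_boundary T' n) ([::] : chain R G d k).
  have [WK /eqv_boundary h] := TW n; apply: evt_mono (h _ _).
  - by move=> t _ ->; rewrite coef_boundary_boundary coef_nil.
  - exact: polyhedral_nondeg (T'K n).
  - exact: polyhedral_nondeg (polyhedral_boundary WK).
have bnil e : 0 < e -> exists N, forall n, (N <= n)%N ->
    dF nrm K (flat_boundary T' n) ([::] : chain R G d k) < e.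
  by move=> e0; exists 0%N => n _; rewrite (dF_eqv0 nrmP (bK n) nilK (b0 n)).
have bC : fcauchy nrm K (flat_boundary T').
  split=> // e e0; exists 0%N => m n _ _; rewrite (dF_eqv0 nrmP (bK m) (bK n)) //.
  by apply: evt_mono (evtI (b0 m) (b0 n)) => t _ [-> ->].
exists T', E; split=> //; last exact/(flat_eqE nrmP bK (fun=> nilK)).
split; first exact/(flat_chainE nrmP).
apply: lte_add_pinfty.
  apply: le_lt_trans T'M _.
  by rewrite lte_mul_pinfty // ?lee_fin ?addr_ge0 // ltW.
suff h : (flat_mass nrm K (flat_boundary T') <= (0 : R)%:E)%E by exact: le_lt_trans h (ltry _).
refine (flat_mass_le nrmP bC _) => e e0.
exists [::]; split=> //; first by rewrite (M_nil _ nrmP) add0r.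
by exists 0%N => n _; rewrite (dF_sym nrmP) // (dF_eqv0 nrmP (bK n) nilK (b0 n)).
Qed.

Theorem theorem1p1 (R : realType) (d k : nat) (K : set 'rV[R]_d)
    (Kconvex : convex_set K) (Kcompact : compact K) (Kint : interior K !=set0)
    (k1 : (1 <= k)%N) (kd : (k < d)%N) :
  (forall (G : zmodType) (nrm : G -> R),
     group_norm nrm -> group_complete nrm ->
     forall T : nat -> chain R G d k,
       flat_chain nrm K T -> (flat_mass nrm K T < +oo)%E ->
       forall eps : R, 0 < eps ->
       exists (T' : nat -> chain R G d k) (E : set 'rV[R]_d),
         [/\ normal_chain nrm K T',
             borel E /\ E `<=` K,
             flat_eq nrm K (flat_boundary T') (flat_zero R G d k.-1),
             is_restriction nrm K T' E T &
             (flat_mass nrm K T' <= (2 + eps)%:E * flat_mass nrm K T)%E]) /\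
  (forall T : nat -> chain R int d k,
     flat_chain (@int_norm R) K T -> (flat_mass (@int_norm R) K T < +oo)%E ->
     forall eps : R, 0 < eps ->
     exists (T' : nat -> chain R int d k) (E : set 'rV[R]_d),
       [/\ integral_current K T',
           borel E /\ E `<=` K,
           flat_eq (@int_norm R) K (flat_boundary T') (flat_zero R int d k.-1),
           is_restriction (@int_norm R) K T' E T &
           (flat_mass (@int_norm R) K T'
              <= (2 + eps)%:E * flat_mass (@int_norm R) K T)%E]).
Proof.
have k1d : (0 < k < d)%N by rewrite k1.
split=> [G nrm nrmP _|] T TC Tfin eps eps0; first exact: closed_normal_extension.
exact: (closed_normal_extension (int_norm_group R)).
Qed.
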